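(* Let $f\in C^\infty(\mathbb{R}^n)$ be a (real-valued) smooth function with $\int_{\mathbb{R}^n} f=0$ and $\int_{\mathbb{R}^n}|x||f(x)|\,dx<\infty$. Define $F:\mathbb{S}^{n-1}\to\mathbb{R}$ by $$F(\nu)=-\frac12\int_{\mathbb{R}^n}\int_{\mathbb{R}^n}f(x)f(y)\,|(x-y)\cdot\nu|\,dx\,dy .$$ Then $F\in C^{0,1}(\mathbb{S}^{n-1})$, and for any set $E\subset\mathbb{R}^n$ of finite perimeter, $$\lim_{r\to0^+}\frac1r\|f_r*\mathbf{1}_E\|_{L^2(\mathbb{R}^n)}^2=\int_{\partial^*E}F(\nu)\,d\mathcal{H}^{n-1}.$$
   Context: $f_r(x)=r^{-n}f(x/r)$. $\mathbf{1}_E$ is the indicator function of $E$, $\partial^*E$ its reduced boundary, $\nu=\nu(x)$ the measure-theoretic unit normal to $\partial^*E$ at $x$, and $\mathcal{H}^{n-1}$ is $(n-1)$-dimensional Hausdorff measure. $\mathbb{S}^{n-1}$ is the unit sphere in $\mathbb{R}^n$, and $C^{0,1}$ denotes Lipschitz functions. *)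

(* Defs.v *)
From HB Require Import structures.
From mathcomp Require Import all_boot all_order all_algebra.
From mathcomp Require Import all_classical all_reals all_analysis.

Set Implicit Arguments.
Unset Strict Implicit.
Unset Printing Implicit Defensive.
Import Order.TTheory GRing.Theory Num.Theory.
Import numFieldNormedType.Exports.

Local Open Scope classical_set_scope.
Local Open Scope ring_scope.

(** Euclidean structure of [R^n = 'rV[R]_n].  The library's norm on matrices is
    the sup norm: it is only used through the topology it induces. *)

Definition dot (R : realType) (n : nat) (x y : 'rV[R]_n) : R :=
  \sum_i x 0 i * y 0 i.

Definition enorm (R : realType) (n : nat) (x : 'rV[R]_n) : R :=
  Num.sqrt (dot x x).

Definition eball (R : realType) (n : nat) (x : 'rV[R]_n) (r : R) :
  set 'rV[R]_n := [set y | enorm (y - x) < r].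

Definition usphere (R : realType) (n : nat) : set 'rV[R]_n :=
  [set v | enorm v = 1].

(** Lebesgue measure on [R^n]: the [n]-fold product of the Lebesgue measure
    on [R], followed by completion. *)

Definition rV_cylinders (R : realType) (n : nat) : set (set 'rV[R]_n) :=
  \bigcup_(i in [set: 'I_n])
    preimage_set_system setT (fun x : 'rV[R]_n => x 0 i)
      (@measurable _ (measurableTypeR R)).

(* The product sigma-algebra, which is the Borel sigma-algebra of R^n. *)
Definition borel_rV (R : realType) (n : nat) :=
  g_sigma_algebraType (@rV_cylinders R n).
HB.instance Definition _ (R : realType) (n : nat) :=
  Measurable.on (borel_rV R n).

Definition rV_cons (R : realType) (n : nat)
    (p : measurableTypeR R * borel_rV R n) : borel_rV R n.+1 :=
  \row_i oapp (fun j => (p.2 : 'rV[R]_n) 0 j) p.1 (unlift ord0 i).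

Definition rV_uncons (R : realType) (n : nat) (x : borel_rV R n.+1) :
    measurableTypeR R * borel_rV R n :=
  ((x : 'rV[R]_n.+1) 0 0, \row_j (x : 'rV[R]_n.+1) 0 (lift ord0 j)).

Lemma rV_consK (R : realType) (n : nat) :
  cancel (@rV_cons R n) (@rV_uncons R n).
Proof.
case=> t v; rewrite /rV_uncons /rV_cons; congr pair.
  by rewrite mxE unlift_none.
by apply/rowP => j; rewrite !mxE liftK.
Qed.

Lemma measurable_rV_coord (R : realType) (n : nat) (i : 'I_n) :
  measurable_fun [set: borel_rV R n]
    (fun x : borel_rV R n => (x : 'rV[R]_n) 0 i : measurableTypeR R).
Proof.
move=> _ A mA; apply: sub_sigma_algebra; exists i => //.
by exists A.
Qed.

Lemma measurable_fun_rV (d : measure_display) (T : measurableType d)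
    (R : realType) (n : nat) (f : T -> borel_rV R n) :
  (forall i, measurable_fun [set: T]
    (fun x => (f x : 'rV[R]_n) 0 i : measurableTypeR R)) ->
  measurable_fun [set: T] f.
Proof.
move=> mf; apply: measurability; first by [].
move=> _ [_ [i _ [A mA <-]] <-]; rewrite !setTI.
by have := mf i measurableT A mA; rewrite setTI.
Qed.

Lemma measurable_rV_cons (R : realType) (n : nat) :
  measurable_fun setT (@rV_cons R n).
Proof.
apply: measurable_fun_rV => i; case: (unliftP ord0 i) => [j ->|->].
  rewrite (_ : (fun x => _) =
      (fun v : borel_rV R n => (v : 'rV[R]_n) 0 j) \o snd).
    exact: (measurableT_comp (@measurable_rV_coord R n j) measurable_snd).
  by apply/funext => x; rewrite mxE liftK.
rewrite (_ : (fun x => _) = fst); first exact: measurable_fst.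
by apply/funext => x; rewrite mxE unlift_none.
Qed.

HB.instance Definition _ (R : realType) (n : nat) :=
  isMeasurableFun.Build _ _ _ _ (@rV_cons R n) (@measurable_rV_cons R n).

Lemma measurable_rV_uncons (R : realType) (n : nat) :
  measurable_fun setT (@rV_uncons R n).
Proof.
apply/measurable_fun_pair; first exact: measurable_rV_coord.
apply: measurable_fun_rV => i.
rewrite (_ : (fun x => _) =
    (fun v : borel_rV R n.+1 => (v : 'rV[R]_n.+1) 0 (lift ord0 i))).
  exact: measurable_rV_coord.
by apply/funext => x; rewrite mxE.
Qed.

Section lebesgue_step.
Local Open Scope ereal_scope.
Context (R : realType) (n : nat).
Variable mu : {sigma_finite_measure set (borel_rV R n) -> \bar R}.

Let lebesgue1 : {sigma_finite_measure set (measurableTypeR R) -> \bar R} :=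
  @lebesgue_measure R.

Definition lebesgue_step : set (borel_rV R n.+1) -> \bar R :=
  pushforward (lebesgue1 \x mu) (@rV_cons R n).

Let lebesgue_step0 : lebesgue_step set0 = 0.
Proof. exact: measure0. Qed.

Let lebesgue_step_ge0 A : 0 <= lebesgue_step A.
Proof. exact: measure_ge0. Qed.

Let lebesgue_step_sigma_additive : semi_sigma_additive lebesgue_step.
Proof. exact: measure_semi_sigma_additive. Qed.

HB.instance Definition _ := isMeasure.Build _ _ _ lebesgue_step
  lebesgue_step0 lebesgue_step_ge0 lebesgue_step_sigma_additive.

Let lebesgue_step_sigma_finite : sigma_finite setT lebesgue_step.
Proof.
have /sigma_finiteP[F [FT ndF Foo]] := sigma_finiteT lebesgue1.
have /sigma_finiteP[G [GT ndG Goo]] := sigma_finiteT mu.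
exists (fun k => @rV_uncons R n @^-1` (F k `*` G k)).
  rewrite -preimage_bigcup -[LHS](preimage_setT (@rV_uncons R n)).
  congr (_ @^-1` _); rewrite -setXTT FT GT predeqE => -[x y]; split.
    move=> [/= [i _ Fix] [j _ Gjy]]; exists (maxn i j) => //; split.
    - by move: x Fix; exact/subsetPset/ndF/leq_maxl.
    - by move: y Gjy; exact/subsetPset/ndG/leq_maxr.
  by move=> [i _ []/= ? ?]; split; exists i.
move=> k; have [mFk Fk] := Foo k; have [mGk Gk] := Goo k; split.
  rewrite -[X in measurable X]setTI; apply: measurable_rV_uncons => //.
  exact: measurableX.
rewrite /lebesgue_step /pushforward -comp_preimage.
rewrite (_ : _ \o _ = id); last by apply/funext => p /=; rewrite rV_consK.
by rewrite preimage_id product_measure1E// lte_mul_pinfty// ge0_fin_numE.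
Qed.

HB.instance Definition _ := Measure_isSigmaFinite.Build _ _ _ lebesgue_step
  lebesgue_step_sigma_finite.

End lebesgue_step.

Fixpoint borel_lebesgue (R : realType) (n : nat) :
    {sigma_finite_measure set (borel_rV R n) -> \bar R} :=
  if n is n'.+1 then lebesgue_step (borel_lebesgue R n')
  else @dirac _ (borel_rV R 0) (0 : 'rV[R]_0) R.

Definition lebesgue_type (R : realType) (n : nat) :=
  caratheodory_type ((borel_lebesgue R n)^*)%mu.
HB.instance Definition _ (R : realType) (n : nat) :=
  Measurable.on (lebesgue_type R n).

Definition lebesgue_rV (R : realType) (n : nat) :
    {measure set (lebesgue_type R n) -> \bar R} :=
  @completed_measure_extension _ _ _ (borel_lebesgue R n).

(** Hausdorff measure of integer dimension [k] on [R^n], normalised so that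
    the unit ball of [R^k] has the volume given by Lebesgue measure. *)

(* [-oo] for the empty set *)
Definition ediam (R : realType) (n : nat) (A : set 'rV[R]_n) : \bar R :=
  ereal_sup [set (enorm (p.1 - p.2))%:E | p in A `*` A].

(* The case distinction only matters for k = 0, where diam(A)^0 must be 0 for
   the empty set and 1 otherwise. *)
Definition hausdorff_gauge (R : realType) (n k : nat) (A : set 'rV[R]_n) :
    \bar R :=
  if `[< A = set0 >] then 0%E
  else (borel_lebesgue R k (eball 0 1) * ((2^-1)%:E * ediam A) ^+ k)%E.

Definition hausdorff_delta (R : realType) (n k : nat) (delta : R)
    (A : set 'rV[R]_n) : \bar R :=
  ereal_inf [set (\sum_(i <oo) hausdorff_gauge k (C i))%E |
    C in [set C : (set 'rV[R]_n)^nat |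
      (forall i, (ediam (C i) <= delta%:E)%E) /\ A `<=` \bigcup_i C i]].

Definition hausdorff (R : realType) (n k : nat) (A : set 'rV[R]_n) : \bar R :=
  ereal_sup [set hausdorff_delta k delta A | delta in [set delta | 0 < delta]].

Section hausdorff_outer_measure.
Local Open Scope ereal_scope.
Context (R : realType) (n k : nat).

Lemma ediam_ge0 (A : set 'rV[R]_n) : A !=set0 -> 0 <= ediam A.
Proof.
move=> [x Ax]; apply: ereal_sup_ubound; exists (x, x) => //=.
rewrite subrr /enorm /dot big1 ?sqrtr0// => i _.
by rewrite mxE mul0r.
Qed.

Lemma hausdorff_gauge_ge0 (A : set 'rV[R]_n) : 0 <= hausdorff_gauge k A.
Proof.
rewrite /hausdorff_gauge; case: asboolP => // /eqP/set0P A0.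
by rewrite mule_ge0// expe_ge0// mule_ge0 ?ediam_ge0// lee_fin.
Qed.

(* [hausdorff_delta] is an instance of [mu_ext]: on the discrete sigma-algebra,
   for a gauge that is infinite on the sets of diameter larger than [delta]. *)
Let T := g_sigma_algebraType [set: set 'rV[R]_n].
Let gauge (delta : R) (A : set T) : \bar R :=
  if ediam (A : set 'rV[R]_n) <= delta%:E then hausdorff_gauge k A else +oo.

Let gauge_ge0 delta A : 0 <= gauge delta A.
Proof. by rewrite /gauge; case: ifP => // _; exact: hausdorff_gauge_ge0. Qed.

Let gauge0 delta : gauge delta set0 = 0.
Proof.
rewrite /gauge /ediam /hausdorff_gauge setX0 image_set0 ereal_sup0 leNye.
by case: asboolP.
Qed.

Let hausdorff_deltaE delta :
  hausdorff_delta k delta = mu_ext (gauge delta).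
Proof.
apply/funext => A; apply/eqP; rewrite eq_le; apply/andP; split.
- apply: le_ereal_inf_tmp => _ [C [_ AC] <-].
  have [dC|/existsNP[i /negP dC]] :=
      pselect (forall i, ediam (C i : set 'rV[R]_n) <= delta%:E).
    apply: ereal_inf_lbound; exists C; first by split.
    by apply: eq_eseriesr => i _; rewrite /gauge dC.
  rewrite [leRHS](@eseries_pinfty _ _ _ i) ?leey//.
    by move=> j _; rewrite -ltNye (lt_le_trans _ (gauge_ge0 _ _)).
  by rewrite /gauge (negbTE dC).
- apply: le_ereal_inf_tmp => _ [C [dC AC] <-].
  apply: ereal_inf_lbound; exists C; first split => //.
    by move=> i; exact: sub_sigma_algebra.
  by apply: eq_eseriesr => i _; rewrite /gauge dC.
Qed.

Let hausdorff0 : hausdorff k (set0 : set 'rV[R]_n) = 0.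
Proof.
rewrite /hausdorff (_ : image _ _ = [set 0]) ?ereal_sup1//.
apply/seteqP; split => [_ [d _ <-]|_ ->] /=.
  rewrite hausdorff_deltaE mu_ext0//; exact: gauge_ge0.
by exists 1%R => //=; rewrite hausdorff_deltaE mu_ext0//; exact: gauge_ge0.
Qed.

Let hausdorff_ge0 (A : set 'rV[R]_n) : 0 <= hausdorff k A.
Proof.
apply: le_trans (ereal_sup_ubound _); last by exists 1%R => //=.
by rewrite hausdorff_deltaE; apply: mu_ext_ge0 => B; exact: gauge_ge0.
Qed.

Let le_hausdorff :
  {homo @hausdorff R n k : A B / A `<=` B >-> A <= B}.
Proof.
move=> A B AB; apply: ge_ereal_sup => _ [d d0 <-].
apply: le_trans (ereal_sup_ubound _); last by exists d.
by rewrite hausdorff_deltaE; exact: le_mu_ext.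
Qed.

Let hausdorff_sigma_subadditive : sigma_subadditive (@hausdorff R n k).
Proof.
move=> F; apply: ge_ereal_sup => _ [d d0 <-].
rewrite hausdorff_deltaE.
apply: (le_trans (mu_ext_sigma_subadditive (gauge_ge0 d) F)).
apply: lee_nneseries => i _.
  by move=> _; apply: mu_ext_ge0 => B; exact: gauge_ge0.
by rewrite -hausdorff_deltaE; apply: ereal_sup_ubound; exists d.
Qed.

HB.instance Definition _ := isOuterMeasure.Build R 'rV[R]_n (@hausdorff R n k)
  hausdorff0 hausdorff_ge0 le_hausdorff hausdorff_sigma_subadditive.

End hausdorff_outer_measure.

Definition caratheodory_measure (R : realType) (T : pointedType)
    (mu : {outer_measure set T -> \bar R}) :
    {measure set (caratheodory_type mu) -> \bar R} := mu.

Definition hausdorff_measure (R : realType) (n k : nat) :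
    {measure set (caratheodory_type (@hausdorff R n k)) -> \bar R} :=
  caratheodory_measure (@hausdorff R n k).

Definition partial (R : realType) (n : nat) (f : 'rV[R]_n -> R) (i : 'I_n) :
    'rV[R]_n -> R :=
  fun x => 'D_(delta_mx 0 i) f x.

Fixpoint is_Ck (R : realType) (n k : nat) (f : 'rV[R]_n -> R) : Prop :=
  if k is k'.+1 then
    (forall x, differentiable f x) /\ forall i, is_Ck k' (partial f i)
  else continuous f.

Definition is_smooth (R : realType) (n : nat) (f : 'rV[R]_n -> R) : Prop :=
  forall k, is_Ck k f.

Definition divergence (R : realType) (n : nat) (phi : 'rV[R]_n -> 'rV[R]_n)
    (x : 'rV[R]_n) : R :=
  \sum_i partial (fun y => phi y 0 i) i x.

Definition is_C1c (R : realType) (n : nat) (phi : 'rV[R]_n -> 'rV[R]_n) : Prop :=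
  (forall i, is_Ck 1 (fun y => phi y 0 i)) /\
  compact (closure [set x | phi x != 0]).

Definition perimeter (R : realType) (n : nat) (E : set 'rV[R]_n) : \bar R :=
  ereal_sup [set (\int[lebesgue_rV R n]_(x in E) (divergence phi x)%:E)%E |
    phi in [set phi | is_C1c phi /\ forall x, enorm (phi x) <= 1]].

Definition finite_perimeter (R : realType) (n : nat) (E : set 'rV[R]_n) : Prop :=
  measurable (E : set (lebesgue_type R n)) /\ (perimeter E < +oo)%E.

(* [- nu *: mu] is the polar decomposition of the distributional gradient of
   the indicator function of [E]: [mu] is its total variation, and [nu] is
   determined mu-almost everywhere.  With this sign [nu] is the outer normal. *)
Definition gauss_green (R : realType) (n : nat) (E : set 'rV[R]_n)
    (mu : {finite_measure set (borel_rV R n) -> \bar R})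
    (nu : 'rV[R]_n -> 'rV[R]_n) : Prop :=
  [/\ measurable_fun [set: borel_rV R n] (nu : borel_rV R n -> borel_rV R n),
      {ae mu, forall x, enorm (nu x : 'rV[R]_n) = 1} &
      forall phi, is_C1c phi ->
        (\int[lebesgue_rV R n]_(x in E) (divergence phi x)%:E =
         \int[mu]_x (dot (phi x) (nu x))%:E)%E].

(* [v] is the density of [nu *: mu] with respect to [mu] at [x], where [x] lies
   in the support of [mu]. *)
Definition is_normal (R : realType) (n : nat) (E : set 'rV[R]_n)
    (x v : 'rV[R]_n) : Prop :=
  exists (mu : {finite_measure set (borel_rV R n) -> \bar R})
      (nu : 'rV[R]_n -> 'rV[R]_n),
    [/\ gauss_green E mu nu,
        (forall rho, 0 < rho -> (0 < mu (eball x rho))%E),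
        (\row_i ((fine (mu (eball x rho)))^-1 *
           \int[mu]_(y in eball x rho) nu y 0 i)) @[rho --> 0^'+] --> v &
        enorm v = 1].

Definition reduced_boundary (R : realType) (n : nat) (E : set 'rV[R]_n) :
    set 'rV[R]_n :=
  [set x | exists v, is_normal E x v].

(* outer unit normal; junk value 0 off the reduced boundary *)
Definition normal (R : realType) (n : nat) (E : set 'rV[R]_n) (x : 'rV[R]_n) :
    'rV[R]_n :=
  xget 0 [set v | is_normal E x v].

Definition rescale (R : realType) (n : nat) (r : R) (f : 'rV[R]_n -> R) :
    'rV[R]_n -> R :=
  fun x => r ^- n * f (r^-1 *: x).

Definition convolution (R : realType) (n : nat) (f g : 'rV[R]_n -> R) :
    'rV[R]_n -> R :=
  fun x => \int[lebesgue_rV R n]_y (f (x - y) * g y).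

Definition surface_tension (R : realType) (n : nat) (f : 'rV[R]_n -> R)
    (v : 'rV[R]_n) : R :=
  - 2^-1 * \int[lebesgue_rV R n]_y \int[lebesgue_rV R n]_x
      (f x * f y * `|dot (x - y) v|).

(* Main.v *)
(* Since f has mean zero, ||f_r * 1_E||^2 is the integral over (z, w) of
     - f(z) f(w) ||1_E(. - r z) - 1_E(. - r w)||_1 / 2,
   whose L1 norm only depends on r (z - w). The Gauss-Green formula D 1_E = - nu mu shows
   that ||1_E(. - r h) - 1_E||_1 / r is at most |h| mu(R^n) and tends to the integral of
   |h . nu| against mu; dominated convergence gives the limit int F(nu) dmu.

   It remains to identify mu with H^(n-1) on the reduced boundary. The pair (mu, nu)
   represents the perimeter functional. Almost every x is a Lebesgue point of nu (weak type
   inequality from Besicovitch packing); there the blow-ups of E converge to a half-space,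
   being monotone along nu(x) and independent of the other directions up to the excess, and
   centred by lower volume density bounds (from averaging over a cube, in place of the
   isoperimetric inequality). So mu has the density of (n-1)-volume; covering arguments then
   give mu <= H^(n-1), by the isodiametric inequality (from Prekopa-Leindler), and
   H^(n-1) <= mu. *)
Require Import Defs.
From HB Require Import structures.
From mathcomp Require Import all_boot all_order all_algebra.
From mathcomp Require Import all_classical all_reals all_analysis.
From mathcomp Require Import measurable_realfun ring lra.

Set Implicit Arguments.
Unset Strict Implicit.
Unset Printing Implicit Defensive.
Import Order.TTheory GRing.Theory Num.Theory.
Import numFieldNormedType.Exports.

Local Open Scope classical_set_scope.
Local Open Scope ring_scope.

(** Three features of the definitions shape the proof. [is_normal] quantifies over all Gauss-Green
    pairs, so uniqueness of (mu, nu) is what ties [normal] to the constructed pair. [E] is only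
    Lebesgue measurable; it is exchanged for a Borel set that contains it and differs by a
    negligible set. The reduced boundary is not known to be Borel, so H^(n-1) of the whole of it is
    bounded by mu(R^n), while mu <= H^(n-1) is proved on Borel sets; equality of the total masses
    then yields equality on a Borel part of full measure and negligibility of the rest.

    Blow-ups are treated without compactness, by explicit estimates. If h . v >= 0, the points x of
    E with x - h off E fill a volume of at most |h| times the integral of |v - nu|, and Young's
    inequality controls |v - nu| by the excess 1 - v . nu. If E had volume beyond the hyperplane
    while its complement has a definite volume near the origin, too many such translations would
    leave E. The complement is treated in the same way. *)

Lemma le_of_eq {disp} {T : porderType disp} (x y : T) : x = y -> (x <= y)%O.
Proof. by move->. Qed.

Lemma normr_indic_le1 {T : Type} {R : numDomainType} (A : set T) x : `|\1_A x : R| <= 1.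
Proof. by rewrite indicE; case: (_ \in _); rewrite ?normr1 ?normr0. Qed.

(** * Euclidean norm and Borel structure on row vectors *)

Section euclidean.
Context {R : realType} {n : nat}.
Local Notation rV := 'rV[R]_n.
Implicit Types (x y z v : rV) (r : R).

Lemma dotC x y : dot x y = dot y x.
Proof. by apply: eq_bigr => i _; rewrite mulrC. Qed.

Lemma dotDl x y z : dot (x + y) z = dot x z + dot y z.
Proof. by rewrite -big_split; apply: eq_bigr => i _; rewrite mxE mulrDl. Qed.

Lemma dotZl (a : R) x y : dot (a *: x) y = a * dot x y.
Proof. by rewrite big_distrr; apply: eq_bigr => i _; rewrite mxE/= mulrA. Qed.

Lemma dotDr x y z : dot x (y + z) = dot x y + dot x z.
Proof. by rewrite ![dot x _]dotC dotDl. Qed.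

Lemma dotZr (a : R) x y : dot x (a *: y) = a * dot x y.
Proof. by rewrite ![dot x _]dotC dotZl. Qed.

Lemma dotNl x y : dot (- x) y = - dot x y.
Proof. by rewrite -scaleN1r dotZl mulN1r. Qed.

Lemma dotNr x y : dot x (- y) = - dot x y.
Proof. by rewrite dotC dotNl dotC. Qed.

Lemma dotBl x y z : dot (x - y) z = dot x z - dot y z.
Proof. by rewrite dotDl dotNl. Qed.

Lemma dotBr x y z : dot x (y - z) = dot x y - dot x z.
Proof. by rewrite dotDr dotNr. Qed.

Lemma dot0l x : dot 0 x = 0.
Proof. by rewrite -(scale0r 0) dotZl mul0r. Qed.

Lemma dot0r x : dot x 0 = 0.
Proof. by rewrite dotC dot0l. Qed.

Lemma dotxx_ge0 x : 0 <= dot x x.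
Proof. by apply: sumr_ge0 => i _; rewrite -expr2 sqr_ge0. Qed.

Lemma enorm_ge0 x : 0 <= enorm x.
Proof. exact: sqrtr_ge0. Qed.

Lemma sqr_enorm x : enorm x ^+ 2 = dot x x.
Proof. by rewrite sqr_sqrtr// dotxx_ge0. Qed.

Lemma enorm0 : enorm (0 : rV) = 0.
Proof. by rewrite /enorm dot0l sqrtr0. Qed.

Lemma ler_coord_enorm x i : `|x 0 i| <= enorm x.
Proof.
rewrite -(@ler_pXn2r _ 2)// ?nnegrE ?enorm_ge0// sqr_enorm real_normK ?num_real//.
rewrite /dot (bigD1 i)//= -expr2 lerDl.
by apply: sumr_ge0 => j _; rewrite -expr2 sqr_ge0.
Qed.

Lemma enorm_eq0 x : (enorm x == 0) = (x == 0).
Proof.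
apply/eqP/eqP => [x0|->]; last exact: enorm0.
apply/rowP => i; rewrite mxE; apply/normr0_eq0/eqP.
by rewrite eq_le normr_ge0 andbT -x0 ler_coord_enorm.
Qed.

Lemma enormZ (a : R) x : enorm (a *: x) = `|a| * enorm x.
Proof. by rewrite /enorm dotZl dotZr mulrA -expr2 sqrtrM ?sqr_ge0// sqrtr_sqr. Qed.

Lemma enormN x : enorm (- x) = enorm x.
Proof. by rewrite -scaleN1r enormZ normrN normr1 mul1r. Qed.

Lemma enormB x y : enorm (x - y) = enorm (y - x).
Proof. by rewrite -enormN opprB. Qed.

Lemma cauchy_schwarz x y : dot x y <= enorm x * enorm y.
Proof.
have [->|y0] := eqVneq y 0; first by rewrite dot0r enorm0 mulr0.
have yy : 0 < enorm y by rewrite lt_def enorm_ge0 enorm_eq0 y0.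
have [->|x0] := eqVneq x 0; first by rewrite dot0l enorm0 mul0r.
have xx : 0 < enorm x by rewrite lt_def enorm_ge0 enorm_eq0 x0.
have := dotxx_ge0 (enorm y *: x - enorm x *: y).
rewrite dotBl !dotBr !dotZl !dotZr -!sqr_enorm (dotC y x).
set a := enorm x; set b := enorm y; set c := dot x y.
have -> : b * (b * a ^+ 2) - b * (a * c) - (a * (b * c) - a * (a * b ^+ 2)) =
  (2 * a * b) * (a * b - c) by ring.
by rewrite pmulr_rge0 ?subr_ge0// !mulr_gt0.
Qed.

Lemma normr_dot x y : `|dot x y| <= enorm x * enorm y.
Proof.
rewrite ler_norml cauchy_schwarz andbT lerNl -dotNl.
by rewrite -(enormN x) cauchy_schwarz.
Qed.

Lemma ler_enormD x y : enorm (x + y) <= enorm x + enorm y.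
Proof.
rewrite -(@ler_pXn2r _ 2)// ?nnegrE ?addr_ge0 ?enorm_ge0//.
rewrite sqr_enorm dotDl !dotDr -!sqr_enorm (dotC y x).
have := cauchy_schwarz x y; nra.
Qed.

Lemma ler_enorm_dist x y z : enorm (x - z) <= enorm (x - y) + enorm (y - z).
Proof. by rewrite -[x - z](subrKA y) ler_enormD. Qed.

Lemma ler_dist_enorm x y : `|enorm x - enorm y| <= enorm (x - y).
Proof.
have := ler_enormD (x - y) y; rewrite subrK => h1.
have := ler_enormD (y - x) x; rewrite subrK (enormB y) => h2.
by rewrite ler_norml; apply/andP; lra.
Qed.

Lemma ler_enorm_norm x : enorm x <= n%:R * `|x|.
Proof.
rewrite -(@ler_pXn2r _ 2)// ?nnegrE ?enorm_ge0 ?mulr_ge0//.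
rewrite sqr_enorm exprMn; apply: (@le_trans _ _ (n%:R * `|x| ^+ 2)).
  rewrite mulr_natl -[X in _ *+ X]card_ord -sumr_const ler_sum// => i _.
  rewrite -expr2 -real_normK ?num_real// ler_sqr ?nnegrE//.
  rewrite /Num.norm/= mx_normrE; apply: (@le_bigmax _ _ _ 0 (fun k => `|x k.1 k.2|) (0, i)).
rewrite ler_wpM2r ?sqr_ge0// -natrX ler_nat.
by case: (n) => // k; rewrite leq_pmull.
Qed.

Lemma ler_norm_enorm x : `|x| <= enorm x.
Proof.
rewrite /Num.norm/= mx_normrE; apply: bigmax_le; first exact: enorm_ge0.
by case=> i j _ /=; rewrite ord1 ler_coord_enorm.
Qed.

Lemma enorm_cvg (F : set_system rV) {FF : Filter F} x :
  (forall e, 0 < e -> \forall y \near F, enorm (x - y) < e) -> F --> x.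
Proof.
move=> Fx; apply/(@cvgrPdist_lt _ rV) => e e0.
by apply: filterS (Fx _ e0) => y; exact: le_lt_trans (ler_norm_enorm _).
Qed.

Lemma near_enorm x e : 0 < e -> \forall y \near x, enorm (x - y) < e.
Proof.
move=> e0; have e1 : 0 < e / n.+1%:R by rewrite divr_gt0.
apply/(@nbhs_ballP R rV); exists (e / n.+1%:R) => //= y.
rewrite mx_norm_ball /= => xy.
apply: le_lt_trans (ler_enorm_norm _) _.
apply: (@le_lt_trans _ _ (n.+1%:R * `|x - y|)).
  by rewrite ler_wpM2r// ler_nat.
by rewrite mulrC -ltr_pdivlMr.
Qed.

Lemma enorm_continuous : continuous (@enorm R n).
Proof.
move=> x; apply/(@cvgrPdist_lt _ _ _ (nbhs x)) => e e0.
by apply: filterS (near_enorm x e0) => y; apply: le_lt_trans (ler_dist_enorm _ _).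
Qed.

Lemma dotl_continuous v : continuous (fun x => dot x v).
Proof.
apply: (@continuous_big _ _ +%R 0 _ (@add_continuous R) _ _ (fun i (x : rV) => x 0 i * v 0 i)) => i _ x.
by rewrite /continuous_at; apply: (@cvgMr_tmp _ _ (nbhs x) _ (fun z : rV => z 0 i)); exact: (@coord_continuous R 1 n 0 i x).
Qed.

Lemma eballE x r : eball x r = [set y | enorm (x - y) < r].
Proof. by apply/funext => y; rewrite /eball/= enormB. Qed.

Lemma open_eball x r : open (eball x r).
Proof.
have c : continuous (fun y => enorm (y - x)).
  move=> y; apply: (@continuous_comp _ _ _ (fun y => y - x) (@enorm R n)).
    by apply: (@cvgB _ _ _ (nbhs y)); [exact: cvg_id|exact: cvg_cst].
  exact: enorm_continuous.
by have /continuousP/(_ _ (@open_lt R r)) := c.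
Qed.

Lemma eball_center x r : 0 < r -> eball x r x.
Proof. by rewrite /eball/= subrr enorm0. Qed.

Lemma open_eballP (U : set rV) :
  open U <-> forall x, U x -> exists2 e, 0 < e & eball x e `<=` U.
Proof.
split=> [oU x Ux|h].
  have /(@nbhs_ballP R rV)[e /= e0 eU] : nbhs x U by exact: open_nbhs_nbhs.
  exists e => // y; rewrite eballE /= => xy; apply: eU.
  by rewrite mx_norm_ball/=; exact: le_lt_trans (ler_norm_enorm _) xy.
rewrite openE => x /h[e e0 eU]; rewrite /interior.
apply: filterS eU _; rewrite eballE; exact: near_enorm.
Qed.

Lemma rat_dense_enorm x e : 0 < e ->
  exists q : 'rV[rat]_n, enorm (x - map_mx ratr q) < e.
Proof.
move=> e0; have e1 : 0 < e / n.+1%:R by rewrite divr_gt0.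
have q_ i : {q : rat | `|x 0 i - ratr q| < e / n.+1%:R}.
  apply: cid; have /rat_in_itvoo[q] : x 0 i - e / n.+1%:R < x 0 i + e / n.+1%:R.
    by rewrite ltrBlDr -addrA ltrDl addr_gt0.
  by rewrite in_itv/= => qe; exists q; rewrite distrC ltr_distl.
exists (\row_i sval (q_ i)).
apply: le_lt_trans (ler_enorm_norm _) _.
apply: (@le_lt_trans _ _ (n.+1%:R * `|x - map_mx ratr (\row_i sval (q_ i))|)).
  by rewrite ler_wpM2r// ler_nat.
rewrite mulrC -ltr_pdivlMr// /Num.norm/= mx_normrE.
apply/bigmax_ltP; split => // -[i j] _ /=; rewrite ord1 !mxE.
by case: (q_ j).
Qed.

Lemma open_bigcup_eball (U : set rV) : open U ->
  exists (c : nat -> rV) (r : nat -> R),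
    (forall k, 0 <= r k) /\ U = \bigcup_k eball (c k) (r k).
Proof.
move=> oU.
pose D k : option ('rV[rat]_n * rat) := unpickle k.
pose good (p : 'rV[rat]_n * rat) :=
  `[< 0 < (ratr p.2 : R) /\ eball (map_mx ratr p.1) (ratr p.2) `<=` U >].
pose c k : rV := if D k is Some p then map_mx ratr p.1 else 0.
(* Radius 0 gives the empty ball, so the codes that are undefined or not contained in [U] contribute
   nothing. *)
pose r k : R := if D k is Some p then if good p then ratr p.2 else 0 else 0.
exists c, r; split.
  by move=> k; rewrite /r; case: (D k) => // p; case: ifPn => // /asboolP[/ltW].
apply/seteqP; split => [x Ux|x [k _]].
  have /open_eballP/(_ x Ux)[e e0 eU] := oU.
  have [q xq] : exists q : 'rV[rat]_n, enorm (x - map_mx ratr q) < e / 3.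
    by apply: rat_dense_enorm; rewrite divr_gt0.
  (* Above e/3, so that the ball around [q] contains [x]; below e/2, so that its points are within
     e/3 + e/2 < e of [x]. *)
  have /rat_in_itvoo[s] : e / 3 < e / 2 by lra.
  rewrite in_itv/= => /andP[s1 s2].
  have gqs : good (q, s).
    apply/asboolP; split => /=; first lra.
    move=> y; rewrite eballE/= => yq; apply: eU; rewrite eballE/=.
    apply: le_lt_trans (ler_enorm_dist _ (map_mx ratr q) _) _; lra.
  exists (pickle (q, s)) => //.
  rewrite /c /r /D pickleK gqs eballE/= enormB; lra.
rewrite /c /r; case: (D k) => [p|]; last by rewrite /eball/= ltNge enorm_ge0.
case: ifPn => [/asboolP[_ pU]|_]; first exact: pU.
by rewrite /eball/= ltNge enorm_ge0.
Qed.

End euclidean.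

Section borel.
Context {R : realType} {n : nat}.
Local Notation rV := 'rV[R]_n.
Local Notation T := (borel_rV R n).

Lemma measurable_dot (d : measure_display) (S : measurableType d) (f g : S -> T) :
  measurable_fun setT f -> measurable_fun setT g ->
  measurable_fun setT (fun x => dot (f x : 'rV_n) (g x : 'rV_n)).
Proof.
move=> mf mg; rewrite /dot.
apply: (@measurable_sum _ _ _ _ _ _ (fun i x => (f x : 'rV_n) 0 i * (g x : 'rV_n) 0 i)).
by move=> i; apply: measurable_funM; exact: (measurableT_comp (@measurable_rV_coord R n i)).
Qed.

Lemma measurable_enorm : measurable_fun [set: T] (@enorm R n : T -> R).
Proof.
apply: (measurableT_comp (continuous_measurable_fun (@sqrt_continuous R))).
by apply: measurable_dot; exact: measurable_id.
Qed.

Lemma measurable_rVD (d : measure_display) (S : measurableType d) (f g : S -> T) :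
  measurable_fun setT f -> measurable_fun setT g ->
  measurable_fun setT (fun x => (f x : rV) + (g x : rV) : T).
Proof.
move=> mf mg; apply: measurable_fun_rV => i.
rewrite (_ : (fun x => _) =
   (fun x => (f x : rV) 0 i + (g x : rV) 0 i)).
  by apply: measurable_funD; exact: (measurableT_comp (@measurable_rV_coord R n i)).
by apply/funext => x; rewrite mxE.
Qed.

Lemma measurable_rVZ (d : measure_display) (S : measurableType d)
    (a : S -> R) (f : S -> T) :
  measurable_fun setT a -> measurable_fun setT f ->
  measurable_fun setT (fun x => a x *: (f x : rV) : T).
Proof.
move=> ma mf; apply: measurable_fun_rV => i.
rewrite (_ : (fun x => _) = (fun x => a x * (f x : rV) 0 i)).
  by apply: measurable_funM => //; exact: (measurableT_comp (@measurable_rV_coord R n i)).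
by apply/funext => x; rewrite mxE.
Qed.

Lemma measurable_rVN (d : measure_display) (S : measurableType d) (f : S -> T) :
  measurable_fun setT f ->
  measurable_fun setT (fun x => - (f x : rV) : T).
Proof.
move=> mf; under eq_fun do rewrite -scaleN1r.
by apply: measurable_rVZ => //; exact: measurable_cst.
Qed.

Lemma measurable_rVB (d : measure_display) (S : measurableType d) (f g : S -> T) :
  measurable_fun setT f -> measurable_fun setT g ->
  measurable_fun setT (fun x => (f x : rV) - (g x : rV) : T).
Proof. by move=> mf mg; apply: measurable_rVD => //; exact: measurable_rVN. Qed.

Lemma measurable_preimageT (d d' : measure_display) (S : measurableType d)
    (S' : measurableType d') (f : S -> S') (A : set S') :
  measurable_fun setT f -> measurable A -> measurable (f @^-1` A).
Proof. by move=> mf mA; rewrite -[X in measurable X]setTI; exact: mf. Qed.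

Lemma measurable_box r : measurable ([set x : rV | forall i, 0 <= x 0 i < r] : set T).
Proof.
rewrite (_ : [set _ | _] = \bigcap_(i in [set: 'I_n])
    (fun x : T => (x : rV) 0 i : measurableTypeR R) @^-1` `[0, r[%classic).
  apply: fin_bigcap_measurable => // i _.
  by apply: measurable_preimageT => //; exact: measurable_rV_coord.
apply/seteqP; split => x /= h i; first by move=> _ /=; rewrite in_itv; exact: h.
by have := h i I; rewrite /= in_itv.
Qed.

Lemma measurable_eball (x : rV) r : measurable (eball x r : set T).
Proof.
rewrite (_ : eball x r = (fun y : T => enorm ((y : 'rV_n) - x)) @^-1` `]-oo, r[%classic).
  apply: measurable_preimageT => //; apply: (measurableT_comp measurable_enorm).
  by apply: measurable_rVB; [exact: measurable_id|exact: measurable_cst].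
by apply/seteqP; split => y; rewrite /eball/= in_itv.
Qed.

Lemma open_measurable_rV (U : set rV) : open U -> measurable (U : set T).
Proof.
move=> /open_bigcup_eball[c [r [_ ->]]].
by apply: bigcup_measurable => k _; exact: measurable_eball.
Qed.

Lemma closed_measurable_rV (U : set rV) : closed U -> measurable (U : set T).
Proof.
move=> /closed_openC/open_measurable_rV/measurableC; by rewrite setCK.
Qed.

Lemma continuous_measurable_rV (f : rV -> R) : continuous f ->
  measurable_fun [set: T] (f : T -> R).
Proof.
move=> /continuousP cf; apply: (measurability _ (RGenOpens.measurableE R)) => _ [_ [a [b ->] <-]].
by rewrite setTI; apply: open_measurable_rV; apply: cf; exact: interval_open.
Qed.

End borel.

Ltac measurable_rV := do ?first [exact: measurable_cst | exact: measurable_id | exact: measurable_fst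
  | exact: measurable_snd | apply: measurable_rVB | apply: measurable_rVD | apply: measurable_rVZ
  | apply: measurable_rVN | apply: measurable_dot].

Lemma measurable_dot_ge {R : realType} {n : nat} (v : 'rV[R]_n) (b : R) :
  measurable ([set y | b <= dot v y] : set (borel_rV R n)).
Proof.
rewrite (_ : [set _ | _] = (fun y : borel_rV R n => dot v (y : 'rV[R]_n)) @^-1` `[b, +oo[%classic).
  by apply: measurable_preimageT => //; measurable_rV.
by apply/seteqP; split => y; rewrite /= in_itv/= andbT.
Qed.

Lemma measurable_dot_le {R : realType} {n : nat} (v : 'rV[R]_n) (b : R) :
  measurable ([set y | dot v y <= b] : set (borel_rV R n)).
Proof.
rewrite (_ : [set _ | _] = (fun y : borel_rV R n => dot v (y : 'rV[R]_n)) @^-1` `]-oo, b]%classic).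
  by apply: measurable_preimageT => //; measurable_rV.
by apply/seteqP; split => y; rewrite /= in_itv.
Qed.

Lemma measurable_slab {R : realType} {n : nat} (v : 'rV[R]_n) (b : R) :
  measurable ([set y | `|dot v y| <= b] : set (borel_rV R n)).
Proof.
rewrite (_ : [set _ | _] = [set y | - b <= dot v y] `&` [set y | dot v y <= b]).
  by apply: measurableI; [exact: measurable_dot_ge|exact: measurable_dot_le].
by apply/seteqP; split => y /=; rewrite ler_norml => /andP.
Qed.

Lemma indic_preimage (S S' : Type) (R : pzRingType) (f : S -> S') (A : set S') x :
  \1_(f @^-1` A) x = \1_A (f x) :> R.
Proof. by rewrite !indicE; congr (_%:R); congr nat_of_bool; apply/idP/idP; rewrite !inE. Qed.

Lemma measurable_indic_comp (d d' : measure_display) (S : measurableType d)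
    (S' : measurableType d') (R : realType) (f : S -> S') (A : set S') :
  measurable A -> measurable_fun setT f ->
  measurable_fun setT (fun x => (\1_A (f x))%:E : \bar R).
Proof.
move=> mA mf; apply/measurable_EFinP.
under eq_fun do rewrite -indic_preimage.
by apply: measurable_indic; exact: measurable_preimageT.
Qed.

(** * Measure-preserving maps and image measures *)

Section preserving.
Local Open Scope ereal_scope.
Context {d : measure_display} {T : measurableType d} {R : realType}.
Variable mu : {measure set T -> \bar R}.

Definition preserves (phi : T -> T) :=
  measurable_fun setT phi /\
  forall A, measurable A -> mu (phi @^-1` A) = mu A.

Lemma preserves_ge0_integral phi f : preserves phi ->
  measurable_fun setT f -> (forall x, 0 <= f x) ->
  \int[mu]_x f (phi x) = \int[mu]_x f x.
Proof.
move=> [mphi pphi] mf f0; pose phi' : {mfun T >-> T} := mfun_Sub (mem_set mphi).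
rewrite -[LHS](@ge0_integral_pushforward _ _ _ _ _ phi' _ mu setT f)//.
by apply: eq_measure_integral => A mA _; exact: pphi.
Qed.

Lemma preserves_integral phi f : preserves phi -> measurable_fun setT f ->
  \int[mu]_x f (phi x) = \int[mu]_x f x.
Proof.
move=> pphi mf; rewrite integralE [RHS]integralE.
have mp : measurable_fun setT f^\+ by exact: measurable_funepos.
have mn : measurable_fun setT f^\- by exact: measurable_funeneg.
rewrite -(preserves_ge0_integral pphi mp (fun x => funepos_ge0 f x)).
rewrite -(preserves_ge0_integral pphi mn (fun x => funeneg_ge0 f x)).
by apply: (f_equal2 (fun x y => x - y)); apply: eq_integral => x _; rewrite ?funeposE ?funenegE.
Qed.

Lemma preserves_comp phi psi : preserves phi -> preserves psi ->
  preserves (phi \o psi).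
Proof.
move=> [mphi pphi] [mpsi ppsi]; split; first exact: measurableT_comp.
move=> A mA; rewrite comp_preimage ppsi ?pphi//.
by rewrite -[X in measurable X]setTI; exact: mphi.
Qed.

Lemma preserves_integrable phi f : preserves phi -> measurable_fun setT f ->
  mu.-integrable setT f -> mu.-integrable setT (f \o phi).
Proof.
move=> pphi mf /integrableP[_ fi]; apply/integrableP; split.
  by apply: measurableT_comp => //; case: pphi.
apply: le_lt_trans fi; apply: le_of_eq.
apply: (@preserves_ge0_integral phi (fun x => `|f x|)) => //.
exact: measurableT_comp.
Qed.

End preserving.

Section image_measure.
Local Open Scope ereal_scope.
Context (d d' : measure_display) (T : measurableType d) (T' : measurableType d').
Context (R : realType) (mu : {measure set T -> \bar R}) (phi : T -> T').

Definition image_measure (mphi : measurable_fun setT phi) : {measure set T' -> \bar R} :=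
  measure_function_pushforward__canonical__measure_function_Measure mu mphi.

Variable mphi : measurable_fun setT phi.

Lemma ge0_integral_image_measure f : measurable_fun setT f ->
  (forall y, 0 <= f y) ->
  \int[image_measure mphi]_y f y = \int[mu]_x f (phi x).
Proof.
by move=> mf f0; rewrite -[RHS](@ge0_integral_pushforward _ _ _ _ _ phi mphi mu setT f).
Qed.

Lemma integral_image_measure f : measurable_fun setT f ->
  \int[image_measure mphi]_y f y = \int[mu]_x f (phi x).
Proof.
move=> mf; rewrite [LHS]integralE [RHS]integralE.
have mp : measurable_fun setT f^\+ by exact: measurable_funepos.
have mn : measurable_fun setT f^\- by exact: measurable_funeneg.
rewrite (ge0_integral_image_measure mp (fun x => funepos_ge0 f x)).
rewrite (ge0_integral_image_measure mn (fun x => funeneg_ge0 f x)).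
by apply: (f_equal2 (fun x y => x - y)); apply: eq_integral => x _; rewrite ?funeposE ?funenegE.
Qed.

End image_measure.

Section sigma_finite_alias.
Context (d : measure_display) (T : measurableType d) (R : realType).
Context (m : {measure set T -> \bar R}).

(** The proof is a parameter of the alias, which allows a canonical sigma-finite structure on a
    measure whose sigma-finiteness is only a hypothesis. *)
Definition sigma_finite_alias of sigma_finite setT m : set T -> \bar R := m.

Variable sf : sigma_finite setT m.
HB.instance Definition _ := Measure.on (sigma_finite_alias sf).
HB.instance Definition _ :=
  Measure_isSigmaFinite.Build _ _ _ (sigma_finite_alias sf) sf.

End sigma_finite_alias.

(** * Lebesgue measure under affine maps *)

Section lebesgue_line.
Context {R : realType}.
Local Notation leb := (@lebesgue_measure R).

Lemma lebesgue_line_shift (a : R) : preserves leb (fun t => t + a).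
Proof.
have ma : measurable_fun setT ((fun t => t + a) : R -> R).
  by apply: measurable_funD => //; exact: measurable_cst.
split=> [|A mA]; first exact: ma.
apply/esym; rewrite -[RHS]/(pushforward leb ((fun t => t + a) : R -> measurableTypeR R) A).
pose phi : {mfun measurableTypeR R >-> measurableTypeR R} := @mfun_Sub _ _ (measurableTypeR R) (measurableTypeR R) (fun t => t + a) (mem_set ma).
apply: (@lebesgue_measure_unique R (pushforward leb phi)) => // _ [[x y] _ <-] /=.
rewrite /pushforward (_ : _ @^-1` _ = `]x - a, y - a]%classic).
  rewrite !lebesgue_measure_itv /= !lte_fin ltrD2r.
  by case: ifP => // _; rewrite -!EFinB opprD opprK addrACA addNr addr0.
by apply/seteqP; split => t; rewrite /= !in_itv/= ltrBlDr lerBrDr.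
Qed.

Lemma lebesgue_line_opp : preserves leb (fun t => - t).
Proof.
split; first exact: (@oppr_measurable R setT).
by move=> A mA; exact: lebesgue_measureN.
Qed.

End lebesgue_line.

Section lebesgue_rn.
Local Open Scope ereal_scope.
Context {R : realType}.
Local Notation leb := (@lebesgue_measure R).
Local Notation L n := (borel_lebesgue R n).

Lemma integral_borel_lebesgueS n (f : borel_rV R n.+1 -> \bar R) :
  measurable_fun setT f -> (forall x, 0 <= f x) ->
  \int[L n.+1]_x f x = \int[leb]_t \int[L n]_y f (rV_cons (t, y)).
Proof.
move=> mf f0 /=.
rewrite (@ge0_integral_pushforward _ _ _ _ _ (@rV_cons R n) _ _ setT f)// preimage_setT.
rewrite (@fubini_tonelli1 _ _ _ _ _ _ _ (f \o @rV_cons R n))//.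
- exact: measurableT_comp.
- by move=> x; exact: f0.
Qed.

Lemma borel_lebesgueS_indic n (A : set (borel_rV R n.+1)) : measurable A ->
  L n.+1 A = \int[leb]_t \int[L n]_y (\1_A (rV_cons (t, y)))%:E.
Proof.
move=> mA; rewrite -[in LHS](setIT A) -(integral_indic (L n.+1))//.
rewrite (@integral_borel_lebesgueS n (fun x => (\1_A x)%:E))//.
  by apply/measurable_EFinP; exact: measurable_indic.
Qed.

Lemma rV_consD n (t a : R) (y b : 'rV[R]_n) :
  ((rV_cons (t, y) : 'rV_n.+1) + (rV_cons (a, b) : 'rV_n.+1) = rV_cons (t + a, y + b))%R.
Proof.
apply/rowP => i; rewrite !mxE; case: (unlift ord0 i) => //= j.
by rewrite mxE.
Qed.

Lemma rV_consN n (t : R) (y : 'rV[R]_n) :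
  (- (rV_cons (t, y) : 'rV_n.+1) = rV_cons (- t, - y))%R.
Proof.
apply/rowP => i; rewrite !mxE; case: (unlift ord0 i) => //= j.
by rewrite mxE.
Qed.

Lemma rV_unconsK n : cancel (@rV_uncons R n) (@rV_cons R n).
Proof.
move=> x; apply/rowP => i; rewrite !mxE.
by case: (unliftP ord0 i) => [j ->|->] /=; rewrite ?mxE.
Qed.

Lemma measurable_shift n (a : 'rV[R]_n) :
  measurable_fun setT ((fun x => (x : 'rV[R]_n) + a)%R : borel_rV R n -> borel_rV R n).
Proof. by measurable_rV. Qed.

Lemma borel_lebesgue_shift n (a : 'rV[R]_n) :
  preserves (L n) (fun x => (x : 'rV[R]_n) + a)%R.
Proof.
elim: n a => [|n IH] a.
  split; first exact: measurable_shift.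
  move=> A _; congr (L 0 _); apply/funext => x /=; congr A.
  by rewrite [LHS]thinmx0 [RHS]thinmx0.
split; first exact: measurable_shift.
move=> A mA; have mA' := measurable_preimageT (measurable_shift a) mA.
apply: (etrans (borel_lebesgueS_indic mA')); apply/esym/(etrans (borel_lebesgueS_indic mA))/esym.
rewrite -[a]rV_unconsK; case: (rV_uncons a) => a0 a'.
pose G (t : R) := \int[L n]_y (\1_A (rV_cons (t, y)))%:E.
have mG : measurable_fun [set: measurableTypeR R] G.
  apply: (measurable_fun_fubini_tonelli_F (m2 := L n) (fun p => (\1_A (rV_cons p))%:E)) => //.
  by apply: measurable_indic_comp => //; exact: measurable_rV_cons.
rewrite -[RHS](preserves_ge0_integral (lebesgue_line_shift a0) mG); last first.
  by move=> t; exact: integral_ge0.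
apply: eq_integral => t _; rewrite /G.
rewrite -[RHS](preserves_ge0_integral (IH a')).
- by apply: eq_integral => y _; rewrite indic_preimage rV_consD.
- apply: measurable_indic_comp => //.
  apply: (measurableT_comp (@measurable_rV_cons R n)).
  exact: (pair1_measurable (t + a0 : measurableTypeR R)%R).
- by [].
Qed.

Lemma borel_lebesgue_opp n :
  preserves (L n) (fun x => - (x : 'rV[R]_n))%R.
Proof.
have mopp m : measurable_fun setT ((fun x => - (x : 'rV[R]_m))%R : borel_rV R m -> borel_rV R m).
  by measurable_rV.
elim: n => [|n IH].
  split=> // A _; congr (L 0 _); apply/funext => x /=; congr A.
  by rewrite [LHS]thinmx0 [RHS]thinmx0.
split=> // A mA; have mA' := measurable_preimageT (mopp n.+1) mA.
apply: (etrans (borel_lebesgueS_indic mA')); apply/esym/(etrans (borel_lebesgueS_indic mA))/esym.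
pose G (t : R) := \int[L n]_y (\1_A (rV_cons (t, y)))%:E.
have mG : measurable_fun [set: measurableTypeR R] G.
  apply: (measurable_fun_fubini_tonelli_F (m2 := L n) (fun p => (\1_A (rV_cons p))%:E)) => //.
  by apply: measurable_indic_comp => //; exact: measurable_rV_cons.
rewrite -[RHS](preserves_ge0_integral lebesgue_line_opp mG); last first.
  by move=> t; exact: integral_ge0.
apply: eq_integral => t _; rewrite /G.
rewrite -[RHS](preserves_ge0_integral IH).
- by apply: eq_integral => y _; rewrite indic_preimage rV_consN.
- apply: measurable_indic_comp => //.
  apply: (measurableT_comp (@measurable_rV_cons R n)).
  exact: (pair1_measurable (- t : measurableTypeR R)%R).
- by [].
Qed.

Lemma borel_lebesgue_box n (r : R) : (0 <= r)%R ->
  L n [set x : 'rV[R]_n | forall i, (0 <= x 0 i < r)%R] = (r ^+ n)%:E.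
Proof.
move=> r0; elim: n => [|n IH].
  by rewrite /= diracE mem_set// => -[].
rewrite /= /lebesgue_step /pushforward.
rewrite (_ : _ @^-1` _ = `[0%R, r[%classic `*` [set x : 'rV[R]_n | forall i, (0 <= x 0 i < r)%R]).
  rewrite product_measure1E//.
  - rewrite exprS EFinM IH; congr (_ * _); apply: (etrans (lebesgue_measure_itv `[0%R, r[)).
    rewrite /= lte_fin sube0.
    by case: ltP => // r0'; congr (_%:E); apply/eqP; rewrite eq_le r0 r0'.
  - exact: measurable_box.
apply/seteqP; split => -[t y] /= => [h|[h1 h2] i].
- split; first by have := h ord0; rewrite mxE unlift_none /= in_itv.
  by move=> i; have := h (lift ord0 i); rewrite mxE liftK.
- by rewrite mxE; case: (unlift ord0 i) => [j|] //=; rewrite in_itv in h1.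
Qed.

(* Tonelli: if m is translation invariant, int L(A - y)dm(y) computed in both orders. *)
Lemma translation_invariant_ratio n
    (m : {sigma_finite_measure set (borel_rV R n) -> \bar R}) A B :
  (forall a : 'rV[R]_n, preserves m (fun x => (x : 'rV[R]_n) + a)%R) ->
  measurable A -> measurable B ->
  L n A * m B = L n B * m A.
Proof.
move=> minv mA mB; set T := borel_rV R n.
have mD : measurable_fun setT (fun p : T * T => (p.2 : 'rV[R]_n) - (p.1 : 'rV[R]_n) : T)%R.
  by measurable_rV.
have key C D : measurable C -> measurable D ->
    L n C * m D = \int[L n]_x \int[m]_y ((\1_C x)%:E * (\1_D ((y : 'rV[R]_n) - (x : 'rV[R]_n))%R)%:E).
  move=> mC mD'.
  have step x : \int[m]_y ((\1_C x)%:E * (\1_D ((y : 'rV[R]_n) - (x : 'rV[R]_n))%R)%:E) = (\1_C x)%:E * m D.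
    rewrite ge0_integralZl//; last first.
      apply: measurable_indic_comp => //.
      by measurable_rV.
    congr (_ * _).
    rewrite (preserves_ge0_integral (minv (- x)%R) (f := fun y => (\1_D y)%:E))//.
      by rewrite integral_indic// setIT.
    exact: measurable_indic_comp.
  under eq_integral do rewrite step.
  rewrite ge0_integralZr//; last exact: measurable_indic_comp.
  by rewrite integral_indic// setIT.
have mF (C D : set (borel_rV R n)) : measurable C -> measurable D ->
    measurable_fun setT (fun p : T * T => (\1_C p.1)%:E * (\1_D ((p.2 : 'rV[R]_n) - (p.1 : 'rV[R]_n))%R)%:E : \bar R).
  move=> mC mD'; apply: emeasurable_funM; apply: measurable_indic_comp => //.
rewrite (key _ _ mA mB) (key _ _ mB mA).
have F0 (C D : set (borel_rV R n)) (p : T * T) :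
    0 <= (\1_C p.1)%:E * (\1_D ((p.2 : 'rV[R]_n) - (p.1 : 'rV[R]_n))%R)%:E :> \bar R.
  exact: mule_ge0.
rewrite (fubini_tonelli (m1 := L n) (m2 := m) _ (mF _ _ mA mB) (F0 A B)).
rewrite (fubini_tonelli (m1 := L n) (m2 := m) _ (mF _ _ mB mA) (F0 B A)).
apply: eq_integral => y _ /=.
have pres : preserves (L n) (fun x => (y : 'rV[R]_n) - (x : 'rV[R]_n))%R.
  rewrite (_ : (fun x => _) = (fun x => x + (y : 'rV[R]_n))%R \o (fun x => - (x : 'rV[R]_n))%R).
    by apply: preserves_comp; [exact: borel_lebesgue_shift|exact: borel_lebesgue_opp].
  by apply/funext => x /=; rewrite addrC.
rewrite -[RHS](preserves_ge0_integral pres)//.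
- by apply: eq_integral => x _; rewrite subKr muleC.
- by apply: emeasurable_funM; apply: measurable_indic_comp => //; case: pres.
Qed.

(** Since [phi] is additive, the image of Lebesgue measure is again translation invariant, hence
    proportional to it. The factor is read off from one test set (the cube for dilations, the unit
    ball for reflections), which replaces a computation with determinants. *)
Lemma linear_image_ratio n (phi psi : 'rV[R]_n -> 'rV[R]_n) (A B : set (borel_rV R n)) :
  measurable_fun setT (phi : borel_rV R n -> borel_rV R n) ->
  measurable_fun setT (psi : borel_rV R n -> borel_rV R n) ->
  cancel psi phi -> cancel phi psi -> {morph phi : x y / (x + y)%R} ->
  measurable A -> measurable B ->
  L n A * L n (phi @^-1` B) = L n B * L n (phi @^-1` A).
Proof.
move=> mphi mpsi psiK phiK phiD mA mB.
have sf : sigma_finite setT (image_measure (L n) mphi).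
  have [F FT Foo] := sigma_finiteT (L n).
  exists (fun k => psi @^-1` F k).
    by rewrite -preimage_bigcup -FT preimage_setT.
  move=> k; have [mF Fk] := Foo k; split; first exact: (measurable_preimageT mpsi mF).
  rewrite /image_measure/= /pushforward -comp_preimage (_ : _ \o _ = id) ?preimage_id//.
  by apply/funext => x /=; exact: phiK.
apply: (@translation_invariant_ratio n (sigma_finite_alias sf)) => // a.
split; first exact: measurable_shift.
move=> C mC; rewrite /sigma_finite_alias /image_measure/= /pushforward.
have [_ /(_ _ (measurable_preimageT mphi mC))<-] := borel_lebesgue_shift (psi a).
by congr (L n _); apply/funext => x /=; rewrite phiD psiK.
Qed.

Lemma borel_lebesgue_scale n (r : R) (A : set (borel_rV R n)) : (0 < r)%R -> measurable A ->
  L n ((fun x : 'rV[R]_n => r^-1 *: x)%R @^-1` A) = (r ^+ n)%:E * L n A.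
Proof.
move=> r0 mA.
pose C : set 'rV[R]_n := [set x : 'rV[R]_n | forall i, (0 <= x 0%R i < 1)%R].
have mZ a : measurable_fun setT ((fun x : 'rV[R]_n => a *: x)%R : borel_rV R n -> borel_rV R n).
  by measurable_rV.
have mC : measurable (C : set (borel_rV R n)) by exact: measurable_box.
have := @linear_image_ratio n (fun x => r^-1 *: x)%R (fun x => r *: x)%R C A.
rewrite (borel_lebesgue_box n (@ler01 R)) expr1n mul1e => -> //; first last.
- by move=> x y; rewrite scalerDr.
- by move=> x; rewrite scalerA mulfV ?scale1r ?gt_eqF.
- by move=> x; rewrite scalerA mulVf ?scale1r ?gt_eqF.
rewrite muleC; congr (_ * _).
rewrite -(borel_lebesgue_box n (ltW r0)); congr (L n _); apply/funext => x.
apply/propext; split => /= h i; have := h i; rewrite mxE.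
  by rewrite pmulr_rge0 ?invr_gt0// ltr_pdivrMl// mulr1.
by rewrite pmulr_rge0 ?invr_gt0// ltr_pdivrMl// mulr1.
Qed.

End lebesgue_rn.

(** * Cutoffs and test functions *)

Section real_functions.
Context {R : realType}.
Implicit Types t h : R.

(** A quadratic remainder spares one-sided derivatives at points where a piecewise formula
    changes. *)
Lemma is_derive_quad (u : R -> R) (du C t : R) :
  (forall h, `|u (t + h) - u t - h * du| <= C * h ^+ 2) -> is_derive t 1 u du.
Proof.
move=> hu; have lim : h^-1 *: (u (h *: 1 + t) - u t) @[h --> 0^'] --> du.
  apply/cvgrPdist_le => e e0.
  have Ce : 0 < (`|C| + 1)^-1 * e by rewrite mulr_gt0// invr_gt0 ltr_wpDl.
  near=> h.
  have h0 : h != 0 by near: h; exact: nbhs_dnbhs_neq.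
  rewrite /GRing.scale/= mulr1 (addrC h) distrC.
  have -> : h^-1 * (u (t + h) - u t) - du = h^-1 * (u (t + h) - u t - h * du).
    by rewrite [in RHS]mulrBr mulrA mulVf// mul1r.
  rewrite normrM normfV ler_pdivrMl ?normr_gt0//.
  apply: le_trans (hu h) _.
  rewrite -real_normK ?num_real// expr2 mulrA [leRHS]mulrC ler_wpM2r//.
  apply: (@le_trans _ _ ((`|C| + 1) * `|h|)).
    by rewrite ler_wpM2r// (le_trans (ler_norm _))// lerDl.
  rewrite -ler_pdivlMl ?ltr_wpDl//.
  by near: h; exact: (@dnbhs0_le R R).
apply: DeriveDef; first by apply/cvg_ex; exists du.
exact: cvg_lim.
Unshelve. all: by end_near. Qed.

Definition sqpos t : R := Num.max t 0 ^+ 2.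

Lemma is_derive_sqpos t : is_derive t 1 sqpos (2 * Num.max t 0).
Proof.
apply: (@is_derive_quad _ _ 1) => h; rewrite mul1r /sqpos ler_norml.
by have [] := leP t 0; have [] := leP (t + h) 0 => *; apply/andP; split; nra.
Qed.

Lemma sqpos_ge0 t : 0 <= sqpos t. Proof. exact: sqr_ge0. Qed.

Lemma sqpos_le0 t : t <= 0 -> sqpos t = 0.
Proof. by move=> t0; rewrite /sqpos max_r// expr0n. Qed.

Lemma sqpos_gt0 t : 0 < t -> 0 < sqpos t.
Proof. by move=> t0; rewrite /sqpos max_l ?ltW// exprn_gt0. Qed.

(** Only C^1: test functions need no more, and the piecewise polynomial 1 - (1 - t^2)^2 can be
    inverted explicitly on [0, 1], which later identifies the superlevel sets of cutoffs as
    balls. *)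
Definition smooth_step t : R := 1 - sqpos (1 - sqpos t).
Definition dsmooth_step t : R := 4 * Num.max (1 - sqpos t) 0 * Num.max t 0.

Lemma is_derive_smooth_step t : is_derive t 1 smooth_step (dsmooth_step t).
Proof.
have d1 : is_derive t 1 (fun t => 1 - sqpos t) (- (2 * Num.max t 0)).
  have := is_derive_sqpos t => ?.
  by rewrite -[X in is_derive _ _ _ X]add0r; apply: is_deriveD.
have d2 := is_derive_sqpos (1 - sqpos t).
have d3 : is_derive t 1 (sqpos \o (fun t => 1 - sqpos t))
   (2 * Num.max (1 - sqpos t) 0 * - (2 * Num.max t 0)).
  exact: is_derive1_comp.
have := @is_deriveD _ _ _ _ _ t 1 _ _ (is_derive_cst (1 : R) t 1) (is_deriveN d3).
rewrite add0r mulrN opprK => h.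
rewrite /dsmooth_step (_ : 4 * _ * _ = 2 * Num.max (1 - sqpos t) 0 * (2 * Num.max t 0)) //.
by ring.
Qed.

Lemma continuous_maxr0 : continuous (fun t : R => Num.max t 0).
Proof.
move=> t; apply/(@cvgrPdist_lt _ _ _ (nbhs t)) => e e0; near=> s.
apply: (@le_lt_trans _ _ `|t - s|).
  by rewrite ler_norml; have [] := leP t 0; have [] := leP s 0; have := ler_norm (t - s);
    have := ler_norm (- (t - s)); rewrite normrN => *; apply/andP; lra.
by near: s; apply: cvgr_dist_lt.
Unshelve. all: by end_near. Qed.

Lemma continuous_sqpos : continuous sqpos.
Proof.
move=> t; apply: (@continuous_comp _ _ _ (fun t => Num.max t 0) (fun x => x ^+ 2)).
  exact: continuous_maxr0.
exact: exprn_continuous.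
Qed.

Lemma continuous_dsmooth_step : continuous dsmooth_step.
Proof.
move=> t; apply: cvgM; last exact: continuous_maxr0.
apply: cvgM; first exact: cvg_cst.
apply: (@continuous_comp _ _ _ (fun t => 1 - sqpos t) (fun t => Num.max t 0)).
  by apply: cvgB; [exact: cvg_cst|exact: continuous_sqpos].
exact: continuous_maxr0.
Qed.

Lemma smooth_step_ge1 t : 1 <= t -> smooth_step t = 1.
Proof.
move=> t1; rewrite /smooth_step [X in 1 - X]sqpos_le0 ?subr0//.
by rewrite subr_le0 /sqpos max_l; [rewrite expr_ge1//|]; lra.
Qed.

Lemma smooth_step_le0 t : t <= 0 -> smooth_step t = 0.
Proof. by move=> t0; rewrite /smooth_step (sqpos_le0 t0) subr0 /sqpos max_l// expr1n subrr. Qed.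

Lemma smooth_step_itv t : 0 <= smooth_step t <= 1.
Proof.
rewrite /smooth_step; have := sqpos_ge0 t; have := sqpos_ge0 (1 - sqpos t).
move=> s1 s0; rewrite lerBlDr lerDl s1 andbT subr_ge0.
rewrite {1}/sqpos; case: (leP (1 - sqpos t) 0) => h; first by rewrite expr0n/= ler01.
by rewrite expr_le1//; lra.
Qed.

Lemma dsmooth_step_itv t : 0 <= dsmooth_step t <= 4.
Proof.
rewrite /dsmooth_step; case: (leP t 0) => t0; first by rewrite mulr0 lexx ler0n.
case: (leP (1 - sqpos t) 0) => h; first by rewrite mulr0 mul0r lexx ler0n.
rewrite mulr_ge0 ?mulr_ge0 ?ltW//=.
have st : sqpos t = t ^+ 2 by rewrite /sqpos max_l// ltW.
rewrite st in h *.
have t1 : t <= 1 by rewrite leNgt; apply/negP => t1; nra.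
nra.
Qed.

Lemma smooth_step_lip s t : `|smooth_step s - smooth_step t| <= 4 * `|s - t|.
Proof.
wlog st : s t / s <= t.
  by move=> h; case: (leP s t) => st; [exact: h|rewrite distrC (distrC s); apply: h; exact: ltW].
have := @MVT_segment R smooth_step dsmooth_step s t st.
case.
- by move=> x _; exact: is_derive_smooth_step.
- apply: continuous_subspaceT => x; apply: differentiable_continuous.
  by apply/derivable1_diffP; have [] := is_derive_smooth_step x.
move=> c _ e; rewrite distrC e normrM (distrC s) ler_wpM2r//.
by have /andP[c0 c4] := dsmooth_step_itv c; rewrite ger0_norm.
Qed.

End real_functions.

Section gradient.
Context {R : realType} {n : nat}.
Local Notation rV := 'rV[R]_n.
Implicit Types (g : rV -> R) (G : rV -> rV).

(** C^1 regularity with the gradient as an explicit field, so that the product and chain rules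
    compute it. *)
Definition has_gradient g G :=
  (forall x, is_diff x g (fun h => dot (G x) h : R)) /\ continuous G.

Lemma has_gradient_eq g G G' : has_gradient g G -> G = G' -> has_gradient g G'.
Proof. by move=> ? <-. Qed.

Lemma has_gradient_cst c : has_gradient (cst c) (cst 0).
Proof.
split => [x|]; last exact: cst_continuous.
apply: (is_diff_eq (is_diff_cst _ _)).
by apply/funext => h; rewrite dot0l.
Qed.

Lemma has_gradientD g G h H : has_gradient g G -> has_gradient h H ->
  has_gradient (fun x => g x + h x) (fun x => G x + H x).
Proof.
move=> [dg cG] [dh cH]; split => [x|x]; last by apply: (@cvgD _ _ _ (nbhs x)); [exact: cG|exact: cH].
apply: (is_diff_eq (is_diffD (dg x) (dh x))).
by apply/funext => y; rewrite dotDl.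
Qed.

Lemma has_gradientM g G h H : has_gradient g G -> has_gradient h H ->
  has_gradient (fun x => g x * h x) (fun x => g x *: H x + h x *: G x).
Proof.
move=> [dg cG] [dh cH]; split => [x|x].
  apply: (is_diff_eq (is_diffM (dg x) (dh x))).
  by apply/funext => y; rewrite dotDl !dotZl.
have cg : {for x, continuous g} by apply: differentiable_continuous; case: (dg x).
have ch : {for x, continuous h} by apply: differentiable_continuous; case: (dh x).
by apply: (@cvgD _ _ _ (nbhs x)); apply: cvgZ => //; [exact: cH|exact: cG].
Qed.

Lemma has_gradientZ c g G : has_gradient g G ->
  has_gradient (fun x => c * g x) (fun x => c *: G x).
Proof.
move=> gG; apply: has_gradient_eq (has_gradientM (has_gradient_cst c) gG) _.
by apply/funext => x; rewrite scaler0 addr0.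
Qed.

Lemma has_gradientN g G : has_gradient g G ->
  has_gradient (fun x => - g x) (fun x => - G x).
Proof.
move=> /(has_gradientZ (-1)) h.
rewrite (_ : (fun x => - g x) = (fun x => -1 * g x)); last by apply/funext => x; rewrite mulN1r.
by apply: has_gradient_eq h _; apply/funext => x; rewrite scaleN1r.
Qed.

Lemma has_gradientB g G h H : has_gradient g G -> has_gradient h H ->
  has_gradient (fun x => g x - h x) (fun x => G x - H x).
Proof. by move=> gG hH; apply: has_gradientD => //; exact: has_gradientN. Qed.

Lemma has_gradient_sum (I : Type) (r : seq I) (g : I -> rV -> R)
    (G : I -> rV -> rV) :
  (forall i, has_gradient (g i) (G i)) ->
  has_gradient (fun x => \sum_(i <- r) g i x) (fun x => \sum_(i <- r) G i x).
Proof.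
move=> gG; elim: r => [|i r IH].
  under eq_fun do rewrite big_nil; under [X in has_gradient _ X]eq_fun do rewrite big_nil.
  exact: has_gradient_cst.
under eq_fun do rewrite big_cons; under [X in has_gradient _ X]eq_fun do rewrite big_cons.
exact: has_gradientD.
Qed.

Lemma has_gradient_continuous g G : has_gradient g G -> continuous g.
Proof. by move=> [dg _] x; apply: differentiable_continuous; case: (dg x). Qed.

Lemma has_gradient_coord i : has_gradient (fun x => x 0 i) (cst (delta_mx 0 i)).
Proof.
split => [x|]; last exact: cst_continuous.
have @f : {linear rV -> R}.
  by exists (fun N : rV => N 0 i); do 2![eexists]; do ?[constructor];
     rewrite ?mxE// => ? *; rewrite ?mxE//; move=> ?; rewrite !mxE.
have cf : continuous f by exact: coord_continuous.
apply: DiffDef; first exact: (linear_differentiable x cf).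
rewrite (diff_lin x cf); apply/funext => h /=.
rewrite /dot (bigD1 i)//= mxE !eqxx mul1r big1 ?addr0// => j /negbTE ji.
by rewrite mxE ji andbF mul0r.
Qed.

Lemma has_gradient_sqdist c :
  has_gradient (fun x => dot (x - c) (x - c)) (fun x => 2 *: (x - c)).
Proof.
have h i : has_gradient (fun x => (x - c) 0 i) (cst (delta_mx 0 i)).
  rewrite (_ : (fun x => _) = (fun x : rV => x 0 i - c 0 i)); last first.
    by apply/funext => x; rewrite !mxE.
  apply: has_gradient_eq (has_gradientB (has_gradient_coord i) (has_gradient_cst _)) _.
  by apply/funext => x; rewrite subr0.
apply: has_gradient_eq (has_gradient_sum _ (fun i => has_gradientM (h i) (h i))) _.
apply/funext => x; rewrite [in RHS](row_sum_delta (x - c)) scaler_sumr.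
by apply: eq_bigr => i _; rewrite -scalerDl scalerA; congr (_ *: _); ring.
Qed.

Lemma has_gradient_comp (u u' : R -> R) g G :
  (forall t : R, is_derive t 1 u (u' t)) -> continuous u' -> has_gradient g G ->
  has_gradient (fun x => u (g x)) (fun x => u' (g x) *: G x).
Proof.
move=> du cu gG; have [dg cG] := gG; split => [x|x].
  have du' : is_diff (g x) u (fun t => t * u' (g x)).
    have [du1 du2] := du (g x); apply: DiffDef; first exact/derivable1_diffP.
    by rewrite deriv1E// derive1E du2.
  apply: (is_diff_eq (is_diff_comp (dg x) du')).
  by apply/funext => y /=; rewrite dotZl mulrC.
apply: (@cvgZ _ _ _ (nbhs x)); last exact: cG.
apply: (@continuous_comp _ _ _ g u'); last exact: cu.
exact: has_gradient_continuous gG _.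
Qed.

Lemma has_gradient_affine (a : R) b g G : has_gradient g G ->
  has_gradient (fun x => g (a *: x + b)) (fun x => a *: G (a *: x + b)).
Proof.
move=> [dg cG]; split => [x|x].
  have da : is_diff x (fun x : rV => a *: x + b) ( *:%R a).
    by apply: (is_diff_eq (is_diffD (is_diff_scaler a x) (is_diff_cst b x))); rewrite addr0.
  apply: (is_diff_eq (is_diff_comp da (dg _))).
  by apply/funext => y /=; rewrite dotZl dotZr.
apply: (@cvgZl_tmp _ _ _ (nbhs x)).
apply: (@continuous_comp _ _ _ (fun x : rV => a *: x + b) G); last exact: cG.
by apply: (@cvgD _ _ _ (nbhs x)); [apply: (@cvgZl_tmp _ _ _ (nbhs x)); exact: cvg_id|exact: cvg_cst].
Qed.

Lemma has_gradient_derive g G x h : has_gradient g G ->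
  'D_h g x = dot (G x) h.
Proof. by move=> [/(_ x)[dg dE] _]; rewrite deriveE// dE. Qed.

Lemma has_gradient_line g G (x h : rV) (s : R) : has_gradient g G ->
  is_derive s 1 (fun s => g (x + s *: h)) (dot (G (x + s *: h)) h).
Proof.
move=> [dg _].
have da : is_diff s (fun s : R => x + s *: h) ( *:%R^~ h).
  by apply: (is_diff_eq (is_diffD (is_diff_cst x s) (is_diff_scalel s h))); rewrite add0r.
have [d1 d2] := is_diff_comp da (dg _).
apply: DeriveDef; first exact/derivable1_diffP.
by rewrite deriveE// d2 /= scale1r.
Qed.

End gradient.

Section test_functions.
Context {R : realType} {n : nat}.
Local Notation rV := 'rV[R]_n.
Implicit Types (g : rV -> R) (G : rV -> rV).
Local Notation T := (borel_rV R n).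

Definition bounded_support g := exists M : R, forall x, M <= enorm x -> g x = 0.

Definition test_fun g G := has_gradient g G /\ bounded_support g.

Lemma enorm_ge_near (M : R) (x : rV) : M < enorm x -> \forall y \near x, M <= enorm y.
Proof.
move=> Mx; have e0 : 0 < enorm x - M by rewrite subr_gt0.
apply: filterS (near_enorm x e0) => y; have := ler_enormD y (x - y).
by rewrite addrC subrK; lra.
Qed.

Lemma has_gradient_near0 g G x : has_gradient g G -> (\forall y \near x, g y = 0) ->
  G x = 0.
Proof.
move=> gG g0; apply/eqP; rewrite -enorm_eq0 -sqrf_eq0 sqr_enorm; apply/eqP.
rewrite -(has_gradient_derive _ _ gG).
by rewrite (@near_eq_derive _ _ _ g (cst 0)) ?derive_cst.
Qed.

Lemma test_grad_support g G : test_fun g G ->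
  exists2 M : R, 0 < M & forall x, M <= enorm x -> g x = 0 /\ G x = 0.
Proof.
move=> [gG [M gM]]; exists (`|M| + 1); first by rewrite ltr_wpDl.
move=> x Mx; have Mx' : M < enorm x by have := ler_norm M; lra.
split; first exact/gM/ltW.
apply: (has_gradient_near0 gG); apply: filterS (enorm_ge_near Mx'); exact: gM.
Qed.

Lemma closed_eball_le (M : R) : closed [set x : rV | enorm x <= M].
Proof.
rewrite (_ : [set _ | _] = @enorm R n @^-1` [set t | t <= M])//.
by apply: closed_comp => [x _|]; [exact: enorm_continuous|exact: closed_le].
Qed.

Lemma continuous_row (f : 'I_n -> rV -> R) :
  (forall i, continuous (f i)) -> continuous (fun x => \row_i f i x).
Proof.
move=> cf x A [P hP PA]; have FF : Filter (nbhs x) := @nbhs_filter rV x.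
apply: filterS (_ : nbhs x [set y | forall i j, P i j ((\row_i f i y) i j)]).
  by move=> y hy; exact: PA.
have h (i : 'I_1) : nbhs x [set y | forall j, P i j (f j y)].
  apply: (@filter_forall _ _ (fun j y => P i j (f j y)) (nbhs x)) => j.
  by have := hP i j; rewrite mxE => /(cf j x).
have h' := @filter_forall _ _ (fun i y => forall j, P i j (f j y)) (nbhs x) FF h.
apply: filterS h' => y hy i j.
by rewrite mxE; exact: hy.
Qed.

Lemma compact_eball_le (M : R) : compact [set x : rV | enorm x <= M].
Proof.
apply: bounded_closed_compact.
  exists M; split; first exact: num_real.
  by move=> N MN x /= xM; apply: le_trans (ler_norm_enorm _) (le_trans xM (ltW MN)).
exact: closed_eball_le.
Qed.

Lemma continuous_support_bounded (f : rV -> R) (M : R) : continuous f ->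
  (forall x, M <= enorm x -> f x = 0) -> exists2 C : R, 0 <= C & forall x, `|f x| <= C.
Proof.
move=> cf f0; have cM : compact [set x : rV | enorm x <= M] by exact: compact_eball_le.
have /compact_bounded[C [_ hC]] := continuous_compact (continuous_subspaceT cf) cM.
exists (`|C| + 1); first by rewrite addr_ge0.
move=> x; have [Mx|/ltW xM] := leP M (enorm x).
  by rewrite f0// normr0 addr_ge0.
by apply: (hC (`|C| + 1)); [have := ler_norm C; lra|exists x].
Qed.

Lemma test_fun_bounded g G : test_fun g G ->
  exists2 C : R, 0 <= C & forall x, `|g x| <= C /\ enorm (G x) <= C.
Proof.
move=> gG; have [M M0 h] := test_grad_support gG.
have [C C0 hC] := @continuous_support_bounded g M (has_gradient_continuous gG.1) (fun x Mx => (h x Mx).1).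
have cG : continuous (fun x => enorm (G x)).
  by move=> x; apply: continuous_comp; [exact: gG.1.2|exact: enorm_continuous].
have [D D0 hD] := @continuous_support_bounded _ M cG (fun x Mx => etrans (f_equal _ (h x Mx).2) (@enorm0 R n)).
exists (C + D); first exact: addr_ge0.
move=> x; split; first by rewrite (le_trans (hC x))// lerDl.
by rewrite -(ger0_norm (enorm_ge0 _)) (le_trans (hD x))// lerDr.
Qed.

Lemma has_gradient_measurable g G : has_gradient g G ->
  measurable_fun [set: T] (g : T -> R).
Proof. by move=> /has_gradient_continuous; exact: continuous_measurable_rV. Qed.

Lemma has_gradient_measurable_dot g G h : has_gradient g G ->
  measurable_fun [set: T] ((fun x => dot (G x) h) : T -> R).
Proof.
move=> [_ cG]; apply: continuous_measurable_rV => x.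
by apply: (@continuous_comp _ _ _ G (fun y => dot y h)); [exact: cG|exact: dotl_continuous].
Qed.

Lemma test_fun_affine (a : R) b g G : a != 0 -> test_fun g G ->
  test_fun (fun x => g (a *: x + b)) (fun x => a *: G (a *: x + b)).
Proof.
move=> a0 [gG [M gM]]; split; first exact: has_gradient_affine.
exists (`|a|^-1 * (`|M| + enorm b)) => x; rewrite ler_pdivrMl ?normr_gt0// -enormZ => h.
apply: gM; have := ler_norm M; have := ler_enormD (a *: x + b) (- b).
by rewrite addrK enormN; lra.
Qed.

Lemma test_fun_shift b g G : test_fun g G ->
  test_fun (fun x => g (x + b)) (fun x => G (x + b)).
Proof.
move=> /(test_fun_affine b (@oner_neq0 R)).
by under eq_fun do rewrite scale1r; under [X in test_fun _ X]eq_fun do rewrite !scale1r.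
Qed.

Lemma test_funM g G h H : test_fun g G -> has_gradient h H ->
  test_fun (fun x => g x * h x) (fun x => g x *: H x + h x *: G x).
Proof.
move=> [gG [M gM]] hH; split; first exact: has_gradientM.
by exists M => x /gM ->; rewrite mul0r.
Qed.

Lemma test_fun_comp (u u' : R -> R) g G :
  (forall t : R, is_derive t 1 u (u' t)) -> continuous u' -> u 0 = 0 ->
  test_fun g G -> test_fun (fun x => u (g x)) (fun x => u' (g x) *: G x).
Proof.
move=> du cu u0 [gG [M gM]]; split; first exact: has_gradient_comp.
by exists M => x /gM ->.
Qed.

Lemma test_funD g G h H : test_fun g G -> test_fun h H ->
  test_fun (fun x => g x + h x) (fun x => G x + H x).
Proof.
move=> [gG [M gM]] [hH [N hN]]; split; first exact: has_gradientD.
exists (Num.max M N) => x; rewrite ge_max => /andP[/gM -> /hN ->].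
by rewrite addr0.
Qed.

Lemma test_funZ c g G : test_fun g G ->
  test_fun (fun x => c * g x) (fun x => c *: G x).
Proof.
move=> [gG [M gM]]; split; first exact: has_gradientZ.
by exists M => x /gM ->; rewrite mulr0.
Qed.

Lemma test_fun0 : test_fun (cst 0) (cst 0).
Proof. by split; [exact: has_gradient_cst|exists 0]. Qed.

Lemma has_gradient_partial g G i x : has_gradient g G -> partial g i x = G x 0 i.
Proof.
move=> gG; rewrite /partial (has_gradient_derive _ _ gG).
rewrite dotC /dot (bigD1 i)//= mxE !eqxx mul1r big1 ?addr0// => j /negbTE ji.
by rewrite mxE ji andbF mul0r.
Qed.

Lemma has_gradient_Ck1 g G : has_gradient g G -> is_Ck 1 g.
Proof.
move=> gG; split => [x|i]; first by have [/(_ x)[]] := gG.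
rewrite /= (_ : partial g i = fun x => G x 0 i).
  move=> x; apply: (@continuous_comp _ _ _ G (fun y : rV => y 0 i)); first exact: gG.2.
  exact: coord_continuous.
by apply/funext => x; exact: has_gradient_partial.
Qed.

Lemma Ck1_has_gradient g : is_Ck 1 g -> has_gradient g (fun x => \row_i partial g i x).
Proof.
move=> [dg cg]; split => [x|x].
  apply: DiffDef; first exact: dg.
  apply/funext => h; rewrite [in LHS](row_sum_delta h) linear_sum.
  rewrite /dot; apply: eq_bigr => i _; rewrite mxE linearZ/= mulrC.
  by congr (_ * _); rewrite /partial deriveE.
by apply: continuous_row => i.
Qed.

Lemma test_fun_C1c g G v : test_fun g G -> is_C1c (fun x => g x *: v).
Proof.
move=> [gG [M gM]]; split => [i|].
  apply: (@has_gradient_Ck1 _ (fun x => v 0 i *: G x)).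
  rewrite (_ : (fun y => _) = (fun y => v 0 i * g y)); first exact: has_gradientZ.
  by apply/funext => y; rewrite mxE mulrC.
apply: (@subclosed_compact _ _ [set x : rV | enorm x <= M]).
- exact: closed_closure.
- exact: compact_eball_le.
- rewrite [X in _ `<=` X](closure_id _).1; last exact: closed_eball_le.
  apply: closure_subset => x /=.
  by apply: contraNT; rewrite -ltNge => /ltW/gM ->; rewrite scale0r.
Qed.

Lemma divergence_scale g G v x : has_gradient g G ->
  divergence (fun y => g y *: v) x = dot (G x) v.
Proof.
move=> gG; apply: eq_bigr => i _.
rewrite (_ : (fun y => _) = (fun y => v 0 i * g y)); last first.
  by apply/funext => y; rewrite mxE mulrC.
by rewrite (has_gradient_partial _ _ (has_gradientZ (v 0 i) gG)) mxE mulrC.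
Qed.

Lemma C1c_test_fun (phi : rV -> rV) i : is_C1c phi ->
  test_fun (fun x => phi x 0 i) (fun x => \row_j partial (fun y => phi y 0 i) j x).
Proof.
move=> [c1 cc]; split; first exact: Ck1_has_gradient.
have [C [_ hC]] := compact_bounded cc.
exists (n%:R * (`|C| + 1) + 1) => x h; apply/eqP; apply: contraTT h => phi0.
have xC : `|x| <= `|C| + 1.
  apply: hC; first by have := ler_norm C; lra.
  by apply: subset_closure => /=; apply: contra_neq phi0 => ->; rewrite mxE.
rewrite -ltNge (le_lt_trans (ler_enorm_norm x))// (@le_lt_trans _ _ (n%:R * (`|C| + 1)))//.
  by rewrite ler_wpM2l.
by rewrite ltrDl.
Qed.

Lemma divergence_sum (phi : rV -> rV) x :
  divergence phi x = \sum_i dot (\row_j partial (fun y => phi y 0 i) j x) (delta_mx 0 i).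
Proof.
apply: eq_bigr => i _; rewrite dotC /dot (bigD1 i)//= !mxE !eqxx mul1r big1 ?addr0// => j /negbTE ji.
by rewrite !mxE ji andbF mul0r.
Qed.

Definition is_C1 g := exists G, has_gradient g G.

Lemma is_C1_cst c : is_C1 (cst c).
Proof. by exists (cst 0); exact: has_gradient_cst. Qed.

Lemma is_C1M g h : is_C1 g -> is_C1 h -> is_C1 (fun x => g x * h x).
Proof. by move=> [G gG] [H hH]; eexists; apply: has_gradientM; eassumption. Qed.

Lemma is_C1B g h : is_C1 g -> is_C1 h -> is_C1 (fun x => g x - h x).
Proof. by move=> [G gG] [H hH]; eexists; apply: has_gradientB; eassumption. Qed.

Lemma is_C1_prod (I : Type) (r : seq I) (g : I -> rV -> R) :
  (forall i, is_C1 (g i)) -> is_C1 (fun x => \prod_(i <- r) g i x).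
Proof.
move=> gC; elim: r => [|i r IH].
  by under eq_fun do rewrite big_nil; exact: is_C1_cst.
by under eq_fun do rewrite big_cons; exact: is_C1M.
Qed.

Lemma is_C1X g m : is_C1 g -> is_C1 (fun x => g x ^+ m).
Proof.
move=> gC; elim: m => [|m IH]; first exact: is_C1_cst.
by under eq_fun do rewrite exprS; exact: is_C1M.
Qed.

Definition ball_bump (c : rV) (r : R) : rV -> R :=
  fun x => smooth_step (r ^+ 2 - dot (x - c) (x - c)).

Lemma is_C1_ball_bump c r : is_C1 (ball_bump c r).
Proof.
eexists; apply: (has_gradient_comp is_derive_smooth_step continuous_dsmooth_step).
exact: has_gradientB (has_gradient_cst _) (has_gradient_sqdist c).
Qed.

Lemma ball_bump_itv c r x : 0 <= ball_bump c r x <= 1.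
Proof. exact: smooth_step_itv. Qed.

Lemma ball_bump_out c r x : 0 <= r -> r <= enorm (x - c) -> ball_bump c r x = 0.
Proof.
move=> r0 h; rewrite /ball_bump -sqr_enorm smooth_step_le0// subr_le0.
by rewrite ler_sqr ?nnegrE ?enorm_ge0.
Qed.

Lemma ball_bump_in c r x : enorm (x - c) < r -> 0 < ball_bump c r x.
Proof.
move=> h; have r0 : 0 < r := le_lt_trans (enorm_ge0 _) h.
have t0 : 0 < r ^+ 2 - dot (x - c) (x - c).
  by rewrite -sqr_enorm subr_gt0 ltr_sqr ?nnegrE ?enorm_ge0// ltW.
rewrite /ball_bump; set t := r ^+ 2 - _ in t0 *.
rewrite /smooth_step; have := sqpos_gt0 t0 => s0.
rewrite subr_gt0 {1}/sqpos; case: (leP (1 - sqpos t) 0) => h1; first by rewrite expr0n/= ltr01.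
by rewrite expr_lt1//; lra.
Qed.

(* A C^1 approximation from below: with U a countable union of balls with bumps
   p_k, take 1 - prod_(k < j) (1 - p_k)^j. *)
Lemma open_test_approx (U : set rV) : open U ->
  exists g : nat -> rV -> R,
    [/\ forall j, exists G, test_fun (g j) G,
        forall j x, 0 <= g j x <= 1,
        forall j x, ~ U x -> g j x = 0 &
        forall x, g j x @[j --> \oo] --> (\1_U x : R)].
Proof.
move=> /open_bigcup_eball[c [r [r0 UE]]].
pose p k := ball_bump (c k) (r k).
pose g (j : nat) x := 1 - \prod_(0 <= k < j) (1 - p k x) ^+ j.
have p01 k x : 0 <= 1 - p k x <= 1 by have := ball_bump_itv (c k) (r k) x; rewrite -/(p k x); lra.
have P01 (j : nat) x : 0 <= \prod_(0 <= k < j) (1 - p k x) ^+ j <= 1.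
  elim/big_ind : _ => [|a b /andP[a0 a1] /andP[b0 b1]|k _]; first by rewrite ler01 lexx.
    by rewrite mulr_ge0//= mulr_ile1.
  by have /andP[h0 h1] := p01 k x; rewrite exprn_ge0//= exprn_ile1.
have gU j x : ~ U x -> g j x = 0.
  move=> Ux; rewrite /g big1 ?subrr// => k _; rewrite /p ball_bump_out ?subr0 ?expr1n//.
  rewrite leNgt; apply/negP => h; apply: Ux; rewrite UE; exists k => //.
exists g; split => //.
- move=> j; have [G gG] : is_C1 (g j).
    apply: is_C1B (is_C1_cst _) _; apply: is_C1_prod => k; apply: is_C1X.
    by apply: is_C1B (is_C1_cst _) _; exact: is_C1_ball_bump.
  exists G; split => //; exists (\sum_(0 <= k < j) (enorm (c k) + r k)) => x hx.
  rewrite /g big_nat big1 ?subrr// => k kj; rewrite /p ball_bump_out ?subr0 ?expr1n//.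
  have : enorm (c k) + r k <= enorm x.
    apply: le_trans hx; rewrite (bigD1_seq k)/= ?iota_uniq ?mem_index_iota ?kj//.
    by rewrite lerDl sumr_ge0// => i _; rewrite addr_ge0 ?enorm_ge0.
  by have := ler_enormD (x - c k) (c k); rewrite subrK; lra.
- by move=> j x; have := P01 j x; rewrite /g; lra.
- move=> x; have [Ux|Ux] := pselect (U x); last first.
    rewrite indicE memNset//= (_ : (fun j => _) = cst 0); first exact: cvg_cst.
    by apply/funext => j; exact: gU.
  rewrite indicE mem_set//=; have := Ux; rewrite UE => -[k _ /= xk].
  have pk : 0 < p k x by exact: ball_bump_in.
  rewrite -[X in _ --> X]subr0; apply: cvgB; first exact: cvg_cst.
  have q1 : `|1 - p k x| < 1 by have /andP[? ?] := p01 k x; rewrite ger0_norm//; lra.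
  apply: (@squeeze_cvgr _ _ _ _ (cst 0) (fun j => (1 - p k x) ^+ j)); last 2 first.
  - exact: cvg_cst.
  - exact: cvg_expr.
  exists k.+1 => // j /= kj; have /andP[-> _] := P01 j x => /=.
  rewrite (bigD1_seq k)/= ?iota_uniq ?mem_index_iota//.
  have /andP[h0 h1] := p01 k x; rewrite ler_piMr ?exprn_ge0//.
  suff /andP[] : 0 <= \prod_(i <- index_iota 0 j | i != k) (1 - p i x) ^+ j <= 1 by [].
  elim/big_ind : _ => [|a b /andP[a0 a1] /andP[b0 b1]|i _]; first by rewrite ler01 lexx.
    by rewrite mulr_ge0//= mulr_ile1.
  by have /andP[u0 u1] := p01 i x; rewrite exprn_ge0//= exprn_ile1.
Qed.

End test_functions.

(** * Integrals of real-valued functions *)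

Section real_integral.
Context {d : measure_display} {T : measurableType d} {R : realType}.
Context {mu : {measure set T -> \bar R}}.
Implicit Types (f g : T -> R) (D : set T).

Lemma EFin_Rintegral D f : measurable D -> mu.-integrable D (EFin \o f) ->
  (\int[mu]_(x in D) f x)%:E = (\int[mu]_(x in D) (f x)%:E)%E.
Proof. by move=> mD fi; rewrite fineK// integrable_fin_num. Qed.

Lemma integrableDR D f g : measurable D -> mu.-integrable D (EFin \o f) ->
  mu.-integrable D (EFin \o g) -> mu.-integrable D (EFin \o (fun x => f x + g x)).
Proof. by move=> mD fi gi; have := integrableD mD fi gi. Qed.

Lemma integrableBR D f g : measurable D -> mu.-integrable D (EFin \o f) ->
  mu.-integrable D (EFin \o g) -> mu.-integrable D (EFin \o (fun x => f x - g x)).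
Proof. by move=> mD fi gi; have := integrableB mD fi gi. Qed.

Lemma integrableZR D (k : R) f : measurable D -> mu.-integrable D (EFin \o f) ->
  mu.-integrable D (EFin \o (fun x => k * f x)).
Proof. by move=> mD fi; have := integrableZl mD k fi. Qed.

Lemma Rintegral_eq0 D f : (forall x, D x -> f x = 0) -> \int[mu]_(x in D) f x = 0.
Proof.
by move=> f0; rewrite /Rintegral integral0_eq// => x Dx; rewrite f0.
Qed.

Lemma bounded_integrable D f (C : R) : measurable D -> (mu D < +oo)%E ->
  measurable_fun setT f -> (forall x, `|f x| <= C) -> mu.-integrable D (EFin \o f).
Proof.
move=> mD muD mf fC; apply: measurable_bounded_integrable => //.
  exact: measurable_funTS.
exists C; split; first exact: num_real.
by move=> M CM x _ /=; exact: le_trans (fC x) (ltW CM).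
Qed.

Lemma Rdominated_cvg D (f_ : nat -> T -> R) f g : measurable D ->
  (forall j, measurable_fun setT (f_ j)) -> measurable_fun setT f ->
  (forall x, D x -> f_ j x @[j --> \oo] --> f x) ->
  mu.-integrable D (EFin \o g) -> (forall j x, D x -> `|f_ j x| <= g x) ->
  \int[mu]_(x in D) f_ j x @[j --> \oo] --> \int[mu]_(x in D) f x.
Proof.
move=> mD mf_ mf f_f ig fg.
have mE (h : T -> R) : measurable_fun setT h -> measurable_fun D (EFin \o h).
  by move=> mh; apply/measurable_EFinP; exact: measurable_funTS.
have cf x : D x -> (f_ j x)%:E @[j --> \oo] --> (f x)%:E.
  by move=> Dx; apply: cvg_EFin; [exact: nearW|exact: f_f].
have fg' x : forall j, D x -> (`|(f_ j x)%:E| <= (g x)%:E)%E.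
  by move=> j Dx; rewrite lee_fin fg.
have [i0 _ c] := dominated_convergence mD (fun j => mE _ (mf_ j)) (mE _ mf)
  (aeW mu cf) ig (aeW mu fg').
by move: c; rewrite /= -EFin_Rintegral// => /fine_cvgP[_].
Qed.

Lemma Rbounded_cvg D (f_ : nat -> T -> R) f (C : R) : measurable D -> (mu D < +oo)%E ->
  (forall j, measurable_fun setT (f_ j)) -> measurable_fun setT f ->
  (forall x, D x -> f_ j x @[j --> \oo] --> f x) -> (forall j x, `|f_ j x| <= C) ->
  \int[mu]_(x in D) f_ j x @[j --> \oo] --> \int[mu]_(x in D) f x.
Proof.
move=> mD muD mf_ mf f_f fC; apply: (@Rdominated_cvg _ _ _ (cst C)) => //.
by apply: (@bounded_integrable _ _ `|C|) => //= x; exact: lexx.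
Qed.

Implicit Types A : set T.

Lemma support_integrable A f (C : R) D : measurable A -> (mu A < +oo)%E ->
  measurable_fun setT f -> (forall x, ~ A x -> f x = 0) -> (forall x, `|f x| <= C) ->
  measurable D -> mu.-integrable D (EFin \o f).
Proof.
move=> mA muA mf f0 fC mD; apply: (@integrableS _ _ _ mu setT) => //.
have -> : f = f \_ A.
  by apply/funext => x; rewrite patchE; case: ifPn => // /negP; rewrite inE => /f0.
rewrite (_ : EFin \o _ = (EFin \o f) \_ A); last by rewrite restrict_EFin.
apply/(integrable_mkcond _ mA).
exact: (bounded_integrable mA muA mf fC).
Qed.

Lemma integrable_sumR (I : Type) (r : seq I) (f : I -> T -> R) D : measurable D ->
  (forall i, mu.-integrable D (EFin \o f i)) ->
  mu.-integrable D (EFin \o (fun x => \sum_(i <- r) f i x)).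
Proof.
move=> mD fi; elim: r => [|i r IH].
  rewrite (_ : EFin \o _ = cst 0%E); first exact: integrable0.
  by apply/funext => x /=; rewrite big_nil.
rewrite (_ : EFin \o _ = EFin \o (fun x => f i x + \sum_(i <- r) f i x)).
  exact: integrableDR.
by apply/funext => x /=; rewrite big_cons.
Qed.

Lemma Rintegral_sum (I : Type) (r : seq I) (f : I -> T -> R) D : measurable D ->
  (forall i, mu.-integrable D (EFin \o f i)) ->
  \int[mu]_(x in D) (\sum_(i <- r) f i x) = \sum_(i <- r) \int[mu]_(x in D) f i x.
Proof.
move=> mD fi; elim: r => [|i r IH].
  by rewrite big_nil; apply: Rintegral_eq0 => x _; rewrite big_nil.
rewrite big_cons -IH -RintegralD//; last exact: integrable_sumR.
by apply: eq_Rintegral => x _; rewrite big_cons.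
Qed.

Lemma Rintegral_indic D f : \int[mu]_(x in D) f x = \int[mu]_x (\1_D x * f x).
Proof.
rewrite Rintegral_mkcond; apply: eq_Rintegral => x _.
by rewrite patchE indicE; case: ifPn => _; rewrite ?mul1r ?mul0r.
Qed.

Lemma integrable_indicM D f : measurable D -> mu.-integrable D (EFin \o f) ->
  mu.-integrable setT (EFin \o (fun x => \1_D x * f x)).
Proof.
move=> mD /(integrable_mkcond _ mD); apply: eq_integrable => // x _ /=.
by rewrite patchE indicE; case: ifPn => _; rewrite ?mul1r ?mul0r.
Qed.

End real_integral.

Lemma preserves_Rintegral (d : measure_display) (T : measurableType d) (R : realType)
    (mu : {measure set T -> \bar R}) (phi : T -> T) (f : T -> R) :
  preserves mu phi -> measurable_fun setT f ->
  \int[mu]_x f (phi x) = \int[mu]_x f x.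
Proof.
move=> pphi mf; rewrite /Rintegral; congr fine.
by apply: (@preserves_integral _ _ _ _ _ (EFin \o f)) => //; exact/measurable_EFinP.
Qed.

(** * Approximation of indicators by test functions in L^1 of a finite measure *)

Section test_density.
Context {R : realType} {n : nat}.
Local Notation rV := 'rV[R]_n.
Local Notation T := (borel_rV R n).
Implicit Types (g : rV -> R) (G : rV -> rV) (A U : set rV).

(** Open sets are countable unions of balls, which are in the product sigma-algebra; conversely the
    coordinates are continuous. *)
Lemma borel_rV_openE : @measurable _ T = <<s [set U : set rV | open U] >>.
Proof.
apply/seteqP; split => [A|]; last first.
  by apply: smallest_sub => [|U]; [exact: sigma_algebra_measurable|exact: open_measurable_rV].
apply: smallest_sub; first exact: smallest_sigma_algebra.
move=> _ [i _ [B mB <-]].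
pose S := g_sigma_algebraType [set U : set rV | open U].
have mc : measurable_fun [set: S] ((fun x : rV => x 0 i) : S -> R).
  apply: (measurability _ (RGenOpens.measurableE R)) => _ [_ [a [b ->] <-]].
  apply: sub_sigma_algebra; rewrite setTI.
  have /continuousP cc : continuous (fun x : rV => x 0 i) by exact: coord_continuous.
  by apply: cc; exact: interval_open.
exact: mc.
Qed.

Definition test_close (mu : {measure set T -> \bar R}) U A (e : R) g :=
  [/\ exists G, test_fun g G, forall x, 0 <= g x <= 1 &
      \int[mu]_(x in U) `|\1_A x - g x| < e].

Variable mu : {measure set T -> \bar R}.
Variable U : set T.
Hypotheses (mU : measurable U) (muU : (mu U < +oo)%E).

Let diff_integrable A g : measurable (A : set T) -> (exists G, test_fun g G) ->
  (forall x, 0 <= g x <= 1) ->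
  mu.-integrable U (EFin \o (fun x => `|\1_A x - g x|)).
Proof.
move=> mA [G [gG _]] g01; apply: (bounded_integrable (C := 1)) => //.
  apply: measurableT_comp => //; apply: measurable_funB; first exact: measurable_indic.
  exact: has_gradient_measurable gG.
move=> x; rewrite normr_id indicE; have := g01 x.
by case: (_ \in _) => /=; rewrite ler_norml => *; apply/andP; lra.
Qed.

Let approximable A := measurable (A : set T) /\
  forall e : R, 0 < e -> exists g, test_close mu U A e g.

Let approximable_open A : open A -> approximable A.
Proof.
move=> oA; split; first exact: open_measurable_rV.
move=> e e0; have [g [gG g01 _ gA]] := open_test_approx oA.
have mg j : measurable_fun setT (g j : T -> R).
  by have [G [gGj _]] := gG j; exact: has_gradient_measurable gGj.
have mA : measurable_fun setT (\1_A : T -> R).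
  by apply: measurable_indic; exact: open_measurable_rV.
have cvg0 : \int[mu]_(x in U) `|\1_A x - g j x| @[j --> \oo] --> 0.
  rewrite -[X in _ --> X](@Rintegral_eq0 _ _ _ mu U (cst 0))//.
  apply: (@Rbounded_cvg _ _ _ _ _ _ _ 1) => //.
  - by move=> j; apply: measurableT_comp => //; exact: measurable_funB.
  - move=> x _; rewrite -[X in _ --> X](@normr0 _ R) -[X in `|X|](subrr (\1_A x)).
    by apply: cvg_norm; apply: cvgB; [exact: cvg_cst|exact: gA].
  - move=> j x; rewrite normr_id indicE; have := g01 j x.
    by case: (_ \in _) => /=; rewrite ler_norml => *; apply/andP; lra.
have /cvgrPdist_lt/(_ _ e0)[j _ /(_ j (leqnn j))] := cvg0.
rewrite sub0r normrN ger0_norm ?Rintegral_ge0// => ge.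
by exists (g j); split.
Qed.

Let approximable_setD A B : B `<=` A -> approximable A -> approximable B ->
  approximable (A `\` B).
Proof.
move=> BA [mA hA] [mB hB]; split; first exact: measurableD.
move=> e e0; have e8 : 0 < e / 8 by rewrite divr_gt0.
have [g [gG g01 gA]] := hA _ e8; have [h [hH h01 hB']] := hB _ e8.
have gi := diff_integrable mA gG g01; have hi := diff_integrable mB hH h01.
have [G gG'] := gG; have [H hH'] := hH.
(* The difference must be brought back to [0, 1]. [smooth_step] fixes the values 0 and 1 of the
   indicator and is 4-Lipschitz, whence the errors e/8 for each of the two functions. *)
pose k x := smooth_step (g x - h x).
have kK : exists K, test_fun k K.
  eexists; apply: (test_fun_comp is_derive_smooth_step continuous_dsmooth_step).
    by rewrite smooth_step_le0.
  rewrite (_ : (fun x => _) = (fun x => g x + (-1) * h x)).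
    apply: test_funD gG' (test_funZ (-1) hH').
  by apply/funext => x; rewrite mulN1r.
exists k; split => //; first by move=> x; exact: smooth_step_itv.
apply: (@le_lt_trans _ _ (4 * (\int[mu]_(x in U) `|\1_A x - g x| + \int[mu]_(x in U) `|\1_B x - h x|))).
  rewrite -RintegralD// -RintegralZl//; last exact: integrableDR.
  apply: le_Rintegral => //.
  - apply: diff_integrable => //; first exact: measurableD.
    by move=> x; exact: smooth_step_itv.
  - by apply: integrableZR => //; exact: integrableDR.
  move=> x _; have -> : \1_(A `\` B) x = smooth_step (\1_A x - \1_B x) :> R.
    rewrite !indicE in_setD; have BAx : (x \in B) -> (x \in A) by rewrite !inE; exact: BA.
    case: (x \in B) BAx => [->//|_] /=; first by rewrite subrr smooth_step_le0.
    by case: (_ \in _); rewrite /= subr0; [rewrite smooth_step_ge1|rewrite smooth_step_le0].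
  apply: le_trans (smooth_step_lip _ _) _; rewrite ler_wpM2l//.
  rewrite (_ : _ - _ = (\1_A x - g x) - (\1_B x - h x)); first exact: ler_normB.
  by ring.
by move: gA hB'; lra.
Qed.

Let approximable_ndseq : ndseq_closed approximable.
Proof.
move=> F ndF hF; have mF i : measurable (F i : set T) by case: (hF i).
have mbF : measurable (\bigcup_i F i : set T) by exact: bigcup_measurable.
split => // e e0; have e2 : 0 < e / 2 by rewrite divr_gt0.
have cvg0 : \int[mu]_(x in U) (\1_(\bigcup_i F i) x - \1_(F j) x) @[j --> \oo] --> 0.
  rewrite -[X in _ --> X](@Rintegral_eq0 _ _ _ mu U (cst 0))//.
  apply: (@Rbounded_cvg _ _ _ _ _ _ _ 1) => //.
  - by move=> j; apply: measurable_funB; exact: measurable_indic.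
  - move=> x _; apply: cvg_near_cst; have [[i _ Fi]|nF] := pselect ((\bigcup_i F i) x).
      exists i => // j /= ij; rewrite !indicE !mem_set ?subrr//; last by exists i.
      by move: x Fi; apply/subsetPset; exact: ndF.
    apply: nearW => j; rewrite !indicE !memNset ?subrr// => Fj.
    by apply: nF; exists j.
  - move=> j x; rewrite !indicE; case: (_ \in _); case: (_ \in _); by rewrite /= ?subrr ?subr0 ?sub0r ?normrN ?normr1 ?normr0 ?ler01 ?lexx.
have /cvgrPdist_lt/(_ _ e2)[j _ /(_ j (leqnn j))] := cvg0.
rewrite sub0r normrN => hj; have [_ /(_ _ e2)[g [gG g01 gF]]] := hF j.
exists g; split => //.
have i1 : mu.-integrable U (EFin \o (fun x => \1_(\bigcup_i F i) x - \1_(F j) x)).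
  apply: integrableBR => //; apply: (bounded_integrable (C := 1)) => //.
  - exact: normr_indic_le1.
  - exact: normr_indic_le1.
have gi := diff_integrable (mF j) gG g01.
apply: (@le_lt_trans _ _ (\int[mu]_(x in U) (\1_(\bigcup_i F i) x - \1_(F j) x) + \int[mu]_(x in U) `|\1_(F j) x - g x|)).
  rewrite -RintegralD//; apply: le_Rintegral => //.
  - exact: diff_integrable.
  - exact: integrableDR.
  move=> x _; rewrite -[X in `|X|](subrKA (\1_(F j) x)).
  apply: le_trans (ler_normD _ _) _; rewrite lerD2r ger0_norm// subr_ge0 !indicE.
  have : (x \in F j) -> (x \in \bigcup_i F i) by rewrite !inE => Fj; exists j.
  by case: (x \in F j) => [->|]//; case: (_ \in _).
have := ler_norm (\int[mu]_(x in U) (\1_(\bigcup_i F i) x - \1_(F j) x)).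
by move: hj gF; lra.
Qed.

(** The approximable sets form a lambda-system that contains the open sets, and these are stable
    under intersection and generate the Borel sets. *)
Lemma test_close_exists A e : measurable (A : set T) -> 0 < e ->
  exists g, test_close mu U A e g.
Proof.
move=> mA; suff : approximable A by case=> _; exact.
move: mA; rewrite borel_rV_openE; apply: (@lambda_system_subset _ _ _ setT) => //.
- by move=> V W oV oW; exact: openI.
- split => //; first exact/approximable_open/openT.
Qed.

(** Multiply an approximation by the functions of [open_test_approx]: they vanish off [U] and tend
    to 1 on it, so the error committed on [U] is as small as desired. *)
Lemma test_close_open A e : open U -> measurable (A : set T) -> A `<=` U -> 0 < e ->
  exists2 g, test_close mu U A e g & forall x, ~ U x -> g x = 0.
Proof.
move=> oU mA AU e0; have e2 : 0 < e / 2 by rewrite divr_gt0.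
have [g [[G gG] g01 gA]] := test_close_exists mA e2.
have [p [pP p01 p0 pU]] := open_test_approx oU.
have mp j : measurable_fun setT (p j : T -> R).
  by have [P [pPj _]] := pP j; exact: has_gradient_measurable pPj.
have mg : measurable_fun setT (g : T -> R) := has_gradient_measurable gG.1.
have cvg0 : \int[mu]_(x in U) (g x * (1 - p j x)) @[j --> \oo] --> 0.
  rewrite -[X in _ --> X](@Rintegral_eq0 _ _ _ mu U (cst 0))//.
  apply: (@Rbounded_cvg _ _ _ _ _ _ _ 1) => //.
  - by move=> j; apply: measurable_funM => //; exact: measurable_funB.
  - move=> x Ux; rewrite -[X in _ --> X](mulr0 (g x)); apply: cvgM; first exact: cvg_cst.
    rewrite -[X in _ --> X](subrr 1); apply: cvgB; first exact: cvg_cst.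
    by have := pU x; rewrite indicE mem_set.
  - move=> j x; have /andP[? ?] := g01 x; have /andP[? ?] := p01 j x.
    by rewrite ger0_norm ?mulr_ge0 ?subr_ge0// mulr_ile1 ?subr_ge0//; lra.
have /cvgrPdist_lt/(_ _ e2)[j _ /(_ j (leqnn j))] := cvg0.
rewrite sub0r normrN => hj; have [P pPj] := pP j.
exists (fun x => g x * p j x); last by move=> x Ux; rewrite p0// mulr0.
have gp01 x : 0 <= g x * p j x <= 1.
  by have /andP[? ?] := g01 x; have /andP[? ?] := p01 j x; rewrite mulr_ge0// mulr_ile1.
have gpG : exists K, test_fun (fun x => g x * p j x) K.
  by eexists; apply: test_funM gG pPj.1.
split => //; have gi := diff_integrable mA (ex_intro _ G gG) g01.
have i1 : mu.-integrable U (EFin \o (fun x => g x * (1 - p j x))).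
  apply: (bounded_integrable (C := 1)) => //.
    by apply: measurable_funM => //; exact: measurable_funB.
  move=> x; have /andP[? ?] := g01 x; have /andP[? ?] := p01 j x.
  by rewrite ger0_norm ?mulr_ge0 ?subr_ge0// mulr_ile1 ?subr_ge0//; lra.
apply: (@le_lt_trans _ _ (\int[mu]_(x in U) `|\1_A x - g x| + \int[mu]_(x in U) (g x * (1 - p j x)))).
  rewrite -RintegralD//; apply: le_Rintegral => //.
  - exact: diff_integrable.
  - exact: integrableDR.
  move=> x _; rewrite (_ : _ - _ = (\1_A x - g x) + g x * (1 - p j x)); last by ring.
  apply: le_trans (ler_normD _ _) _; rewrite lerD2l ger0_norm//.
  by have /andP[? ?] := g01 x; have /andP[? ?] := p01 j x; rewrite mulr_ge0// subr_ge0.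
have := ler_norm (\int[mu]_(x in U) (g x * (1 - p j x))).
by move: hj gA; lra.
Qed.

End test_density.

(** * Translates of test functions and the Gauss-Green formula *)

Section lebesgue_bounded.
Context {R : realType} {n : nat}.
Local Notation rV := 'rV[R]_n.
Local Notation L := (borel_lebesgue R n).
Local Notation T := (borel_rV R n).

Lemma lebesgue_eball_lty (c : rV) r : (L (eball c r) < +oo)%E.
Proof.
pose B := [set x : rV | forall i, 0 <= x 0 i < 2 * (`|r| + 1)].
have r0 : 0 <= 2 * (`|r| + 1) by rewrite mulr_ge0// addr_ge0.
have LB := borel_lebesgue_box n r0.
have mB : measurable (B : set T) by exact: measurable_box.
pose a : rV := const_mx (`|r| + 1) - c.
have [_ /(_ B mB) e] := borel_lebesgue_shift a.
apply: (@le_lt_trans _ _ (L ((fun x : rV => x + a) @^-1` B))); last first.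
  have LB' : (L B < +oo)%E by rewrite LB ltry.
  by rewrite [X in (X < _)%E]e.
apply: le_measure; rewrite ?inE; first exact: measurable_eball.
  exact: (measurable_preimageT (measurable_shift a) mB).
move=> x; rewrite /eball/= => xr i; rewrite !mxE.
have := ler_coord_enorm (x - c) i; rewrite !mxE ler_norml => /andP[h1 h2].
by have := ler_norm r => hr; apply/andP; split; lra.
Qed.

Lemma test_fun_support g (G : rV -> rV) : test_fun g G ->
  exists M : R, forall x, ~ eball 0 M x -> g x = 0 /\ G x = 0.
Proof.
move=> /test_grad_support[M _ h]; exists M => x; rewrite /eball/= subr0 => /negP.
by rewrite -leNgt => /h.
Qed.

Lemma test_fun_integrable g G (D : set T) : test_fun g G -> measurable D ->
  L.-integrable D (EFin \o (g : T -> R)).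
Proof.
move=> gG mD; have [M gM] := test_fun_support gG.
have [C _ gC] := test_fun_bounded gG.
apply: (@support_integrable _ T R L (eball 0 M) g C) => //.
- exact: measurable_eball.
- exact: lebesgue_eball_lty.
- exact: has_gradient_measurable gG.1.
- by move=> x /gM[].
- by move=> x; case: (gC x).
Qed.

Lemma test_grad_integrable g G h (D : set T) : test_fun g G -> measurable D ->
  L.-integrable D (EFin \o ((fun x => dot (G x) h) : T -> R)).
Proof.
move=> gG mD; have [M gM] := test_fun_support gG.
have [C C0 gC] := test_fun_bounded gG.
apply: (@support_integrable _ T R L (eball 0 M) (fun x => dot (G x) h) (C * enorm h)) => //.
- exact: measurable_eball.
- exact: lebesgue_eball_lty.
- exact: has_gradient_measurable_dot gG.1.
- by move=> x /gM[_ ->]; rewrite dot0l.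
- move=> x; apply: le_trans (normr_dot _ _) _; rewrite ler_wpM2r ?enorm_ge0//.
  by case: (gC x).
Qed.

Lemma is_derive_shift_integral (E : set T) g G (h : rV) (s : R) : measurable E -> test_fun g G ->
  is_derive s 1 (fun s : R => \int[L]_(x in E) g ((x : rV) + s *: h))
    (\int[L]_(x in E) dot (G ((x : rV) + s *: h)) h).
Proof.
move=> mE gG; have [M gM] := test_fun_support gG.
have [C C0 gC] := test_fun_bounded gG.
pose f (t : R) (x : T) := g ((x : rV) + t *: h).
have derf (t : R) x : is_derive t 1 (f ^~ x) (dot (G ((x : rV) + t *: h)) h).
  exact: has_gradient_line gG.1.
(* Radius of a ball that contains the supports of all translates with parameter within 1 of [s], as
   the dominating function requires. *)
pose M' := `|M| + (`|s| + 1) * enorm h.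
pose b (x : T) := C * enorm h * \1_(eball 0 M') x.
have Is : [set` `]s - 1, s + 1[] s by rewrite /= in_itv/=; apply/andP; lra.
have fi (t : R) : [set` `]s - 1, s + 1[] t -> L.-integrable E (EFin \o f t).
  by move=> _; exact: test_fun_integrable (test_fun_shift (t *: h) gG) mE.
have df t x : [set` `]s - 1, s + 1[] t -> E x -> derivable (f ^~ x) t 1.
  by move=> _ _; have [] := derf t x.
have b0 x : 0 <= b x by rewrite /b !mulr_ge0 ?enorm_ge0// indicE.
have bi : L.-integrable E (EFin \o b).
  apply: (@support_integrable _ T R L (eball 0 M') b (C * enorm h)) => //.
  - exact: measurable_eball.
  - exact: lebesgue_eball_lty.
  - apply: measurable_funM; first exact: measurable_cst.
    by apply: measurable_indic; exact: measurable_eball.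
  - by move=> x xM; rewrite /b indicE memNset// mulr0.
  - have Ch : 0 <= C * enorm h by rewrite mulr_ge0 ?enorm_ge0.
    by move=> x; rewrite /b indicE; case: (_ \in _); rewrite ?mulr1 ?mulr0 ?normr0 ?ger0_norm.
have fb t x : [set` `]s - 1, s + 1[] t -> E x -> `|partial1of2 f t x| <= b x.
  rewrite /= in_itv/= => /andP[t1 t2] _.
  rewrite partial1of2E (@derive_val _ _ _ _ _ _ _ (derf t x)) /b indicE.
  have [xM|xM] := pselect (eball 0 M' x).
    rewrite mem_set// mulr1; apply: le_trans (normr_dot _ _) _.
    by rewrite ler_wpM2r ?enorm_ge0//; case: (gC ((x : rV) + t *: h)).
  rewrite (gM _ _).2 ?dot0l ?normr0 ?memNset ?mulr0// => {}xM'; apply: xM.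
  move: xM'; rewrite /eball/= !subr0 => xM'.
  have := ler_enormD ((x : rV) + t *: h) (- (t *: h)); rewrite addrK enormN enormZ.
  have : `|t| * enorm h <= (`|s| + 1) * enorm h.
    rewrite ler_wpM2r ?enorm_ge0// ler_norml; have := ler_norm s; have := ler_norm (- s).
    by rewrite normrN => *; apply/andP; lra.
  by have := ler_norm M; rewrite /M'; lra.
have d1 := derivable_under_integral mE Is fi df b0 bi fb.
have d2 := differentiation_under_integral mE Is fi df b0 bi fb.
apply: DeriveDef; first exact: d1.
rewrite -derive1E d2; apply: eq_Rintegral => x _.
by rewrite /= partial1of2E (@derive_val _ _ _ _ _ _ _ (derf s x)).
Qed.

Lemma shift_integralE (E : set T) g (h : rV) :
  measurable E -> measurable_fun setT (g : T -> R) ->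
  \int[L]_(x in E) g ((x : rV) + h) = \int[L]_x (\1_E ((x : rV) - h) * g x).
Proof.
move=> mE mg; rewrite Rintegral_indic.
rewrite -(preserves_Rintegral (borel_lebesgue_shift h) (f := fun x : T => \1_E ((x : rV) - h) * g x)).
  by apply: eq_Rintegral => x _; rewrite addrK.
apply: measurable_funM => //; under eq_fun do rewrite -(indic_preimage _ (fun x : T => (x : rV) - h)).
apply: measurable_indic; apply: (measurable_preimageT _ mE).
exact: measurable_shift.
Qed.

(** The integral of g(x + s h) does not depend on s; its derivative at 0 is the left-hand side. *)
Lemma integral_gradient0 g G h : test_fun g G -> \int[L]_x dot (G x) h = 0.
Proof.
move=> gG; have := is_derive_shift_integral h 0 measurableT gG.
rewrite (_ : (fun s => _) = cst (\int[L]_x g x)); last first.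
  apply/funext => s; rewrite (preserves_Rintegral (borel_lebesgue_shift (s *: h)))//.
  exact: has_gradient_measurable gG.1.
move=> /(@derive_val _ _ _ _ _ _ _); rewrite derive_cst => ->.
by apply: eq_Rintegral => x _; rewrite scale0r addr0.
Qed.

(* The Gauss-Green formula tested on the fields g h with g scalar and h constant;
   here nu has norm 1 everywhere. *)
Definition scalar_gauss_green (E : set T) (mu : {measure set T -> \bar R})
    (nu : rV -> rV) :=
  [/\ measurable_fun [set: T] (nu : T -> T),
      forall x, enorm (nu x) = 1, (mu setT < +oo)%E &
      forall g G h, test_fun g G ->
        \int[L]_(x in E) dot (G x) h = \int[mu]_x (g x * dot h (nu x))].

(** The difference of E + h and E. *)
Definition shift_diff (E : set T) (h : rV) : set T :=
  [set x | E ((x : rV) - h) /\ ~ E x].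

Context {E : set T} {mu : {measure set T -> \bar R}} {nu : rV -> rV}.
Hypotheses (mE : measurable E) (gg : scalar_gauss_green E mu nu).

Lemma measurable_nu_dot h : measurable_fun [set: T] ((fun x => dot h (nu x)) : T -> R).
Proof. by apply: measurable_dot; [exact: measurable_cst|case: gg]. Qed.

Lemma nu_dot_le h x : `|dot h (nu x)| <= enorm h.
Proof. by apply: le_trans (normr_dot _ _) _; have [_ -> _ _] := gg; rewrite mulr1. Qed.

Lemma nu_dot_integrable h (f : T -> R) (C : R) D : measurable D -> measurable_fun setT f ->
  (forall x, `|f x| <= C) -> mu.-integrable D (EFin \o (fun x => f x * dot h (nu x))).
Proof.
move=> mD mf fC; apply: (bounded_integrable (C := (C * enorm h))) => //.
- by apply: le_lt_trans (le_measure mu _ _ (@subsetT _ D)) _; rewrite ?inE//; case: gg.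
- by apply: measurable_funM => //; exact: measurable_nu_dot.
- by move=> x; rewrite normrM ler_pM// nu_dot_le.
Qed.

Lemma mu_fin D : measurable D -> (mu D < +oo)%E.
Proof.
by move=> mD; apply: le_lt_trans (le_measure mu _ _ (@subsetT _ D)) _; rewrite ?inE//; case: gg.
Qed.

Lemma measurable_shift_diff h : measurable (shift_diff E h).
Proof.
apply: measurableI; last exact: measurableC.
by have := measurable_preimageT (measurable_shift (- h)) mE.
Qed.

(** The left-hand side is psi(1) - psi(0), where psi(s) is the integral of g(x + s h) over [E]; by
    the Gauss-Green formula psi'(s) is the integral bounded by [M]. *)
Lemma shift_integral_MVT g G h (M : R) : test_fun g G ->
  (forall s, 0 <= s <= 1 -> \int[mu]_x (g ((x : rV) + s *: h) * dot h (nu x)) <= M) ->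
  \int[L]_x (g x * (\1_E ((x : rV) - h) - \1_E x)) <= M.
Proof.
move=> gG hM; have [_ _ _ hgg] := gg.
pose psi (s : R) := \int[L]_(x in E) g ((x : rV) + s *: h).
have dpsi (s : R) : is_derive s 1 psi (\int[mu]_x (g ((x : rV) + s *: h) * dot h (nu x))).
  by rewrite -(hgg _ _ _ (test_fun_shift (s *: h) gG)); exact: is_derive_shift_integral.
have mg : measurable_fun setT (g : T -> R) := has_gradient_measurable gG.1.
have gi := test_fun_integrable gG measurableT.
have mi : measurable_fun setT ((fun x => \1_E ((x : rV) - h)) : T -> R).
  under eq_fun do rewrite -(indic_preimage _ (fun x : T => (x : rV) - h)).
  by apply: measurable_indic; exact: (measurable_preimageT (measurable_shift (- h)) mE).
have i1 : L.-integrable setT (EFin \o ((fun x => \1_E ((x : rV) - h) * g x) : T -> R)).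
  apply: (le_integrable _ _ _ gi) => //.
    by apply/measurable_EFinP; exact: measurable_funM.
  move=> x _ /=; rewrite lee_fin normrM ler_piMl// indicE.
  by case: (_ \in _); rewrite ?normr1 ?normr0.
have i0 : L.-integrable setT (EFin \o ((fun x => \1_E x * g x) : T -> R)).
  exact: integrable_indicM mE (test_fun_integrable gG mE).
have -> : \int[L]_x (g x * (\1_E ((x : rV) - h) - \1_E x)) = psi 1 - psi 0.
  rewrite /psi !shift_integralE// scale1r scale0r -RintegralB//; last first.
    by under eq_fun do rewrite subr0.
  by apply: eq_Rintegral => x _; rewrite subr0 mulrBr ![g x * _]mulrC.
have cpsi : {within `[0, 1], continuous psi}.
  apply: continuous_subspaceT => s; apply: differentiable_continuous.
  by apply/derivable1_diffP; have [] := dpsi s.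
have [c c01 ->] := MVT_segment ler01 (fun s _ => dpsi s) cpsi.
by rewrite subr0 mulr1; apply: hM; move: c01; rewrite in_itv.
Qed.

(** Test with g of values in [0, 1], vanishing off [U] and close to the indicator of the set on the
    left. Then g(y + s h) h . nu(y) is at most the positive part of h . nu(y), and it vanishes
    unless y + s h lies in [U], that is, unless y lies in [V]. *)
Lemma shift_diff_le (U V : set T) h : open U -> (L U < +oo)%E -> measurable V ->
  (forall y s, 0 <= s <= 1 -> U ((y : rV) + s *: h) -> V y) ->
  (L (U `&` shift_diff E h) <= (\int[mu]_(x in V) Num.max (dot h (nu x)) 0)%:E)%E.
Proof.
move=> oU LU mV UV; set A := U `&` shift_diff E h.
have mU : measurable (U : set T) := open_measurable_rV oU.
have mA : measurable (A : set T) by apply: measurableI => //; exact: measurable_shift_diff.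
have LA : L A \is a fin_num.
  rewrite ge0_fin_numE//; apply: le_lt_trans LU; apply: le_measure; rewrite ?inE//.
  by move=> x [].
rewrite -[leLHS]fineK// lee_fin; apply/ler_addgt0Pr => e e0.
have [g [[G gG] g01 gA] g0] := @test_close_open _ _ _ _ mU LU A e oU mA (@subIsetl _ _ _) e0.
have mg : measurable_fun setT (g : T -> R) := has_gradient_measurable gG.1.
pose D (x : T) : R := \1_E ((x : rV) - h) - \1_E x.
have D1 x : `|D x| <= 1.
  by rewrite /D !indicE; case: (_ \in _); case: (_ \in _); rewrite /= ?subrr ?subr0 ?sub0r ?normrN ?normr1 ?normr0.
have mD : measurable_fun setT D.
  apply: measurable_funB; last exact: measurable_indic.
  under eq_fun do rewrite -(indic_preimage _ (fun x : T => (x : rV) - h)).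
  by apply: measurable_indic; exact: (measurable_preimageT (measurable_shift (- h)) mE).
have AD x : A x -> D x = 1.
  by move=> [_ [Exh nEx]]; rewrite /D !indicE mem_set// memNset// subr0.
have main : \int[L]_x (g x * D x) <= \int[mu]_(x in V) Num.max (dot h (nu x)) 0.
  apply: (shift_integral_MVT gG) => s s01.
  rewrite [leRHS]Rintegral_indic.
  have gs := test_fun_shift (s *: h) gG.
  have [C C0 gC] := test_fun_bounded gs.
  have mxi : mu.-integrable setT (EFin \o (fun x => \1_V x * Num.max (dot h (nu x)) 0)).
    apply: (bounded_integrable (C := (enorm h))) => //; first exact: mu_fin.
      apply: measurable_funM; first exact: measurable_indic.
      by apply: measurable_maxr; [exact: measurable_nu_dot|exact: measurable_cst].
    move=> x; rewrite normrM; apply: (@le_trans _ _ (1 * enorm h)); last by rewrite mul1r.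
    apply: ler_pM => //; first exact: normr_indic_le1.
    apply: le_trans (nu_dot_le h x).
    by case: (leP (dot h (nu x)) 0); rewrite ?normr0.
  apply: le_Rintegral => //.
  - apply: (@nu_dot_integrable _ _ C) => //; first exact: (has_gradient_measurable gs.1).
    by move=> x; case: (gC x).
  move=> x _; have /andP[g1 g2] := g01 ((x : rV) + s *: h).
  have [Vx|Vx] := pselect (V x); last first.
    rewrite indicE memNset// mul0r g0 ?mul0r// => Uy; apply: Vx.
    exact: (UV x s s01 Uy).
  rewrite indicE mem_set// mul1r; apply: (@le_trans _ _ (g ((x : rV) + s *: h) * Num.max (dot h (nu x)) 0)).
    by rewrite ler_wpM2l// le_max lexx.
  by rewrite ler_piMl// le_max lexx orbT.
have gDU : \int[L]_x (g x * D x) = \int[L]_(x in U) (g x * D x).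
  rewrite [RHS]Rintegral_indic; apply: eq_Rintegral => x _.
  have [Ux|Ux] := pselect (U x); first by rewrite indicE mem_set// mul1r.
  by rewrite g0// mul0r mulr0.
have LAE : fine (L A) = \int[L]_(x in U) \1_A x.
  rewrite /Rintegral integral_indic//; congr (fine (L _)).
  by apply/seteqP; split => x; [move=> [? ?]; split|case].
have iA : L.-integrable U (EFin \o (\1_A : T -> R)).
  apply: (bounded_integrable (C := 1)) => //.
  exact: normr_indic_le1.
have igD : L.-integrable U (EFin \o ((fun x => g x * D x) : T -> R)).
  apply: (bounded_integrable (C := 1)) => //; first exact: measurable_funM.
  move=> x; rewrite normrM mulr_ile1//; have := g01 x => /andP[? ?].
  by rewrite ger0_norm.
have iAg : L.-integrable U (EFin \o ((fun x => `|\1_A x - g x|) : T -> R)).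
  apply: (bounded_integrable (C := 1)) => //.
    by apply: measurableT_comp => //; apply: measurable_funB => //; exact: measurable_indic.
  move=> x; rewrite normr_id indicE; have := g01 x.
  by case: (_ \in _) => /=; rewrite ler_norml => *; apply/andP; lra.
rewrite LAE; apply: (@le_trans _ _ (\int[L]_(x in U) (g x * D x + `|\1_A x - g x|))).
  apply: le_Rintegral => //; first exact: integrableDR.
  move=> x Ux; have [Ax|Ax] := pselect (A x).
    by rewrite AD// mulr1 -lerBlDl ler_norm.
  rewrite indicE memNset//= sub0r normrN ger0_norm; last by case/andP: (g01 x).
  have := D1 x; rewrite ler_norml => /andP[? _].
  by have /andP[? ?] := g01 x; nra.
rewrite RintegralD// -gDU lerD// ltW//.
Qed.

End lebesgue_bounded.

(** * Translates and total variation *)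

Section total_variation.
Context {R : realType} {n : nat}.
Local Notation rV := 'rV[R]_n.
Local Notation L := (borel_lebesgue R n).
Local Notation T := (borel_rV R n).

(** The integrals of a gradient over [E] and over its complement add up to 0. The complement
    supplies the second half of every two-sided estimate. *)
Lemma scalar_gauss_greenC (E : set T) (mu : {measure set T -> \bar R}) nu :
  measurable E -> scalar_gauss_green E mu nu ->
  scalar_gauss_green (~` E) mu (fun x => - nu x).
Proof.
move=> mE [mnu nu1 muT hgg]; split => //.
- exact: measurable_rVN.
- by move=> x; rewrite enormN.
move=> g G h gG; have gi D := @test_grad_integrable _ _ g G h D gG.
have e0 : \int[L]_(x in E) dot (G x) h + \int[L]_(x in ~` E) dot (G x) h = 0.
  have i : L.-integrable (E `|` ~` E) (EFin \o ((fun x => dot (G x) h) : T -> R)).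
    by rewrite setUv; exact: gi.
  have dE : [disjoint E & ~` E] by apply/disj_setPS; rewrite setICr.
  by rewrite -(Rintegral_setU mE (measurableC mE) i dE) setUv; exact: (integral_gradient0 h gG).
move: e0 => /eqP; rewrite addrC addr_eq0 => /eqP ->; rewrite (hgg g G h gG) -mulN1r -RintegralZl//.
  by apply: eq_Rintegral => x _; rewrite dotNr mulrN mulN1r.
have [C _ gC] := test_fun_bounded gG.
apply: (@nu_dot_integrable _ _ E mu nu _ h g C) => //.
- exact: (has_gradient_measurable gG.1).
- by move=> x; case: (gC x).
Qed.

Definition shift_var (E : set T) (h : rV) : \bar R :=
  (\int[L]_x (`|\1_E ((x : rV) - h) - \1_E x|)%:E)%E.

Lemma measurable_shift_indic (E : set T) h : measurable E ->
  measurable_fun setT ((fun x => \1_E ((x : rV) - h)) : T -> R).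
Proof.
move=> mE; under eq_fun do rewrite -(indic_preimage _ (fun x : T => (x : rV) - h)).
by apply: measurable_indic; exact: (measurable_preimageT (measurable_shift (- h)) mE).
Qed.

Lemma measurable_shift_indicB (E : set T) h : measurable E ->
  measurable_fun setT ((fun x => \1_E ((x : rV) - h) - \1_E x) : T -> R).
Proof.
by move=> mE; apply: measurable_funB; [exact: measurable_shift_indic|exact: measurable_indic].
Qed.

Lemma shift_indicB_le1 (E : set T) h x : `|\1_E ((x : rV) - h) - \1_E x : R| <= 1.
Proof.
by rewrite !indicE; case: (_ \in _); case: (_ \in _); rewrite /= ?subrr ?subr0 ?sub0r ?normrN ?normr1 ?normr0.
Qed.

Lemma shift_varE (E : set T) h : measurable E ->
  shift_var E h = (L (shift_diff E h) + L (shift_diff (~` E) h))%E.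
Proof.
move=> mE; rewrite /shift_var.
have m1 := measurable_shift_diff mE h; have m2 := measurable_shift_diff (measurableC mE) h.
have iE A : measurable A -> L A = (\int[L]_x (\1_A x)%:E)%E.
  by move=> mA; rewrite integral_indic// setIT.
rewrite (iE _ m1) (iE _ m2) -ge0_integralD//; last 2 first.
- by apply/measurable_EFinP; exact: measurable_indic.
- by apply/measurable_EFinP; exact: measurable_indic.
apply: eq_integral => x _; rewrite -EFinD; congr EFin.
have e1 : (x \in shift_diff E h) = (((x : rV) - h) \in E) && (x \notin E).
  apply/idP/andP => [/set_mem[a b]|[/set_mem a /negP b]].
    by split; [exact: mem_set|apply/negP => /set_mem].
  by apply/mem_set; split => // c; exact/b/mem_set.
have e2 : (x \in shift_diff (~` E) h) = (((x : rV) - h) \notin E) && (x \in E).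
  apply/idP/andP => [/set_mem[a /contrapT b]|[/negP a /set_mem b]].
    by split; [apply/negP => /set_mem|exact: mem_set].
  by apply/mem_set; split => [c|]; [exact/a/mem_set|exact].
rewrite !indicE e1 e2; case: (_ \in E); case: (_ \in E) => /=.
all: by rewrite ?subrr ?sub0r ?subr0 ?normrN ?normr1 ?normr0 ?addr0 ?add0r.
Qed.

Section limit.
Context {E : set T} {mu : {measure set T -> \bar R}} {nu : rV -> rV}.
Hypotheses (mE : measurable E) (gg : scalar_gauss_green E mu nu).

Lemma shift_diff_leT h :
  (L (shift_diff E h) <= (\int[mu]_x Num.max (dot h (nu x)) 0)%:E)%E.
Proof.
pose F k := shift_diff E h `&` eball (0 : rV) k%:R.
have mF k : measurable (F k : set T).
  by apply: measurableI; [exact: measurable_shift_diff|exact: measurable_eball].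
have FE : \bigcup_k F k = shift_diff E h.
  rewrite -setI_bigcupr (_ : \bigcup_k _ = setT) ?setIT//.
  apply/seteqP; split => // x _; exists (Num.bound (enorm (x : rV))) => //.
  rewrite /eball/= subr0; have := archi_boundP (enorm_ge0 (x : rV)); exact.
have ndF : nondecreasing_seq F.
  move=> i j ij; apply/subsetPset => x [? b]; split => //.
  by move: b; rewrite /eball/= => /lt_le_trans; apply; rewrite ler_nat.
have := @nondecreasing_cvg_mu _ _ _ L F mF; rewrite FE => /(_ (measurable_shift_diff mE h) ndF) Fc.
rewrite -(cvg_lim _ Fc)//; apply: lime_le; first by apply/cvg_ex; eexists; exact: Fc.
apply: nearW => k /=; rewrite /F setIC; apply: (shift_diff_le mE gg) => //.
- exact: open_eball.
- exact: lebesgue_eball_lty.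
Qed.

Lemma normr_dot_integrable h : mu.-integrable setT (EFin \o (fun x => `|dot h (nu x)|)).
Proof.
have [mnu nu1 muT _] := gg; apply: (bounded_integrable (C := (enorm h))) => //.
  by apply: measurableT_comp => //; exact: (measurable_nu_dot gg).
by move=> x; rewrite normr_id; exact: (nu_dot_le gg).
Qed.

Lemma max_dot_integrable h : mu.-integrable setT (EFin \o (fun x => Num.max (dot h (nu x)) 0)).
Proof.
apply: (le_integrable _ _ _ (normr_dot_integrable h)) => //.
  apply/measurable_EFinP; apply: measurable_maxr; first exact: (measurable_nu_dot gg).
  exact: measurable_cst.
move=> x _ /=; rewrite lee_fin normr_id.
by case: (leP (dot h (nu x)) 0); rewrite ?normr0.
Qed.

End limit.

Section limit2.
Context {E : set T} {mu : {measure set T -> \bar R}} {nu : rV -> rV}.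
Hypotheses (mE : measurable E) (gg : scalar_gauss_green E mu nu).

Lemma shift_var_le h : (shift_var E h <= (\int[mu]_x `|dot h (nu x)|)%:E)%E.
Proof.
have ggC := scalar_gauss_greenC mE gg.
rewrite shift_varE//; apply: le_trans (leeD (shift_diff_leT mE gg h) (shift_diff_leT (measurableC mE) ggC h)) _.
rewrite -EFinD lee_fin -RintegralD//; last 2 first.
- exact: (max_dot_integrable gg).
- exact: (max_dot_integrable ggC).
apply: le_of_eq; apply: eq_Rintegral => x _.
rewrite dotNr; case: (leP (dot h (nu x)) 0) => h0.
  by rewrite max_l ?oppr_ge0// add0r ler0_norm.
by rewrite max_r ?oppr_le0 ?ltW// addr0 gtr0_norm.
Qed.

Lemma shift_var_fin h : shift_var E h \is a fin_num.
Proof.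
rewrite ge0_fin_numE; last by apply: integral_ge0 => x _; rewrite lee_fin.
by apply: le_lt_trans (shift_var_le h) _; rewrite ltry.
Qed.

Lemma shift_var_ge g G h : test_fun g G -> (forall x, `|g x| <= 1) ->
  \int[L]_(x in E) g ((x : rV) + h) - \int[L]_(x in E) g x <= fine (shift_var E h).
Proof.
move=> gG g1; have mg : measurable_fun setT (g : T -> R) := has_gradient_measurable gG.1.
have vi : L.-integrable setT (EFin \o ((fun x => `|\1_E ((x : rV) - h) - \1_E x|) : T -> R)).
  apply/integrableP; split.
    by apply/measurable_EFinP; apply: measurableT_comp => //; exact: measurable_shift_indicB.
  rewrite (_ : (\int[L]_x _)%E = shift_var E h); first by rewrite ltey_eq shift_var_fin.
  by apply: eq_integral => x _ /=; rewrite normr_id.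
have gi h' : L.-integrable setT (EFin \o ((fun x => \1_E ((x : rV) - h') * g x) : T -> R)).
  apply: (le_integrable _ _ _ (test_fun_integrable gG measurableT)) => //.
    by apply/measurable_EFinP; apply: measurable_funM => //; exact: measurable_shift_indic.
  move=> x _ /=; rewrite lee_fin normrM ler_piMl// indicE.
  by case: (_ \in _); rewrite ?normr1 ?normr0.
have -> : \int[L]_(x in E) g x = \int[L]_(x in E) g ((x : rV) + 0).
  by apply: eq_Rintegral => x _; rewrite addr0.
rewrite (shift_integralE h mE mg) (shift_integralE 0 mE mg) -RintegralB//.
rewrite /shift_var -/(Rintegral L setT (fun x => `|\1_E ((x : rV) - h) - \1_E x|)).
apply: le_Rintegral => //; first by apply: integrableBR => //; exact: gi.
move=> x _; rewrite subr0 -mulrBl; apply: le_trans (ler_norm _) _.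
by rewrite normrM ler_piMr.
Qed.

(** The function is p - q, with p and q close to the indicators of h . nu > 0 and h . nu < 0: an
    approximate sign of h . nu. *)
Lemma sign_test_exists h e : 0 < e -> exists g G, [/\ test_fun g G, forall x, `|g x| <= 1 &
  \int[mu]_x `|dot h (nu x)| - e * enorm h <= \int[mu]_x (g x * dot h (nu x))].
Proof.
move=> e0; have [mnu nu1 muT _] := gg; have e2 : 0 < e / 2 by rewrite divr_gt0.
have md := measurable_nu_dot gg h.
pose P : set T := [set x | 0 < dot h (nu x)].
pose N : set T := [set x | dot h (nu x) < 0].
have mP : measurable P.
  rewrite (_ : P = (fun x => dot h (nu x)) @^-1` `]0, +oo[%classic); first exact: measurable_preimageT.
  by apply/seteqP; split => x; rewrite /P/= in_itv/= andbT.
have mN : measurable N.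
  rewrite (_ : N = (fun x => dot h (nu x)) @^-1` `]-oo, 0[%classic); first exact: measurable_preimageT.
  by apply/seteqP; split => x; rewrite /N/= in_itv/=.
have [p [[P' pP] p01 pe]] := test_close_exists measurableT muT mP e2.
have [q [[Q' qQ] q01 qe]] := test_close_exists measurableT muT mN e2.
have [C _ pC] := test_fun_bounded pP; have [C' _ qC] := test_fun_bounded qQ.
have mp : measurable_fun setT (p : T -> R) := has_gradient_measurable pP.1.
have mq : measurable_fun setT (q : T -> R) := has_gradient_measurable qQ.1.
have gG : test_fun (fun x => p x + -1 * q x) (fun x => P' x + -1 *: Q' x).
  exact: test_funD pP (test_funZ (-1) qQ).
have g1 x : `|p x + -1 * q x| <= 1.
  by rewrite mulN1r ler_norml; have := p01 x; have := q01 x => *; apply/andP; lra.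
eexists; eexists; split; [exact: gG|exact: g1|].
have i1 : mu.-integrable setT (EFin \o (fun x => `|\1_P x - p x|)).
  apply: (bounded_integrable (C := 1)) => //.
    by apply: measurableT_comp => //; apply: measurable_funB => //; exact: measurable_indic.
  move=> x; rewrite normr_id indicE; have := p01 x.
  by case: (_ \in _) => /=; rewrite ler_norml => *; apply/andP; lra.
have i2 : mu.-integrable setT (EFin \o (fun x => `|\1_N x - q x|)).
  apply: (bounded_integrable (C := 1)) => //.
    by apply: measurableT_comp => //; apply: measurable_funB => //; exact: measurable_indic.
  move=> x; rewrite normr_id indicE; have := q01 x.
  by case: (_ \in _) => /=; rewrite ler_norml => *; apply/andP; lra.
have i3 := normr_dot_integrable gg h.
have i4 : mu.-integrable setT (EFin \o (fun x => (p x + -1 * q x) * dot h (nu x))).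
  apply: (@nu_dot_integrable _ _ E mu nu gg h (fun x => p x + -1 * q x) 1) => //.
  exact: (has_gradient_measurable gG.1).
have i5 : mu.-integrable setT (EFin \o (fun x => `|\1_P x - p x| + `|\1_N x - q x|)).
  exact: integrableDR.
rewrite lerBlDl; apply: (@le_trans _ _ (\int[mu]_x (enorm h * (`|\1_P x - p x| + `|\1_N x - q x|) + (p x + -1 * q x) * dot h (nu x)))).
  apply: le_Rintegral => //.
    by apply: integrableDR => //; exact: integrableZR.
  move=> x _; have -> : `|dot h (nu x)| = (\1_P x - \1_N x) * dot h (nu x).
    rewrite !indicE; have [h0|h0|h0] := ltgtP (dot h (nu x)) 0.
    - rewrite [x \in N]mem_set// memNset ?sub0r ?mulN1r ?ltr0_norm//.
      by rewrite /P/=; apply/negP; rewrite -leNgt ltW.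
    - rewrite [x \in P]mem_set// memNset ?subr0 ?mul1r ?gtr0_norm//.
      by rewrite /N/=; apply/negP; rewrite -leNgt ltW.
    - by rewrite h0 normr0 mulr0.
  rewrite -lerBlDr -mulrBl; apply: le_trans (ler_norm _) _.
  rewrite normrM mulrC ler_pM ?(nu_dot_le gg)//.
  rewrite (_ : _ - _ = (\1_P x - p x) - (\1_N x - q x)); first exact: ler_normB.
  by ring.
rewrite RintegralD//; last exact: integrableZR.
rewrite RintegralZl// RintegralD// lerD2r mulrC ler_wpM2r ?enorm_ge0//.
by move: pe qe; lra.
Qed.

(** The upper bound [shift_var_le] holds for every r. For the lower one, a test function g close to
    the sign of h . nu gives a difference quotient whose limit is the integral of g h . nu, within
    e/2 of the claimed limit. *)
Lemma shift_var_cvg h :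
  r^-1 * fine (shift_var E (r *: h)) @[r --> 0^'+] --> \int[mu]_x `|dot h (nu x)|.
Proof.
apply/cvgrPdist_le => e e0.
have k0 : 0 < enorm h + 1 by rewrite ltr_wpDl ?enorm_ge0.
have e1 : 0 < e / 2 / (enorm h + 1) by rewrite !divr_gt0.
have [g [G [gG g1 gw]]] := sign_test_exists h e1.
have [_ _ _ hgg] := gg.
pose psi (s : R) := \int[L]_(x in E) g ((x : rV) + s *: h).
have d0 : is_derive (0 : R) 1 psi (\int[mu]_x (g x * dot h (nu x))).
  rewrite -(hgg _ _ _ gG).
  have -> : \int[L]_(x in E) dot (G x) h = \int[L]_(x in E) dot (G ((x : rV) + (0 : R) *: h)) h.
    by apply: eq_Rintegral => x _; rewrite scale0r addr0.
  exact: is_derive_shift_integral.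
set d := \int[mu]_x (g x * dot h (nu x)) in gw d0.
have e2 : 0 < e / 2 by rewrite divr_gt0.
have c : r^-1 *: (psi (r *: 1 + 0) - psi 0) @[r --> 0^'] --> d.
  by have [dd <-] := d0; exact: dd.
move/cvgrPdist_le : c => /(_ _ e2).
rewrite /dnbhs near_withinE => c; rewrite /at_right near_withinE; apply: filterS c => r c r0.
have {c} := c (lt0r_neq0 r0); rewrite addr0 [_ *: 1]mulr1 => c.
have lb : r^-1 * (psi r - psi 0) <= r^-1 * fine (shift_var E (r *: h)).
  have ri : 0 <= r^-1 by rewrite invr_ge0 ltW.
  rewrite ler_wpM2l//; have := shift_var_ge (r *: h) gG g1.
  have -> : \int[L]_(x in E) g x = psi 0; last by [].
  by apply: eq_Rintegral => x _; rewrite scale0r addr0.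
have ub : r^-1 * fine (shift_var E (r *: h)) <= \int[mu]_x `|dot h (nu x)|.
  rewrite ler_pdivrMl//; have := shift_var_le (r *: h).
  rewrite -[X in (X <= _)%E](fineK (shift_var_fin _)) lee_fin => /le_trans; apply.
  rewrite -(RintegralZl r measurableT (normr_dot_integrable gg h)).
  apply: le_of_eq; apply: eq_Rintegral => x _.
  by rewrite dotZl normrM (gtr0_norm r0).
have eh : e / 2 / (enorm h + 1) * enorm h <= e / 2.
  rewrite mulrAC ler_pdivrMr// ler_wpM2l//; last by rewrite lerDl.
  exact: ltW.
rewrite ger0_norm ?subr_ge0//; move: c; rewrite ler_norml => /andP[c1 c2].
by move: lb; rewrite -[r^-1 * (_ - _)]/(r^-1 *: _); lra.
Unshelve. all: by end_near. Qed.

End limit2.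
End total_variation.

Lemma ler_sqr0 (R : realDomainType) (a b : R) : 0 <= a -> 0 <= b ->
  (a ^+ 2 <= b ^+ 2) = (a <= b).
Proof. by move=> a0 b0; rewrite ler_sqr. Qed.

Lemma ltr_sqr0 (R : realDomainType) (a b : R) : 0 <= a -> 0 <= b ->
  (a ^+ 2 < b ^+ 2) = (a < b).
Proof. by move=> a0 b0; rewrite ltr_sqr. Qed.

(** * Flatness and density estimates *)

Section radial_cutoff.
Context {R : realType} {n : nat}.
Local Notation rV := 'rV[R]_n.
Local Notation T := (borel_rV R n).
Variables (r s : R).
Hypotheses (r0 : 0 < r) (rs : r < s).

Ltac rslra := have := r0; have := rs; lra.

(** A function of |x|^2, which is differentiable at the origin too. The form x - 0 is that of
    [has_gradient_sqdist] centred at 0. *)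
Definition radial_cutoff (x : rV) : R :=
  smooth_step ((s ^+ 2 - r ^+ 2)^-1 * (s ^+ 2 - dot (x - 0) (x - 0))).

Definition radial_grad (x : rV) : rV :=
  dsmooth_step ((s ^+ 2 - r ^+ 2)^-1 * (s ^+ 2 - dot (x - 0) (x - 0))) *:
  ((s ^+ 2 - r ^+ 2)^-1 *: (0 - 2 *: (x - 0))).

Let sr : 0 < s ^+ 2 - r ^+ 2. Proof. by rewrite subr_gt0 ltr_sqr0//; rslra. Qed.

Lemma radial_cutoff_out x : s <= enorm x -> radial_cutoff x = 0.
Proof.
move=> sx; rewrite /radial_cutoff smooth_step_le0// pmulr_rle0 ?invr_gt0//.
by rewrite subr0 -sqr_enorm subr_le0 ler_sqr0 ?enorm_ge0//; rslra.
Qed.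

Lemma radial_cutoff_in x : enorm x <= r -> radial_cutoff x = 1.
Proof.
move=> xr; rewrite /radial_cutoff; apply: smooth_step_ge1.
rewrite ler_pdivlMl ?sr// mulr1 subr0 -sqr_enorm lerD2l lerN2 ler_sqr0 ?enorm_ge0//.
rslra.
Qed.

Lemma radial_cutoff_itv x : 0 <= radial_cutoff x <= 1.
Proof. exact: smooth_step_itv. Qed.

Lemma radial_test_fun : test_fun radial_cutoff radial_grad.
Proof.
split; last by exists s; exact: radial_cutoff_out.
apply: (has_gradient_comp is_derive_smooth_step continuous_dsmooth_step).
apply: has_gradientZ; exact: has_gradientB (has_gradient_cst _) (has_gradient_sqdist 0).
Qed.

(** The derivative of the step is at most 4, and that of its argument has norm 2|x| / ((s - r)(s +
    r)) with |x| <= s + r on the support. *)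
Lemma radial_grad_le x : enorm (radial_grad x) <= 8 / (s - r) * \1_(eball 0 s) x.
Proof.
rewrite /radial_grad; set t := _ * _; have /andP[d0 d4] := dsmooth_step_itv t.
have [xs|xs] := pselect (eball 0 s x); last first.
  rewrite indicE memNset// mulr0 /dsmooth_step.
  have t0 : t <= 0.
    rewrite /t pmulr_rle0 ?invr_gt0// subr0 -sqr_enorm subr_le0 ler_sqr0 ?enorm_ge0//; last rslra.
    by rewrite leNgt; apply/negP => h; apply: xs; rewrite /eball/= subr0.
  by rewrite (max_r t0) mulr0 scale0r enorm0.
rewrite indicE mem_set// mulr1 !enormZ sub0r enormN enormZ subr0 (ger0_norm d0).
rewrite (gtr0_norm (_ : 0 < (s ^+ 2 - r ^+ 2)^-1)) ?invr_gt0// (ger0_norm (ler0n _ 2)).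
have x_s : enorm x <= s by move: xs; rewrite /eball/= subr0; exact: ltW.
have s_r : 0 < s - r by rslra.
have -> : s ^+ 2 - r ^+ 2 = (s - r) * (s + r) by ring.
set D := dsmooth_step t in d0 d4 *.
have -> : D * (((s - r) * (s + r))^-1 * (2 * enorm x)) = (s - r)^-1 * ((s + r)^-1 * (D * (2 * enorm x))).
  by rewrite invfM; ring.
rewrite [leRHS]mulrC ler_wpM2l ?invr_ge0//; first exact: ltW.
rewrite ler_pdivrMl; last rslra.
have := r0; have := enorm_ge0 x; nra.
Qed.

Lemma smooth_step_superlevel (c : R) : 0 <= c < 1 ->
  exists2 t : R, 0 <= t < 1 & forall u : R, (c < smooth_step u) = (t < u).
Proof.
(* The level t solves 1 - (1 - t^2)^2 = c, so that t^2 = 1 - q with q^2 = 1 - c. *)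
move=> /andP[c0 c1]; pose q := Num.sqrt (1 - c).
have q0 : 0 < q by rewrite sqrtr_gt0; rslra.
have q2 : q ^+ 2 = 1 - c by rewrite sqr_sqrtr//; rslra.
have q1 : q <= 1 by rewrite -ler_sqr0 ?expr1n ?q2//; [rslra|exact: ltW].
pose t := Num.sqrt (1 - q).
have t0 : 0 <= t by exact: sqrtr_ge0.
have t2 : t ^+ 2 = 1 - q by rewrite sqr_sqrtr//; rslra.
have t1 : t < 1 by rewrite -ltr_sqr0// expr1n t2; rslra.
exists t; first by rewrite t0 t1.
move=> u; apply/idP/idP => h.
  rewrite ltNge; apply/negP => ut; have [u0|u0] := leP u 0.
    by move: h; rewrite smooth_step_le0//; rslra.
  move: h; rewrite /smooth_step ltrBrDr -ltrBrDl => h.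
  have u2 : sqpos u = u ^+ 2 by rewrite /sqpos max_l// ltW.
  have uq : q <= 1 - sqpos u by rewrite u2; nra.
  have : q ^+ 2 <= sqpos (1 - sqpos u).
    by rewrite [leRHS]/sqpos max_l; [rewrite ler_sqr0//|]; rslra.
  by rewrite q2; rslra.
have u0 : 0 < u by rslra.
have u2 : sqpos u = u ^+ 2 by rewrite /sqpos max_l// ltW.
rewrite /smooth_step; have : sqpos (1 - sqpos u) < q ^+ 2; last by rewrite q2; rslra.
rewrite {1}/sqpos; case: (leP (1 - sqpos u) 0) => h1; first by rewrite expr0n exprn_gt0.
by rewrite ltr_sqr0; [rewrite u2; nra|rslra|rslra].
Qed.

Lemma radial_superlevel (c : R) : 0 <= c < 1 -> exists2 rho : R, 0 < rho <= s &
  [set x | c < radial_cutoff x] = eball 0 rho.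
Proof.
move=> /smooth_step_superlevel[t /andP[t0 t1] ht].
have p0 : 0 < s ^+ 2 - t * (s ^+ 2 - r ^+ 2).
  have := sr; set a := s ^+ 2 - r ^+ 2 => a0; have -> : s ^+ 2 = a + r ^+ 2 by rewrite /a; ring.
  nra.
exists (Num.sqrt (s ^+ 2 - t * (s ^+ 2 - r ^+ 2))).
  rewrite sqrtr_gt0 p0/= -ler_sqr0 ?sqrtr_ge0//; last rslra.
  rewrite sqr_sqrtr; last exact: ltW.
  by rewrite gerBl mulr_ge0//; exact: ltW.
apply/seteqP; split => x /=; rewrite /radial_cutoff ht /eball/= subr0 -sqr_enorm ltr_pdivlMl//.
  move=> h; rewrite -ltr_sqr0 ?enorm_ge0 ?sqrtr_ge0// [ltRHS]sqr_sqrtr; last exact: ltW.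
  by rewrite ltrBrDr addrC -ltrBrDr mulrC.
rewrite -ltr_sqr0 ?enorm_ge0 ?sqrtr_ge0// [ltRHS]sqr_sqrtr; last exact: ltW.
by rewrite ltrBrDr addrC -ltrBrDr mulrC.
Qed.

(** The sum is the ceiling of z. *)
Lemma count_lt_bounds (N : nat) (z : R) : 0 <= z <= N%:R ->
  z <= \sum_(k < N) (k%:R < z :> R)%:R <= z + 1.
Proof.
elim: N => [|N IH] /andP[z0 zN].
  by rewrite big_ord0; apply/andP; lra.
rewrite big_ord_recr/=; have [zN'|zN'] := leP z N%:R.
  by rewrite addr0; apply: IH; rewrite z0.
rewrite (eq_bigr (fun=> 1)) ?sumr_const ?card_ord; last first.
  by move=> k _; rewrite (lt_trans _ zN')// ltr_nat.
by rewrite natr1; apply/andP; split => //; rewrite -natr1 lerD2r ltW.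
Qed.

Section flat.
Context (E : set T) (mu : {measure set T -> \bar R}) (nu : rV -> rV).
Hypotheses (mE : measurable E) (gg : scalar_gauss_green E mu nu).
Context (v : rV) (eps : R).
Hypotheses (v1 : enorm v = 1) (eps0 : 0 <= eps).
Hypothesis flat : forall rho, 0 < rho <= s ->
  \int[mu]_(x in eball 0 rho) (1 - dot v (nu x)) <= eps * fine (mu (eball 0 rho)).

Let def_itv x : 0 <= 1 - dot v (nu x) <= 2.
Proof. by have := nu_dot_le gg v x; rewrite v1 ler_norml; lra. Qed.

Let mdef : measurable_fun [set: T] ((fun x => 1 - dot v (nu x)) : T -> R).
Proof. by apply: measurable_funB; [exact: measurable_cst|exact: (measurable_nu_dot gg)]. Qed.

Let muT : (mu setT < +oo)%E. Proof. by case: gg. Qed.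

Let bi (f : T -> R) (C : R) : measurable_fun setT f -> (forall x, `|f x| <= C) ->
  mu.-integrable setT (EFin \o f).
Proof. by move=> mf fC; exact: (bounded_integrable measurableT muT mf fC). Qed.

Let zi : mu.-integrable setT (EFin \o (radial_cutoff : T -> R)).
Proof.
apply: (@bi _ 1); first exact: (has_gradient_measurable radial_test_fun.1).
by move=> x; have /andP[? ?] := radial_cutoff_itv x; rewrite ger0_norm.
Qed.

Let step N (x : T) : R := N.+1%:R^-1 * \sum_(k < N.+1) \1_[set x | k%:R / N.+1%:R < radial_cutoff x] x.

Let mlev c : measurable ([set x | c < radial_cutoff x] : set T).
Proof.
rewrite (_ : [set x | _] = (radial_cutoff : T -> R) @^-1` `]c, +oo[%classic).
  by apply: measurable_preimageT => //; exact: (has_gradient_measurable radial_test_fun.1).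
by apply/seteqP; split => x /=; rewrite in_itv/= andbT.
Qed.

Let mstep N : measurable_fun setT (step N).
Proof.
apply: measurable_funM; first exact: measurable_cst.
by apply: measurable_sum => k; apply: measurable_indic.
Qed.

Let step_itv N x : radial_cutoff x <= step N x <= radial_cutoff x + N.+1%:R^-1.
Proof.
have /andP[z0 z1] := radial_cutoff_itv x.
have zN : 0 <= N.+1%:R * radial_cutoff x <= N.+1%:R by rewrite mulr_ge0//= ler_piMr.
have /andP[h1 h2] := count_lt_bounds zN.
have e : \sum_(k < N.+1) \1_[set x | k%:R / N.+1%:R < radial_cutoff x] x =
    \sum_(k < N.+1) (k%:R < N.+1%:R * radial_cutoff x :> R)%:R :> R.
  apply: eq_bigr => k _; rewrite indicE; congr (_%:R); congr nat_of_bool.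
  apply/idP/idP; first by move=> /set_mem/=; rewrite ltr_pdivrMr// mulrC.
  by move=> h; apply/mem_set => /=; rewrite ltr_pdivrMr// mulrC.
have NN : N.+1%:R * (radial_cutoff x + N.+1%:R^-1) = N.+1%:R * radial_cutoff x + 1.
  by rewrite mulrDr mulfV.
rewrite /step e; apply/andP; split; first by rewrite ler_pdivlMl.
by rewrite ler_pdivrMl//; apply: le_trans h2 _; rewrite NN.
Qed.

(** Flatness is assumed on balls only. A discrete layer-cake formula passes to the cutoff: within
    1/(N + 1) it is the mean of the indicators of its superlevel sets, which are balls of radius at
    most s. *)
Lemma radial_flat :
  \int[mu]_x (radial_cutoff x * (1 - dot v (nu x))) <= eps * \int[mu]_x radial_cutoff x.
Proof.
have step2 N x : `|step N x| <= 2.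
  have /andP[h1 h2] := step_itv N x; have /andP[z0 z1] := radial_cutoff_itv x.
  rewrite ger0_norm; last exact: le_trans h1.
  apply: le_trans h2 _; rewrite -[2]/(1 + 1) lerD// invf_le1//.
  by rewrite ler1n.
have si N : mu.-integrable setT (EFin \o step N) by exact: (@bi _ 2).
have lev_int (f : T -> R) N : measurable_fun setT f -> (forall x, `|f x| <= 2) ->
    \int[mu]_x (step N x * f x) = N.+1%:R^-1 * \sum_(k < N.+1) \int[mu]_(x in [set x | k%:R / N.+1%:R < radial_cutoff x]) f x.
  move=> mf f2.
  have ti (k : 'I_N.+1) : mu.-integrable setT (EFin \o (fun x => \1_[set x | k%:R / N.+1%:R < radial_cutoff x] x * f x)).
    apply: (@bi _ 2); first by apply: measurable_funM => //; exact: measurable_indic.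
    move=> x; rewrite normrM; apply: le_trans (f2 x); rewrite ler_piMl// indicE.
    by case: (_ \in _); rewrite ?normr1 ?normr0.
  have -> : \int[mu]_x (step N x * f x) = \int[mu]_x (N.+1%:R^-1 *
      \sum_(k < N.+1) (\1_[set x | k%:R / N.+1%:R < radial_cutoff x] x * f x)).
    by apply: eq_Rintegral => x _; rewrite /step -mulrA mulr_suml.
  rewrite (RintegralZl _ measurableT (integrable_sumR _ measurableT ti)).
  congr (_ * _); rewrite (Rintegral_sum _ measurableT ti).
  by apply: eq_bigr => k _; rewrite [RHS]Rintegral_indic.
have lev_flat N (k : 'I_N.+1) :
    \int[mu]_(x in [set x | k%:R / N.+1%:R < radial_cutoff x]) (1 - dot v (nu x)) <=
    eps * \int[mu]_(x in [set x | k%:R / N.+1%:R < radial_cutoff x]) 1.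
  have k01 : 0 <= (k%:R / N.+1%:R : R) < 1.
    by rewrite divr_ge0//= ltr_pdivrMr// mul1r ltr_nat.
  have [rho rhos ->] := radial_superlevel k01.
  rewrite (@Rintegral_cst _ _ _ mu _ (measurable_eball _ _)) mul1r; exact: flat.
have key N : \int[mu]_x (radial_cutoff x * (1 - dot v (nu x))) <=
    eps * (\int[mu]_x radial_cutoff x + N.+1%:R^-1 * fine (mu setT)).
  have d2 x : `|1 - dot v (nu x)| <= 2 by have /andP[? ?] := def_itv x; rewrite ger0_norm.
  have m1 : measurable_fun setT (cst 1 : T -> R) by exact: measurable_cst.
  have i1 : mu.-integrable setT (EFin \o (fun x => radial_cutoff x * (1 - dot v (nu x)))).
    apply: (@bi _ 2); first by apply: measurable_funM => //; exact: (has_gradient_measurable radial_test_fun.1).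
    move=> x; rewrite normrM; apply: le_trans (d2 x); rewrite ler_piMl//.
    by have /andP[? ?] := radial_cutoff_itv x; rewrite ger0_norm.
  have i2 : mu.-integrable setT (EFin \o (fun x => step N x * (1 - dot v (nu x)))).
    apply: (@bi _ 4); first exact: measurable_funM.
    by move=> x; rewrite normrM -[4]/((2 + 2)%:R) (_ : (2 + 2)%:R = 2 * 2) ?ler_pM//; ring.
  apply: (@le_trans _ _ (\int[mu]_x (step N x * (1 - dot v (nu x))))).
    apply: le_Rintegral => // x _; have /andP[? _] := step_itv N x.
    by rewrite ler_wpM2r//; have /andP[] := def_itv x.
  rewrite (lev_int _ _ mdef d2).
  apply: (@le_trans _ _ (eps * \int[mu]_x (step N x * 1))).
    rewrite (lev_int _ _ m1) => [|x]; last by rewrite normr1 ler1n.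
    rewrite mulrCA ler_wpM2l ?invr_ge0// mulr_sumr; apply: ler_sum => k _; exact: lev_flat.
  rewrite ler_wpM2l//; apply: (@le_trans _ _ (\int[mu]_x (radial_cutoff x + N.+1%:R^-1))).
    apply: le_Rintegral => //.
    - by under eq_fun do rewrite mulr1.
    - by apply: integrableDR => //; apply: (@bi _ `|N.+1%:R^-1|).
    by move=> x _; rewrite mulr1; have /andP[] := step_itv N x.
  rewrite RintegralD//; last by apply: (@bi _ `|N.+1%:R^-1|).
  by rewrite (@Rintegral_cst _ _ _ mu _ measurableT).
apply/ler_addgt0Pr => e e0; set M := fine (mu setT).
have M0 : 0 <= M by rewrite fine_ge0.
pose N := Num.bound (M * eps / e).
apply: le_trans (key N) _; rewrite mulrDr lerD2l mulrCA -/M ler_pdivrMl//.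
rewrite mulrC -ler_pdivrMr//; apply: ltW.
apply: lt_le_trans (archi_boundP _) _; first by rewrite divr_ge0 ?mulr_ge0// ltW.
by rewrite ler_nat.
Qed.

(* Testing the Gauss-Green formula with the cutoff times v. *)
Lemma perimeter_upper_density : eps <= 2^-1 ->
  fine (mu (eball 0 r)) <= 16 / (s - r) * fine (borel_lebesgue R n (E `&` eball 0 s)).
Proof.
move=> e2; set L := borel_lebesgue R n.
have zdi : mu.-integrable setT (EFin \o (fun x => radial_cutoff x * (1 - dot v (nu x)))).
  apply: (@bi _ 2); first by apply: measurable_funM => //; exact: (has_gradient_measurable radial_test_fun.1).
  move=> x; have /andP[d0 d2] := def_itv x; rewrite normrM (ger0_norm d0); apply: le_trans d2.
  by rewrite ler_piMl//; have /andP[? ?] := radial_cutoff_itv x; rewrite ger0_norm.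
have h1 : fine (mu (eball 0 r)) <= \int[mu]_x radial_cutoff x.
  rewrite -[leLHS]mul1r -(@Rintegral_cst _ _ _ mu _ (measurable_eball 0 r)) Rintegral_indic.
  apply: le_Rintegral => //.
    apply: (@bi _ 1).
      by apply: measurable_funM => //; apply: measurable_indic; exact: measurable_eball.
    by move=> x; rewrite mulr1 indicE; case: (_ \in _); rewrite ?normr1 ?normr0.
  move=> x _; have /andP[? ?] := radial_cutoff_itv x; rewrite mulr1 indicE.
  have [xr|xr] := pselect (eball 0 r x); last by rewrite memNset.
  by rewrite mem_set// radial_cutoff_in//; move: xr; rewrite /eball/= subr0 => /ltW.
have [_ _ _ hgg] := gg.
have h2 : \int[mu]_x (radial_cutoff x * dot v (nu x)) <= 8 / (s - r) * fine (L (E `&` eball 0 s)).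
  rewrite -(hgg _ _ v radial_test_fun) -(@Rintegral_cst _ _ _ L (E `&` eball 0 s)); last first.
    by apply: measurableI => //; exact: measurable_eball.
  rewrite (Rintegral_indic (E `&` eball 0 s)) (Rintegral_indic E).
  have sr' : 0 <= 8 / (s - r) by rewrite divr_ge0//; rslra.
  have mEs : measurable (E `&` eball 0 s : set T) by apply: measurableI => //; exact: measurable_eball.
  apply: le_Rintegral => //.
  - by apply: integrable_indicM => //; exact: (test_grad_integrable v radial_test_fun).
  - apply: (@support_integrable _ T R L (eball 0 s) _ (8 / (s - r))) => //.
    + exact: measurable_eball.
    + exact: lebesgue_eball_lty.
    + by apply: measurable_funM => //; exact: measurable_indic.
    + by move=> x xs; rewrite indicE memNset ?mul0r// => -[].
    + move=> x; rewrite normrM (ger0_norm sr') ler_piMl// indicE.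
      by case: (_ \in _); rewrite ?normr1 ?normr0.
  move=> x _; rewrite !indicE in_setI; case: (x \in E); last by rewrite !mul0r.
  rewrite mul1r/=; apply: le_trans (cauchy_schwarz _ _) _.
  by rewrite v1 mulr1 mulrC; apply: le_trans (radial_grad_le x) _; rewrite indicE.
have h3 : \int[mu]_x radial_cutoff x = \int[mu]_x (radial_cutoff x * (1 - dot v (nu x))) + \int[mu]_x (radial_cutoff x * dot v (nu x)).
  rewrite -RintegralD//.
    by apply: eq_Rintegral => x _; rewrite mulrBr mulr1 subrK.
  apply: (@nu_dot_integrable _ _ E mu nu gg v radial_cutoff 1) => //.
    exact: (has_gradient_measurable radial_test_fun.1).
  by move=> x; have /andP[? ?] := radial_cutoff_itv x; rewrite ger0_norm.
(* As eps <= 1/2, the excess term is absorbed by half of the integral of the cutoff; this doubles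
   the constant 8 to 16. *)
have h4 := radial_flat.
have z0 : 0 <= \int[mu]_x radial_cutoff x.
  by apply: Rintegral_ge0 => x _; have /andP[] := radial_cutoff_itv x.
have h5 : eps * \int[mu]_x radial_cutoff x <= 2^-1 * \int[mu]_x radial_cutoff x.
  exact: ler_wpM2r.
rewrite (_ : 16 / (s - r) = 2 * (8 / (s - r))); last by rewrite mulrA; congr (_ / _); ring.
by rewrite -mulrA; move: h1 h2 h3 h4 h5 z0; set a := \int[mu]_x radial_cutoff x; lra.
Qed.

End flat.
End radial_cutoff.

Lemma le_measureS {d} {T : measurableType d} {R : realType}
  (mu : {measure set T -> \bar R}) (A B : set T) : measurable A -> measurable B ->
  A `<=` B -> (mu A <= mu B)%E.
Proof. by move=> mA mB AB; apply: le_measure => //; rewrite inE. Qed.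

Lemma measure_indicE {d} {T : measurableType d} {R : realType}
  (mu : {measure set T -> \bar R}) (A : set T) : measurable A ->
  mu A = (\int[mu]_x (\1_A x)%:E)%E.
Proof. by move=> mA; rewrite integral_indic// setIT. Qed.

Lemma measure_indicI {d} {T : measurableType d} {R : realType}
  (mu : {measure set T -> \bar R}) (A B : set T) : measurable (A `&` B) ->
  mu (A `&` B) = (\int[mu]_x ((\1_A x)%:E * (\1_B x)%:E))%E.
Proof. by move=> mA; rewrite measure_indicE//; apply: eq_integral => x _; rewrite indicI EFinM. Qed.

Lemma fubini_indic_bound {d1 d2} {T1 : measurableType d1} {T2 : measurableType d2} {R : realType}
  (m1 : {sigma_finite_measure set T1 -> \bar R}) (m2 : {sigma_finite_measure set T2 -> \bar R})
  (f : T1 * T2 -> \bar R) (H : set T1) (A : set T2) (c M : R) :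
  measurable_fun setT f -> (forall p, (0 <= f p)%E) -> measurable H -> measurable A ->
  0 <= c -> 0 <= M -> (forall h, (\int[m2]_x f (h, x) <= (\1_H h)%:E * M%:E)%E) ->
  (forall x, ((\1_A x)%:E * c%:E <= \int[m1]_h f (h, x))%E) ->
  (m2 A * c%:E <= m1 H * M%:E)%E.
Proof.
move=> mf f0 mH mA c0 M0 fH fA.
have mi d (T : measurableType d) (B : set T) : measurable B -> measurable_fun setT (fun x => (\1_B x)%:E : \bar R).
  by move=> mB; apply/measurable_EFinP; exact: measurable_indic.
have Ic d (T : measurableType d) (m : {measure set T -> \bar R}) (B : set T) (k : R) :
    measurable B -> 0 <= k -> (\int[m]_x ((\1_B x)%:E * k%:E) = m B * k%:E)%E.
  move=> mB k0; rewrite ge0_integralZr//; first by rewrite -measure_indicE.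
  exact: mi.
rewrite -!Ic//; apply: (@le_trans _ _ (\int[m2]_x \int[m1]_h f (h, x))%E).
  apply: ge0_le_integral => //.
  all: do ?[by move=> x _; apply: integral_ge0|by move=> x _; rewrite mule_ge0// lee_fin].
    by apply: emeasurable_funM => //; exact: mi.
  exact: (measurable_fun_fubini_tonelli_G (m1 := m1) f).
rewrite -fubini_tonelli//; apply: ge0_le_integral => //.
all: do ?[by move=> x _; apply: integral_ge0|by move=> x _; rewrite mule_ge0// lee_fin].
  exact: (measurable_fun_fubini_tonelli_F (m2 := m2) f).
by apply: emeasurable_funM => //; exact: mi.
Qed.

Section density_estimates.
Context {R : realType} {n : nat}.
Local Notation rV := 'rV[R]_n.
Local Notation L := (borel_lebesgue R n).
Local Notation T := (borel_rV R n).

Definition flat_normal (mu : {measure set T -> \bar R}) (nu : rV -> rV)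
    (v : rV) (eps K : R) :=
  forall rho, 0 < rho <= K ->
    \int[mu]_(x in eball 0 rho) (1 - dot v (nu x)) <= eps * fine (mu (eball 0 rho)).

Lemma lebesgue_fin_sub (A : set T) r : measurable A -> A `<=` eball 0 r -> L A \is a fin_num.
Proof.
move=> mA Ar; rewrite ge0_fin_numE//; apply: le_lt_trans (lebesgue_eball_lty 0 r).
by apply: le_measure => //; rewrite inE//; exact: measurable_eball.
Qed.

Lemma le_fine_lebesgue (A B : set T) r : measurable A -> measurable B -> A `<=` B ->
  B `<=` eball 0 r -> fine (L A) <= fine (L B).
Proof.
move=> mA mB AB Br; apply: fine_le.
- by apply: (@lebesgue_fin_sub _ r) => //; exact: subset_trans Br.
- exact: (@lebesgue_fin_sub _ r).
- by apply: le_measure => //; rewrite inE.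
Qed.

Lemma lebesgue_reflect (x : rV) (A : set T) : measurable A ->
  L [set h : rV | A (x - h)] = L A.
Proof.
move=> mA; have pres : preserves L (fun h => x - (h : rV)).
  rewrite (_ : (fun h => _) = (fun y => (y : rV) + x) \o (fun h => - (h : rV))).
    by apply: preserves_comp; [exact: borel_lebesgue_shift|exact: borel_lebesgue_opp].
  by apply/funext => h /=; rewrite addrC.
by case: pres => _ /(_ _ mA).
Qed.

Section one_set.
Context (E : set T) (mu : {measure set T -> \bar R}) (nu : rV -> rV).
Hypotheses (mE : measurable E) (gg : scalar_gauss_green E mu nu).

Let m r := fine (L (E `&` eball 0 r)).

Let mEr r : measurable (E `&` eball 0 r : set T).
Proof. by apply: measurableI => //; exact: measurable_eball. Qed.

Let m_homo r s : r <= s -> m r <= m s.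
Proof.
move=> rs; apply: (@le_fine_lebesgue _ _ s) => //.
by move=> x [Ex]; rewrite /eball/= => xr; split => //; exact: lt_le_trans xr rs.
Qed.

Let measurable_sub2 : measurable_fun [set: T * T] (fun p => (p.2 : rV) - (p.1 : rV) : T).
Proof. by measurable_rV. Qed.

(* Tonelli over the pairs (h, x) with h in H, x in A and x - h off E. *)
Lemma translate_pair_bound (A H : set T) r s (c M : R) : 0 <= c -> 0 <= M ->
  measurable A -> measurable H -> A `<=` E `&` eball 0 r -> (L H < +oo)%E ->
  (forall h, H h -> enorm h <= s - r) ->
  (forall h, H h -> \int[mu]_(x in eball 0 s) Num.max (dot h (- nu x)) 0 <= M) ->
  (forall x, A x -> (c%:E <= L (H `&` ([set h : rV | ~ E ((x : rV) - h)%R] : set T)))%E) ->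
  fine (L A) * c <= fine (L H) * M.
Proof.
move=> c0 M0 mA mH AE LH Hs HM Ac; pose V : set T := eball 0 s.
have LA : L A \is a fin_num by apply: (@lebesgue_fin_sub _ r) => // x /AE[].
have LHf : L H \is a fin_num by rewrite ge0_fin_numE.
pose f (p : T * T) : \bar R := ((\1_H p.1)%:E * ((\1_A p.2)%:E * (\1_(~` E) ((p.2 : rV) - (p.1 : rV)))%:E))%E.
have f0 p : (0 <= f p)%E by rewrite /f !mule_ge0// lee_fin.
have mf : measurable_fun setT f.
  apply: emeasurable_funM; first exact: measurable_indic_comp.
  apply: emeasurable_funM; first exact: measurable_indic_comp.
  by apply: measurable_indic_comp => //; exact: measurableC.
have inner1 h : (\int[L]_x f (h, x) <= (\1_H h)%:E * M%:E)%E.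
  have [Hh|Hh] := pselect (H h); last first.
    rewrite integral0_eq; first by rewrite mule_ge0// lee_fin.
    have h0 : \1_H h = 0 :> R by rewrite indicE memNset.
    by move=> x _; rewrite /f [(h, x).1]/= h0 mul0e.
  have h1 : \1_H h = 1 :> R by rewrite indicE mem_set.
  rewrite h1 mul1e.
  have mS : measurable (A `&` [set x | ~ E ((x : rV) - h)] : set T).
    apply: measurableI; first exact: mA.
    by have := measurable_preimageT (measurable_shift (- h)) (measurableC mE).
  have -> : (\int[L]_x f (h, x) = L (A `&` [set x | ~ E ((x : rV) - h)%R]))%E.
    rewrite (measure_indicI _ mS); apply: eq_integral => x _.
    by rewrite /f [(h, x).1]/= [(h, x).2]/= h1 mul1e.
  have UV y t : 0 <= t <= 1 -> eball 0 r ((y : rV) + t *: h) -> V y.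
    move=> /andP[t0 t1]; rewrite /V /eball/= !subr0 => ysr.
    have := ler_enormD ((y : rV) + t *: h) (- (t *: h)); rewrite addrK enormN enormZ (ger0_norm t0).
    have : t * enorm h <= s - r by apply: le_trans (Hs _ Hh); rewrite ler_piMl ?enorm_ge0.
    by lra.
  have oU : open (eball (0 : rV) r) by exact: open_eball.
  (* A point x of [A] with x - h off [E] belongs to the difference set of the complement of [E],
     whose normal is - nu. *)
  have := shift_diff_le (measurableC mE) (scalar_gauss_greenC mE gg) oU (lebesgue_eball_lty 0 r) (measurable_eball 0 s) UV.
  move=> hh; apply: (le_trans _ (le_trans hh _)); last by rewrite lee_fin; exact: HM.
  apply: le_measureS; first exact: mS.
    by apply: measurableI; [exact: measurable_eball|apply: measurable_shift_diff; exact: measurableC].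
  by move=> x [/AE[Ex xr] nE]; split => //; split => //; exact.
have inner2 x : ((\1_A x)%:E * c%:E <= \int[L]_h f (h, x))%E.
  have [Ax|Ax] := pselect (A x); last first.
    have x0 : \1_A x = 0 :> R by rewrite indicE memNset.
    by rewrite x0 mul0e; apply: integral_ge0.
  have x1 : \1_A x = 1 :> R by rewrite indicE mem_set.
  rewrite x1 mul1e.
  have mS : measurable (H `&` ([set h : rV | ~ E ((x : rV) - h)] : set T) : set T).
    apply: measurableI; first exact: mH.
    have ms : measurable_fun [set: T] (fun h : T => (x : rV) - (h : rV) : T).
      by measurable_rV.
    by have := measurable_preimageT ms (measurableC mE).
  apply: (le_trans (Ac x Ax)); rewrite (measure_indicI _ mS).
  apply: le_of_eq; apply: eq_integral => h _.
  by rewrite /f [(h, x).1]/= [(h, x).2]/= x1 mul1e.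
have : (L A * c%:E <= L H * M%:E)%E by exact: (fubini_indic_bound mf f0).
by rewrite -(fineK LA) -(fineK LHf) -!EFinM lee_fin.
Qed.

Let max_dotN_integrable h D : measurable D ->
  mu.-integrable D (EFin \o (fun x => Num.max (dot h (- nu x)) 0)).
Proof.
move=> mD; have := max_dot_integrable (scalar_gauss_greenC mE gg) h.
exact: integrableS.
Qed.

(* Averaging over the translates by a cube Q of volume l^n: since E fills at most half
   of x - Q, most translations move x out of E. *)
Lemma cube_average r delta l : 0 < r -> 0 < l -> n%:R * l <= delta ->
  m (r + delta) <= l ^+ n / 2 -> m r <= 2 * (n%:R * l) * fine (mu (eball 0 (r + delta))).
Proof.
move=> r0 l0 nl hm; have d0 : 0 <= delta by apply: le_trans nl; rewrite mulr_ge0// ltW.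
pose Q := [set x : rV | forall i, 0 <= x 0 i < l].
have LQ : L Q = (l ^+ n)%:E by exact: borel_lebesgue_box (ltW l0).
have mQ : measurable (Q : set T) by exact: measurable_box.
have Ql h : Q h -> enorm h <= n%:R * l.
  move=> Qh; apply: le_trans (ler_enorm_norm h) _; rewrite ler_wpM2l//.
  rewrite /Num.norm/= mx_normrE; apply: bigmax_le; first exact: ltW.
  by case=> i j _ /=; rewrite ord1; have /andP[? ?] := Qh j; rewrite ger0_norm// ltW.
set V := eball 0 (r + delta); set A := E `&` eball 0 r.
have muV : mu V \is a fin_num.
  by rewrite ge0_fin_numE//; apply: (mu_fin gg); exact: measurable_eball.
have ln0 : 0 < l ^+ n by exact: exprn_gt0.
have Lm : (L (E `&` eball 0 (r + delta)))%E = (m (r + delta))%:E.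
  by rewrite /m fineK//; apply: (@lebesgue_fin_sub _ (r + delta)) => // x [].
have key := @translate_pair_bound A Q r (r + delta) (l ^+ n / 2) (n%:R * l * fine (mu V)).
have {key} : fine (L A) * (l ^+ n / 2) <= fine (L Q) * (n%:R * l * fine (mu V)).
  apply: key => //.
  - by rewrite divr_ge0// ltW.
  - by rewrite !mulr_ge0// ?ltW// fine_ge0.
  - exact: mEr.
  - by rewrite LQ ltry.
  - by move=> h /Ql hl; rewrite addrAC subrr add0r; exact: le_trans nl.
  - move=> h Qh; rewrite -(@Rintegral_cst _ _ _ mu V (measurable_eball _ _) (n%:R * l)).
    apply: le_Rintegral => //; first exact: measurable_eball.
    - by apply: max_dotN_integrable; exact: measurable_eball.
    - by apply: (bounded_integrable (C := (n%:R * l))) => //; [exact: measurable_eball|rewrite -ge0_fin_numE|move=> x; rewrite ger0_norm// mulr_ge0// ltW].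
    move=> x _; rewrite ge_max; apply/andP; split; last by rewrite mulr_ge0// ltW.
    apply: le_trans (Ql _ Qh).
    by apply: le_trans (ler_norm _) _; apply: (nu_dot_le (scalar_gauss_greenC mE gg)).
  - move=> x [Ex xr]; set S := [set h | _].
    pose S' := [set h : rV | (E `&` eball 0 (r + delta)) ((x : rV) - h)].
    have ms : measurable_fun [set: T] (fun h : T => (x : rV) - (h : rV) : T).
      by measurable_rV.
    have mS : measurable (S : set T) by have := measurable_preimageT ms (measurableC mE).
    have mS' : measurable (S' : set T) by have := measurable_preimageT ms (mEr (r + delta)).
    have QS : Q `<=` (Q `&` S) `|` S'.
      move=> h Qh; have [Eh|Eh] := pselect (E ((x : rV) - h)); last by left.
      right; split => //; rewrite /eball/= subr0; move: xr; rewrite /eball/= subr0 => xr.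
      by apply: le_lt_trans (ler_enormD _ _) _; rewrite enormN; have := Ql _ Qh; lra.
    have : (L Q <= L (Q `&` S) + L S')%E.
      have mQS := measurableI _ _ mQ mS.
      apply: le_trans (_ : (L ((Q `&` S) `|` S') <= _)%E); last exact: measureU2.
      by apply: le_measure; rewrite ?inE//; exact: measurableU.
    rewrite LQ lebesgue_reflect// Lm => hQ.
    have : ((l ^+ n)%:E - (m (r + delta))%:E <= L (Q `&` S))%E by rewrite leeBlDr.
    by apply: le_trans; rewrite -EFinB lee_fin; lra.
rewrite LQ /= -/(m r) => hk; rewrite -(ler_pM2r (_ : 0 < l ^+ n / 2)) ?divr_gt0//.
apply: le_trans hk _; apply: le_of_eq.
by field.
Qed.

Hypotheses (n0 : (0 < n)%N).

(** De Giorgi iteration. If the volume in the ball of radius rho were small, then [cube_average] and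
    [perimeter_upper_density] would propagate the smallness along radii R_k that decrease from rho
    to rho/2, with bounds tending to 0. Then E would have no volume in the ball of radius rho/2, and
    the upper density bound would make mu vanish on that of radius rho/4. *)
Lemma volume_lower_density v eps rho : 0 < rho -> enorm v = 1 -> 0 <= eps <= 2^-1 ->
  flat_normal mu nu v eps rho -> (forall s, 0 < s -> (0 < mu (eball (0 : rV) s))%E) ->
  ((256 * n%:R * 2 ^+ n)^-1 * rho) ^+ n / 2 < m rho.
Proof.
move=> rho0 v1 /andP[e0 e2] flat mupos; rewrite ltNge; apply/negP => small.
(* R_k - R_(k+1) = t_k/4 is shared equally between the cube translations and the cutoff. With cubes
   of edge a t_k one step costs the factor (2 n a t_k)(16 / (t_k/8)) = 256 n a, which must be 2^-n
   because (a t_k)^n is divided by 2^n at each step. *)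
set a : R := (256 * n%:R * 2 ^+ n)^-1 in small.
have n0R : 0 < n%:R :> R by rewrite ltr0n.
have p256 : 0 < 256 * n%:R :> R by have := n0R; lra.
have a0 : 0 < a by rewrite invr_gt0; exact: mulr_gt0.
have aE : 256 * n%:R * a = 2^-1 ^+ n.
  by rewrite /a exprVn invfM mulrA mulfV ?mul1r ?(gt_eqF p256).
have p1 : (2^-1 : R) ^+ n <= 1 by rewrite exprn_ile1//; lra.
have pn : (0 : R) < 2^-1 ^+ n by rewrite exprn_gt0.
pose t k : R := rho * 2^-1 ^+ k; pose Rk k := rho / 2 + t k / 2.
have t0 k : 0 < t k by rewrite mulr_gt0// exprn_gt0.
have tS k : t k.+1 = t k / 2 by rewrite /t exprS; ring.
have trho k : t k <= rho by rewrite /t ger_pMr// exprn_ile1//; lra.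
have up r s : 0 < r -> r < s -> s <= rho -> fine (mu (eball 0 r)) <= 16 / (s - r) * m s.
  move=> r0 rs sr; apply: (perimeter_upper_density r0 rs mE gg v1 e0 _ e2).
  by move=> u /andP[u0 us]; apply: flat; rewrite u0 (le_trans us).
have step k : m (Rk k) <= (a * t k) ^+ n / 2 -> m (Rk k.+1) <= (a * t k.+1) ^+ n / 2.
  move=> hk; have tk0 := t0 k; have tk1 := trho k; have mR0 : 0 <= m (Rk k) by rewrite fine_ge0.
  have e1 : Rk k.+1 + t k / 8 <= Rk k by rewrite /Rk tS; lra.
  have R0 : 0 < Rk k.+1 by rewrite /Rk tS; lra.
  have nl : n%:R * (a * t k) <= t k / 8.
    by rewrite mulrA; have := aE; nra.
  have c1 := cube_average R0 (mulr_gt0 a0 tk0) nl (le_trans (m_homo e1) hk).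
  have c2 : fine (mu (eball 0 (Rk k.+1 + t k / 8))) <= 16 / (Rk k - (Rk k.+1 + t k / 8)) * m (Rk k).
    by apply: up; rewrite /Rk ?tS; lra.
  have e3 : Rk k - (Rk k.+1 + t k / 8) = t k / 8 by rewrite /Rk tS; lra.
  rewrite e3 in c2.
  apply: (@le_trans _ _ (2^-1 ^+ n * m (Rk k))).
    apply: le_trans c1 _; apply: le_trans (ler_wpM2l _ c2) _.
      by rewrite !mulr_ge0// ltW.
    by rewrite -aE; apply: le_of_eq; field; rewrite gt_eqF.
  apply: le_trans (ler_wpM2l (ltW pn) hk) _.
  by rewrite mulrA -exprMn tS; apply: le_of_eq; congr (_ ^+ _ / _); ring.
have all k : m (Rk k) <= (a * t k) ^+ n / 2.
  elim: k => [|k /step//]; rewrite (_ : Rk 0%N = rho) /t ?expr0 ?mulr1//.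
  by rewrite /Rk /t expr0; lra.
have m0 : m (rho / 2) <= 0.
  rewrite leNgt; apply/negP => mp.
  have mk k : m (rho / 2) <= (a * rho) ^+ n * 2^-1 ^+ k.
    apply: (@le_trans _ _ (m (Rk k))); first by apply: m_homo; rewrite /Rk; have := t0 k; lra.
    apply: le_trans (all k) _; rewrite /t mulrA exprMn.
    have c0 : 0 <= (a * rho) ^+ n by rewrite exprn_ge0// mulr_ge0// ltW.
    have q1 : (2^-1 : R) ^+ k <= 1 by rewrite exprn_ile1//; lra.
    have : (2^-1 ^+ k : R) ^+ n <= 2^-1 ^+ k.
      by rewrite -[leRHS]expr1 ler_wiXn2l// ltW.
    by have : 0 <= (2^-1 ^+ k : R) ^+ n by [rewrite exprn_ge0// ltW]; nra.
  set C := (a * rho) ^+ n in mk; have C0 : 0 <= C by rewrite exprn_ge0// mulr_ge0// ltW.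
  have Cm0 : 0 <= C / m (rho / 2) by rewrite divr_ge0// ltW.
  have := archi_boundP Cm0; set K := Num.bound _ => CK.
  have K2 : (K%:R : R) < 2 ^+ K by rewrite -natrX ltr_nat ltn_expl.
  have := mk K; rewrite exprVn -[leRHS]/(C / _) ler_pdivlMr ?exprn_gt0//.
  rewrite leNgt => /negP; apply; move: CK; rewrite ltr_pdivrMr// => CK.
  by apply: lt_trans CK _; rewrite mulrC ltr_pM2l.
have r4 : 0 < rho / 4 by lra.
have hu : fine (mu (eball 0 (rho / 4))) <= 16 / (rho / 2 - rho / 4) * m (rho / 2).
  by apply: up; lra.
have : 0 < fine (mu (eball (0 : rV) (rho / 4))).
  by rewrite fine_gt0// mupos//=; apply: (mu_fin gg); exact: measurable_eball.
rewrite ltNge => /negP; apply; apply: le_trans hu _.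
by rewrite mulr_ge0_le0// divr_ge0//; lra.
Qed.

End one_set.
End density_estimates.

Section flatness.
Context {R : realType} {n : nat}.
Local Notation rV := 'rV[R]_n.
Local Notation L := (borel_lebesgue R n).
Local Notation T := (borel_rV R n).
Context (E : set T) (mu : {measure set T -> \bar R}) (nu : rV -> rV).
Hypotheses (mE : measurable E) (gg : scalar_gauss_green E mu nu).

(** Young's inequality applied to |v - u|, whose square is 2 (1 - v . u) for unit vectors. *)
Lemma enormB_le_excess (eta : R) (u v : rV) : 0 < eta -> enorm u = 1 -> enorm v = 1 ->
  enorm (v - u) <= eta / 2 + eta^-1 * (1 - dot v u).
Proof.
move=> e0 u1 v1; have h : enorm (v - u) ^+ 2 = 2 * (1 - dot v u).
  have du : dot u u = 1 by rewrite -sqr_enorm u1 expr1n.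
  have dv : dot v v = 1 by rewrite -sqr_enorm v1 expr1n.
  by rewrite sqr_enorm dotBl !dotBr du dv (dotC u v); ring.
have -> : eta / 2 + eta^-1 * (1 - dot v u) = (2 * eta)^-1 * (eta ^+ 2 + enorm (v - u) ^+ 2).
  by rewrite h; field; rewrite gt_eqF.
rewrite ler_pdivlMl ?mulr_gt0//; have := sqr_ge0 (eta - enorm (v - u)); lra.
Qed.

Lemma dot_nu_measurable v : measurable_fun [set: T] (fun x => 1 - dot v (nu x)).
Proof. by apply: measurable_funB; [exact: measurable_cst|exact: (measurable_nu_dot gg)]. Qed.

Lemma excess_integrable v D : measurable D -> mu.-integrable D (EFin \o (fun x => 1 - dot v (nu x))).
Proof.
move=> mD; apply: (bounded_integrable (C := (1 + enorm v))) => //.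
- exact: (mu_fin gg).
- exact: dot_nu_measurable.
- by move=> x; apply: le_trans (ler_normB _ _) _; rewrite normr1 lerD2l; exact: (nu_dot_le gg).
Qed.

(* A point of E on the far side of the hyperplane and a point off E near 0 differ by
   a vector h with dot h v >= 0; translations along such h rarely leave E. *)
Lemma flatness_estimate v eta tau c : (0 < n)%N -> enorm v = 1 -> 0 < eta -> eta ^+ 2 <= 2^-1 ->
  0 < tau <= 1 -> flat_normal mu nu v (eta ^+ 2) 4 -> 0 <= c ->
  (c%:E <= L (eball (0 : rV) tau `&` ~` E))%E ->
  fine (L (E `&` eball 0 1 `&` ([set y : rV | tau <= dot v y] : set T))) * c <=
    48 * eta * fine (L (eball 0 4)) * fine (L (eball (0 : rV) 2)).
Proof.
move=> n0 v1 eta0 eta2 /andP[tau0 tau1] flat c0 hc.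
set A : set T := _ `&` _.
have mhalf := @measurable_dot_ge R n v.
have mb x r : measurable (eball (x : rV) r : set T) by exact: measurable_eball.
have mA : measurable A by apply: measurableI => //; apply: measurableI.
pose H : set T := eball (0 : rV) 2 `&` [set h : rV | 0 <= dot v h].
have mH : measurable H by apply: measurableI.
have L2 := lebesgue_eball_lty (0 : rV) 2.
have LHle : (L H <= L (eball (0 : rV) 2))%E by apply: le_measureS => // x [].
have mu3 := mu_fin gg (mb 0 3).
have muB : fine (mu (eball (0 : rV) 3)) <= 16 * fine (L (eball (0 : rV) 4)).
  apply: (@le_trans _ _ (16 / (4 - 3) * fine (L (E `&` eball 0 4)))).
    have h3 : (0 : R) < 3 by lra.
    have h34 : (3 : R) < 4 by lra.
    exact: (perimeter_upper_density h3 h34 mE gg v1 (exprn_ge0 _ (ltW eta0)) (fun rho hr => flat rho hr) eta2).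
  rewrite (_ : 16 / (4 - 3) = 16 :> R); last by field.
  by rewrite ler_wpM2l//; apply: (@le_fine_lebesgue _ _ _ _ 4) => //; exact: measurableI.
(* For |h| < 2 and h . v >= 0, - h . nu <= 2 |v - nu| <= eta + 2 eta^-1 (1 - v . nu), and flatness
   eta^2 turns the integral of the last term into at most 2 eta times the mass. With [muB] this
   gives 3 * 16 = 48. *)
set M := 3 * eta * fine (mu (eball (0 : rV) 3)).
have M0 : 0 <= M by rewrite !mulr_ge0// ltW.
have key := @translate_pair_bound R n E mu nu mE gg A H 1 3 c M c0 M0 mA mH.
have {key} hA : fine (L A) * c <= fine (L H) * M.
  apply: key => //.
  - by move=> x [].
  - exact: le_lt_trans LHle L2.
  - by move=> h [h2 _]; move: h2; rewrite /eball/= subr0 => h2; lra.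
  - move=> h [h2' hv]; have h2 : enorm (h : rV) < 2 by move: h2'; rewrite /eball/= subr0.
    apply: (@le_trans _ _ (\int[mu]_(x in eball 0 3) (eta + (2 * eta^-1) * (1 - dot v (nu x))))).
      apply: le_Rintegral; first exact: mb.
      + apply: (integrableS (measurableT)) => //.
        exact: (max_dot_integrable (scalar_gauss_greenC mE gg)).
      + apply: integrableDR => //; last by apply: integrableZR => //; exact: excess_integrable.
        by apply: (bounded_integrable (C := `|eta|)).
      move=> x _; have nx : enorm (nu x) = 1 by case: gg.
      have := enormB_le_excess eta0 nx v1.
      have := ler_norm (dot h (v - nu x)); have := normr_dot h (v - nu x).
      have := enorm_ge0 (v - nu x); rewrite dotNr dotBr (dotC h v) => a1 a2 a3 a4.
      have hv' : 0 <= dot v h by exact: hv.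
      have a6 : enorm h * enorm (v - nu x) <= 2 * enorm (v - nu x) by rewrite ler_wpM2r// ltW.
      by rewrite ge_max; apply/andP; split; lra.
    rewrite RintegralD//; last 2 first.
      by apply: (bounded_integrable (C := `|eta|)).
      by apply: integrableZR => //; exact: excess_integrable.
    rewrite (@Rintegral_cst _ _ _ mu _ (mb 0 3) eta) RintegralZl//; last exact: excess_integrable.
    have h3 : (0 : R) < 3 by lra.
    have h4 : (3 : R) <= 4 by lra.
    have f3 := flat 3 (introT andP (conj h3 h4)); rewrite /M -!mulrA.
    apply: (@le_trans _ _ (eta * fine (mu (eball (0 : rV) 3)) + 2 * (eta^-1 * (eta ^+ 2 * fine (mu (eball (0 : rV) 3)))))).
      by rewrite lerD2l ler_wpM2l// ler_wpM2l// invr_ge0 ltW.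
    by apply: le_of_eq; field; rewrite gt_eqF.
  - move=> y [[Ey y1] yv]; apply: (le_trans hc).
    pose S := eball (0 : rV) tau `&` ~` E : set T.
    have mS : measurable S by apply: measurableI => //; exact: measurableC.
    rewrite -/S -(lebesgue_reflect y mS); apply: le_measureS.
    + have ms : measurable_fun [set: T] (fun h : T => (y : rV) - (h : rV) : T).
        by measurable_rV.
      by have := measurable_preimageT ms mS.
    + apply: measurableI => //.
      have ms : measurable_fun [set: T] (fun h : T => (y : rV) - (h : rV) : T).
        by measurable_rV.
      by have := measurable_preimageT ms (measurableC mE).
    move=> h [hb hE]; split => //; move: hb y1 yv; rewrite /eball/= !subr0 => hb y1 yv.
    set z := (y : rV) - h in hb hE *.
    have hz : h = y - z by rewrite /z opprB addrCA subrr addr0.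
    rewrite hz; split => /=.
      by rewrite /eball/= subr0; apply: le_lt_trans (ler_enormD _ _) _; rewrite enormN; lra.
    rewrite dotBr; have := ler_norm (dot v z); have := normr_dot v z; rewrite v1 mul1r; lra.
apply: le_trans hA _; rewrite mulrC /M.
have LH0 : 0 <= fine (L H) by exact: fine_ge0.
have LHf : fine (L H) <= fine (L (eball (0 : rV) 2)).
  by apply: (@le_fine_lebesgue _ _ _ _ 2) => // x [].
apply: ler_pM => //.
apply: (@le_trans _ _ (3 * eta * (16 * fine (L (eball (0 : rV) 4))))); last lra.
by rewrite ler_wpM2l// mulr_ge0// ltW.
Qed.

End flatness.

(** * Half-space limits of blow-ups *)

Section householder.
Context {R : realType} {n : nat}.

(* For w = 0 the division by zero gives the identity. *)
Definition householder (w x : 'rV[R]_n) : 'rV[R]_n := x - (2 * dot x w / dot w w) *: w.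

Lemma householderD w x y : householder w (x + y) = householder w x + householder w y.
Proof.
rewrite /householder dotDl mulrDr mulrDl scalerDl opprD !addrA; congr (_ + _).
by rewrite -!addrA; congr (_ + _); rewrite addrC.
Qed.

Lemma householderZ w a x : householder w (a *: x) = a *: householder w x.
Proof. by rewrite /householder dotZl scalerBr scalerA; congr (_ - _ *: _); ring. Qed.

Lemma householderB w x y : householder w (x - y) = householder w x - householder w y.
Proof. by rewrite householderD -(scaleN1r y) householderZ scaleN1r. Qed.

Lemma dot_householder w x y : dot (householder w x) y = dot x (householder w y).
Proof. by rewrite /householder dotBl dotBr dotZl dotZr (dotC y w); ring. Qed.

Lemma householderK w : involutive (householder w).
Proof.
move=> x; have [->|w0] := eqVneq w 0; first by rewrite /householder !scaler0 !subr0.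
have ww : dot w w != 0 by rewrite -sqr_enorm sqrf_eq0 enorm_eq0.
rewrite /householder dotBl dotZl; set a := 2 * dot x w / dot w w.
have -> : 2 * (dot x w - a * dot w w) / dot w w = - a by rewrite /a; field.
by rewrite scaleNr opprK subrK.
Qed.

Lemma enorm_householder w x : enorm (householder w x) = enorm x.
Proof. by rewrite /enorm dot_householder householderK. Qed.

Lemma householder_swap (u v : 'rV[R]_n) : enorm u = 1 -> enorm v = 1 ->
  householder (v - u) u = v.
Proof.
move=> u1 v1; have uu : dot u u = 1 by rewrite -sqr_enorm u1 expr1n.
have vv : dot v v = 1 by rewrite -sqr_enorm v1 expr1n.
have [->|uv] := eqVneq v u; first by rewrite subrr /householder scaler0 subr0.
have ww0 : dot (v - u) (v - u) != 0 by rewrite -sqr_enorm sqrf_eq0 enorm_eq0 subr_eq0.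
have ww : dot (v - u) (v - u) = - (2 * dot u (v - u)).
  by rewrite !(dotBl, dotBr) uu vv (dotC v u); ring.
have c : 2 * dot u (v - u) / dot (v - u) (v - u) = - 1.
  by rewrite ww in ww0 *; rewrite invrN mulrN divff// -oppr_eq0.
by rewrite /householder c scaleN1r opprK addrC subrK.
Qed.

Lemma measurable_householder w :
  measurable_fun setT (householder w : borel_rV R n -> borel_rV R n).
Proof.
apply: measurable_rVB; first exact: measurable_id.
apply: measurable_rVZ; last exact: measurable_cst.
apply: measurable_funM; last exact: measurable_cst.
apply: measurable_funM; first exact: measurable_cst.
by measurable_rV.
Qed.

Lemma lebesgue_eball_gt0 : (0 < borel_lebesgue R n (eball 0 1))%E.
Proof.
set a : R := (n%:R + 1)^-1; have a0 : 0 < a by rewrite invr_gt0 ltr_wpDl.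
have LB := borel_lebesgue_box n (ltW a0); set B := [set _ | _] in LB.
have mB : measurable (B : set (borel_rV R n)) by exact: measurable_box.
apply: lt_le_trans (le_measureS _ mB (measurable_eball 0 1) _).
  have : (0 < (a ^+ n)%:E)%E by rewrite lte_fin exprn_gt0.
  by rewrite -LB.
move=> x Bx; rewrite /eball/= subr0; apply: le_lt_trans (ler_enorm_norm x) _.
have xa : `|x| <= a.
  rewrite /Num.norm/= mx_normrE; apply: bigmax_le; first exact: ltW.
  by case=> i j _ /=; rewrite ord1; have /andP[? ?] := Bx j; rewrite ger0_norm// ltW.
have na : n%:R * a < 1 by rewrite /a ltr_pdivrMr ?mul1r ?ltrDl// ltr_wpDl.
by apply: le_lt_trans na; rewrite ler_wpM2l.
Qed.

(** In [linear_image_ratio], compare with the unit ball, which the isometry preserves and whose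
    measure is positive and finite. *)
Lemma preserves_householder w : preserves (borel_lebesgue R n) (householder w).
Proof.
split=> [|A mA]; first exact: measurable_householder.
have mB := @measurable_eball R n 0 1.
have := linear_image_ratio (measurable_householder w) (measurable_householder w) (householderK w) (householderK w) (householderD w) mB mA.
have -> : householder w @^-1` eball 0 1 = eball 0 1.
  by apply/seteqP; split => x; rewrite /eball/= !subr0 enorm_householder.
have fB : borel_lebesgue R n (eball 0 1) \is a fin_num.
  by rewrite ge0_fin_numE//; exact: lebesgue_eball_lty.
have p0 : borel_lebesgue R n (eball 0 1) != 0%E by rewrite gt_eqF// lebesgue_eball_gt0.
rewrite [RHS]muleC -(fineK fB) => e.
have c0 : fine (borel_lebesgue R n (eball 0 1)) != 0 by rewrite fine_eq0.
have := congr1 (fun z => ((fine (borel_lebesgue R n (eball 0 1)))^-1)%:E * z)%E e.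
by rewrite !muleA -!EFinM mulVf// !mul1e.
Qed.
End householder.

Section slices.
Context {R : realType} {n : nat}.
Local Notation rV := 'rV[R]_n.
Local Notation L := (borel_lebesgue R).
Local Notation leb := (@lebesgue_measure R).
Local Notation T := (borel_rV R n.+1).

Let e0 : 'rV[R]_n.+1 := delta_mx 0 0.

Lemma dot_delta0 (x : 'rV[R]_n.+1) : dot x e0 = x 0 0.
Proof.
rewrite /dot (bigD1 0)//= big1 ?addr0 ?mxE ?eqxx ?mulr1// => i i0.
by rewrite mxE eqxx (negbTE i0) mulr0.
Qed.

Lemma enorm_delta0 : enorm e0 = 1.
Proof. by rewrite /enorm dot_delta0 mxE !eqxx sqrtr1. Qed.

Lemma rV_cons_line (t : R) (y : rV) :
  (rV_cons (t, y) : 'rV[R]_n.+1) = (rV_cons (0, y) : 'rV[R]_n.+1) + t *: e0.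
Proof.
apply/rowP => i; rewrite !mxE; case: (unliftP ord0 i) => [j ->|->] /=.
  by rewrite mulr0 addr0.
by rewrite mulr1 add0r.
Qed.

Lemma dot_rV_cons (s t : R) (x y : rV) :
  dot (rV_cons (s, x)) (rV_cons (t, y)) = s * t + dot x y.
Proof.
rewrite /dot big_ord_recl /rV_cons !mxE unlift_none/=; congr (_ + _).
by apply: eq_bigr => i _; rewrite !mxE liftK.
Qed.

Lemma enorm_rV_cons0 (y : rV) : enorm (rV_cons (0, y)) = enorm y.
Proof. by rewrite /enorm dot_rV_cons mul0r add0r. Qed.

Lemma enorm_rV_cons_ge (t : R) (y : rV) : enorm y <= enorm (rV_cons (t, y)).
Proof. by rewrite /enorm ler_wsqrtr// dot_rV_cons lerDr -expr2 sqr_ge0. Qed.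

(* A linear isometry exchanging the first basis vector and v. *)
Definition orth (v : 'rV[R]_n.+1) := householder (v - e0).

(** For a unit vector [v], an isometric parametrisation of the hyperplane orthogonal to [v]. *)
Definition slice (v : 'rV[R]_n.+1) (y : rV) : 'rV[R]_n.+1 := orth v (rV_cons (0, y)).

Lemma orth_e0 v : enorm v = 1 -> orth v e0 = v.
Proof. by move=> v1; apply: householder_swap => //; exact: enorm_delta0. Qed.

Lemma dot_orth v x : enorm v = 1 -> dot v (orth v x) = x 0 0.
Proof. by move=> v1; rewrite -{1}(orth_e0 v1) /orth dot_householder householderK dotC dot_delta0. Qed.

Lemma enorm_slice v y : enorm (slice v y) = enorm y.
Proof. by rewrite /slice enorm_householder enorm_rV_cons0. Qed.

Lemma enorm_sliceB v x y : enorm (slice v x - slice v y) = enorm (x - y).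
Proof.
rewrite -[RHS](enorm_slice v); congr enorm.
rewrite /slice /orth -householderB; congr householder.
by rewrite rV_consN rV_consD oppr0 addr0.
Qed.

Lemma orth_line v t y : enorm v = 1 -> orth v (rV_cons (t, y)) = slice v y + t *: v.
Proof. by move=> v1; rewrite rV_cons_line /orth householderD householderZ -/(orth v) orth_e0. Qed.

Lemma measurable_slice v : measurable_fun setT (slice v : borel_rV R n -> T).
Proof.
apply: measurableT_comp; first exact: measurable_householder.
apply: (measurableT_comp (@measurable_rV_cons R n)).
by apply: measurable_fun_pair => //; exact: measurable_cst.
Qed.

Lemma slice_integral v (f : T -> R) : enorm v = 1 -> measurable_fun setT f ->
  (L n.+1).-integrable setT (EFin \o f) ->
  (\int[L n.+1]_x (f x)%:E = \int[L n]_y \int[leb]_t (f (slice v y + t *: v))%:E)%E.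
Proof.
move=> v1 mf fi.
have po := preserves_householder (v - e0).
have mF : measurable_fun setT (EFin \o f) by exact/measurable_EFinP.
rewrite -(preserves_integral po mF).
have gi := preserves_integrable po mF fi.
set g := ((EFin \o f) \o _) in gi.
have mg : measurable_fun setT g by apply: measurableT_comp => //; exact: measurable_householder.
have gci : (leb \x L n)%E.-integrable setT (g \o @rV_cons R n).
  apply/integrableP; split; first exact: (measurableT_comp mg (@measurable_rV_cons R n)).
  move/integrableP : gi => [_]; rewrite (_ : (\int[L n.+1]_x _ = \int[(leb \x L n)%E]_x `|(g \o @rV_cons R n) x|)%E)//.
  rewrite (@ge0_integral_pushforward _ _ _ _ _ (@rV_cons R n) _ _ setT (fun x => `|g x|%E))//.
  exact: measurableT_comp.
rewrite -[LHS]/(\int[L n.+1]_x g x)%E.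
have -> : (\int[L n.+1]_x g x = \int[(leb \x L n)%E]_p (g \o @rV_cons R n) p)%E.
  have := integral_pushforward (@measurable_rV_cons R n) (mu := (leb \x L n)%E) (D := setT) mg gci measurableT.
  by rewrite preimage_setT => <-.
rewrite -(integral21_prod_meas1 gci).
apply: eq_integral => y _; apply: eq_integral => t _.
by rewrite /g /= -/(orth v) orth_line.
Qed.

(** On each line parallel to [v] the integrand is the derivative of g along a half-line that ends on
    the hyperplane, and g vanishes at its far end. *)
Lemma slice_gradient v g G : enorm v = 1 -> test_fun g G ->
  \int[L n.+1]_(x in [set x : 'rV[R]_n.+1 | dot v x <= 0]) dot (G x) v = \int[L n]_y g (slice v y).
Proof.
move=> v1 gG; have [M M0 gM] := test_grad_support gG.
set H := [set _ | _].
have mH : measurable (H : set T) by exact: measurable_dot_le.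
rewrite Rintegral_indic.
have mD := has_gradient_measurable_dot v gG.1.
have fi := integrable_indicM mH (test_grad_integrable v gG mH).
rewrite /Rintegral; congr fine; rewrite (slice_integral v1 _ fi); last first.
  by apply: measurable_funM => //; exact: measurable_indic.
apply: eq_integral => y _; set p := slice v y.
pose K := M + enorm p + 1.
have K0 : 0 < K by rewrite /K; have := enorm_ge0 p; lra.
have far (t : R) : t <= - K + 1 -> M <= enorm (p + t *: v).
  move=> tK; have := ler_enormD (p + t *: v) (- p); rewrite addrAC subrr add0r enormN enormZ v1 mulr1.
  by have := ler_norm (- t); rewrite normrN /K in tK *; lra.
have pv : dot v p = 0 by rewrite /p /slice dot_orth// /rV_cons mxE unlift_none.
have vv : dot v v = 1 by rewrite -sqr_enorm v1 expr1n.
have dH (t : R) : (p + t *: v \in H) = (t <= 0).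
  by apply/idP/idP => [/set_mem|h]; [|apply/mem_set]; rewrite /H/= dotDr dotZr pv vv mulr1 add0r.
have -> : (\int[leb]_t (\1_H (p + t *: v) * dot (G (p + t *: v)) v)%:E =
    \int[leb]_(t in `[(- K)%R, 0%R]) (dot (G (p + t *: v)) v)%:E)%E.
  rewrite [RHS]integral_mkcond; apply: eq_integral => t _; rewrite patchE indicE dH.
  have [|tK] := boolP (t \in _); first by rewrite inE/= in_itv/= => /andP[_ ->]; rewrite mul1r.
  case: (leP t 0) => [t0|]; rewrite ?mul0r// mul1r.
  have [//|_ ->] := gM (p + t *: v); last by rewrite dot0l.
  apply: far; apply: contraNT tK; rewrite -ltNge => tK; rewrite inE/= in_itv/= t0 andbT; lra.
have dk (t : R) : is_derive t 1 (fun s : R => g (p + s *: v)) (dot (G (p + t *: v)) v).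
  exact: has_gradient_line gG.1.
have cg : continuous (fun s : R => g (p + s *: v)).
  by move=> s; apply: differentiable_continuous; apply/derivable1_diffP; case: (dk s).
have cG : continuous (fun s : R => dot (G (p + s *: v)) v).
  move=> s; apply: (@continuous_comp _ _ _ (fun s : R => G (p + s *: v)) (fun x => dot x v)); last first.
    exact: dotl_continuous.
  apply: (@continuous_comp _ _ _ (fun s : R => p + s *: v) G); last exact: gG.1.2.
  apply: (@cvgD _ _ _ (nbhs s)); first exact: cvg_cst.
  by apply: cvgZr_tmp; exact: cvg_id.
rewrite (@continuous_FTC2 _ _ (fun s : R => g (p + s *: v)) (- K) 0) ?oppr_lt0//.
- have fK : M <= enorm (p + (- K) *: v) by apply: far; lra.
  by rewrite (gM _ fK).1 scale0r addr0 sube0.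
- exact: continuous_subspaceT.
- split; first by move=> t _; case: (dk t).
  + by apply: cvg_at_right_filter; exact: cg.
  + by apply: cvg_at_left_filter; exact: cg.
- by move=> t _; rewrite derive1E; apply: derive_val.
Qed.

Lemma strip_le v (tau : R) : enorm v = 1 -> 0 < tau ->
  (L n.+1 (eball 0 1 `&` ([set y : 'rV[R]_n.+1 | (`|dot v y| <= tau)%R] : set T)) <=
    (2 * tau)%:E * L n (eball (0 : rV) 1))%E.
Proof.
move=> v1 tau0; set S : set T := _ `&` _.
have mS : measurable S.
  by apply: measurableI; [exact: measurable_eball|exact: measurable_slab].
have [mo po] := preserves_householder (v - e0).
have eS : L n.+1 S = (\int[leb]_t \int[L n]_y (\1_(householder (v - e0) @^-1` S) (rV_cons (t, y)))%:E)%E.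
  by rewrite -(po _ mS); apply: borel_lebesgueS_indic; exact: measurable_preimageT mo mS.
rewrite eS.
apply: (@le_trans _ _ (\int[leb]_t ((\1_(`[(- tau)%R, tau]%classic) t)%:E * L n (eball (0 : rV) 1)))%E).
  apply: ge0_le_integral => //.
  - by move=> t _; apply: integral_ge0 => y _; rewrite lee_fin.
  - apply: (measurable_fun_fubini_tonelli_F (m2 := L n) (fun p => (\1_(householder (v - e0) @^-1` S) (rV_cons p))%:E)) => //.
    apply: measurable_indic_comp; first exact: measurable_preimageT mo mS.
    exact: measurable_rV_cons.
  - apply: emeasurable_funM; last exact: measurable_cst.
    by apply/measurable_EFinP; exact: measurable_indic.
  move=> t _; have [tt|tt] := boolP (t \in `[(- tau)%R, tau]%classic).
    rewrite [X in (X%:E * _)%E]indicE tt mul1e (measure_indicE _ (measurable_eball 0 1)).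
    apply: ge0_le_integral => //.
    - apply/measurable_EFinP; under eq_fun do rewrite -(indic_preimage _ (fun y : borel_rV R n => rV_cons (t, y))).
      apply: measurable_indic; apply: measurable_preimageT; last exact: measurable_preimageT mo mS.
      by apply: (measurableT_comp (@measurable_rV_cons R n)); exact: measurable_fun_pair.
    - by apply/measurable_EFinP; apply: measurable_indic; exact: measurable_eball.
    move=> y _; rewrite lee_fin !indicE ler_nat.
    have [h|//] := boolP (rV_cons (t, y) \in _); rewrite mem_set//.
    move/set_mem : h => [+ _]; rewrite /eball/= !subr0 enorm_householder.
    exact/le_lt_trans/enorm_rV_cons_ge.
  rewrite integral0_eq; first by rewrite mule_ge0// lee_fin.
  move=> y _; rewrite indicE memNset// => -[_ /=].
  rewrite -/(orth v) dot_orth// /rV_cons mxE unlift_none/= => ttau.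
  move/negP : tt; apply; rewrite inE/= in_itv/=.
  by rewrite -ler_norml.
rewrite ge0_integralZr//.
  rewrite -measure_indicE//; apply: lee_wpmul2r => //.
  apply: le_of_eq.
  apply: (etrans (lebesgue_measure_itv _)) => /=; rewrite lte_fin.
  by rewrite (_ : - tau < tau) ?EFinN ?oppeK; [rewrite -EFinD mulr_natl mulr2n|lra].
by apply/measurable_EFinP; exact: measurable_indic.
Qed.

End slices.

Section halfspace_limit.
Context {R : realType} {m : nat}.
Local Notation n := m.+1.
Local Notation rV := 'rV[R]_n.
Local Notation L := (borel_lebesgue R).
Local Notation T := (borel_rV R n).

Definition halfspace (v : rV) : set T := [set x : rV | dot v x <= 0].

Lemma measurable_halfspace v : measurable (halfspace v).
Proof. exact: measurable_dot_le. Qed.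

Definition symdiff (A B : set T) : set T := (A `&` ~` B) `|` (B `&` ~` A).

Lemma flat_normalN (mu : {measure set T -> \bar R}) nu v eps K : flat_normal mu nu v eps K ->
  flat_normal mu (fun x => - nu x) (- v) eps K.
Proof.
move=> h rho hr; apply: le_trans (h rho hr); apply: le_of_eq.
by apply: eq_Rintegral => x _; rewrite dotNl dotNr opprK.
Qed.

(** In the unit ball, the symmetric difference lies in a slab of half-width [tau], the part of E
    beyond it and the part of the complement on its other side. Each of the three has volume at most
    e/3, the last two by [flatness_estimate] for E and for its complement. The lower volume density
    of both sets supplies the constant [c] of that estimate. *)
Lemma halfspace_close v e : enorm v = 1 -> 0 < e ->
  exists2 d : R, 0 < d & forall (E : set T) (mu : {measure set T -> \bar R}) nu,
    measurable E -> scalar_gauss_green E mu nu -> flat_normal mu nu v d 4 ->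
    (forall s, 0 < s -> (0 < mu (eball (0 : rV) s))%E) ->
    [/\ d <= 2^-1, fine (mu (eball (0 : rV) 1)) <= 16 * fine (L n (eball 0 4)) &
     fine (L n (eball (0 : rV) 1 `&` symdiff E (halfspace v))) <= e].
Proof.
move=> v1 e0; set K := fine (L m (eball 0 1)); have K0 : 0 <= K by exact: fine_ge0.
set P := fine (L n (eball 0 4)) * fine (L n (eball (0 : rV) 2)).
have P0 : 0 <= P by rewrite mulr_ge0// fine_ge0.
(* Small enough for the slab, of volume at most 2 tau K, to contribute at most e/3. *)
pose tau := e / (e + 6 * (K + 1)).
have den0 : 0 < e + 6 * (K + 1) by lra.
have tau0 : 0 < tau by rewrite divr_gt0.
have tau1 : tau <= 1 by rewrite ler_pdivrMr// mul1r; lra.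
have tauK : 2 * tau * K <= e / 3.
  have h : tau * (e + 6 * (K + 1)) = e by rewrite mulfVK// gt_eqF.
  by nra.
pose a : R := (256 * n%:R * 2 ^+ n)^-1.
pose c := (a * tau) ^+ n / 2.
have c0 : 0 < c.
  rewrite divr_gt0// exprn_gt0// mulr_gt0// invr_gt0; apply: mulr_gt0; last exact: exprn_gt0.
  by have : (0 : R) < n%:R by []; lra.
(* Here 144 = 3 * 48 gives 48 eta P <= e c / 3, and the summand 2 e c keeps eta <= 1/2. *)
pose eta := e * c / (2 * (e * c) + 144 * P).
have ec0 : 0 < e * c by exact: mulr_gt0.
have den1 : 0 < 2 * (e * c) + 144 * P by lra.
have eta0 : 0 < eta by rewrite divr_gt0.
have heta : eta * (2 * (e * c) + 144 * P) = e * c by rewrite mulfVK// gt_eqF.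
have eta2 : eta <= 2^-1.
  by rewrite /eta ler_pdivrMr//; lra.
have etaP : 48 * eta * P <= e * c / 3 by nra.
have eta22 : eta ^+ 2 <= 2^-1 by rewrite expr2; nra.
have [a0 a1] : 0 <= eta ^+ 2 /\ eta ^+ 2 <= 2^-1 by split=> //; exact: exprn_ge0 (ltW eta0).
exists (eta ^+ 2); first exact: exprn_gt0.
move=> E mu nu mE gg flat mupos.
have mb (x : rV) r : measurable (eball x r : set T) by exact: measurable_eball.
split => //.
  have h1 : (0 : R) < 1 by lra.
  have h14 : (1 : R) < 4 by lra.
  have := perimeter_upper_density h1 h14 mE gg v1 a0 flat a1.
  have : fine (L n (E `&` eball (0 : rV) 4)) <= fine (L n (eball (0 : rV) 4)).
    by apply: (@le_fine_lebesgue _ _ _ _ 4) => //; exact: measurableI.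
  have : 0 <= fine (L n (E `&` eball (0 : rV) 4)) by exact: fine_ge0.
  rewrite (_ : 16 / (4 - 1) = 16 / 3 :> R); [lra|by congr (_ / _); ring].
have flatt (mu' : {measure set T -> \bar R}) nu' v' : flat_normal mu' nu' v' (eta ^+ 2) 4 -> flat_normal mu' nu' v' (eta ^+ 2) tau.
  by move=> h rho /andP[r0 rt]; apply: h; rewrite r0/=; lra.
have gC := scalar_gauss_greenC mE gg.
have mC := measurableC mE.
have fN := flat_normalN flat.
have v1' : enorm (- v) = 1 by rewrite enormN.
have a01 : 0 <= eta ^+ 2 <= 2^-1 by rewrite a0 a1.
have d1 := volume_lower_density mE gg (ltn0Sn m) tau0 v1 a01 (flatt _ _ _ flat) mupos.
have d2 := volume_lower_density mC gC (ltn0Sn m) tau0 v1' a01 (flatt _ _ _ fN) mupos.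
have fin_c (A : set T) : measurable A -> c < fine (L n (A `&` eball (0 : rV) tau)) ->
    (c%:E <= L n (eball (0 : rV) tau `&` A))%E.
  move=> mA hA; rewrite setIC -[leRHS]fineK ?lee_fin; first exact: ltW.
  by apply: (@lebesgue_fin_sub _ _ _ tau) => [|x []//]; exact: measurableI.
have tt1 : 0 < tau <= 1 by rewrite tau0.
have f1 := flatness_estimate mE gg (ltn0Sn m) v1 eta0 a1 tt1 flat (ltW c0) (fin_c _ mC d2).
have d1' : (c%:E <= L n (eball (0 : rV) tau `&` ~` (~` E)))%E by rewrite setCK; exact: fin_c.
have f2 := flatness_estimate mC gC (ltn0Sn m) v1' eta0 a1 tt1 fN (ltW c0) d1'.
have mhalf (u : rV) := measurable_dot_ge u tau.
have mabs := measurable_slab v tau.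
set A1 := _ `&` _ in f1; set A2 := _ `&` _ in f2.
pose S : set T := eball (0 : rV) 1 `&` ([set y : rV | `|dot v y| <= tau] : set T).
have mA1 : measurable A1 by apply: measurableI => //; exact: measurableI.
have mA2 : measurable A2 by apply: measurableI => //; exact: measurableI.
have mS : measurable S by exact: measurableI.
have hS : fine (L n S) <= e / 3.
  apply: le_trans tauK; rewrite -lee_fin fineK; last first.
    by apply: (@lebesgue_fin_sub _ _ _ 1) => // x [].
  apply: le_trans (strip_le v1 tau0) _; rewrite /K [leRHS]EFinM fineK//.
  by rewrite ge0_fin_numE//; exact: lebesgue_eball_lty.
have hA1 : fine (L n A1) <= e / 3.
  by rewrite -(ler_pM2r c0); apply: le_trans f1 _; rewrite -mulrA -/P; lra.
have hA2 : fine (L n A2) <= e / 3.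
  by rewrite -(ler_pM2r c0); apply: le_trans f2 _; rewrite -mulrA -/P; lra.
have sub : eball (0 : rV) 1 `&` symdiff E (halfspace v) `<=` A1 `|` A2 `|` S.
  move=> x [x1 hx]; have [xt|xt] := leP `|dot v x| tau; first by right.
  left; case: hx => -[hx1 hx2].
    left; split; first by split.
    move/negP : hx2; rewrite /halfspace/= -ltNge => v0.
    by move: xt; rewrite gtr0_norm// => /ltW.
  right; split; first by split.
  move: xt; rewrite ler0_norm//= => xt; rewrite dotNl; exact: ltW.
have mU : measurable (A1 `|` A2 `|` S) by do 2?apply: measurableU.
have mD : measurable (eball (0 : rV) 1 `&` symdiff E (halfspace v) : set T).
  apply: measurableI => //; apply: measurableU; apply: measurableI => //; do ?apply: measurableC => //; exact: measurable_halfspace.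
have Ub : A1 `|` A2 `|` S `<=` eball (0 : rV) 1 by move=> x [[[[]]|[[]]]|[]].
apply: (@le_trans _ _ (fine (L n (A1 `|` A2 `|` S)))).
  exact: (@le_fine_lebesgue _ _ _ _ 1).
have fn (A : set T) : measurable A -> A `<=` eball (0 : rV) 1 -> L n A = (fine (L n A))%:E.
  by move=> mA Ab; rewrite fineK//; exact: (@lebesgue_fin_sub _ _ _ 1).
rewrite -lee_fin -fn//; have mA12 := measurableU _ _ mA1 mA2.
apply: (@le_trans _ _ (L n (A1 `|` A2) + L n S)%E); first exact: measureU2.
apply: (@le_trans _ _ ((L n A1 + L n A2) + L n S)%E).
  by rewrite leeD2r//; apply: measureU2.
have s1 : A1 `<=` eball (0 : rV) 1 by move=> y [[]].
have s2 : A2 `<=` eball (0 : rV) 1 by move=> y [[]].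
have s3 : S `<=` eball (0 : rV) 1 by move=> y [].
rewrite (fn _ mA1 s1) (fn _ mA2 s2) (fn _ mS s3) -!EFinD lee_fin.
have e3 : e = e / 3 + e / 3 + e / 3 by field.
by rewrite [leRHS]e3; apply: lerD => //; exact: lerD.
Qed.

(** Write g = g (1 - v . nu) + g v . nu. The first part has integral at most a bound of g times the
    excess in the unit ball. By Gauss-Green the second is an integral over E, compared with the one
    over the half-space, whose value is the slice integral; the error is a bound of the gradient
    times the volume of the symmetric difference. *)
Lemma blowup_unit v g G e : enorm v = 1 -> test_fun g G ->
  (forall x, 1 <= enorm x -> g x = 0 /\ G x = 0) -> 0 < e ->
  exists2 d : R, 0 < d & forall (E : set T) (mu : {measure set T -> \bar R}) nu,
    measurable E -> scalar_gauss_green E mu nu -> flat_normal mu nu v d 4 ->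
    (forall s, 0 < s -> (0 < mu (eball (0 : rV) s))%E) ->
    `|\int[mu]_x g x - \int[L m]_y g (slice v y)| <= e.
Proof.
move=> v1 gG g0 e0; have [C C0 gC] := test_fun_bounded gG.
set K := 16 * fine (L n (eball (0 : rV) 4)); have K0 : 0 <= K by rewrite mulr_ge0// fine_ge0.
have e20 : 0 < e / 2 / (C + 1) by rewrite !divr_gt0//; lra.
have [d1 d10 hd1] := halfspace_close v1 e20.
pose d := Num.min d1 (e / 2 / (C * K + 1)).
have CK0 : 0 <= C * K by exact: mulr_ge0.
have d0 : 0 < d by rewrite lt_min d10 !divr_gt0//; lra.
have dd1 : d <= d1 by rewrite ge_min lexx.
have dCK : C * (d * K) <= e / 2.
  apply: (@le_trans _ _ ((e / 2 / (C * K + 1)) * (C * K))).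
    by rewrite mulrCA ler_wpM2r// ge_min lexx orbT.
  by rewrite -mulrA ler_piMr ?divr_ge0 ?(ltW e0)// mulrC ler_pdivrMr; lra.
exists d => // E mu nu mE gg flat mupos.
have flat1 : flat_normal mu nu v d1 4.
  move=> rho hr; apply: le_trans (flat rho hr) _; apply: ler_wpM2r => //; exact: fine_ge0.
have [_ muK hE] := hd1 E mu nu mE gg flat1 mupos.
have mg : measurable_fun setT (g : T -> R) := has_gradient_measurable gG.1.
have mb : measurable (eball (0 : rV) 1 : set T) by exact: measurable_eball.
have [_ nu1 muT hgg] := gg.
have nui : mu.-integrable setT (EFin \o (fun x => g x * dot v (nu x))).
  by apply: (@nu_dot_integrable _ _ E mu nu gg v g C) => // x; case: (gC x).
have gi : mu.-integrable setT (EFin \o (g : T -> R)).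
  by apply: (bounded_integrable (C := C)) => // x; case: (gC x).
have exi := excess_integrable gg v.
have mex : measurable_fun [set: T] (fun x => 1 - dot v (nu x)) by exact: dot_nu_measurable gg v.
have nu0 x : 0 <= 1 - dot v (nu x).
  by have := normr_dot v (nu x); rewrite nu1 v1 mulr1; have := ler_norm (dot v (nu x)); lra.
have gxi : mu.-integrable setT (EFin \o (fun x => g x * (1 - dot v (nu x)))).
  apply: (bounded_integrable (C := (C * 2))) => //; first exact: measurable_funM.
  move=> x; rewrite normrM; apply: ler_pM => //; first by case: (gC x).
  rewrite ger0_norm//; have := nu_dot_le gg v x; rewrite v1 => h.
  by have := ler_normr (dot v (nu x)) (- dot v (nu x)); move: h; rewrite ler_norml => /andP[]; lra.
have split_g : \int[mu]_x g x = \int[mu]_x (g x * (1 - dot v (nu x))) + \int[L n]_(x in E) dot (G x) v.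
  rewrite (hgg g G v gG) -RintegralD//; apply: eq_Rintegral => x _; ring.
have h1 : `|\int[mu]_x (g x * (1 - dot v (nu x)))| <= e / 2.
  apply: le_trans (le_normr_Rintegral measurableT gxi) _.
  apply: (@le_trans _ _ (\int[mu]_(x in eball 0 1) (C * (1 - dot v (nu x))))).
    rewrite [leRHS]Rintegral_indic; apply: le_Rintegral => //.
    - have := @integrable_norm _ _ _ mu setT _ gxi; exact.
    - apply: (integrable_indicM mb); apply: integrableZR => //; exact: exi.
    move=> x _; rewrite normrM (ger0_norm (nu0 x)).
    have [x1|x1] := ltP (enorm x) 1.
      rewrite indicE mem_set ?mul1r; last by rewrite /eball/= subr0.
      by rewrite ler_wpM2r//; case: (gC x).
    by rewrite (g0 _ x1).1 normr0 mul0r mulr_ge0// mulr_ge0.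
  rewrite RintegralZl//; last exact: exi.
  apply: le_trans dCK; apply: ler_wpM2l => //.
  have h01 : (0 : R) < 1 by []. have h14 : (1 : R) <= 4 by lra.
  apply: le_trans (flat 1 (introT andP (conj h01 h14))) _.
  by apply: ler_wpM2l => //; exact: ltW.
have mH := measurable_halfspace v.
have iE := test_grad_integrable v gG mE; have iH := test_grad_integrable v gG mH.
have iT := test_grad_integrable v gG measurableT.
set D := (fun x : T => dot (G x) v) in iE iH iT.
have mSD : measurable (eball (0 : rV) 1 `&` symdiff E (halfspace v) : set T).
  by apply: measurableI => //; apply: measurableU; apply: measurableI => //; exact: measurableC.
have h2 : `|\int[L n]_(x in E) D x - \int[L n]_y D y * 0 - \int[L n]_(x in halfspace v) D x| <= e / 2.
  rewrite mulr0 subr0 [X in X - _]Rintegral_indic [X in _ - X]Rintegral_indic.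
  have iEi := integrable_indicM mE iE; have iHi := integrable_indicM mH iH.
  rewrite -RintegralB//.
  apply: le_trans (le_normr_Rintegral measurableT _) _; first exact: integrableBR.
  apply: (@le_trans _ _ (\int[L n]_(x in eball (0 : rV) 1 `&` symdiff E (halfspace v)) C)).
    rewrite [leRHS]Rintegral_indic; apply: le_Rintegral => //.
    - by apply: integrable_norm => //; exact: integrableBR.
    - apply: (integrable_indicM mSD).
      apply: (bounded_integrable (C := C)) => //; last by move=> x; rewrite ger0_norm.
      by apply: le_lt_trans (lebesgue_eball_lty (0 : rV) 1); apply: le_measureS => // x [].
    move=> x _; rewrite -mulrBl normrM.
    have [x1|x1] := ltP (enorm x) 1; last first.
      by rewrite /D (g0 _ x1).2 dot0l normr0 mulr0 mulr_ge0.
    have DC : `|D x| <= C.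
      by apply: le_trans (normr_dot _ _) _; rewrite v1 mulr1; case: (gC x).
    have [Ex|Ex] := pselect (E x); have [Hx|Hx] := pselect (halfspace v x).
    - by rewrite !indicE (mem_set Ex) (mem_set Hx) subrr normr0 mul0r mulr_ge0.
    - rewrite 2!indicE (mem_set Ex) (memNset Hx) subr0 normr1 mul1r.
      rewrite indicE mem_set ?mul1r//; split; last by left.
      by rewrite /eball/= subr0.
    - rewrite 2!indicE (memNset Ex) (mem_set Hx) sub0r normrN normr1 mul1r.
      rewrite indicE mem_set ?mul1r//; split; last by right.
      by rewrite /eball/= subr0.
    - by rewrite !indicE (memNset Ex) (memNset Hx) subrr normr0 mul0r mulr_ge0.
  rewrite (@Rintegral_cst _ _ _ (L n) _ mSD C).
  apply: le_trans (ler_wpM2l C0 hE) _.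
  by rewrite mulrCA -[leRHS]mulr1 ler_wpM2l ?divr_ge0 ?(ltW e0)// ler_pdivrMr; lra.
rewrite split_g -(slice_gradient v1 gG) -addrA.
rewrite mulr0 subr0 in h2; apply: le_trans (ler_normD _ _) _.
by apply: le_trans (lerD h1 h2) _; lra.
Qed.

End halfspace_limit.

Lemma Rintegral_mscale {d} {T : measurableType d} {R : realType} (mu : {measure set T -> \bar R})
  (k : {nonneg R}) (f : T -> R) : mu.-integrable setT (EFin \o f) ->
  \int[mscale k mu]_x f x = k%:num * \int[mu]_x f x.
Proof.
move=> fi; have mf := measurable_int _ fi.
have fp : (\int[mu]_x (fun x => (f x)%:E)^\+ x)%E \is a fin_num := integrable_pos_fin_num measurableT fi.
have fn : (\int[mu]_x (fun x => (f x)%:E)^\- x)%E \is a fin_num := integrable_neg_fin_num measurableT fi.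
rewrite /Rintegral integralE [in RHS]integralE.
rewrite !ge0_integral_mscale//; last 2 first.
- exact: measurable_funeneg.
- exact: measurable_funepos.
by rewrite -(fineK fp) -(fineK fn) -!EFinM -!EFinB /= mulrBr.
Qed.

Section dilation.
Context {R : realType} {n : nat}.
Local Notation rV := 'rV[R]_n.
Local Notation L := (borel_lebesgue R n).
Local Notation T := (borel_rV R n).
Variables (x : rV) (rho : R).

(** The map (y - x) / rho, in the form of the affine maps of [test_fun_affine]. *)
Definition dilate (y : rV) : rV := rho^-1 *: y - rho^-1 *: x.

Lemma measurable_dilate : measurable_fun setT (dilate : T -> T).
Proof.
by measurable_rV.
Qed.

(** For rho > 0, the blow-up (A - x) / rho. *)
Definition zoom (A : set T) : set T := [set z : rV | A (x + rho *: z)].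

Lemma measurable_zoom A : measurable A -> measurable (zoom A).
Proof.
move=> mA; have mz : measurable_fun setT ((fun z : rV => x + rho *: z) : T -> T).
  by measurable_rV.
exact: (measurable_preimageT mz mA).
Qed.

Hypothesis rho0 : 0 < rho.

Let rhoN0 : rho != 0. Proof. by rewrite gt_eqF. Qed.

Lemma dilateK y : x + rho *: dilate y = y.
Proof. by rewrite /dilate -scalerBr scalerA mulfV// scale1r addrCA subrr addr0. Qed.

Lemma enorm_dilate y : enorm (dilate y) = rho^-1 * enorm (y - x).
Proof. by rewrite /dilate -scalerBr enormZ ger0_norm// invr_ge0 ltW. Qed.

Lemma dilate_eball s : dilate @^-1` eball 0 s = eball x (rho * s).
Proof.
by apply/seteqP; split => y; rewrite /eball/= subr0 enorm_dilate ltr_pdivrMl.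
Qed.

Lemma lebesgue_dilate (A : set T) : measurable A -> L (dilate @^-1` A) = ((rho ^+ n)%:E * L A)%E.
Proof.
move=> mA; rewrite -borel_lebesgue_scale//.
have [_ ps] := borel_lebesgue_shift (- x : rV).
have mS : measurable ((fun y : rV => rho^-1 *: y) @^-1` A : set T).
  have mz : measurable_fun setT ((fun z : rV => rho^-1 *: z) : T -> T).
    by measurable_rV.
  exact: (measurable_preimageT mz mA).
rewrite -(ps _ mS); congr (L _); apply/seteqP; split => y /=; rewrite /dilate scalerBr; exact.
Qed.

Lemma Rintegral_dilate (f : T -> R) : L.-integrable setT (EFin \o f) ->
  \int[L]_y f (dilate y) = rho ^+ n * \int[L]_y f y.
Proof.
move=> fi; have r0 : 0 <= rho ^+ n by rewrite exprn_ge0// ltW.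
have mf := measurable_int _ fi.
rewrite -(Rintegral_mscale (NngNum r0) fi) /Rintegral; congr fine.
rewrite -(integral_image_measure L measurable_dilate mf).
by apply: eq_measure_integral => A mA _; exact: lebesgue_dilate.
Qed.

End dilation.

Section blowup.
Context {R : realType} {m : nat}.
Local Notation n := m.+1.
Local Notation rV := 'rV[R]_n.
Local Notation L := (borel_lebesgue R).
Local Notation T := (borel_rV R n).

(** The factor rho^-m is the scaling of area in dimension m = n - 1; its absolute value makes it a
    nonnegative number for every rho. *)
Definition blowup_measure (mu : {measure set T -> \bar R}) (x : rV) (rho : R) :
    {measure set T -> \bar R} :=
  mscale (NngNum (normr_ge0 (rho ^- m))) (image_measure mu (measurable_dilate x rho)).

Lemma Rintegral_blowup (mu : {measure set T -> \bar R}) x rho (f : T -> R) : 0 < rho -> measurable_fun setT f ->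
  mu.-integrable setT (EFin \o (fun y => f (dilate x rho y))) ->
  \int[blowup_measure mu x rho]_z f z = rho ^- m * \int[mu]_y f (dilate x rho y).
Proof.
move=> r0 mf fi; have mF : measurable_fun setT (EFin \o f) by exact/measurable_EFinP.
rewrite /blowup_measure Rintegral_mscale; last first.
  apply/integrableP; split => //; move/integrableP : fi => [_].
  rewrite (@ge0_integral_image_measure _ _ _ _ _ mu _ (measurable_dilate x rho) (fun z => `|(f z)%:E|%E))//.
  exact: measurableT_comp.
rewrite /= ger0_norm ?invr_ge0 ?exprn_ge0 ?(ltW r0)//; congr (_ * fine _).
by rewrite integral_image_measure.
Qed.

Lemma blowup_eball (mu : {measure set T -> \bar R}) x rho s : 0 < rho ->
  blowup_measure mu x rho (eball 0 s) = ((rho ^- m)%:E * mu (eball x (rho * s)))%E.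
Proof.
move=> r0; rewrite -(dilate_eball x r0).
transitivity ((`|rho ^- m|)%:E * mu (dilate x rho @^-1` eball 0 s))%E; first by [].
by rewrite ger0_norm// invr_ge0 exprn_ge0// ltW.
Qed.

Context (E : set T) (mu : {measure set T -> \bar R}) (nu : rV -> rV).
Hypotheses (mE : measurable E) (gg : scalar_gauss_green E mu nu).

(** Volume scales by rho^n and gradients by rho^-1, which leaves the power rho^m of the surface
    measure. *)
Lemma dilate_gauss_green x rho : 0 < rho ->
  scalar_gauss_green (zoom x rho E) (blowup_measure mu x rho) (fun z => nu (x + rho *: z)).
Proof.
move=> r0; have rN0 : rho != 0 by rewrite gt_eqF.
have [mnu nu1 muT hgg] := gg.
have mz : measurable_fun setT ((fun z : rV => x + rho *: z) : T -> T).
  by measurable_rV.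
have mnu' : measurable_fun setT ((fun z => nu (x + rho *: z)) : T -> T) by exact: (measurableT_comp mnu mz).
split => //.
  by apply: lte_mul_pinfty => //; rewrite lee_fin.
move=> g G h gG; have mzE := measurable_zoom x rho mE.
have [C C0 gC] := test_fun_bounded gG.
have mg : measurable_fun setT (g : T -> R) := has_gradient_measurable gG.1.
have rV0 : rho^-1 != 0 by rewrite invr_eq0.
have gG' := test_fun_affine (- (rho^-1 *: x)) rV0 gG.
have key := hgg _ _ h gG'.
have i1 : mu.-integrable setT (EFin \o (fun y => g (dilate x rho y) * dot h (nu (x + rho *: dilate x rho y)))).
  under eq_fun do rewrite dilateK//.
  apply: (@nu_dot_integrable _ _ E mu nu gg h _ C) => //.
    by apply: (measurableT_comp mg); exact: measurable_dilate.
  by move=> y; case: (gC (dilate x rho y)).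
have mgn : measurable_fun setT ((fun z => g z * dot h (nu (x + rho *: z))) : T -> R).
  by apply: measurable_funM => //; apply: measurable_dot; [exact: measurable_cst|].
rewrite (Rintegral_blowup r0 mgn i1).
have -> : \int[mu]_y (g (dilate x rho y) * dot h (nu (x + rho *: dilate x rho y))) =
    \int[mu]_y (g (rho^-1 *: y - rho^-1 *: x) * dot h (nu y)).
  by apply: eq_Rintegral => y _; rewrite dilateK.
rewrite -key [LHS]Rintegral_indic [in RHS]Rintegral_indic.
have fi := integrable_indicM mzE (test_grad_integrable h gG mzE).
have := Rintegral_dilate x r0 fi.
have -> : \int[L n]_y (\1_(zoom x rho E) (dilate x rho y) * dot (G (dilate x rho y)) h) =
    rho * \int[L n]_y (\1_E y * dot (rho^-1 *: G (rho^-1 *: y - rho^-1 *: x)) h).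
  rewrite -RintegralZl//; last exact: (integrable_indicM mE (test_grad_integrable h gG' mE)).
  apply: eq_Rintegral => y _; rewrite dotZl.
  transitivity (\1_E y * dot (G (dilate x rho y)) h); last by rewrite /dilate; field.
  congr (_ * _); rewrite !indicE; congr (nat_of_bool _)%:R.
  by apply/idP/idP => /set_mem; [rewrite /zoom/= dilateK|move=> Ey; apply/mem_set; rewrite /zoom/= dilateK] => // ?; exact/mem_set.
move=> e; apply: (mulfI (expf_neq0 n rN0)); rewrite -e mulrA; congr (_ * _).
by rewrite exprS -mulrA mulfV ?mulr1// expf_neq0.
Qed.

Definition excess_small (x v : rV) := forall d : R, 0 < d -> exists2 r : R, 0 < r &
  forall rho, 0 < rho < r ->
    \int[mu]_(y in eball x rho) (1 - dot v (nu y)) <= d * fine (mu (eball x rho)).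

Lemma blowup_limit x v g G e : enorm v = 1 -> excess_small x v ->
  (forall s, 0 < s -> (0 < mu (eball x s))%E) -> test_fun g G -> 0 < e ->
  exists2 r : R, 0 < r & forall rho, 0 < rho < r ->
    `|rho ^- m * \int[mu]_y g (dilate x rho y) - \int[L m]_y g (slice v y)| <= e.
Proof.
move=> v1 exs mupos gG e0; have [K K0 gK] := test_grad_support gG.
have KN0 : K != 0 by rewrite gt_eqF.
have gG1 : test_fun (fun z => g (K *: z)) (fun z => K *: G (K *: z)).
  by have := test_fun_affine 0 KN0 gG; under eq_fun do rewrite addr0; under [X in test_fun _ X]eq_fun do rewrite addr0.
have g1 z : 1 <= enorm z -> g (K *: z) = 0 /\ K *: G (K *: z) = 0.
  move=> z1; have Kz : K <= enorm (K *: z) by rewrite enormZ gtr0_norm// ler_peMr// ltW.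
  by have [-> ->] := gK _ Kz; rewrite scaler0.
have K1 : 0 < K ^- m * e by rewrite mulr_gt0// invr_gt0 exprn_gt0.
have [d d0 hd] := blowup_unit v1 gG1 g1 K1.
have [r r0 hr] := exs d d0.
have [_ nu1 _ _] := gg.
have mg : measurable_fun setT (g : T -> R) := has_gradient_measurable gG.1.
have mg1 : measurable_fun setT ((fun z => g (K *: z)) : T -> R) := has_gradient_measurable gG1.1.
have [C C0 gC] := test_fun_bounded gG.
(* At scale rho K the support of g fits in the unit ball. The unit-scale lemma uses flatness up to
   radius 4, that is, up to 4 rho K < r before rescaling. *)
exists (r / (4 * K)); first by rewrite divr_gt0// mulr_gt0.
move=> rho /andP[rho0 rhor]; have rK0 : 0 < rho * K by exact: mulr_gt0.
have mzE := measurable_zoom x (rho * K) mE.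
have gg' := dilate_gauss_green x rK0.
have ballE s : fine (blowup_measure mu x (rho * K) (eball 0 s)) = (rho * K) ^- m * fine (mu (eball x (rho * K * s))).
  by rewrite blowup_eball// fineM// ge0_fin_numE//; apply: (mu_fin gg); exact: measurable_eball.
have flat : flat_normal (blowup_measure mu x (rho * K)) (fun z => nu (x + (rho * K) *: z)) v d 4.
  move=> s /andP[s0 s4]; rewrite ballE Rintegral_indic.
  have mb : measurable (eball (0 : rV) s : set T) by exact: measurable_eball.
  have fE y : \1_(eball (0 : rV) s) (dilate x (rho * K) y) * (1 - dot v (nu (x + (rho * K) *: dilate x (rho * K) y))) =
     \1_(eball x (rho * K * s)) y * (1 - dot v (nu y)).
    by rewrite dilateK// -(dilate_eball _ rK0) indic_preimage.
  have fI : mu.-integrable setT (EFin \o (fun y => \1_(eball (0 : rV) s) (dilate x (rho * K) y) * (1 - dot v (nu (x + (rho * K) *: dilate x (rho * K) y))))).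
    under eq_fun do rewrite fE.
    by apply: integrable_indicM; [exact: measurable_eball|apply: (excess_integrable gg); exact: measurable_eball].
  rewrite (Rintegral_blowup rK0 _ fI); last first.
    by apply: measurable_funM; [exact: measurable_indic|exact: (dot_nu_measurable gg' v)].
  rewrite mulrCA; apply: ler_wpM2l; first by rewrite invr_ge0 exprn_ge0// ltW.
  under eq_Rintegral do rewrite fE.
  rewrite -Rintegral_indic; apply: hr; rewrite mulr_gt0//=.
  move: rhor; rewrite ltr_pdivlMr ?mulr_gt0// => rhor.
  by apply: le_lt_trans rhor; rewrite mulrA [rho * 4]mulrC -!mulrA mulrC -mulrA; have := mulr_gt0 rho0 K0; nra.
have pos s : 0 < s -> (0 < blowup_measure mu x (rho * K) (eball 0 s))%E.
  by move=> s0; rewrite blowup_eball// mule_gt0 ?mupos ?mulr_gt0// lte_fin invr_gt0 exprn_gt0.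
have := hd _ _ _ mzE gg' flat pos.
have dE y : K *: dilate x (rho * K) y = dilate x rho y.
  by rewrite /dilate scalerBr !scalerA invfM mulrCA mulfV// mulr1.
have i1 : mu.-integrable setT (EFin \o (fun y => g (K *: dilate x (rho * K) y))).
  under eq_fun do rewrite dE.
  apply: (bounded_integrable (C := C)) => //; first exact: (mu_fin gg).
    by apply: (measurableT_comp mg); exact: measurable_dilate.
  by move=> y; case: (gC (dilate x rho y)).
rewrite (Rintegral_blowup rK0 mg1 i1); under eq_Rintegral do rewrite dE.
have KV0 : 0 < K^-1 by rewrite invr_gt0.
have si : (L m).-integrable setT (EFin \o (fun y => g (slice v y))).
  apply: (@support_integrable _ _ _ (L m) (eball 0 K) _ C) => //.
  - exact: measurable_eball.
  - exact: lebesgue_eball_lty.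
  - exact: (measurableT_comp mg (measurable_slice v)).
  - by move=> y; rewrite /eball/= subr0 => /negP; rewrite -leNgt -(enorm_slice v) => /gK[].
  - by move=> y; case: (gC (slice v y)).
have -> : \int[L m]_y g (K *: slice v y) = K ^- m * \int[L m]_y g (slice v y).
  rewrite -exprVn -(Rintegral_dilate 0 KV0 si); apply: eq_Rintegral => y _.
  rewrite /dilate invrK scaler0 subr0 /slice /orth -householderZ; congr (g (householder _ _)).
  by apply/rowP => i; rewrite /rV_cons !mxE; case: unliftP => [j _|_] /=; rewrite ?mxE ?mulr0.
rewrite exprMn invfM [rho ^- m * K ^- m]mulrC -mulrA -mulrBr normrM gtr0_norm ?invr_gt0 ?exprn_gt0//.
by rewrite ler_pM2l// invr_gt0 exprn_gt0.
Qed.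

End blowup.

(** * Hausdorff measure and the isodiametric inequality *)

Section metric_outer_measure.
Context {R : realType} {n : nat} (mu : {outer_measure set 'rV[R]_n -> \bar R}).

Definition separated_by (d : R) (A B : set 'rV[R]_n) := forall x y, A x -> B y -> d <= enorm (x - y).

(** Caratheodory's condition: an outer measure that is additive on sets at positive distance
    measures the Borel sets. *)
Definition metric_outer := forall (A B : set 'rV[R]_n) (d : R), 0 < d -> separated_by d A B ->
  (mu A + mu B <= mu (A `|` B))%E.

Hypothesis metric_mu : metric_outer.

Section open_set.
Variables (U X : set 'rV[R]_n).
Hypotheses (oU : open U) (Xfin : (mu X < +oo)%E).

Let radius k : R := k.+1%:R^-1.
Let inner k : set 'rV[R]_n := [set x | forall y, ~ U y -> radius k <= enorm (x - y)].
Let ring k := inner k.+1 `&` ~` inner k.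

Let radius_gt0 k : 0 < radius k. Proof. by rewrite invr_gt0. Qed.

Let radius_lt i : radius i.+1 < radius i.
Proof. by rewrite ltf_pV2 ?posrE// ltr_nat. Qed.

Let inner_homo i j : (i <= j)%N -> inner i `<=` inner j.
Proof.
move=> ij x h y Uy; apply: le_trans (h y Uy).
by rewrite lef_pV2 ?posrE// ler_nat.
Qed.

Let inner_cover x : U x -> exists k, inner k x.
Proof.
move=> Ux; have [r r0 rU] := (open_eballP U).1 oU x Ux.
have r10 : 0 <= r^-1 by rewrite invr_ge0 ltW.
exists (Num.bound r^-1) => y Uy; rewrite enormB leNgt; apply/negP => h.
apply: Uy; apply: rU; rewrite /eball/=; apply: lt_trans h _.
rewrite -[ltRHS]invrK ltf_pV2 ?posrE ?invr_gt0//.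
by apply: lt_le_trans (archi_boundP r10) _; rewrite ler_nat.
Qed.

Let a i := mu (X `&` ring i.+1).

Let two_rings k : (mu (X `&` inner k) + a k <= mu (X `&` inner k.+2))%E.
Proof.
have d0 : 0 < radius k - radius k.+1 by rewrite subr_gt0.
apply: le_trans (metric_mu d0 _) _.
  move=> x y [_ xk] [_ [_ /existsNP[z /not_implyP[Uz /negP]]]]; rewrite -ltNge => yz.
  have := xk z Uz; have := ler_enormD (x - y) (y - z); rewrite addrA subrK.
  by move: (x - z) yz => w; lra.
apply: le_outer_measure => x [[Xx xk]|[Xx [xk _]]]; split => //.
by apply: (@inner_homo k k.+2 _ x xk); rewrite -addn2 leq_addr.
Qed.

(** Rings are known to be at positive distance only if their indices differ by two or more. The even
    and the odd ones are therefore summed separately, which costs a second copy of mu X. *)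
Let sum_rings N : (\sum_(0 <= i < N.*2) a i <= mu (X `&` inner N.*2) + mu (X `&` inner N.*2.+1))%E.
Proof.
elim: N => [|N IH]; first by rewrite big_nat1_eq || rewrite big_geq// adde_ge0.
rewrite doubleS !big_nat_recr//=.
apply: le_trans (leeD (two_rings N.*2) (two_rings N.*2.+1)).
rewrite addeACA; apply: (@le_trans _ _ (\sum_(0 <= i < N.*2) a i + (a N.*2 + a N.*2.+1))%E).
  by rewrite addeA.
exact: leeD2r.
Qed.

Let rings_fin : (\sum_(0 <= i <oo) a i < +oo)%E.
Proof.
have muX2 : (mu X + mu X < +oo)%E by rewrite lte_add_pinfty.
apply: le_lt_trans muX2; apply: lime_le; first exact: is_cvg_nneseries.
apply: nearW => N; apply: (@le_trans _ _ (\sum_(0 <= i < N.*2) a i)%E).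
  apply: (@lee_sum_nneg_natr _ a xpredT 0) => //.
  by rewrite -addnn leq_addr.
by apply: le_trans (sum_rings N) _; apply: leeD; apply: le_outer_measure => x [].
Qed.

Let open_decomp k : X `&` U `<=` (X `&` inner k.+1) `|` \bigcup_(i in ~` `I_k) (X `&` ring i.+1).
Proof.
move=> x [Xx Ux]; have [xk|xk] := pselect (inner k.+1 x); first by left.
right; have ex : exists j, `[< inner j x >] by have [j xj] := inner_cover Ux; exists j; exact/asboolP.
case: (ex_minnP ex) => j /asboolP xj jmin.
have kj : (k.+1 < j)%N.
  by rewrite ltnNge; apply/negP => jk; apply: xk; exact: inner_homo jk _ xj.
case: j xj jmin kj => // -[//|j] xj jmin kj; exists j.
  by apply/negP; rewrite -leqNgt; exact: kj.
split => //; split => // xj'; have := jmin j.+1; rewrite ltnn.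
by move=> h; apply: notF; apply: h; exact/asboolP.
Qed.

(** The points of X at distance at least 1/(k + 1) from the complement of [U] are separated from X
    minus U, and the remaining points of X in [U] lie in rings whose total mass is the tail of a
    convergent series. *)
Lemma metric_outer_open : (mu (X `&` U) + mu (X `&` ~` U) <= mu X)%E.
Proof.
apply/lee_addgt0Pr => e e0.
have := nneseries_tail_cvg rings_fin (fun _ _ => outer_measure_ge0 _ _).
move=> /fine_cvgP[[N1 _ h1] /cvgrPdist_lt /(_ e e0)[N2 _ h2]].
pose K := maxn N1 N2; have t1 := h1 K (leq_maxl _ _); have := h2 K (leq_maxr _ _).
set t := (\sum_(K <= i <oo) a i)%E in t1 *.
rewrite /= sub0r normrN ger0_norm ?fine_ge0 ?nneseries_ge0// => te.
have te' : (t <= e%:E)%E by rewrite -(fineK t1) lee_fin ltW.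
have hU : (mu (X `&` U) <= mu (X `&` inner K.+1) + t)%E.
  apply: le_trans (le_outer_measure mu _ _ (open_decomp K)) _.
  apply: le_trans (outer_measureU2 _ _ _) _; rewrite leeD2l//.
  exact: outer_measure_sigma_subadditive_tail.
have hX : (mu (X `&` inner K.+1) + mu (X `&` ~` U) <= mu X)%E.
  apply: le_trans (metric_mu (radius_gt0 K.+1) _) _.
    by move=> x y [_ xk] [_ Uy]; exact: xk.
  by apply: le_outer_measure => x [[]|[]].
apply: le_trans (leeD2r _ hU) _; rewrite addeAC.
exact: leeD.
Qed.
End open_set.

Lemma metric_outer_borel (A : set (borel_rV R n)) : measurable A ->
  measurable (A : set (caratheodory_type mu)).
Proof.
rewrite borel_rV_openE; apply: smallest_sub; first exact: (@sigma_algebra_measurable _ (caratheodory_type mu)).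
move=> U /= oU; apply: le_caratheodory_measurable => X.
have [Xfin|] := ltP (mu X) +oo%E; first exact: metric_outer_open.
by rewrite leye_eq => /eqP ->; rewrite leey.
Qed.

End metric_outer_measure.

Section hausdorff_metric.
Context {R : realType} {n k : nat}.
Local Notation rV := 'rV[R]_n.
Local Notation H := (@hausdorff R n k).

Lemma hausdorff_gauge0 : hausdorff_gauge k (set0 : set rV) = 0%E.
Proof. by rewrite /hausdorff_gauge; case: asboolP. Qed.

Lemma ediam_ubound (A : set rV) x y : A x -> A y -> ((enorm (x - y))%:E <= ediam A)%E.
Proof. by move=> Ax Ay; apply: ereal_sup_ubound; exists (x, y). Qed.

Lemma ediam_le (A : set rV) (d : \bar R) :
  (forall x y, A x -> A y -> ((enorm (x - y))%:E <= d)%E) -> (ediam A <= d)%E.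
Proof. by move=> h; apply: ge_ereal_sup => _ [[x y] [Ax Ay] <-]; exact: h. Qed.

Lemma hausdorff_delta_le (d : R) (A : set rV) (C : (set rV)^nat) :
  (forall i, (ediam (C i) <= d%:E)%E) -> A `<=` \bigcup_i C i ->
  (hausdorff_delta k d A <= \sum_(i <oo) hausdorff_gauge k (C i))%E.
Proof. by move=> dC AC; apply: ereal_inf_lbound; exists C. Qed.

Lemma hausdorff_delta_homo (d e : R) (A : set rV) : d <= e ->
  (hausdorff_delta k e A <= hausdorff_delta k d A)%E.
Proof.
move=> de; apply: le_ereal_inf_tmp => _ [C [dC AC] <-].
by apply: hausdorff_delta_le => // i; apply: le_trans (dC i) _; rewrite lee_fin.
Qed.

Lemma hausdorff_delta_le_hausdorff (d : R) (A : set rV) : 0 < d ->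
  (hausdorff_delta k d A <= H A)%E.
Proof. by move=> d0; apply: ereal_sup_ubound; exists d. Qed.

Lemma hausdorff_delta_ge0 d (A : set rV) : (0 <= hausdorff_delta k d A)%E.
Proof.
by apply: le_ereal_inf_tmp => _ [C _ <-]; apply: nneseries_ge0 => i _ _; exact: hausdorff_gauge_ge0.
Qed.

(** A set of diameter at most e < d cannot meet both A and B, so every admissible covering of the
    union splits into two. *)
Lemma hausdorff_deltaD (d e : R) (A B : set rV) : e < d -> separated_by d A B ->
  (hausdorff_delta k e A + hausdorff_delta k e B <= hausdorff_delta k e (A `|` B))%E.
Proof.
move=> ed sep; apply: le_ereal_inf_tmp => _ [C [dC ABC] <-].
pose part (S : set rV) i := if `[< C i `&` S !=set0 >] then C i else set0.
have dP S i : (ediam (part S i) <= e%:E)%E.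
  by rewrite /part; case: asboolP => // _; rewrite /ediam setX0 image_set0 ereal_sup0 leNye.
have cP (S : set rV) : S `<=` A `|` B -> S `<=` \bigcup_i part S i.
  move=> SAB x Sx; have [i _ Cx] := ABC x (SAB x Sx); exists i => //.
  by rewrite /part; case: asboolP => // h; exfalso; apply: h; exists x.
apply: le_trans (leeD (hausdorff_delta_le (dP A) (cP A (@subsetUl _ _ _))) (hausdorff_delta_le (dP B) (cP B (@subsetUr _ _ _)))) _.
rewrite -nneseriesD; [|by move=> i _ _; exact: hausdorff_gauge_ge0..].
apply: lee_nneseries => i _; first by move=> _; rewrite adde_ge0 ?hausdorff_gauge_ge0.
rewrite /part; case: asboolP => [[x [Cx Ax]]|_]; case: asboolP => [[y [Cy By]]|_];
  rewrite ?hausdorff_gauge0 ?adde0 ?add0e ?hausdorff_gauge_ge0//.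
have := le_trans (ediam_ubound Cx Cy) (dC i); rewrite lee_fin => h.
by exfalso; have := sep x y Ax By; lra.
Qed.

Lemma hausdorff_metric_outer : metric_outer H.
Proof.
move=> A B d d0 sep; have [fin|] := ltP (H (A `|` B)) +oo%E; last first.
  by rewrite leye_eq => /eqP e; rewrite [leRHS](_ : _ = +oo%E) ?leey.
have HA : H A \is a fin_num.
  rewrite ge0_fin_numE; last exact: outer_measure_ge0.
  exact: (le_lt_trans (le_outer_measure (@hausdorff R n k) _ _ (@subsetUl _ A B)) fin).
have HB : H B \is a fin_num.
  rewrite ge0_fin_numE; last exact: outer_measure_ge0.
  exact: (le_lt_trans (le_outer_measure (@hausdorff R n k) _ _ (@subsetUr _ A B)) fin).
have main (e1 e2 : R) : 0 < e1 -> 0 < e2 ->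
    (hausdorff_delta k e1 A + hausdorff_delta k e2 B <= H (A `|` B))%E.
  move=> e10 e20; pose e := Num.min (d / 2) (Num.min e1 e2).
  have e0 : 0 < e by rewrite !lt_min e10 e20 divr_gt0.
  have ed : e < d by rewrite gt_min; apply/orP; left; lra.
  have ee1 : e <= e1 by rewrite !ge_min lexx orbT.
  have ee2 : e <= e2 by rewrite !ge_min lexx !orbT.
  apply: le_trans (hausdorff_delta_le_hausdorff _ e0).
  apply: le_trans (hausdorff_deltaD ed sep).
  by apply: leeD; exact: hausdorff_delta_homo.
have dB (e : R) : 0 < e -> hausdorff_delta k e B \is a fin_num.
  move=> e0; rewrite ge0_fin_numE ?hausdorff_delta_ge0//.
  apply: (le_lt_trans (hausdorff_delta_le_hausdorff B e0)); rewrite -ge0_fin_numE//; exact: outer_measure_ge0.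
have h1 (e : R) : 0 < e -> (H A + hausdorff_delta k e B <= H (A `|` B))%E.
  move=> e0; rewrite -leeBrDr ?dB//; apply: ge_ereal_sup => _ [e1 e10 <-].
  by rewrite leeBrDr ?dB//; exact: main.
rewrite addeC -leeBrDr//; apply: ge_ereal_sup => _ [e e0 <-].
by rewrite leeBrDr// addeC; exact: h1.
Qed.

Lemma hausdorff_borel (A : set (borel_rV R n)) : measurable A ->
  measurable (A : set (caratheodory_type H)).
Proof. exact: (metric_outer_borel hausdorff_metric_outer). Qed.

End hausdorff_metric.

(** * Layer-cake formula, Prekopa-Leindler and isodiametric inequalities *)

Lemma measurable_lt_set {d} {T : measurableType d} {R : realType} (u w : T -> R) :
  measurable_fun setT u -> measurable_fun setT w -> measurable [set x | u x < w x].
Proof.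
move=> mu mw; have := measurable_preimageT (measurable_funB mw mu) (measurable_itv `]0, +oo[).
by congr measurable; apply/seteqP; split => x; rewrite /= in_itv/= andbT subr_gt0.
Qed.

Lemma layer_cake {d} {T : measurableType d} {R : realType} (mu : {sigma_finite_measure set T -> \bar R})
  (f : T -> R) : measurable_fun setT f -> (forall x, 0 <= f x) ->
  (\int[mu]_x (f x)%:E = \int[@lebesgue_measure R]_(s in `[0%R, +oo[) mu [set x | (s < f x)%R])%E.
Proof.
move=> mf f0; pose leb : {sigma_finite_measure set (measurableTypeR R) -> \bar R} := @lebesgue_measure R.
pose S : set (measurableTypeR R * T) := [set p | (0 <= p.1)%R /\ (p.1 < f p.2)%R].
have m1 : measurable_fun setT (fun p : measurableTypeR R * T => p.1 : R) by exact: measurable_fst.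
have m2 : measurable_fun setT (fun p : measurableTypeR R * T => f p.2) by exact: (measurableT_comp mf measurable_snd).
have mS : measurable S.
  apply: measurableI.
    rewrite -[X in measurable X]setTI (_ : (fun p => _) = (fun p : measurableTypeR R * T => p.1 : R) @^-1` `[0, +oo[%classic).
      exact: m1.
    by apply/seteqP; split => p; rewrite /= in_itv/= andbT.
  exact: (measurable_lt_set m1 m2).
pose F (p : measurableTypeR R * T) : \bar R := (\1_S p)%:E.
have mF : measurable_fun setT F by apply/measurable_EFinP; exact: measurable_indic.
have F0 p : (0 <= F p)%E by rewrite lee_fin.
have mx s : 0 <= s -> measurable [set x | s < f x].
  move=> _; rewrite (_ : [set x | s < f x] = f @^-1` `]s, +oo[%classic).
    exact: measurable_preimageT.
  by apply/seteqP; split => x; rewrite /= in_itv/= andbT.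
transitivity (\int[mu]_x \int[leb]_s F (s, x))%E.
  apply: eq_integral => x _.
  rewrite -[LHS](_ : leb `[0%R, f x[%classic = _); last first.
    apply: (etrans (lebesgue_measure_itv _)); rewrite /= lte_fin; have := f0 x; rewrite le_eqVlt => /predU1P[<-|->].
      by rewrite ltxx.
    by rewrite oppr0 addr0.
  rewrite (measure_indicE leb)//; apply: eq_integral => s _; rewrite /F !indicE; congr ((nat_of_bool _)%:R)%:E.
  apply/idP/idP => /set_mem; rewrite /= ?in_itv/= => h; apply/mem_set; rewrite /S/= ?in_itv/=.
    by case/andP: h.
  by case: h => -> ->.
rewrite -(fubini_tonelli F mF F0) [RHS]integral_mkcond; apply: eq_integral => s _.
rewrite patchE; case: ifPn => [|/negP hs].
  rewrite inE/= in_itv/= andbT => s0; rewrite (measure_indicE _ (mx _ s0)).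
  apply: eq_integral => x _; rewrite /F !indicE; congr ((nat_of_bool _)%:R)%:E.
  by apply/idP/idP => /set_mem h; apply/mem_set; [case: h|split].
apply: integral0_eq => x _; rewrite /F indicE memNset// => -[/= s0 _].
by apply: hs; rewrite inE/= in_itv/= s0.
Qed.

Section line.
Context {R : realType}.
Local Notation leb := (@lebesgue_measure R).

(** With a0 in A near sup A and b0 in B near inf B, the translates by b0 of the part of A below a0
    and by a0 of the part of B above b0 lie in C on either side of a0 + b0. A measurable C is given
    in place of the sum set, which need not be Borel. *)
Lemma brunn_minkowski_line (A B C : set (measurableTypeR R)) (K : R) :
  measurable A -> measurable B -> measurable C -> A `<=` `[- K, K] -> B `<=` `[- K, K] ->
  A !=set0 -> B !=set0 -> (forall a b : R, A a -> B b -> C (a + b)) ->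
  (leb A + leb B <= leb C)%E.
Proof.
move=> mA mB mC AK BK A0 B0 ABC.
have Aub : has_sup A.
  by split => //; exists K => x /AK; rewrite /= in_itv/= => /andP[].
have Blb : has_inf B.
  by split => //; exists (- K) => x /BK; rewrite /= in_itv/= => /andP[].
have lebI (D : set (measurableTypeR R)) (x y : R) : measurable D -> x <= y -> D `<=` `[x, y] -> (leb D <= (y - x)%:E)%E.
  move=> mD xy Dxy; apply: le_trans (le_measureS _ mD _ Dxy) _ => //.
  apply: le_of_eq; apply: (etrans (lebesgue_measure_itv _)) => /=.
  by rewrite lte_fin; case: ltgtP xy => // -> _; rewrite subrr.
have shift (D : set (measurableTypeR R)) (x : R) : measurable D -> leb [set y : R | D (y + x)] = leb D /\ measurable [set y : R | D (y + x)].
  move=> mD; have [ms ps] := lebesgue_line_shift x; split; first exact: ps.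
  exact: measurable_preimageT ms mD.
apply/lee_addgt0Pr => e0 e00; set e := e0 / 2.
have e_gt0 : 0 < e by rewrite divr_gt0.
have [a0 Aa0 a0e] := sup_adherent e_gt0 Aub.
have [b0 Bb0 b0e] := inf_adherent e_gt0 Blb.
set s := a0 + b0.
pose A' : set (measurableTypeR R) := A `&` `]-oo, a0[.
pose B' : set (measurableTypeR R) := B `&` `[b0, +oo[.
have mA' : measurable A' by exact: measurableI.
have mB' : measurable B' by exact: measurableI.
have hA : (leb A <= leb A' + e%:E)%E.
  have mAr : measurable (A `&` `[a0, +oo[ : set (measurableTypeR R)) by exact: measurableI.
  apply: (@le_trans _ _ (leb A' + leb (A `&` `[a0, +oo[))%E).
    apply: (@le_trans _ _ (leb (A' `|` (A `&` `[a0, +oo[)))); last exact: measureU2.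
    apply: le_measureS => //; first exact: measurableU.
    move=> x Ax; have [xa|xa] := ltP x a0; [left|right]; split => //=; rewrite in_itv/= ?andbT//.
  rewrite leeD2l//; apply: (le_trans (lebI _ a0 (sup A) mAr _ _)).
  - exact: sup_upper_bound.
  - move=> x [Ax]; rewrite /= !in_itv/= andbT => ->; exact: sup_upper_bound.
  - by rewrite lee_fin; lra.
have hB : (leb B <= leb B' + e%:E)%E.
  have mBr : measurable (B `&` `]-oo, b0] : set (measurableTypeR R)) by exact: measurableI.
  apply: (@le_trans _ _ (leb B' + leb (B `&` `]-oo, b0]))%E).
    apply: (@le_trans _ _ (leb (B' `|` (B `&` `]-oo, b0])))); last exact: measureU2.
    apply: le_measureS => //; first exact: measurableU.
    move=> x Bx; have [xa|/ltW xa] := leP b0 x; [left|right]; split => //=; rewrite in_itv/= ?andbT//.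
  rewrite leeD2l//; apply: (le_trans (lebI _ (inf B) b0 mBr _ _)).
  - by apply: ge_inf => //; case: Blb.
  - move=> x [Bx]; rewrite /= !in_itv/= => ->; rewrite andbT; case: Blb => _ hlb; exact: (ge_inf hlb).
  - by rewrite lee_fin; lra.
have [eA mA2] := shift A' (- b0) mA'; have [eB mB2] := shift B' (- a0) mB'.
have hC : (leb A' + leb B' <= leb C)%E.
  have m1 : measurable (C `&` `]-oo, s[ : set (measurableTypeR R)) by exact: measurableI.
  have m2 : measurable (C `&` `[s, +oo[ : set (measurableTypeR R)) by exact: measurableI.
  apply: (@le_trans _ _ (leb (C `&` `]-oo, s[) + leb (C `&` `[s, +oo[))%E).
    rewrite -eA -eB; apply: leeD; apply: le_measureS => //.
    - move=> x [Ax xs0]; have xs : x - b0 < a0 by move: xs0; rewrite /= in_itv.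
      split; last by rewrite /= in_itv/= /s; lra.
      by rewrite -(subrK b0 x); exact: ABC.
    - move=> x [Bx xs0]; have xs : b0 <= x - a0 by move: xs0; rewrite /= in_itv/= andbT.
      split; last by rewrite /= in_itv/= andbT /s; lra.
      by rewrite -(subrK a0 x) addrC; exact: ABC.
  rewrite -measureU//; last first.
    by apply/seteqP; split => // x [[_ /=]]; rewrite in_itv/= => h1 [_ /=]; rewrite in_itv/= andbT leNgt h1.
  by apply: le_measureS => //; [exact: measurableU|move=> x [[]|[]]].
apply: le_trans (leeD hA hB) _; rewrite addeACA -EFinD (_ : e + e = e0); last by rewrite /e; field.
exact: leeD2r.
Qed.

(** Let a, b be the suprema of f, g and c = sqrt(a b). For 0 <= s < 1 the sets f > s a and g > s b
    are nonempty and their sum lies in h > s c; for s >= 1 they are empty. Brunn-Minkowski and the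
    layer-cake formula give I/a + J/b <= W/c for the integrals, and 4 p q <= (p + q)^2 concludes. *)
Lemma prekopa_leindler_line (f g h : measurableTypeR R -> R) (K C : R) :
  measurable_fun setT f -> measurable_fun setT g -> measurable_fun setT h ->
  (forall x, 0 <= f x <= C) -> (forall x, 0 <= g x <= C) -> (forall x, 0 <= h x) ->
  (forall x : R, K < `|x| -> f x = 0 /\ g x = 0) -> leb.-integrable setT (EFin \o h) ->
  (forall x y : R, f x * g y <= h (x + y) ^+ 2) ->
  4 * (\int[leb]_x f x * \int[leb]_x g x) <= (\int[leb]_x h x) ^+ 2.
Proof.
move=> mf mg mh fC gC h0 fgK hi fgh.
have f0 x : 0 <= f x by case/andP: (fC x).
have g0 x : 0 <= g x by case/andP: (gC x).
have int0 (u : measurableTypeR R -> R) : (forall x, u x = 0) -> \int[leb]_x u x = 0.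
  by move=> u0; rewrite /Rintegral integral0_eq// => x _; rewrite u0.
have [fz|/existsNP[x0 /eqP fx0]] := pselect (forall x, f x = 0).
  by rewrite (int0 f)// mul0r mulr0 sqr_ge0.
have [gz|/existsNP[y0 /eqP gy0]] := pselect (forall x, g x = 0).
  by rewrite (int0 g)// mulr0 mulr0 sqr_ge0.
have supP (u : measurableTypeR R -> R) (z : R) : (forall x, 0 <= u x <= C) -> u z != 0 ->
    exists a : R, [/\ 0 < a, forall x, u x <= a & forall s, s < 1 -> exists x, s * a < u x].
  move=> uC uz; have hs : has_sup (range u).
    by split; [exists (u z), z|exists C => _ [x _ <-]; case/andP: (uC x)].
  have a0 : 0 < sup (range u).
    apply: (@lt_le_trans _ _ (u z)); first by rewrite lt_neqAle eq_sym uz; case/andP: (uC z).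
    by apply: sup_upper_bound => //; exists z.
  exists (sup (range u)); split => // [x|s s1]; first by apply: sup_upper_bound => //; exists x.
  have e0 : 0 < (1 - s) * sup (range u) by rewrite mulr_gt0// subr_gt0.
  have [_ [x _ <-] hx] := sup_adherent e0 hs; exists x; lra.
have [a [a0 fa fs]] := supP f x0 fC fx0; have [b [b0 gb gs]] := supP g y0 gC gy0.
pose c := Num.sqrt (a * b); have c0 : 0 < c by rewrite sqrtr_gt0 mulr_gt0.
have c2 : c ^+ 2 = a * b by rewrite sqr_sqrtr// ltW// mulr_gt0.
have mlevel (u : measurableTypeR R -> R) (t : R) : measurable_fun setT u -> measurable ([set x | t < u x] : set (measurableTypeR R)).
  move=> mu; rewrite (_ : [set x | t < u x] = u @^-1` `]t, +oo[%classic).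
    exact: measurable_preimageT.
  by apply/seteqP; split => x; rewrite /= in_itv/= andbT.
have bnd (u : measurableTypeR R -> R) (x : R) : (forall x : R, K < `|x| -> u x = 0) -> 0 < u x -> - K <= x <= K.
  move=> uK ux; rewrite -ler_norml leNgt; apply/negP => /uK u0; by rewrite u0 ltxx in ux.
have fi (u : measurableTypeR R -> R) : measurable_fun setT u -> (forall x, 0 <= u x <= C) -> (forall x : R, K < `|x| -> u x = 0) ->
    leb.-integrable setT (EFin \o u).
  move=> mu uC uK; apply: (@support_integrable _ _ _ leb `[- K, K]%classic u C) => //.
  - by have := lebesgue_measure_itv `[- K, K] => /= ->; case: ifP => _; rewrite ?ltry.
  - move=> x; rewrite /= in_itv/= -ler_norml => /negP; rewrite -ltNge; exact: uK.
  - by move=> x; rewrite ger0_norm; case/andP: (uC x).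
have iF := fi f mf fC (fun x h => (fgK x h).1); have iG := fi g mg gC (fun x h => (fgK x h).2).
have scale (u : measurableTypeR R -> R) (k : R) : 0 < k -> measurable_fun setT u -> (forall x, 0 <= u x) ->
    leb.-integrable setT (EFin \o u) ->
    (\int[leb]_(s in `[0%R, +oo[) leb [set x | (s * k < u x)%R] = (k^-1 * \int[leb]_x u x)%:E)%E.
  move=> k0 mu u0 ui; have mu' : measurable_fun setT (fun x => k^-1 * u x) by exact: measurable_funM.
  have u0' x : 0 <= k^-1 * u x by rewrite mulr_ge0// invr_ge0 ltW.
  have kV0 : (0 <= (k^-1)%:E)%E by rewrite lee_fin invr_ge0 ltW.
  have mU : measurable_fun setT (EFin \o u) by exact/measurable_EFinP.
  rewrite EFinM EFin_Rintegral// -(ge0_integralZl _ measurableT mU (fun x _ => u0 x) kV0).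
  rewrite [RHS](layer_cake leb mu' u0').
  by apply: eq_integral => s _; congr (leb _); apply/seteqP; split => x /=; rewrite ltr_pdivlMl// mulrC.
have F1 := scale f a a0 mf f0 iF; have G1 := scale g b b0 mg g0 iG; have H1 := scale h c c0 mh h0 hi.
have key : (\int[leb]_(s in `[0%R, +oo[) leb [set x | (s * a < f x)%R] + \int[leb]_(s in `[0%R, +oo[) leb [set x | (s * b < g x)%R] <=
   \int[leb]_(s in `[0%R, +oo[) leb [set x | (s * c < h x)%R])%E.
  have mlev (u : measurableTypeR R -> R) (k : R) : 0 < k -> measurable_fun setT u ->
      measurable_fun (`[0%R, +oo[%classic : set (measurableTypeR R)) (fun s : measurableTypeR R => leb [set x | (s * k < u x)%R]).
    move=> k0 mu; apply: measurable_funTS.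
    pose S : set (measurableTypeR R * measurableTypeR R) := [set p | (p.1 * k < u p.2)%R].
    have mS : measurable S.
      have n1 : measurable_fun setT (fun p : measurableTypeR R * measurableTypeR R => p.1 * k : R).
        by apply: measurable_funM; [exact: measurable_fst|exact: measurable_cst].
      have n2 : measurable_fun setT (fun p : measurableTypeR R * measurableTypeR R => u p.2) by exact: (measurableT_comp mu measurable_snd).
      exact: (measurable_lt_set n1 n2).
    have := measurable_fun_xsection leb mS; congr measurable_fun; apply/funext => s /=.
    by congr (leb _); apply/seteqP; split => x; rewrite /xsection/= inE.
  rewrite -ge0_integralD//; [|exact: mlev..].
  apply: ge0_le_integral => //.
  - by move=> s _; rewrite adde_ge0.
  - by apply: emeasurable_funD; exact: mlev.
  - exact: mlev.
  move=> s; rewrite /= in_itv/= andbT => s0; have [s1|s1] := ltP s 1; last first.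
    rewrite (_ : [set x | _] = set0); last first.
      by apply/seteqP; split => // x /=; apply/negP; rewrite -leNgt; apply: le_trans (fa x) _; rewrite ler_peMl// ltW.
    rewrite (_ : [set x | (_ < g x)%R] = set0); last first.
      by apply/seteqP; split => // x /=; apply/negP; rewrite -leNgt; apply: le_trans (gb x) _; rewrite ler_peMl// ltW.
    by rewrite measure0 add0e.
  apply: (@brunn_minkowski_line _ _ _ K); try exact: mlevel.
  - move=> x /= hx; rewrite in_itv/=; apply: (bnd f); first by move=> y /fgK[].
    by apply: le_lt_trans hx; rewrite mulr_ge0// ltW.
  - move=> x /= hx; rewrite in_itv/=; apply: (bnd g); first by move=> y /fgK[].
    by apply: le_lt_trans hx; rewrite mulr_ge0// ltW.
  - by have [x hx] := fs s s1; exists x.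
  - by have [x hx] := gs s s1; exists x.
  move=> x y /= fx gy; rewrite ltNge; apply/negP => hc.
  have sa0 : 0 <= s * a by rewrite mulr_ge0// ltW.
  have sb0 : 0 <= s * b by rewrite mulr_ge0// ltW.
  have : (s * a) * (s * b) < f x * g y by apply: ltr_pM.
  rewrite ltNge => /negP; apply; apply: le_trans (fgh x y) _.
  rewrite (_ : s * a * (s * b) = (s * c) ^+ 2); last by rewrite exprMn c2; ring.
  by rewrite ler_pXn2r ?nnegrE// mulr_ge0// ltW.
rewrite F1 G1 H1 -EFinD lee_fin in key.
set I := \int[leb]_x f x in key *; set J := \int[leb]_x g x in key *; set W := \int[leb]_x h x in key *.
have I0 : 0 <= I by apply: Rintegral_ge0.
have J0 : 0 <= J by apply: Rintegral_ge0.
have I0' : 0 <= a^-1 * I by rewrite mulr_ge0// invr_ge0 ltW.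
have J0' : 0 <= b^-1 * J by rewrite mulr_ge0// invr_ge0 ltW.
have e1 : I * J = c ^+ 2 * ((a^-1 * I) * (b^-1 * J)).
  by rewrite c2; field; rewrite !gt_eqF.
have e2 : W ^+ 2 = c ^+ 2 * (c^-1 * W) ^+ 2 by field; rewrite gt_eqF.
rewrite e1 e2 mulrCA ler_pM2l ?exprn_gt0//.
set p := a^-1 * I in key I0' *; set q := b^-1 * J in key J0' *.
apply: (@le_trans _ _ ((p + q) ^+ 2)); first by have := sqr_ge0 (p - q); lra.
by rewrite ler_pXn2r ?nnegrE ?addr_ge0// (le_trans _ key)// addr_ge0.
Qed.

End line.

Section space.
Context {R : realType}.
Local Notation L m := (borel_lebesgue R m).
Local Notation leb := (@lebesgue_measure R).

Lemma enorm_rV_cons_ge_head m (t : R) (y : 'rV[R]_m) : `|t| <= enorm (rV_cons (t, y)).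
Proof.
rewrite -[leLHS]sqrtr_sqr /enorm ler_wsqrtr// dot_rV_cons -expr2 lerDl.
by rewrite -sqr_enorm sqr_ge0.
Qed.

(* With x + y in place of the midpoint there is no dilation to handle, at the price of
   the factor 4^m. *)
Lemma prekopa_leindler m (f g h : borel_rV R m -> R) (K C : R) :
  measurable_fun setT f -> measurable_fun setT g -> measurable_fun setT h ->
  (forall x, 0 <= f x <= C) -> (forall x, 0 <= g x <= C) -> (forall x, 0 <= h x <= C) ->
  (forall x : 'rV[R]_m, K < enorm x -> [/\ f x = 0, g x = 0 & h x = 0]) ->
  (forall x y : 'rV[R]_m, f x * g y <= h (x + y) ^+ 2) ->
  4 ^+ m * (\int[L m]_x f x * \int[L m]_x g x) <= (\int[L m]_x h x) ^+ 2.
Proof.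
elim: m f g h C => [|m IH] f g h C mf mg mh fC gC hC K0 fgh.
  rewrite expr0 mul1r /Rintegral /=.
  have i0 (u : borel_rV R 0 -> R) : measurable_fun setT u -> (\int[\d_(0%R : borel_rV R 0)]_x (u x)%:E = (u 0%R)%:E)%E.
    move=> mu; rewrite integral_dirac//; last exact/measurable_EFinP.
    by rewrite diracE mem_set ?mul1e.
  by rewrite !i0//= -{3}(addr0 (0 : 'rV[R]_0)); exact: fgh.
have mcons t : measurable_fun setT ((fun y => rV_cons (t, y)) : borel_rV R m -> borel_rV R m.+1).
  by apply: (measurableT_comp (@measurable_rV_cons R m)); exact: measurable_fun_pair.
have K' (y : 'rV[R]_m) (t : R) : K < enorm y -> K < enorm (rV_cons (t, y)).
  by move=> h0; apply: lt_le_trans h0 _; exact: enorm_rV_cons_ge.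
pose B := fine (L m (eball 0 (K + 1))).
have mball : measurable (eball (0 : 'rV[R]_m) (K + 1) : set (borel_rV R m)) by exact: measurable_eball.
have B0 : 0 <= B by exact: fine_ge0.
have C0 : 0 <= C by have /andP[] := fC 0; exact: le_trans.
have far (y : 'rV[R]_m) : ~ eball (0 : 'rV[R]_m) (K + 1) y -> K < enorm y.
  by rewrite /eball/= subr0 => /negP; rewrite -leNgt; lra.
have sint (u : borel_rV R m.+1 -> R) (t : R) : measurable_fun setT u -> (forall x, 0 <= u x <= C) ->
    (forall x : 'rV[R]_m.+1, K < enorm x -> u x = 0) ->
    (L m).-integrable setT (EFin \o (fun y => u (rV_cons (t, y)))).
  move=> mu uC uK; apply: (@support_integrable _ _ _ (L m) (eball 0 (K + 1)) _ C) => //.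
  - exact: lebesgue_eball_lty.
  - exact: (measurableT_comp mu (mcons t)).
  - by move=> y /far yK; apply: uK; exact: K'.
  - by move=> y; rewrite ger0_norm; case/andP: (uC (rV_cons (t, y))).
pose I (u : borel_rV R m.+1 -> R) (t : measurableTypeR R) : R := \int[L m]_y u (rV_cons (t, y)).
have mI (u : borel_rV R m.+1 -> R) : measurable_fun setT u -> (forall x, 0 <= u x <= C) -> measurable_fun setT (I u).
  move=> mu uC; apply: (@measurableT_comp _ _ _ _ _ _ (fine : \bar R -> R)); first exact: fine_measurable.
  apply: (measurable_fun_fubini_tonelli_F (m2 := L m) (fun p => (u (rV_cons p))%:E)).
    by apply/measurable_EFinP; exact: (measurableT_comp mu (@measurable_rV_cons R m)).
  by move=> p; rewrite lee_fin; case/andP: (uC (rV_cons p)).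
have Ibd (u : borel_rV R m.+1 -> R) t : measurable_fun setT u -> (forall x, 0 <= u x <= C) ->
    (forall x : 'rV[R]_m.+1, K < enorm x -> u x = 0) -> 0 <= I u t <= C * B.
  move=> mu uC uK; have u0 x : 0 <= u x by case/andP: (uC x).
  rewrite Rintegral_ge0//= /B -(@Rintegral_cst _ _ _ (L m) _ mball C) [leRHS]Rintegral_indic.
  apply: le_Rintegral => //; first exact: sint.
    apply: integrable_indicM => //; apply: (bounded_integrable (C := C)) => //.
      exact: lebesgue_eball_lty.
    by move=> x; rewrite ger0_norm.
  move=> y _; have [yb|yb] := pselect (eball (0 : 'rV[R]_m) (K + 1) y).
    by rewrite indicE mem_set// mul1r; case/andP: (uC (rV_cons (t, y))).
  by rewrite uK ?mulr_ge0//; apply: K'; exact: far.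
have Ifar (u : borel_rV R m.+1 -> R) (t : R) : (forall x : 'rV[R]_m.+1, K < enorm x -> u x = 0) ->
    K < `|t| -> I u t = 0.
  move=> uK tK; rewrite /I /Rintegral integral0_eq// => y _; rewrite uK//.
  by apply: lt_le_trans tK _; exact: enorm_rV_cons_ge_head.
have EI (u : borel_rV R m.+1 -> R) : measurable_fun setT u -> (forall x, 0 <= u x <= C) ->
    (forall x : 'rV[R]_m.+1, K < enorm x -> u x = 0) -> \int[L m.+1]_x u x = \int[leb]_t I u t.
  move=> mu uC uK; rewrite /Rintegral; congr fine.
  apply: etrans; first apply: integral_borel_lebesgueS.
  - exact/measurable_EFinP.
  - by move=> x; rewrite lee_fin; case/andP: (uC x).
  by apply: eq_integral => t _; rewrite /I EFin_Rintegral//; exact: sint.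
have fK x : K < enorm x -> f x = 0 by move=> /K0[].
have gK x : K < enorm x -> g x = 0 by move=> /K0[].
have hK x : K < enorm x -> h x = 0 by move=> /K0[].
have sec (s t : R) : 4 ^+ m * (I f s * I g t) <= I h (s + t) ^+ 2.
  apply: (IH _ _ _ C); do ?[by apply: measurableT_comp => //; exact: mcons]; do ?[by move=> x; apply/andP; split; case/andP: (fC (rV_cons (s, x)))|by move=> x; apply/andP; split; case/andP: (gC (rV_cons (t, x)))|by move=> x; apply/andP; split; case/andP: (hC (rV_cons (s + t, x)))].
    by move=> x xK; split; [apply: fK|apply: gK|apply: hK]; exact: K'.
  by move=> x y; rewrite -rV_consD; exact: fgh.
rewrite !EI//.
have p2 : (2 ^+ m : R) * 2 ^+ m = 4 ^+ m by rewrite -exprMn; congr (_ ^+ _); ring.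
have e1 (u : borel_rV R m.+1 -> R) : measurable_fun setT u -> (forall x, 0 <= u x <= C) ->
    (forall x : 'rV[R]_m.+1, K < enorm x -> u x = 0) ->
    leb.-integrable setT (EFin \o I u).
  move=> mu uC uK; apply: (@support_integrable _ _ _ leb `[- K, K]%classic (I u) (C * B)) => //.
  - by have := lebesgue_measure_itv `[- K, K] => /= ->; case: ifP => _; rewrite ?ltry.
  - exact: mI.
  - move=> x; rewrite /= in_itv/= -ler_norml => /negP; rewrite -ltNge; exact: Ifar.
  - by move=> x; rewrite ger0_norm; case/andP: (Ibd u x mu uC uK).
(* A factor 2^m on each of the section integrals of f and g absorbs the 4^m of the induction
   hypothesis [sec]. *)
have := @prekopa_leindler_line R (fun t => 2 ^+ m * I f t) (fun t => 2 ^+ m * I g t) (I h) K (2 ^+ m * (C * B)).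
have q0 : (0 : R) <= 2 ^+ m by exact: exprn_ge0.
move=> H; apply: le_trans (H _ _ _ _ _ _ _ _ _) => {H}.
- rewrite !RintegralZl//; [|exact: e1..].
  by rewrite exprS -p2; apply: le_of_eq; ring.
- by apply: measurable_funM => //; exact: mI.
- by apply: measurable_funM => //; exact: mI.
- exact: mI.
- by move=> t; have /andP[? ?] := Ibd f t mf fC fK; rewrite mulr_ge0//= ler_wpM2l.
- by move=> t; have /andP[? ?] := Ibd g t mg gC gK; rewrite mulr_ge0//= ler_wpM2l.
- by move=> t; case/andP: (Ibd h t mh hC hK).
- by move=> t tK; rewrite !Ifar// mulr0.
- exact: e1.
by move=> s t; rewrite mulrACA p2.
Qed.

(** Prekopa-Leindler for the indicators of P, - P and P - P gives 2^m |P| <= |P - P|, and P - P lies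
    in the ball of radius d. Since P is open, so is P - P, hence it is measurable. *)
Lemma isodiametric m (P : set 'rV[R]_m) (d : R) : open P -> P !=set0 ->
  (forall x y, P x -> P y -> enorm (x - y) < d) ->
  2 ^+ m * fine (L m P) <= d ^+ m * fine (L m (eball 0 1)).
Proof.
move=> oP [p0 Pp0] Pd; have d0 : 0 < d by have := Pd p0 p0 Pp0 Pp0; rewrite subrr enorm0.
pose N : set 'rV[R]_m := [set x | P (- x)].
pose D : set 'rV[R]_m := [set z | exists2 x, P x & N (z - x)].
have oN : open N.
  apply/open_eballP => x Nx; have [e e0 eP] := (open_eballP P).1 oP _ Nx; exists e => // y.
  rewrite /eball/= => ye; apply: eP; rewrite /eball/=.
  by rewrite -opprD enormN.
have oD : open D.
  apply/open_eballP => z [x Px Nzx]; have [e e0 eN] := (open_eballP N).1 oN _ Nzx; exists e => // y.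
  rewrite /eball/= => ye; exists x => //; apply: eN; rewrite /eball/=.
  by rewrite opprB addrA subrK.
have mP := open_measurable_rV oP; have mN := open_measurable_rV oN; have mD := open_measurable_rV oD.
have Pb (x : 'rV[R]_m) : P x -> enorm x < enorm p0 + d.
  by move=> Px; have := ler_enormD (x - p0) p0; rewrite subrK; have := Pd x p0 Px Pp0; lra.
have Nb (x : 'rV[R]_m) : N x -> enorm x < enorm p0 + d by move=> /Pb; rewrite enormN.
have Db (z : 'rV[R]_m) : D z -> enorm z < d.
  by move=> [x Px Nzx]; have := Pd _ _ Px Nzx; rewrite opprK addrC subrK.
set K := enorm p0 + d; have K0 : 0 <= enorm p0 by exact: enorm_ge0.
have i01 (A : set (borel_rV R m)) x : 0 <= (\1_A x : R) <= 1.
  by rewrite indicE; case: (_ \in _); rewrite ?ler01 ?lexx.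
have := @prekopa_leindler m (\1_P) (\1_N) (\1_D) K 1 (measurable_indic mP) (measurable_indic mN) (measurable_indic mD) (i01 _) (i01 _) (i01 _).
have iL (A : set (borel_rV R m)) : measurable A -> \int[L m]_x \1_A x = fine (L m A).
  by move=> mA; rewrite /Rintegral -measure_indicE.
rewrite !iL//.
have -> : L m N = L m P.
  have [_ po] := @borel_lebesgue_opp R m; exact: po mP.
move=> H.
have {H} : 4 ^+ m * (fine (L m P) * fine (L m P)) <= fine (L m D) ^+ 2.
  apply: H.
    move=> x xK; split; rewrite indicE memNset//.
    - by move=> /Pb; rewrite ltNge (ltW xK).
    - by move=> /Nb; rewrite ltNge (ltW xK).
    - by move=> /Db; rewrite ltNge; apply/negP; rewrite negbK; move: xK; rewrite /K; lra.
  move=> x y; have [Px|Px] := pselect (P x); last by rewrite [\1_P x]indicE memNset// mul0r sqr_ge0.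
  have [Ny|Ny] := pselect (N y); last by rewrite [\1_N y]indicE memNset// mulr0 sqr_ge0.
  rewrite !indicE (mem_set Px) (mem_set Ny) mem_set ?expr1n ?mulr1//.
  by exists x => //; rewrite addrC addKr.
have LD : fine (L m D) <= d ^+ m * fine (L m (eball 0 1)).
  apply: (@le_trans _ _ (fine (L m (eball (0 : 'rV[R]_m) d)))).
    by apply: (@le_fine_lebesgue _ _ _ _ d) => // [|x /Db]; [exact: measurable_eball|rewrite /eball/= subr0].
  have dV0 : 0 < d^-1 by rewrite invr_gt0.
  have := borel_lebesgue_scale d0 (@measurable_eball R m 0 1).
  rewrite (_ : _ @^-1` _ = eball (0 : 'rV[R]_m) d).
    move=> ->; rewrite fineM//.
    by rewrite ge0_fin_numE//; exact: lebesgue_eball_lty.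
  apply/seteqP; split => x; rewrite /eball/= !subr0 enormZ gtr0_norm// ltr_pdivrMl// mulr1; exact.
have LP0 : 0 <= fine (L m P) by exact: fine_ge0.
have LD0 : 0 <= fine (L m D) by exact: fine_ge0.
have p2 : (2 ^+ m : R) * 2 ^+ m = 4 ^+ m by rewrite -exprMn; congr (_ ^+ _); ring.
rewrite -p2 (_ : _ * _ * _ = (2 ^+ m * fine (L m P)) ^+ 2); last by ring.
rewrite ler_pXn2r ?nnegrE ?mulr_ge0// ?exprn_ge0// => h; exact: le_trans LD.
Qed.

End space.

(** * The perimeter measure and its normal *)

Section borel_outer.
Context {R : realType} {n : nat} (mu : {outer_measure set 'rV[R]_n -> \bar R}).
Local Notation T := (borel_rV R n).

Definition borel_outer of metric_outer mu : set T -> \bar R := mu.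

Variable hmu : metric_outer mu.

Let outer0 : borel_outer hmu set0 = 0%E. Proof. exact: outer_measure0. Qed.
Let outer_ge0 A : (0 <= borel_outer hmu A)%E. Proof. exact: outer_measure_ge0. Qed.
Let outer_sigma_additive : semi_sigma_additive (borel_outer hmu).
Proof.
move=> F mF tF mUF.
apply: (@measure_semi_sigma_additive _ (caratheodory_type mu) R mu F) => //.
- by move=> i; exact: metric_outer_borel.
- exact: (metric_outer_borel hmu mUF).
Qed.

HB.instance Definition _ := isMeasure.Build _ _ _ (borel_outer hmu)
  outer0 outer_ge0 outer_sigma_additive.
End borel_outer.

Section staircase.
Context {R : realType}.

(** Within 1 of the positive part of t as long as t <= M, but a sum of C^1 steps with values in
    [0, 1]; in [Lam_le_integral] each step is an admissible test function. *)
Definition staircase (M : nat) (t : R) : R := \sum_(k < M) smooth_step (t - k%:R).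

Lemma staircase_le0 M t : t <= 0 -> staircase M t = 0.
Proof.
move=> t0; rewrite /staircase big1// => k _; rewrite smooth_step_le0//.
by have : (0 : R) <= k%:R by []; lra.
Qed.

Lemma staircase_close M t : 0 <= t <= M%:R -> `|staircase M t - t| <= 1.
Proof.
elim: M => [|M IH] /andP[t0 tM].
  by rewrite /staircase big_ord0 (le_anti (introT andP (conj tM t0)))// subrr normr0.
rewrite /staircase big_ord_recr/= -/(staircase M t).
have [tM'|tM'] := leP t M%:R.
  by rewrite smooth_step_le0 ?addr0 ?IH ?t0//; lra.
have -> : staircase M t = M%:R.
  rewrite /staircase (eq_bigr (fun=> 1)); first by rewrite sumr_const card_ord.
  move=> k _; rewrite smooth_step_ge1//.
  have : (k.+1%:R : R) <= M%:R by rewrite ler_nat.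
  by rewrite -natr1; lra.
have := smooth_step_itv (t - M%:R); rewrite -natr1 in tM => h.
by rewrite ler_norml; apply/andP; lra.
Qed.

Lemma count_le M (t : R) : 0 <= t -> \sum_(k < M) ((k%:R < t)%R%:R : R) <= t + 1.
Proof.
move=> t0; suff h : \sum_(k < M) ((k%:R < t)%R%:R : R) <= Num.min M%:R (t + 1).
  by apply: le_trans h _; rewrite ge_min lexx orbT.
elim: M => [|M IH]; first by rewrite big_ord0 le_min lexx addr_ge0.
rewrite big_ord_recr/=; rewrite le_min in IH; case/andP: IH => h1 h2; rewrite le_min.
rewrite -natr1; case: ltP => ht /=; rewrite ?addr0; apply/andP; lra.
Qed.

Lemma prod_itv (F : nat -> R) N : (forall k, 0 <= F k <= 1) -> 0 <= \prod_(k < N) F k <= 1.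
Proof.
move=> F01; elim/big_ind : _ => [|x y /andP[x0 x1] /andP[y0 y1]|k _]; rewrite ?ler01 ?lexx//.
by rewrite mulr_ge0//= mulr_ile1.
Qed.

Lemma prod_le_factor (F : nat -> R) N i : (forall k, 0 <= F k <= 1) -> (i < N)%N ->
  \prod_(k < N) F k <= F i.
Proof.
move=> F01; elim: N => [//|N IH]; rewrite ltnS leq_eqVlt big_ord_recr/= => /predU1P[->|/IH h].
  by have /andP[? ?] := prod_itv N F01; rewrite ler_piMl//; case/andP: (F01 N).
apply: le_trans h; have /andP[? ?] := prod_itv N F01; rewrite ler_piMr//.
by case/andP: (F01 N).
Qed.
End staircase.

(** * Variation measure of a bounded functional on test functions *)

Section variation.
Context {R : realType} {n : nat}.
Local Notation rV := 'rV[R]_n.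
Local Notation T := (borel_rV R n).
Implicit Types (g h : rV -> R) (U : set rV).

Definition is_test g := exists G, test_fun g G.

Lemma is_testD g h : is_test g -> is_test h -> is_test (fun x => g x + h x).
Proof. by move=> [G gG] [H hH]; eexists; exact: test_funD gG hH. Qed.

Lemma is_testZ c g : is_test g -> is_test (fun x => c * g x).
Proof. by move=> [G gG]; eexists; exact: test_funZ gG. Qed.

Lemma is_test0 : is_test (fun=> 0).
Proof. by eexists; exact: test_fun0. Qed.

Lemma is_testM g h : is_test g -> is_C1 h -> is_test (fun x => g x * h x).
Proof. by move=> [G gG] [H hH]; eexists; exact: test_funM gG hH. Qed.

Lemma is_test_C1 g : is_test g -> is_C1 g.
Proof. by move=> [G [gG _]]; exists G. Qed.

Lemma is_test_sum (I : Type) (r : seq I) (F : I -> rV -> R) :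
  (forall i, is_test (F i)) -> is_test (fun x => \sum_(i <- r) F i x).
Proof.
move=> FT; elim: r => [|i r IH].
  by under eq_fun do rewrite big_nil; exact: is_test0.
by under eq_fun do rewrite big_cons; exact: is_testD.
Qed.

Lemma is_test_comp (u u' : R -> R) g : (forall t : R, is_derive t 1 u (u' t)) -> continuous u' ->
  u 0 = 0 -> is_test g -> is_test (fun x => u (g x)).
Proof. by move=> du cu u0 [G gG]; eexists; exact: test_fun_comp du cu u0 gG. Qed.

Lemma is_test_step (a b : R) g : b <= 0 -> is_test g -> is_test (fun x => smooth_step (a * g x + b)).
Proof.
have da (t : R) : is_derive t 1 (fun s : R => a * s + b) a.
  by apply: (@is_derive_quad _ _ _ 0) => s; rewrite mul0r (_ : _ - _ - _ = 0) ?normr0//; ring.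
move=> b0; apply: (@is_test_comp (fun t => smooth_step (a * t + b)) (fun t => a * dsmooth_step (a * t + b))).
- move=> t; have := @is_derive1_comp R smooth_step (fun s : R => a * s + b) t _ _ (is_derive_smooth_step (a * t + b)) (da t).
  by rewrite mulrC.
- have cd : continuous (fun t : R => dsmooth_step (a * t + b)).
    move=> t; apply: (@continuous_comp _ _ _ (fun t : R => a * t + b) dsmooth_step); last exact: continuous_dsmooth_step.
    by apply: differentiable_continuous; apply/derivable1_diffP; case: (da t).
  by move=> t; rewrite /continuous_at; apply: (@cvgMl_tmp _ _ (nbhs t) _ (fun t : R => dsmooth_step (a * t + b))); exact: cd.
- by rewrite mulr0 add0r smooth_step_le0.
Qed.

Variable Lam : (rV -> R) -> R.

Definition admissible U g := [/\ is_test g, forall x, `|g x| <= 1 & forall x, ~ U x -> g x = 0].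

(** The maximum with 0 makes the value nonnegative for an arbitrary [Lam]: the outer measure is
    built before linearity is assumed. *)
Definition open_var U : \bar R :=
  maxe 0%E (ereal_sup [set (Lam g)%:E | g in [set g | admissible U g]]).

Let S := g_sigma_algebraType [set: set rV].

(** As in Riesz's construction, the value +oo confines coverings to open sets. The empty set is
    treated apart because [Lam] may not vanish at 0 at this stage. *)
Definition var_gauge (A : set S) : \bar R :=
  if `[< A = set0 >] then 0%E else if `[< open (A : set rV) >] then open_var A else +oo%E.

Lemma open_var_ge0 U : (0 <= open_var U)%E. Proof. by rewrite /open_var le_max lexx. Qed.

Lemma var_gauge_ge0 A : (0 <= var_gauge A)%E.
Proof. by rewrite /var_gauge; case: asboolP => // _; case: asboolP => // _; exact: open_var_ge0. Qed.

Lemma var_gauge0 : var_gauge set0 = 0%E.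
Proof. by rewrite /var_gauge; case: asboolP. Qed.

Definition var_outer : set rV -> \bar R := mu_ext var_gauge.

HB.instance Definition _ := isOuterMeasure.Build R rV var_outer
  (mu_ext0 var_gauge0 var_gauge_ge0) (mu_ext_ge0 var_gauge_ge0) (le_mu_ext var_gauge)
  (mu_ext_sigma_subadditive var_gauge_ge0).

Variable P : R.
Hypotheses (LamD : forall g h, is_test g -> is_test h -> Lam (fun x => g x + h x) = Lam g + Lam h)
  (LamZ : forall c g, is_test g -> Lam (fun x => c * g x) = c * Lam g)
  (LamP : forall g, is_test g -> (forall x, `|g x| <= 1) -> Lam g <= P).

Lemma Lam0 : Lam (fun=> 0) = 0.
Proof. by have := LamZ 0 is_test0; under eq_fun do rewrite mul0r; rewrite mul0r. Qed.

Lemma Lam_sum (I : Type) (r : seq I) (F : I -> rV -> R) :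
  (forall i, is_test (F i)) -> Lam (fun x => \sum_(i <- r) F i x) = \sum_(i <- r) Lam (F i).
Proof.
move=> FT; elim: r => [|i r IH].
  by under eq_fun do rewrite big_nil; rewrite Lam0 big_nil.
under eq_fun do rewrite big_cons; rewrite LamD//; last exact: is_test_sum.
by rewrite IH big_cons.
Qed.

Lemma P_ge0 : 0 <= P.
Proof. by rewrite -Lam0; apply: LamP => [|x]; [exact: is_test0|rewrite normr0]. Qed.

Lemma Lam_sup g (c : R) : 0 < c -> is_test g -> (forall x, `|g x| <= c) -> Lam g <= c * P.
Proof.
move=> c0 gt gc; rewrite -ler_pdivrMl// -LamZ//; apply: LamP; first exact: is_testZ.
by move=> x; rewrite normrM gtr0_norm ?invr_gt0// ler_pdivrMl// mulr1.
Qed.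

Lemma admissible_le U g : admissible U g -> ((Lam g)%:E <= open_var U)%E.
Proof. by move=> ag; rewrite /open_var le_max ereal_sup_ubound ?orbT//; exists g. Qed.

Lemma admissible0 U : admissible U (fun=> 0).
Proof. by split => [|x|//]; [exact: is_test0|rewrite normr0]. Qed.

Lemma open_varE U : open_var U = ereal_sup [set (Lam g)%:E | g in [set g | admissible U g]].
Proof.
rewrite /open_var; apply/max_idPr; apply: ereal_sup_ubound; exists (fun=> 0); first exact: admissible0.
by rewrite Lam0.
Qed.

Lemma open_var_le U : (open_var U <= P%:E)%E.
Proof.
rewrite open_varE; apply: ge_ereal_sup => _ [g [gt g1 _] <-]; rewrite lee_fin.
exact: LamP.
Qed.

Lemma open_var_set0 : open_var set0 = 0%E.
Proof.
apply/eqP; rewrite eq_le open_var_ge0 andbT open_varE; apply: ge_ereal_sup => _ [g [_ _ g0] <-].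
by rewrite (_ : g = fun=> 0) ?Lam0//; apply/funext => x; exact: g0.
Qed.

Lemma var_gauge_open U : open U -> var_gauge U = open_var U.
Proof.
move=> oU; rewrite /var_gauge; case: asboolP => [->|_]; first by rewrite open_var_set0.
by case: asboolP.
Qed.

Lemma open_cover_uniform (K : set rV) (V : nat -> set rV) : compact K ->
  (forall i, open (V i)) -> (forall i j, (i <= j)%N -> V i `<=` V j) -> K `<=` \bigcup_i V i ->
  exists N, K `<=` V N.
Proof.
rewrite compact_cover => cK oV Vh KV.
have [D' _ KD] := cK nat setT V (fun i _ => oV i) KV.
exists (\max_(i <- finmap.enum_fset D') i) => x /KD[i /= iD Vx].
apply: (Vh i) => //; rewrite (big_rem i)//=; exact: leq_maxl.
Qed.

(* Multiplying by a partition of unity made of test functions supported in the V j. *)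
Lemma open_var_subadditive U (V : nat -> set rV) : (forall i, open (V i)) ->
  U `<=` \bigcup_i V i -> (open_var U <= \sum_(i <oo) open_var (V i))%E.
Proof.
move=> oV UV; rewrite [leLHS]open_varE; apply: ge_ereal_sup => _ [g [gt g1 g0] <-].
apply/lee_addgt0Pr => e e0.
pose d := e / (P + 1); have P1 : 0 < P + 1 by have := P_ge0; lra.
have d0 : 0 < d by exact: divr_gt0.
have dP : d * P <= e.
  by have := P_ge0; rewrite /d mulrAC ler_pdivrMr// ler_pM2l//; lra.
have /choice[p pP] : forall j, exists p : nat -> rV -> R,
    [/\ forall k, is_test (p k), forall k x, 0 <= p k x <= 1,
        forall k x, ~ V j x -> p k x = 0 & forall x, p k x @[k --> \oo] --> (\1_(V j) x : R)].
  by move=> j; exact: (open_test_approx (oV j)).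
(* On this compact set finitely many cutoffs make the remainder [Q] at most d, while off it |g| < d.
   In both cases |g Q| <= d, which [Lam_sup] turns into an error of at most d P. *)
pose K := [set x | d <= `|g x|].
have cg : continuous g by have [G [gG _]] := gt; exact: has_gradient_continuous gG.
have cK : compact K.
  have [G [gG [M gM]]] := gt; have cB := @compact_eball_le R n M.
  refine (subclosed_compact _ cB _).
    rewrite (_ : K = (fun x => `|g x|) @^-1` `[d, +oo[%classic).
      apply: closed_comp; last exact: interval_closed.
      by move=> x _; apply: continuous_comp; [exact: cg|exact: norm_continuous].
    by apply/seteqP; split => x; rewrite /K /= in_itv/= andbT.
  move=> x; rewrite /K/= => dx; rewrite leNgt; apply/negP => /ltW /gM gx.
  by move: dx; rewrite gx normr0 leNgt d0.
pose O N := \bigcup_(i in [set i | (i < N)%N]) \bigcup_(k in [set k | (k < N)%N]) [set x | 1 - d < p i k x].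
have [N KN] : exists N, K `<=` O N.
  apply: open_cover_uniform => //.
  - move=> N; apply: bigcup_open => i _; apply: bigcup_open => k _.
    have [pt _ _ _] := pP i; have [G [pG _]] := pt k.
    rewrite (_ : [set x | _] = p i k @^-1` `]1 - d, +oo[%classic).
      by apply: open_comp; [move=> x _; exact: (has_gradient_continuous pG)|exact: interval_open].
    by apply/seteqP; split => x; rewrite /= in_itv/= andbT.
  - by move=> i j ij x [i' /= i'i [k /= ki h]]; exists i'; [exact: leq_trans ij|exists k => //; exact: leq_trans ij].
  move=> x Kx; have Ux : U x.
    by apply: contrapT => /g0 gx; move: Kx; rewrite /K/= gx normr0 leNgt d0.
  have [j _ Vx] := UV x Ux; have [_ _ _ /(_ x)] := pP j; rewrite indicE mem_set//.
  move=> /cvgrPdist_lt /(_ d d0)[k _ /(_ k (leqnn k))]; rewrite /= => hk.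
  exists (maxn j k).+1 => //; exists j; first by rewrite /= ltnS leq_maxl.
  exists k; first by rewrite /= ltnS leq_maxr.
  by move: hk; rewrite /= ltr_norml => /andP[]; lra.
have p01 i k x : 0 <= 1 - p i k x <= 1.
  by have [_ /(_ k x) ? _ _] := pP i; lra.
pose r i x := \prod_(k < N) (1 - p i k x).
have r01 i x : 0 <= r i x <= 1 by exact: (prod_itv N (fun k => p01 i k x)).
have rC1 i : is_C1 (r i).
  apply: is_C1_prod => k; apply: is_C1B; first exact: is_C1_cst.
  by have [pt _ _ _] := pP i; exact: is_test_C1.
have r1V i x : ~ V i x -> r i x = 1.
  by move=> Vx; have [_ _ p0 _] := pP i; rewrite /r big1// => k _; rewrite p0// subr0.
(* The sum 1 - Q_N = sum of (1 - r_i) Q_i telescopes; its i-th term vanishes off [V i], so these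
   terms act as the partition of unity. *)
pose Q J x := \prod_(i < J) r i x.
have Q01 J x : 0 <= Q J x <= 1 by exact: (prod_itv J (fun i => r01 i x)).
have QC1 J : is_C1 (Q J) by apply: is_C1_prod => i; exact: rC1.
have QK x : K x -> Q N x <= d.
  move=> /KN[i /= iN [k /= kN h]].
  apply: le_trans (prod_le_factor (fun i => r01 i x) iN) _.
  by apply: le_trans (prod_le_factor (fun k => p01 i k x) kN) _; lra.
have part J : ((Lam (fun x => g x * (1 - Q J x)))%:E <= \sum_(0 <= i < J) open_var (V i))%E.
  elim: J => [|J IH].
    rewrite big_geq// lee_fin (_ : (fun x => _) = fun=> 0) ?Lam0//.
    by apply/funext => x; rewrite /Q big_ord0 subrr mulr0.
  have qC1 : is_C1 (fun x => (1 - r J x) * Q J x).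
    by apply: is_C1M => //; apply: is_C1B => //; exact: is_C1_cst.
  have t2 := is_testM gt qC1.
  have t1 : is_test (fun x => g x * (1 - Q J x)).
    by apply: is_testM => //; apply: is_C1B => //; exact: is_C1_cst.
  rewrite big_nat_recr//= (_ : (fun x => g x * (1 - Q J.+1 x)) =
      fun x => g x * (1 - Q J x) + g x * ((1 - r J x) * Q J x)); last first.
    by apply/funext => x; rewrite /Q big_ord_recr/=; ring.
  rewrite LamD// EFinD; apply: leeD => //; apply: admissible_le; split => //.
    move=> x; have /andP[? ?] := r01 J x; have /andP[? ?] := Q01 J x.
    rewrite normrM mulr_ile1// ger0_norm ?mulr_ge0 ?subr_ge0// mulr_ile1 ?subr_ge0//; lra.
  by move=> x Vx; rewrite r1V// subrr mul0r mulr0.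
have tQ : is_test (fun x => g x * Q N x) by exact: is_testM.
have t1Q : is_test (fun x => g x * (1 - Q N x)).
  by apply: is_testM => //; apply: is_C1B => //; exact: is_C1_cst.
have -> : Lam g = Lam (fun x => g x * (1 - Q N x)) + Lam (fun x => g x * Q N x).
  by rewrite -LamD//; congr Lam; apply/funext => x; ring.
rewrite EFinD; apply: leeD.
  apply: le_trans (part N) _; apply: nneseries_lim_ge => i _ _.
  exact: open_var_ge0.
rewrite lee_fin; apply: le_trans dP; apply: Lam_sup => // x.
have /andP[q0 q1] := Q01 N x; rewrite normrM (ger0_norm q0).
have [xK|xK] := leP d `|g x|; first by apply: le_trans (QK x xK); rewrite ler_piMl.
by apply: le_trans (ltW xK); rewrite ler_piMr.
Qed.

Lemma open_var_outer U : open U -> (open_var U <= var_outer U)%E.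
Proof.
move=> oU; apply: le_ereal_inf_tmp => _ [C [_ UC] <-].
have [oC|/existsNP[i nC]] := pselect (forall i, open (C i : set rV)).
  apply: le_trans (open_var_subadditive oC UC) _; apply: le_of_eq.
  by apply: eq_eseriesr => i _; rewrite var_gauge_open.
rewrite [leRHS](@eseries_pinfty _ _ _ i) ?leey//.
  by move=> j _; rewrite -ltNye (lt_le_trans _ (var_gauge_ge0 _)).
rewrite /var_gauge; case: asboolP => [C0|_]; first by exfalso; apply: nC; rewrite C0; exact: open0.
by case: asboolP.
Qed.

Lemma var_outer_open U : open U -> (var_outer U <= open_var U)%E.
Proof.
move=> oU; pose C (i : nat) : set rV := if i is 0%N then U else set0.
apply: le_trans (_ : (\sum_(i <oo) var_gauge (C i) <= _)%E).
  apply: ereal_inf_lbound; exists C => //; split; first by move=> i; exact: sub_sigma_algebra.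
  by move=> x Ux; exists 0%N.
rewrite (@nneseries_recl _ xpredT)//; last by move=> k _; exact: var_gauge_ge0.
rewrite eseries0 ?adde0 /= ?var_gauge_open// => -[|k]//= _ _; exact: var_gauge0.
Qed.

Lemma var_outer_fin A : (var_outer A <= P%:E)%E.
Proof.
apply: le_trans (open_var_le setT); apply: le_trans (var_outer_open openT).
by apply: (le_outer_measure var_outer).
Qed.

Lemma open_varD U V : U `&` V = set0 -> (open_var U + open_var V <= open_var (U `|` V))%E.
Proof.
move=> UV0; have fin W : open_var W \is a fin_num.
  by rewrite ge0_fin_numE ?open_var_ge0//; apply: le_lt_trans (open_var_le W) (ltry _).
rewrite -leeBrDr// [leLHS]open_varE; apply: ge_ereal_sup => _ [g [gt g1 g0] <-].
rewrite leeBrDr// addeC -leeBrDr// [leLHS]open_varE; apply: ge_ereal_sup => _ [h [ht h1 h0] <-].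
rewrite leeBrDr// addeC -EFinD -LamD//; apply: admissible_le; split; first exact: is_testD.
  move=> x; have [Ux|Ux] := pselect (U x); last by rewrite (g0 x Ux) add0r.
  rewrite (h0 x) ?addr0// => Vx; have : (U `&` V) x by [].
  by rewrite UV0.
by move=> x UVx; rewrite g0 ?h0 ?addr0// => Wx; apply: UVx; [right|left].
Qed.

Lemma open_var_homo U V : U `<=` V -> (open_var U <= open_var V)%E.
Proof.
move=> UV; rewrite [leLHS]open_varE; apply: ge_ereal_sup => _ [g [gt g1 g0] <-].
by apply: admissible_le; split => // x Vx; apply: g0 => /UV.
Qed.

Lemma open_nbhd_set (A : set rV) (r : R) : open (\bigcup_(a in A) eball a r).
Proof. by apply: bigcup_open => a _; exact: open_eball. Qed.

(** Intersect an open covering with the d/2-neighbourhoods of A and of B. These are disjoint and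
    open, and [open_var] is superadditive on disjoint sets. *)
Lemma var_outer_metric : metric_outer var_outer.
Proof.
move=> A B d d0 sep; apply: le_ereal_inf_tmp => _ [C [_ ABC] <-].
pose N (D : set rV) := \bigcup_(a in D) eball a (d / 2).
have oN D : open (N D) by exact: open_nbhd_set.
have DN (D : set rV) : D `<=` N D.
  by move=> x Dx; exists x => //; apply: eball_center; rewrite divr_gt0.
have NAB : N A `&` N B = set0.
  apply/seteqP; split => // x [[a Aa xa] [b Bb xb]]; move: xa xb; rewrite /eball/= => xa xb.
  have := sep a b Aa Bb; have := ler_enormD (a - x) (x - b); rewrite addrA subrK (enormB a x); lra.
have cov (D : set rV) : D `<=` A `|` B -> (var_outer D <= \sum_(i <oo) var_gauge (C i `&` N D))%E.
  move=> DAB; apply: ereal_inf_lbound; exists (fun i => C i `&` N D) => //.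
  split; first by move=> i; exact: sub_sigma_algebra.
  by move=> x Dx; have [i _ Cx] := ABC x (DAB x Dx); exists i => //; split => //; exact: DN.
apply: le_trans (leeD (cov A (@subsetUl _ _ _)) (cov B (@subsetUr _ _ _))) _.
rewrite -nneseriesD; [|by move=> i _ _; exact: var_gauge_ge0..].
apply: lee_nneseries => i _; first by move=> _; rewrite adde_ge0 ?var_gauge_ge0.
have [->|Ci0] := eqVneq (C i) set0; first by rewrite !set0I var_gauge0 adde0.
have [oC|nC] := pselect (open (C i : set rV)); last first.
  rewrite [leRHS](_ : _ = +oo%E) ?leey// /var_gauge; case: asboolP => [/eqP|_]; first by rewrite (negbTE Ci0).
  by case: asboolP.
rewrite !var_gauge_open//; [|exact: openI..].
apply: le_trans (open_varD _) _; first by rewrite setIACA NAB setI0.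
by apply: open_var_homo => x [[]|[]].
Qed.

Definition var_measure : {measure set T -> \bar R} := borel_outer var_outer_metric.

Lemma var_measure_fin A : (var_measure A <= P%:E)%E.
Proof. exact: var_outer_fin. Qed.

(** h is within D of D times the sum of the u_k, where u_k is a difference of steps of h/D and - h/D
    at height k, admissible for the open set |h| > D k. Hence Lam h is at most D times the sum of
    the masses of these sets plus D P, and D times the sum of their indicators is at most |h| +
    D. *)
Lemma Lam_le_integral g : is_test g -> `|Lam g| <= \int[var_measure]_x `|g x|.
Proof.
suff main h : is_test h -> Lam h <= \int[var_measure]_x `|h x|.
  move=> gt; rewrite ler_norml lerNl; apply/andP; split; last exact: main.
  have := main _ (is_testZ (-1) gt); rewrite LamZ// mulN1r => h; apply: le_trans h _.
  by apply: le_of_eq; apply: eq_Rintegral => x _; rewrite mulN1r normrN.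
move=> {g} ht; set mu := var_measure.
have muT : (mu setT < +oo)%E by apply: le_lt_trans (var_measure_fin _) (ltry _).
have [C C0 hC] : exists2 C : R, 0 <= C & forall x, `|h x| <= C.
  by have [G hG] := ht; have [C C0 gC] := test_fun_bounded hG; exists C => // x; case: (gC x).
have mh : measurable_fun setT (h : T -> R).
  by have [G [hG _]] := ht; exact: has_gradient_measurable hG.
have mah : measurable_fun setT ((fun x => `|h x|) : T -> R) by exact: measurableT_comp.
have ih : mu.-integrable setT (EFin \o ((fun x => `|h x|) : T -> R)).
  by apply: (bounded_integrable (C := C)) => // x; rewrite normr_id.
apply/ler_addgt0Pr => e e0; pose D := e / (P + fine (mu setT) + 1).
have m0 : 0 <= fine (mu setT) by exact: fine_ge0.
have den : 0 < P + fine (mu setT) + 1 by have := P_ge0; lra.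
have D0 : 0 < D by exact: divr_gt0.
have De : D * P + D * fine (mu setT) <= e.
  rewrite -mulrDr /D mulrAC ler_pdivrMr// ler_pM2l//; lra.
pose M := Num.bound (C / D).
have CM : C <= D * M%:R.
  have CD0 : 0 <= C / D by rewrite divr_ge0// ltW.
  by have /ltW := archi_boundP CD0; rewrite ler_pdivrMr// mulrC.
pose u (k : nat) x := smooth_step (D^-1 * h x - k%:R) - smooth_step (- D^-1 * h x - k%:R).
have ut k : is_test (u k).
  have k0 : - (k%:R : R) <= 0 by rewrite oppr_le0.
  have := is_testD (is_test_step (D^-1) k0 ht) (is_testZ (-1) (is_test_step (- D^-1) k0 ht)).
  by congr is_test; apply/funext => x; rewrite mulN1r.
have absE x : `|D^-1 * h x| = D^-1 * `|h x| by rewrite normrM gtr0_norm// invr_gt0.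
pose U k : set rV := [set x | D * k%:R < `|h x|].
have oU k : open (U k).
  rewrite (_ : U k = (fun x => `|h x|) @^-1` `]D * k%:R, +oo[%classic).
    apply: open_comp; last exact: interval_open.
    move=> x _; have [G [hG _]] := ht.
    by apply: continuous_comp; [exact: (has_gradient_continuous hG)|exact: norm_continuous].
  by apply/seteqP; split => x; rewrite /U /= in_itv/= andbT.
have uU k : admissible (U k) (u k).
  split => // x.
    have /andP[? ?] := smooth_step_itv (D^-1 * h x - k%:R).
    have /andP[? ?] := smooth_step_itv (- D^-1 * h x - k%:R).
    by rewrite ler_norml /u; apply/andP; lra.
  move=> /negP; rewrite -leNgt -ler_pdivrMl// -absE ler_norml => /andP[h1 h2].
  by rewrite /u !smooth_step_le0 ?subrr// ?mulNr; lra.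
have muU k : (open_var (U k) = mu (U k))%E.
  by apply/eqP; rewrite eq_le open_var_outer//= var_outer_open.
have sumE x : \sum_(k < M) u k x = staircase M (D^-1 * h x) - staircase M (- (D^-1 * h x)).
  by rewrite /staircase -sumrB; apply: eq_bigr => k _; rewrite /u mulNr.
have close x : `|h x - D * \sum_(k < M) u k x| <= D.
  rewrite sumE; have hM : `|D^-1 * h x| <= M%:R.
    by rewrite absE ler_pdivrMl//; apply: le_trans (hC x) _.
  have -> : h x - D * (staircase M (D^-1 * h x) - staircase M (- (D^-1 * h x))) =
     - D * ((staircase M (D^-1 * h x) - staircase M (- (D^-1 * h x))) - D^-1 * h x).
    by field; rewrite gt_eqF.
  suff hs : `|(staircase M (D^-1 * h x) - staircase M (- (D^-1 * h x))) - D^-1 * h x| <= 1.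
    by rewrite normrM [`|- D|]normrN (gtr0_norm D0) ler_piMr// ltW.
  have [t0|/ltW t0] := leP 0 (D^-1 * h x).
    rewrite (staircase_le0 M (t := - _)) ?oppr_le0// subr0; apply: staircase_close.
    by rewrite t0 (le_trans (ler_norm _)).
  rewrite (staircase_le0 M t0) sub0r -opprD normrN -[X in `|_ + X|]opprK; apply: staircase_close.
  by rewrite oppr_ge0 t0 (le_trans (ler_norm _))// normrN.
have sumt : is_test (fun x => D * \sum_(k < M) u k x) by apply: is_testZ; exact: is_test_sum.
have rest : is_test (fun x => h x - D * \sum_(k < M) u k x).
  have := is_testD ht (is_testZ (-1) sumt); congr is_test; apply/funext => x; by rewrite mulN1r.
have -> : Lam h = Lam (fun x => D * \sum_(k < M) u k x) + Lam (fun x => h x - D * \sum_(k < M) u k x).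
  by rewrite -LamD//; congr Lam; apply/funext => x; rewrite addrC subrK.
have h1 : Lam (fun x => h x - D * \sum_(k < M) u k x) <= D * P by exact: Lam_sup.
have mUk k : measurable (U k : set T) by exact: open_measurable_rV.
have h2 : Lam (fun x => D * \sum_(k < M) u k x) <= \int[mu]_x `|h x| + D * fine (mu setT).
  rewrite LamZ//; last exact: is_test_sum.
  rewrite Lam_sum//; apply: (@le_trans _ _ (D * \sum_(k < M) \int[mu]_x \1_(U k) x)).
    rewrite ler_pM2l//; apply: ler_sum => k _.
    rewrite /Rintegral -measure_indicE// -lee_fin fineK; last first.
      by rewrite ge0_fin_numE//; apply: le_lt_trans (var_measure_fin _) (ltry _).
    by rewrite -muU; apply: admissible_le; exact: uU.
  have ind k : mu.-integrable setT (EFin \o (\1_(U k) : T -> R)).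
    by apply: (bounded_integrable (C := 1)) => // x; exact: normr_indic_le1.
  have ind' (k : 'I_M) := ind k.
  rewrite -(Rintegral_sum _ measurableT ind') -RintegralZl//; last exact: integrable_sumR.
  rewrite -(@Rintegral_cst _ _ _ mu setT measurableT D) -RintegralD//; last first.
    by apply: (bounded_integrable (C := D)) => // x; rewrite ger0_norm// ltW.
  apply: le_Rintegral => //.
  - by apply: integrableZR => //; exact: integrable_sumR.
  - by apply: integrableDR => //; apply: (bounded_integrable (C := D)) => // x; rewrite ger0_norm// ltW.
  move=> x _; have := @count_le _ M (D^-1 * `|h x|); rewrite mulr_ge0 ?invr_ge0 ?(ltW D0)// => /(_ isT) hc.
  have -> : `|h x| + D = D * (D^-1 * `|h x| + 1) by field; rewrite gt_eqF.
  rewrite ler_pM2l//; apply: le_trans hc; apply: le_of_eq.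
  apply: eq_bigr => k _; rewrite indicE; congr (nat_of_bool _)%:R.
  by apply/idP/idP => [/set_mem|hk]; [rewrite /U/= ltr_pdivlMl|apply/mem_set; rewrite /U/= -ltr_pdivlMl].
lra.
Qed.

End variation.

Section finite_alias.
Context (d : measure_display) (T : measurableType d) (R : realType).
Context (m : {measure set T -> \bar R}).

Definition finite_alias of (m setT < +oo)%E : set T -> \bar R := m.

Variable mfin : (m setT < +oo)%E.
HB.instance Definition _ := Measure.on (finite_alias mfin).

Let fin : fin_num_fun (finite_alias mfin).
Proof.
move=> A mA; rewrite ge0_fin_numE//; apply: le_lt_trans mfin.
exact: le_measureS.
Qed.

HB.instance Definition _ := Measure_isFinite.Build _ _ _ (finite_alias mfin) fin.
End finite_alias.

(** * Extension of functionals to bounded functions and their densities *)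

Section density.
Context {R : realType}.

Lemma count_ge M (t : R) : Num.min M%:R t <= \sum_(k < M) ((k%:R < t)%R%:R : R).
Proof.
elim: M => [|M IH]; first by rewrite big_ord0 ge_min lexx.
rewrite big_ord_recr/= -natr1; have [Mt|tM] := ltP M%:R t.
  by rewrite min_l in IH; [rewrite ge_min lerD2r IH|exact: ltW].
by rewrite addr0; apply: le_trans IH; rewrite !min_r//; have : (0 : R) <= 1 by []; lra.
Qed.

Lemma step_approx {d} {T : measurableType d} (f : T -> R) (C D : R) :
  measurable_fun setT f -> (forall x, `|f x| <= C) -> 0 < D ->
  exists (N : nat) (c : nat -> R) (A : nat -> set T), (forall k, measurable (A k)) /\
    forall x, `|f x - \sum_(k < N) c k * \1_(A k) x| <= D.
Proof.
move=> mf fC D0; pose M := Num.bound (`|C| / D).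
have CM : `|C| <= D * M%:R.
  have CD0 : 0 <= `|C| / D by rewrite divr_ge0// ltW.
  by have /ltW := archi_boundP CD0; rewrite ler_pdivrMr// mulrC.
(* The levels count f/D + M, which is nonnegative; the last set is the whole space, with coefficient
   - D M, and undoes the shift. *)
pose A k := if (k < M + M)%N then [set x | k%:R < f x / D + M%:R] else setT.
pose c k := if (k < M + M)%N then D else - (D * M%:R).
exists (M + M).+1, c, A; split.
  move=> k; rewrite /A; case: ifP => // _; apply: measurable_lt_set; first exact: measurable_cst.
  by apply: measurable_funD => //; apply: measurable_funM.
move=> x; rewrite big_ord_recr/= {2}/c {2}/A ltnn indicE mem_set// mulr1.
have -> : \sum_(k < M + M) c k * \1_(A k) x = D * \sum_(k < M + M) ((k%:R < f x / D + M%:R)%R%:R : R).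
  rewrite mulr_sumr; apply: eq_bigr => k _; rewrite /c /A ltn_ord indicE; congr (_ * (nat_of_bool _)%:R).
  by apply/idP/idP => [/set_mem//|h]; exact/mem_set.
set t := f x / D + M%:R.
have fx : `|f x| <= D * M%:R by apply: le_trans (fC x) _; apply: le_trans (ler_norm C) CM.
have ft : f x = D * (t - M%:R) by rewrite /t; field; rewrite gt_eqF.
have fx2 : `|t - M%:R| <= M%:R by move: fx; rewrite ft normrM gtr0_norm// ler_pM2l.
have /andP[t0 tM] : 0 <= t <= (M + M)%:R by rewrite natrD; move: fx2; rewrite ler_norml; lra.
have h1 := count_le (M + M) t0; have := count_ge (M + M) t; rewrite min_r// => h2.
set S := \sum_(k < _) _ in h1 h2 *.
rewrite ft (_ : _ - _ = - D * (S - t)); last by ring.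
rewrite normrM [`|- D|]normrN (gtr0_norm D0) ler_piMr ?(ltW D0)// ler_norml; apply/andP; lra.
Qed.

Context {n : nat}.
Local Notation T := (borel_rV R n).
Variable mu : {measure set T -> \bar R}.
Hypothesis mufin : (mu setT < +oo)%E.

Let bint (f : T -> R) (C : R) : measurable_fun setT f -> (forall x, `|f x| <= C) -> mu.-integrable setT (EFin \o f).
Proof. by move=> mf fC; apply: (bounded_integrable (C := C)). Qed.

Lemma is_test_measurable (g : 'rV[R]_n -> R) : is_test g -> measurable_fun setT (g : T -> R).
Proof. by move=> [G [gG _]]; exact: has_gradient_measurable gG. Qed.

Lemma is_test_bounded (g : 'rV[R]_n -> R) : is_test g -> exists2 C : R, 0 <= C & forall x, `|g x| <= C.
Proof. by move=> [G gG]; have [C C0 h] := test_fun_bounded gG; exists C => // x; case: (h x). Qed.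

Lemma test_dense (f : T -> R) (C e : R) : measurable_fun setT f -> (forall x, `|f x| <= C) -> 0 < e ->
  exists2 g, is_test g & \int[mu]_x `|f x - g x| <= e.
Proof.
move=> mf fC e0; pose K := fine (mu setT); have K0 : 0 <= K by exact: fine_ge0.
pose D := e / 2 / (K + 1); have D0 : 0 < D by rewrite !divr_gt0//; lra.
have DK : D * K <= e / 2 by rewrite /D mulrAC ler_pdivrMr; [rewrite ler_pM2l; lra|lra].
have [N [c [A [mA fA]]]] := step_approx mf fC D0.
pose W := \sum_(k < N) `|c k|; have W0 : 0 <= W by exact: sumr_ge0.
pose eta := e / 2 / (W + 1); have eta0 : 0 < eta by rewrite !divr_gt0//; lra.
have Weta : W * eta <= e / 2 by rewrite mulrC /eta mulrAC ler_pdivrMr; [rewrite ler_pM2l; lra|lra].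
have /choice[g gP] k := test_close_exists measurableT mufin (mA k) eta0.
have gt k : is_test (g k) by case: (gP k).
have mg k := is_test_measurable (gt k).
have mi k : measurable_fun setT (\1_(A k) : T -> R) by exact: measurable_indic.
have dk k : measurable_fun setT ((fun x => `|\1_(A k) x - g k x|) : T -> R).
  by apply: measurableT_comp => //; exact: measurable_funB.
have dki k : mu.-integrable setT (EFin \o ((fun x => `|c k| * `|\1_(A k) x - g k x|) : T -> R)).
  apply: (@bint _ (`|c k| * 2)); first exact: measurable_funM.
  move=> x; rewrite normrM !normr_id ler_wpM2l//; case: (gP k) => _ /(_ x) /andP[? ?] _.
  by rewrite indicE ler_norml; case: (_ \in _) => /=; apply/andP; lra.
exists (fun x => \sum_(k < N) c k * g k x).
  by apply: is_test_sum => k; exact: is_testZ.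
have mG : measurable_fun setT ((fun x => \sum_(k < N) c k * g k x) : T -> R).
  by apply: is_test_measurable; apply: is_test_sum => k; exact: is_testZ.
have [B B0 gB] : exists2 B : R, 0 <= B & forall x, `|\sum_(k < N) c k * g k x| <= B.
  by apply: is_test_bounded; apply: is_test_sum => k; exact: is_testZ.
apply: (@le_trans _ _ (\int[mu]_x (D + \sum_(k < N) `|c k| * `|\1_(A k) x - g k x|))).
  apply: le_Rintegral => //.
  - apply: (@bint _ (C + B)); first by apply: measurableT_comp => //; exact: measurable_funB.
    by move=> x; rewrite normr_id; apply: le_trans (ler_normB _ _) _; exact: lerD.
  - apply: integrableDR => //; last exact: (integrable_sumR _ _ (fun k : 'I_N => dki k)).
    by apply: (@bint _ D) => // x; rewrite gtr0_norm.
  move=> x _; rewrite (_ : f x - _ = (f x - \sum_(k < N) c k * \1_(A k) x) + \sum_(k < N) c k * (\1_(A k) x - g k x)).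
    apply: le_trans (ler_normD _ _) _; apply: lerD => //.
    by apply: le_trans (ler_norm_sum _ _ _) _; apply: ler_sum => k _; rewrite normrM.
  under [X in _ = _ + X]eq_bigr do rewrite mulrBr.
  by rewrite sumrB; ring.
rewrite RintegralD//; last 2 first.
- by apply: (@bint _ D) => // x; rewrite gtr0_norm.
- exact: (integrable_sumR _ _ (fun k : 'I_N => dki k)).
rewrite (@Rintegral_cst _ _ _ mu _ measurableT D) (Rintegral_sum _ measurableT (fun k : 'I_N => dki k)).
apply: (@le_trans _ _ (e / 2 + W * eta)); last lra.
apply: lerD => //; rewrite /W mulr_suml; apply: ler_sum => k _.
rewrite RintegralZl//; last first.
  apply: (@bint _ 2) => // x; case: (gP k) => _ /(_ x) /andP[? ?] _.
  by rewrite normr_id indicE ler_norml; case: (_ \in _) => /=; apply/andP; lra.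
by rewrite ler_wpM2l//; case: (gP k) => _ _ /ltW.
Qed.

Section extension.
Variable Lam : ('rV[R]_n -> R) -> R.
Hypotheses (LamD : forall g h, is_test g -> is_test h -> Lam (fun x => g x + h x) = Lam g + Lam h)
  (LamZ : forall c g, is_test g -> Lam (fun x => c * g x) = c * Lam g)
  (Lam_le : forall g, is_test g -> `|Lam g| <= \int[mu]_x `|g x|).

Let bdd (f : T -> R) := measurable_fun setT f /\ exists C : R, forall x, `|f x| <= C.

Let bdd_int f : bdd f -> mu.-integrable setT (EFin \o f).
Proof. by move=> [mf [C fC]]; exact: bint fC. Qed.

Let bddB f g : bdd f -> bdd g -> bdd (fun x => f x - g x).
Proof.
move=> [mf [C fC]] [mg [B gB]]; split; first exact: measurable_funB.
by exists (C + B) => x; apply: le_trans (ler_normB _ _) _; exact: lerD.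
Qed.

Let bddD f g : bdd f -> bdd g -> bdd (fun x => f x + g x).
Proof.
move=> [mf [C fC]] [mg [B gB]]; split; first exact: measurable_funD.
by exists (C + B) => x; apply: le_trans (ler_normD _ _) _; exact: lerD.
Qed.

Let bddZ c f : bdd f -> bdd (fun x => c * f x).
Proof.
move=> [mf [C fC]]; split; first exact: measurable_funM.
by exists (`|c| * C) => x; rewrite normrM ler_wpM2l.
Qed.

Let bdd_norm f : bdd f -> bdd (fun x => `|f x|).
Proof. by move=> [mf [C fC]]; split; [exact: measurableT_comp|exists C => x; rewrite normr_id]. Qed.

Let bdd_test g : is_test g -> bdd g.
Proof. by move=> gt; split; [exact: is_test_measurable|have [C _ h] := is_test_bounded gt; exists C]. Qed.

Let bdd_indic A : measurable A -> bdd (\1_A : T -> R).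
Proof.
move=> mA; split; first exact: measurable_indic.
by exists 1 => x; exact: normr_indic_le1.
Qed.

Let dist (f g : T -> R) := \int[mu]_x `|f x - g x|.

Let dist_tri f g h : bdd f -> bdd g -> bdd h -> dist g h <= dist f g + dist f h.
Proof.
move=> bf bg bh; rewrite /dist -RintegralD//; [|exact/bdd_int/bdd_norm/bddB..].
apply: le_Rintegral => //; [exact/bdd_int/bdd_norm/bddB|apply/bdd_int/bddD; exact/bdd_norm/bddB|].
move=> x _; rewrite (_ : g x - h x = (f x - h x) - (f x - g x)); last by ring.
by apply: le_trans (ler_normB _ _) _; rewrite addrC.
Qed.

Let dist_dense f e : bdd f -> 0 < e -> exists2 g, is_test g & dist f g <= e.
Proof. by move=> [mf [C fC]] e0; exact: test_dense fC e0. Qed.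

(** McShane's extension of a functional that is 1-Lipschitz for the L^1 distance, evaluated at
    bounded Borel functions. It needs no choice of approximating sequences; linearity follows from
    density of the test functions. *)
Let tau (f : T -> R) : R := sup [set Lam g - dist f g | g in is_test].

Let tauP f g : bdd f -> is_test g -> `|tau f - Lam g| <= dist f g.
Proof.
move=> bf gt; have ub h : is_test h -> Lam h - dist f h <= Lam g + dist f g.
  move=> ht; have := Lam_le (is_testD ht (is_testZ (-1) gt)).
  rewrite LamD ?LamZ//; last exact: is_testZ.
  have -> : \int[mu]_x `|h x + -1 * g x| = dist h g by apply: eq_Rintegral => x _; rewrite mulN1r.
  move=> h1; have := dist_tri bf (bdd_test ht) (bdd_test gt).
  by have := ler_norm (Lam h + -1 * Lam g); lra.
have hs : has_sup [set Lam g - dist f g | g in is_test].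
  by split; [exists (Lam g - dist f g), g|exists (Lam g + dist f g) => _ [h ht <-]; exact: ub].
have h1 : tau f <= Lam g + dist f g.
  by apply: ge_sup => [|_ [h ht <-]]; [case: hs|exact: ub].
have h2 : Lam g - dist f g <= tau f by apply: sup_upper_bound => //; exists g.
by rewrite ler_norml; apply/andP; lra.
Qed.

Let eq_eps (a b : R) : (forall e : R, 0 < e -> `|a - b| <= e) -> a = b.
Proof.
move=> h; apply/eqP; rewrite -subr_eq0 -normr_eq0 eq_le normr_ge0 andbT.
by apply/ler_addgt0Pr => e e0; rewrite add0r; exact: h.
Qed.

Let tau_test g : is_test g -> tau g = Lam g.
Proof.
move=> gt; apply/eqP; rewrite -subr_eq0 -normr_eq0 eq_le normr_ge0 andbT.
apply: le_trans (tauP (bdd_test gt) gt) _.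
rewrite /dist (_ : (fun x => _) = cst 0); last by apply/funext => x; rewrite subrr normr0.
by rewrite (@Rintegral_cst _ _ _ mu _ measurableT 0) mul0r.
Qed.

Let tauD f1 f2 : bdd f1 -> bdd f2 -> tau (fun x => f1 x + f2 x) = tau f1 + tau f2.
Proof.
move=> b1 b2; apply: eq_eps => e e0; have e4 : 0 < e / 4 by lra.
have [g1 t1 d1] := dist_dense b1 e4; have [g2 t2 d2] := dist_dense b2 e4.
have h1 := tauP b1 t1; have h2 := tauP b2 t2; have h3 := tauP (bddD b1 b2) (is_testD t1 t2).
have d3 : dist (fun x => f1 x + f2 x) (fun x => g1 x + g2 x) <= dist f1 g1 + dist f2 g2.
  rewrite /dist -RintegralD//; [|exact/bdd_int/bdd_norm/bddB/bdd_test..].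
  apply: le_Rintegral => //.
  - by apply/bdd_int/bdd_norm/bddB; [exact: bddD|exact/bddD/bdd_test/t2/bdd_test].
  - by apply/bdd_int/bddD; exact/bdd_norm/bddB/bdd_test.
  move=> x _; rewrite (_ : _ - _ = (f1 x - g1 x) + (f2 x - g2 x)); last by ring.
  exact: ler_normD.
rewrite LamD// in h3; move: h1 h2 h3; rewrite !ler_norml => /andP[? ?] /andP[? ?] /andP[? ?].
by apply/andP; lra.
Qed.

Let tauZ c f : bdd f -> tau (fun x => c * f x) = c * tau f.
Proof.
move=> bf; apply: eq_eps => e e0; have c1 : 0 < 2 * (`|c| + 1) by rewrite mulr_gt0// ltr_wpDl.
have ec : 0 < e / (2 * (`|c| + 1)) by exact: divr_gt0.
have [g gt dg] := dist_dense bf ec.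
have h1 := tauP bf gt; have h2 := tauP (bddZ c bf) (is_testZ c gt).
have d2 : dist (fun x => c * f x) (fun x => c * g x) = `|c| * dist f g.
  rewrite /dist -RintegralZl//; last exact/bdd_int/bdd_norm/bddB/bdd_test.
  by apply: eq_Rintegral => x _; rewrite -mulrBr normrM.
rewrite LamZ// d2 in h2; rewrite (_ : _ - _ = (tau (fun x => c * f x) - c * Lam g) - c * (tau f - Lam g)); last by ring.
apply: le_trans (ler_normB _ _) _; rewrite normrM.
have h3 : `|c| * `|tau f - Lam g| <= `|c| * dist f g by rewrite ler_wpM2l.
have h4 : `|c| * dist f g <= `|c| * (e / (2 * (`|c| + 1))) by rewrite ler_wpM2l.
have h5 : (e / (2 * (`|c| + 1))) * (2 * (`|c| + 1)) = e by rewrite mulfVK// gt_eqF.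
by move: h2 h3 h4 h5 ec; lra.
Qed.

Let tau_le f : bdd f -> `|tau f| <= \int[mu]_x `|f x|.
Proof.
move=> bf; have L0 : Lam (fun=> 0) = 0.
  by have := LamZ 0 is_test0; under eq_fun do rewrite mul0r; rewrite mul0r.
have := tauP bf is_test0; rewrite L0 subr0 => h; apply: le_trans h _.
by apply: le_of_eq; apply: eq_Rintegral => x _; rewrite subr0.
Qed.

Let tau0 : tau (cst 0) = 0.
Proof.
have := tau_test is_test0; rewrite -[X in tau X]/(cst 0) => ->.
by have := LamZ 0 is_test0; under eq_fun do rewrite mul0r; rewrite mul0r.
Qed.

Let tau_sum N (F : nat -> T -> R) : (forall k, bdd (F k)) ->
  bdd (fun x => \sum_(k < N) F k x) /\ tau (fun x => \sum_(k < N) F k x) = \sum_(k < N) tau (F k).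
Proof.
move=> bF; elim: N => [|N [IH1 IH2]].
  under eq_fun do rewrite big_ord0; rewrite big_ord0; split; last exact: tau0.
  by split => //; exists 0 => x; rewrite normr0.
under eq_fun do rewrite big_ord_recr; rewrite big_ord_recr/= tauD// IH2; split => //.
exact: bddD.
Qed.

Let nu (A : set T) : \bar R := (tau \1_A)%:E.

Let nu0 : nu set0 = 0%E.
Proof. by rewrite /nu indic0 tau0. Qed.

Let nu_fin A : measurable A -> nu A \is a fin_num. Proof. by []. Qed.

Let sum_eq_nat (j N : nat) : \sum_(i < N) ((i == j :> nat)%:R : R) = (j < N)%N%:R.
Proof.
elim: N => [|N IH]; first by rewrite big_ord0 ltn0.
rewrite big_ord_recr/= IH ltnS [in RHS]leq_eqVlt eq_sym.
by case: eqVneq => [->|_]/=; rewrite ?ltnn ?add0r ?addr0.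
Qed.

Let nu_sigma_additive : semi_sigma_additive nu.
Proof.
move=> F mF tF mUF; set A := \bigcup_k F k in mUF *.
(* For disjoint sets the remainder of the partial sum is the indicator of the union of the tail,
   which tends to 0 at every point. *)
have pw N x : \1_A x - \sum_(k < N) \1_(F k) x = if `[< exists2 j, (N <= j)%N & F j x >] then 1 else 0 :> R.
  have [[j _ Fj]|nA] := pselect (A x); last first.
    rewrite indicE memNset// big1 ?subrr; last by move=> k _; rewrite indicE memNset// => Fk; apply: nA; exists k.
    by case: asboolP => // -[j _ Fj]; exfalso; apply: nA; exists j.
  have uj k : F k x -> k = j by move=> Fk; apply: (tF k j) => //; exists x.
  rewrite indicE mem_set; last by exists j.
  rewrite (eq_bigr (fun k : 'I_N => (nat_of_ord k == j)%:R)); last first.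
    move=> k _; rewrite indicE; congr (nat_of_bool _)%:R; apply/idP/eqP => [/set_mem/uj//|kj].
    by apply/mem_set; rewrite kj.
  rewrite sum_eq_nat; case: asboolP => [[i Ni Fi]|h].
    by rewrite -(uj i Fi) ltnNge Ni subr0.
  by rewrite (_ : (j < N)%N) ?subrr// ltnNge; apply/negP => Nj; apply: h; exists j.
have bA := bdd_indic mUF; have bF k := bdd_indic (mF k).
rewrite (_ : (fun N => _) = EFin \o (fun N => \sum_(k < N) tau \1_(F k))); last first.
  by apply/funext => N; rewrite /= big_mkord -sumEFin.
apply: cvg_EFin; first exact: nearW.
rewrite /nu /=; apply: cvg_sub0; last exact: cvg_cst.
have lim0 : \int[mu]_x (if `[< exists2 j, (N <= j)%N & F j x >] then 1 else 0 : R) @[N --> \oo] --> (0 : R).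
  rewrite -[X in _ --> X](@Rintegral_eq0 _ _ _ mu setT (cst 0))//.
  apply: (@Rbounded_cvg _ _ _ _ _ _ _ 1) => //.
  - move=> N; rewrite (_ : (fun x => _) = fun x => \1_A x - \sum_(k < N) \1_(F k) x).
      by case: (bddB bA (tau_sum N bF).1).
    by apply/funext => x; rewrite pw.
  - move=> x _; apply: cvg_near_cst; have [[j _ Fj]|nA] := pselect (A x).
      exists j.+1 => // N /= jN; case: asboolP => // -[i Ni Fi].
      have ij : i = j by apply: (tF i j) => //; exists x.
      by move: jN; rewrite ltnNge -ij Ni.
    apply: nearW => N; case: asboolP => // -[j _ Fj]; exfalso; apply: nA; exists j => //.
  - by move=> N x; case: asboolP => _; rewrite ?normr1 ?normr0.
apply/cvgrPdist_le => e e0; move/cvgrPdist_le : lim0 => /(_ e e0); apply: filterS => N.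
rewrite sub0r normrN => hN; have [bS tS] := tau_sum N bF.
rewrite sub0r normrN -[X in `|X|]/(\sum_(k < N) tau \1_(F k) - tau \1_A).
have -> : \sum_(k < N) tau \1_(F k) - tau \1_A = - tau (fun x => \1_A x - \sum_(k < N) \1_(F k) x).
  have -> : (fun x => \1_A x - \sum_(k < N) \1_(F k) x) = (fun x => \1_A x + (-1) * \sum_(k < N) \1_(F k) x : R).
    by apply/funext => x; rewrite mulN1r.
  by rewrite tauD ?tauZ// ?tS; [ring|exact: bddZ].
rewrite normrN; apply: le_trans (tau_le (bddB bA bS)) _; apply: le_trans hN.
apply: le_trans (ler_norm _); apply: le_of_eq.
by apply: eq_Rintegral => x _; rewrite pw; case: asboolP => _; rewrite ?normr1 ?normr0.
Qed.

(** On indicators [tau] is a charge dominated by mu. Its Radon-Nikodym derivative represents [tau]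
    on step functions, and uniform approximation by these extends the formula to test functions. *)
Lemma functional_density : exists2 s : T -> R, mu.-integrable setT (EFin \o s) &
  forall g, is_test g -> Lam g = \int[mu]_x (g x * s x).
Proof.
pose nuc : {charge set T -> \bar R} := HB.pack nu (isCharge.Build _ T R nu nu0 nu_fin nu_sigma_additive).
pose m : {finite_measure set T -> \bar R} := finite_alias mufin.
have dom : nuc `<< m.
  move=> A nA B mB BA; have mB0 : mu B = 0%E by exact: (nA B mB BA).
  rewrite -[LHS]/(nu B) /nu; congr EFin; apply/eqP; rewrite -normr_eq0 eq_le normr_ge0 andbT.
  apply: le_trans (tau_le (bdd_indic mB)) _.
  rewrite (_ : \int[mu]_x `|\1_B x| = 0)//.
  transitivity (fine (mu B)); last by rewrite mB0.
  rewrite /Rintegral (measure_indicE mu)//; congr fine; apply: eq_integral => x _.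
  by rewrite indicE; case: (_ \in _); rewrite ?normr1 ?normr0.
pose f := Radon_Nikodym nuc m.
have ffin x : f x \is a fin_num by exact: Radon_Nikodym_fin_num.
have fint : m.-integrable setT f by exact: Radon_Nikodym_integrable.
pose s (x : T) : R := fine (f x).
have sE : EFin \o s = f by apply/funext => x; rewrite /s /= fineK.
have si : mu.-integrable setT (EFin \o s) by rewrite sE; exact: fint.
exists s => //.
have ms : measurable_fun setT s by apply/measurable_EFinP; exact: measurable_int si.
have sA A : measurable A -> tau \1_A = \int[mu]_x (\1_A x * s x).
  move=> mA; rewrite -Rintegral_indic /Rintegral.
  rewrite (eq_integral f); last by move=> x _; rewrite -sE.
  by rewrite -[LHS]/(fine (nuc A)); congr fine; exact: (Radon_Nikodym_integral dom mA).
have asi : mu.-integrable setT (EFin \o (fun x => `|s x|)) by exact: integrable_norm si.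
have bs u : bdd u -> mu.-integrable setT (EFin \o (fun x => u x * s x)).
  move=> [mu_ [C uC]]; have Ci : mu.-integrable setT (EFin \o (fun x => C * `|s x|)) by exact: integrableZR.
  apply: (le_integrable _ _ _ Ci) => //; first by apply/measurable_EFinP; exact: measurable_funM.
  move=> x _ /=; rewrite lee_fin normrM; apply: le_trans (ler_norm _).
  by rewrite ler_wpM2r.
move=> g gt; apply: eq_eps => e e0.
pose K := fine (mu setT); have K0 : 0 <= K by exact: fine_ge0.
pose W := \int[mu]_x `|s x|; have W0 : 0 <= W by apply: Rintegral_ge0.
pose D := e / (K + W + 1); have den : 0 < K + W + 1 by lra.
have D0 : 0 < D by exact: divr_gt0.
have De : D * K + D * W <= e by rewrite -mulrDr /D mulrAC ler_pdivrMr// ler_pM2l//; lra.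
have [C C0 gC] := is_test_bounded gt.
have [N [c [A [mA gA]]]] := step_approx (is_test_measurable gt) gC D0.
pose F k : T -> R := fun x => c k * \1_(A k) x.
have bF k : bdd (F k) by apply: bddZ; exact: bdd_indic.
have [bS tS] := tau_sum N bF; set st := (fun x => \sum_(k < N) F k x) in bS tS.
have bg := bdd_test gt.
have eS : tau st = \int[mu]_x (st x * s x).
  rewrite tS (eq_bigr (fun k : 'I_N => \int[mu]_x (F k x * s x))); last first.
    move=> k _; rewrite /F tauZ ?sA//; last exact: bdd_indic.
    rewrite -RintegralZl//; last by apply: bs; exact: bdd_indic.
    by apply: eq_Rintegral => x _; rewrite mulrA.
  rewrite -(Rintegral_sum _ measurableT (fun k : 'I_N => bs _ (bF k))).
  by apply: eq_Rintegral => x _; rewrite /st mulr_suml.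
have bgS := bddB bg bS.
have tB : tau (fun x => g x - st x) = Lam g - tau st.
  rewrite (_ : (fun x => g x - st x) = fun x => g x + (-1) * st x); last by apply/funext => x; rewrite mulN1r.
  by rewrite (tauD bg (bddZ (-1) bS)) (tauZ (-1) bS) (tau_test gt) mulN1r.
rewrite (_ : _ - _ = tau (fun x => g x - st x) - \int[mu]_x ((g x - st x) * s x)); last first.
  rewrite tB eS (_ : \int[mu]_x ((g x - st x) * s x) = \int[mu]_x (g x * s x) - \int[mu]_x (st x * s x)); first by ring.
  by rewrite -RintegralB//; [apply: eq_Rintegral => x _; rewrite mulrBl|exact: bs..].
apply: le_trans (ler_normB _ _) _; apply: le_trans (_ : D * K + D * W <= e) => //; apply: lerD.
  apply: le_trans (tau_le bgS) _; rewrite -(@Rintegral_cst _ _ _ mu _ measurableT D).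
  apply: le_Rintegral => //; first by apply: bdd_int; exact: bdd_norm.
  by apply: (@bint _ D) => // x; rewrite gtr0_norm.
apply: le_trans (le_normr_Rintegral measurableT (bs _ bgS)) _.
rewrite -RintegralZl//; apply: le_Rintegral => //.
- by apply: integrable_norm; exact: bs.
- exact: integrableZR.
by move=> x _; rewrite normrM ler_wpM2r.
Qed.

End extension.
End density.

Section weighted_measure.
Context {d : measure_display} {T : measurableType d} {R : realType}.

(** The induced measure has a Radon-Nikodym derivative with the same integrals over measurable sets
    as N, hence almost everywhere equal to N; the formula is then the change of variables for this
    derivative. *)
Lemma weighted_measure_exists (sig : {finite_measure set T -> \bar R}) (N : T -> R) :
  (forall x, 0 <= N x) -> sig.-integrable setT (EFin \o N) ->
  exists m : {finite_measure set T -> \bar R},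
    forall (f : T -> R) (C : R), measurable_fun setT f -> (forall x, `|f x| <= C) ->
      \int[m]_x f x = \int[sig]_x (f x * N x).
Proof.
move=> N0 iN; have mN := measurable_int _ iN.
have N0' x : (0 <= (EFin \o N) x)%E by rewrite lee_fin.
pose w (A : set T) : \bar R := (\int[sig]_(x in A) (EFin \o N) x)%E.
have w0 : w set0 = 0%E by rewrite /w integral_set0.
have wge0 A : (0 <= w A)%E by apply: integral_ge0 => x _; exact: N0'.
have wsa : semi_sigma_additive w by exact: (semi_sigma_additive_nng_induced mN N0').
pose m1 : {measure set T -> \bar R} := HB.pack w (isMeasure.Build _ T R w w0 wge0 wsa).
have m1fin : (m1 setT < +oo)%E.
  move/integrableP : iN => [_]; apply: le_lt_trans; rewrite -[leLHS]/(w setT) /w.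
  apply: ge0_le_integral => //; first exact: measurableT_comp.
  by move=> x _; rewrite gee0_abs.
pose m : {finite_measure set T -> \bar R} := finite_alias m1fin.
exists m => f C mf fC.
have fi : m.-integrable setT (EFin \o f) by apply: (bounded_integrable (C := C)).
have dom : m `<< sig.
  move=> A nA B mB BA; rewrite -[LHS]/(w B) /w; apply: (@null_set_integral _ _ _ sig B) => //.
  - exact: measurable_funTS.
  - exact: nA.
rewrite /Rintegral -(Radon_Nikodym_change_of_variables dom measurableT fi); congr fine.
have RN : sig.-integrable setT (Radon_Nikodym (charge_of_finite_measure m) sig) by exact: Radon_Nikodym_integrable.
have mF : measurable_fun setT (EFin \o f) by exact/measurable_EFinP.
apply: ae_eq_integral => //.
- exact: emeasurable_funM.
- by apply/measurable_EFinP; apply: measurable_funM => //; exact/measurable_EFinP.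
have : ae_eq sig setT (Radon_Nikodym (charge_of_finite_measure m) sig) (EFin \o N).
  apply: integral_ae_eq => // A _ mA.
  by rewrite -Radon_Nikodym_integral.
by apply: filterS => x h _; rewrite h.
Qed.
End weighted_measure.

(** * Polar decomposition of the distributional gradient *)

Section gauss_green_existence.
Context {R : realType} {n : nat}.
Local Notation rV := 'rV[R]_n.
Local Notation L := (borel_lebesgue R n).
Local Notation T := (borel_rV R n).
Variables (E : set T) (P : R).
Hypotheses (n_gt0 : (0 < n)%N) (mE : measurable E)
  (hP : forall (i : 'I_n) g G, test_fun g G -> (forall x, `|g x| <= 1) -> \int[L]_(x in E) dot (G x) (delta_mx 0 i) <= P).

Let Lam (i : 'I_n) (g : rV -> R) : R := \int[L]_(x in E) partial g i x.

Let LamE i g G : test_fun g G -> Lam i g = \int[L]_(x in E) dot (G x) (delta_mx 0 i).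
Proof. by move=> [gG _]; apply: eq_Rintegral => x _; rewrite /partial (has_gradient_derive _ _ gG). Qed.

Let LamD i g h : is_test g -> is_test h -> Lam i (fun x => g x + h x) = Lam i g + Lam i h.
Proof.
move=> [G gG] [H hH]; rewrite (LamE i (test_funD gG hH)) (LamE i gG) (LamE i hH) -RintegralD//.
- by apply: eq_Rintegral => x _; rewrite dotDl.
- exact: test_grad_integrable gG mE.
- exact: test_grad_integrable hH mE.
Qed.

Let LamZ i c g : is_test g -> Lam i (fun x => c * g x) = c * Lam i g.
Proof.
move=> [G gG]; rewrite (LamE i (test_funZ c gG)) (LamE i gG) -RintegralZl//.
- by apply: eq_Rintegral => x _; rewrite dotZl.
- exact: test_grad_integrable gG mE.
Qed.

Let LamP i g : is_test g -> (forall x, `|g x| <= 1) -> Lam i g <= P.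
Proof. by move=> gt g1; have [G gG] := gt; rewrite (LamE i gG); have q := (@hP i g G gG g1); apply: le_trans q; apply: le_refl. Qed.

Let V i : {measure set T -> \bar R} := var_measure (LamD i) (LamZ i) (LamP i).

(** The sum sig of the variation measures of the n partial derivatives dominates each of them, which
    gives densities s_i with respect to sig. The pair is mu = |s| sig and nu = s / |s|. *)
Lemma gauss_green_exists : exists (mu : {finite_measure set T -> \bar R}) (nu : rV -> rV),
  scalar_gauss_green E mu nu.
Proof.
(* The family is extended by the zero measure to all natural indices, as [msum] expects. *)
pose W (k : nat) : {measure set T -> \bar R} := oapp V mzero (insub k : option 'I_n).
have WV (i : 'I_n) : W i = V i by rewrite /W valK.
pose sig0 : {measure set T -> \bar R} := msum W n.
have sfin : (sig0 setT < +oo)%E.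
  rewrite -[ltLHS]/(\sum_(k < n) W k setT)%E; apply: lte_sum_pinfty => k _.
  by rewrite WV; apply: le_lt_trans (var_measure_fin _ _ _ _) (ltry P).
pose sig : {finite_measure set T -> \bar R} := finite_alias sfin.
have Lle i g : is_test g -> `|Lam i g| <= \int[sig]_x `|g x|.
  move=> gt; apply: le_trans (Lam_le_integral (LamD i) (LamZ i) (LamP i) gt) _.
  have mg := is_test_measurable gt; have [C C0 gC] := is_test_bounded gt.
  have mag : measurable_fun setT ((fun x => (`|g x|)%:E) : T -> \bar R).
    by apply/measurable_EFinP; exact: measurableT_comp.
  have iV : (V i).-integrable setT (EFin \o ((fun x => `|g x|) : T -> R)).
    apply: (bounded_integrable (C := C)) => //.
    - by apply: le_lt_trans (var_measure_fin _ _ _ _) (ltry P).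
    - exact: measurableT_comp.
    - by move=> x; rewrite normr_id.
  have iS : sig.-integrable setT (EFin \o ((fun x => `|g x|) : T -> R)).
    apply: (bounded_integrable (C := C)) => //.
    - exact: measurableT_comp.
    - by move=> x; rewrite normr_id.
  rewrite -lee_fin !EFin_Rintegral//.
  rewrite -[X in (_ <= X)%E]/(\int[msum W n]_x (`|g x|)%:E)%E ge0_integral_measure_sum//.
  rewrite (bigD1 i)//= WV leeDl//; apply: sume_ge0 => k _; exact: integral_ge0.
have /choice[s sP] : forall i, exists s : T -> R, sig.-integrable setT (EFin \o s) /\
    forall g, is_test g -> Lam i g = \int[sig]_x (g x * s x).
  move=> i; have [s s1 s2] := functional_density (mu := sig) sfin (LamD i) (LamZ i) (Lle i).
  by exists s.
have ms i : measurable_fun setT (s i) by apply/measurable_EFinP; have [si _] := sP i; exact: measurable_int si.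
pose vec (x : T) : rV := \row_i s i x.
have mvec : measurable_fun setT (vec : T -> T).
  by apply: measurable_fun_rV => i; under eq_fun do rewrite mxE; exact: ms.
pose N (x : T) := enorm (vec x).
have mN : measurable_fun setT N by exact: (measurableT_comp measurable_enorm mvec).
have asi i : sig.-integrable setT (EFin \o (fun x => `|s i x|)).
  by apply: integrable_norm; case: (sP i).
have iN : sig.-integrable setT (EFin \o N).
  have i2 : sig.-integrable setT (EFin \o (fun x => \sum_(i < n) `|s i x|)).
    exact: (integrable_sumR _ _ asi).
  apply: (le_integrable _ _ _ i2) => //; first exact/measurable_EFinP.
  move=> x _ /=; rewrite lee_fin !ger0_norm ?sumr_ge0 ?enorm_ge0//.
  rewrite -(ler_pXn2r (n := 2))// ?nnegrE ?sumr_ge0 ?enorm_ge0// sqr_enorm /dot.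
  apply: (@le_trans _ _ (\sum_(i < n) `|s i x| * \sum_(j < n) `|s j x|)); last by rewrite -mulr_suml expr2.
  apply: ler_sum => i _; rewrite mxE -expr2 -real_normK ?num_real// expr2 ler_wpM2l//.
  by rewrite (bigD1 i)//= lerDl sumr_ge0.
have [m hm] := weighted_measure_exists (fun x => enorm_ge0 (vec x)) iN.
pose e1 : rV := delta_mx 0 (Ordinal n_gt0).
have e11 : enorm e1 = 1.
  rewrite /enorm /dot (bigD1 (Ordinal n_gt0))//= big1 ?addr0 ?mxE ?eqxx ?mulr1 ?sqrtr1// => i i0.
  by rewrite !mxE (negbTE i0) andbF mulr0.
(* The unit vector [e1] where the density vanishes is a default value; it makes |nu| = 1 hold
   everywhere, and the set has mu-measure 0. *)
pose nu (x : T) : rV := if N x == 0 then e1 else (N x)^-1 *: vec x.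
have mnu : measurable_fun setT (nu : T -> T).
  apply: measurable_fun_ifT.
  - apply: measurable_fun_eqr => //; exact: measurable_cst.
  - exact: measurable_cst.
  - apply: measurable_rVZ => //; rewrite (_ : (fun x => _) = (fun x => N x `^ (-1))).
      exact: (measurableT_comp (measurable_powR _) mN).
    by apply/funext => x; rewrite powR_inv1 ?enorm_ge0.
exists m, nu; split => //.
- move=> x; rewrite /nu; case: eqVneq => // N0.
  by rewrite enormZ normfV ger0_norm ?enorm_ge0// mulVf.
- by rewrite -ge0_fin_numE//; exact: fin_num_measure.
move=> g G h gG; have gt : is_test g by exists G.
have [C C0 gC] := is_test_bounded gt; have mg := is_test_measurable gt.
have nuN x : N x *: nu x = vec x.
  rewrite /nu; case: eqVneq => [N0|N0]; last by rewrite scalerA mulfV// scale1r.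
  by rewrite N0 scale0r; apply/esym/eqP; rewrite -enorm_eq0 -/(N x) N0.
have gsi i : sig.-integrable setT (EFin \o (fun x => g x * s i x)).
  have Ci : sig.-integrable setT (EFin \o (fun x => C * `|s i x|)) by exact: integrableZR.
  apply: (le_integrable _ _ _ Ci) => //; first by apply/measurable_EFinP; exact: measurable_funM.
  move=> x _ /=; rewrite lee_fin normrM; apply: le_trans (ler_norm _).
  by rewrite ler_wpM2r.
rewrite (hm _ (C * enorm h)); last 2 first.
- by apply: measurable_funM => //; apply: measurable_dot => //; exact: measurable_cst.
- move=> x; rewrite normrM ler_pM//; apply: le_trans (normr_dot _ _) _.
  rewrite (_ : enorm (nu x) = 1) ?mulr1// /nu; case: eqVneq => // N0.
  by rewrite enormZ normfV ger0_norm ?enorm_ge0// mulVf.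
transitivity (\sum_(i < n) h 0 i * Lam i g).
  rewrite (eq_bigr (fun i => \int[L]_(x in E) (h 0 i * dot (G x) (delta_mx 0 i)))); last first.
    by move=> i _; rewrite (LamE i gG) -RintegralZl//; exact: test_grad_integrable gG mE.
  rewrite -(Rintegral_sum _ mE); last by move=> i; apply: integrableZR => //; exact: test_grad_integrable gG mE.
  apply: eq_Rintegral => x _; rewrite /dot; apply: eq_bigr => i _.
  rewrite mulrC (bigD1 i)//= big1 ?addr0 ?mxE ?eqxx ?mulr1// => j ji.
  by rewrite mxE (negbTE ji) andbF mulr0.
rewrite (eq_bigr (fun i => \int[sig]_x (h 0 i * (g x * s i x)))); last first.
  by move=> i _; rewrite RintegralZl//; case: (sP i) => _ ->.
rewrite -(Rintegral_sum _ measurableT); last by move=> i; exact: integrableZR.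
apply: eq_Rintegral => x _; rewrite -mulrA [dot h (nu x) * _]mulrC -dotZr nuN /dot mulr_sumr.
by apply: eq_bigr => i _; rewrite mxE mulrCA.
Qed.

End gauss_green_existence.

(** * Besicovitch covering and differentiation *)

Section uniqueness.
Context {R : realType} {n : nat}.
Local Notation T := (borel_rV R n).
Context {E : set T} {mu mu' : {measure set T -> \bar R}} {nu nu' : 'rV[R]_n -> 'rV[R]_n}.

(** For test functions both sides equal the same integral over [E], and test functions are dense in
    L^1 of mu + mu'. *)
Lemma gauss_green_unique_integral h (s : T -> R) (C : R) : scalar_gauss_green E mu nu ->
  scalar_gauss_green E mu' nu' -> measurable_fun setT s -> (forall x, `|s x| <= C) ->
  \int[mu]_x (s x * dot h (nu x)) = \int[mu']_x (s x * dot h (nu' x)).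
Proof.
move=> gg gg' ms sC; have [_ nu1 mufin gE] := gg; have [_ nu1' mufin' gE'] := gg'.
pose sig : {measure set T -> \bar R} := measure_add mu mu'.
have sigE A : sig A = (mu A + mu' A)%E by exact: measure_addE.
have sigfin : (sig setT < +oo)%E by rewrite sigE lte_add_pinfty.
apply/eqP; rewrite -subr_eq0 -normr_le0; apply/ler_addgt0Pl => e e0; rewrite addr0.
pose c := 2 * enorm h + 1.
have h0 := enorm_ge0 h.
have c0 : 0 < c by rewrite /c; lra.
have [g gt gs] := test_dense sigfin ms sC (divr_gt0 e0 c0).
have mg := is_test_measurable gt; have [D D0 gD] := is_test_bounded gt.
have msg : measurable_fun setT ((fun x => s x - g x) : T -> R) by exact: measurable_funB.
have sgD x : `|s x - g x| <= C + D by apply: le_trans (ler_normB _ _) _; exact: lerD.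
have isg (m : {measure set T -> \bar R}) : (m setT < +oo)%E ->
    m.-integrable setT (EFin \o (fun x => `|s x - g x|)).
  move=> mfin; apply: (bounded_integrable (C := (C + D))) => //; first exact: measurableT_comp.
  by move=> x; rewrite normr_id.
have key (m : {measure set T -> \bar R}) w : scalar_gauss_green E m w -> (forall A, (m A <= sig A)%E) ->
    `|\int[m]_x (s x * dot h (w x)) - \int[m]_x (g x * dot h (w x))| <= enorm h * (e / c).
  move=> mw mle; have [_ w1 mfin _] := mw.
  have msw := @nu_dot_integrable _ _ E m w mw h s C setT measurableT ms sC.
  have mgw := @nu_dot_integrable _ _ E m w mw h g D setT measurableT mg gD.
  rewrite -RintegralB//; apply: (le_trans (le_normr_Rintegral _ _)) => //; first exact: integrableBR.
  apply: (@le_trans _ _ (\int[m]_x (enorm h * `|s x - g x|))).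
    apply: le_Rintegral => //.
    - by apply: integrable_norm; exact: integrableBR.
    - by apply: integrableZR => //; exact: isg.
    - by move=> x _; rewrite -mulrBl normrM mulrC ler_wpM2r// (nu_dot_le mw).
  rewrite RintegralZl//; last exact: isg.
  rewrite ler_wpM2l//; apply: le_trans gs.
  rewrite -lee_fin !EFin_Rintegral//; try exact: isg.
  apply: (@ge0_le_measure_integral _ _ _ m sig (fun A _ => mle A) _ setT measurableT) => //.
  by apply/measurable_EFinP; exact: measurableT_comp.
have k2 : `|\int[mu']_x (s x * dot h (nu' x)) - \int[mu']_x (g x * dot h (nu' x))| <= enorm h * (e / c).
  by apply: key => // A; rewrite sigE leeDr.
have k3 : `|\int[mu]_x (s x * dot h (nu x)) - \int[mu]_x (g x * dot h (nu x))| <= enorm h * (e / c).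
  by apply: key => // A; rewrite sigE leeDl.
have gEE : \int[mu]_x (g x * dot h (nu x)) = \int[mu']_x (g x * dot h (nu' x)).
  by have [G gG] := gt; rewrite -(gE g G h gG) -(gE' g G h gG).
move: k2 k3; rewrite gEE => k2 k3.
apply: le_trans (ler_distD (\int[mu']_x (g x * dot h (nu' x))) _ _) _.
rewrite [X in _ + X]distrC; apply: le_trans (lerD k3 k2) _.
set q := e / c; have q0 : 0 < q by rewrite divr_gt0.
have -> : e = q * c by rewrite mulfVK ?gt_eqF.
by rewrite /c; nra.
Qed.
End uniqueness.

(** Take the functions 1_A nu_i and the basis vectors and sum over i: mu(A) is the integral over A
    of nu . nu' against mu', at most mu'(A) by Cauchy-Schwarz. By symmetry the measures coincide. *)
Lemma gauss_green_unique_le {R : realType} {n : nat} {E : set (borel_rV R n)}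
    {mu mu' : {measure set (borel_rV R n) -> \bar R}} {nu nu' : 'rV[R]_n -> 'rV[R]_n} A :
  scalar_gauss_green E mu nu -> scalar_gauss_green E mu' nu' -> measurable A -> (mu A <= mu' A)%E.
Proof.
move=> gg gg' mA; have [mnu nu1 mufin gE] := gg; have [mnu' nu1' mufin' gE'] := gg'.
have muA := mu_fin gg mA; have muA' := mu_fin gg' mA.
rewrite -(@fineK _ (mu A)) ?ge0_fin_numE// -(@fineK _ (mu' A)) ?ge0_fin_numE// lee_fin.
have coordE i (w : 'rV[R]_n) : dot (delta_mx 0 i) w = w 0 i.
  rewrite /dot (bigD1 i)//= big1 ?addr0 ?mxE ?eqxx ?mul1r// => j ji.
  by rewrite mxE (negbTE ji) andbF mul0r.
pose s i (x : borel_rV R n) : R := \1_A x * nu x 0 i.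
have s1 i x : `|s i x| <= 1.
  rewrite /s indicE normrM; case: (_ \in _); rewrite ?normr0 ?mul0r// normr1 mul1r.
  by rewrite -(nu1 x) ler_coord_enorm.
have ms i : measurable_fun setT (s i).
  by apply: measurable_funM; [exact: measurable_indic|exact: (measurableT_comp (measurable_rV_coord i) mnu)].
have i1 i : mu.-integrable setT (EFin \o (fun x => s i x * dot (delta_mx 0 i) (nu x))).
  exact: (@nu_dot_integrable _ _ E mu nu gg _ (s i) 1).
have i2 i : mu'.-integrable setT (EFin \o (fun x => s i x * dot (delta_mx 0 i) (nu' x))).
  exact: (@nu_dot_integrable _ _ E mu' nu' gg' _ (s i) 1).
have indE (m : {measure set (borel_rV R n) -> \bar R}) : (m A < +oo)%E -> fine (m A) = \int[m]_x \1_A x.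
  by move=> _; rewrite /Rintegral -measure_indicE.
rewrite !indE//.
have -> : \int[mu]_x \1_A x = \sum_i \int[mu]_x (s i x * dot (delta_mx 0 i) (nu x)).
  rewrite -(Rintegral_sum _ measurableT i1); apply: eq_Rintegral => x _.
  transitivity (\1_A x * dot (nu x) (nu x)); first by rewrite -sqr_enorm nu1 expr1n mulr1.
  by rewrite [dot (nu x) (nu x)]/dot mulr_sumr; apply: eq_bigr => i _; rewrite coordE /s mulrA.
under eq_bigr => i _ do rewrite (gauss_green_unique_integral (delta_mx 0 i) gg gg' (ms i) (s1 i)).
rewrite -(Rintegral_sum _ measurableT i2); apply: le_Rintegral => //.
- exact: (integrable_sumR _ measurableT i2).
- by apply: (bounded_integrable (C := 1)) => // x; exact: normr_indic_le1.
move=> x _; rewrite (eq_bigr (fun i => \1_A x * (nu x 0 i * nu' x 0 i))); last first.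
  by move=> i _; rewrite /= (coordE i (nu' x)) /s mulrA.
rewrite -mulr_sumr -[X in _ <= X]mulr1 ler_wpM2l ?indicE//.
by apply: le_trans (cauchy_schwarz (nu x) (nu' x)) _; rewrite nu1 nu1' mulr1.
Qed.

(** * Packings and bounded overlap of balls *)

Section packing.
Context {R : realType}.

Lemma overlap_sum_le {d} {T : measurableType d} (mu : {measure set T -> \bar R}) (I : Type)
    (s : seq I) (F : I -> set T) (f : T -> R) (C : R) :
  (forall i, measurable (F i)) -> measurable_fun setT f -> (forall x, 0 <= f x) -> 0 <= C ->
  (forall x, f x != 0 -> \sum_(i <- s) \1_(F i) x <= C) ->
  (\sum_(i <- s) \int[mu]_x (\1_(F i) x * f x)%:E <= C%:E * \int[mu]_x (f x)%:E)%E.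
Proof.
move=> mF mf f0 C0 FC.
have m1 i : measurable_fun setT (fun x => (\1_(F i) x * f x)%:E).
  by apply/measurable_EFinP; apply: measurable_funM => //; exact: measurable_indic.
have p1 i x : (0 <= (\1_(F i) x * f x)%:E)%E by rewrite lee_fin mulr_ge0 ?indicE.
have mfE : measurable_fun setT (EFin \o f) by exact/measurable_EFinP.
rewrite -ge0_integral_sum// -ge0_integralZl_EFin//.
apply: ge0_le_integral => //.
- by move=> x _; apply: sume_ge0.
- exact: emeasurable_sum.
- exact: measurable_funeM.
- move=> x _; rewrite sumEFin lee_fin -mulr_suml.
  have [->|fx] := eqVneq (f x) 0; first by rewrite !mulr0.
  by rewrite ler_wpM2r// FC.
by move=> x _; rewrite lee_fin.
Qed.

Lemma disjoint_indic_sum (I : eqType) (T : Type) (F : I -> set T) (s : seq I) (y : T) :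
  pairwise (fun i j => `[< ~ (F i y /\ F j y) >]) s -> \sum_(i <- s) \1_(F i) y <= 1 :> R.
Proof.
elim: s => [|i s IH] /=; first by rewrite big_nil.
move=> /andP[/allP ai ps]; rewrite big_cons.
have [Fi|Fi] := pselect (F i y); last by rewrite indicE memNset// add0r; exact: IH.
rewrite [X in X + _]indicE mem_set// big1_seq ?addr0// => j /andP[_ js].
by have /asboolP h := ai j js; rewrite indicE memNset// => Fj; apply: h.
Qed.

Lemma disjoint_mass_bound {d} {T : measurableType d} (mu : {measure set T -> \bar R}) (I : eqType)
    (F : I -> set T) (U : set T) (c : R) : measurable U -> (mu U < +oo)%E ->
  (forall i, measurable (F i)) -> 0 < c ->
  exists N, forall s : seq I, (forall i, i \in s -> F i `<=` U /\ (c%:E <= mu (F i))%E) ->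
    pairwise (fun i j => `[< F i `&` F j = set0 >]) s -> (size s <= N)%N.
Proof.
move=> mU muU mF c0; have cU0 : 0 <= c^-1 * fine (mu U) by rewrite mulr_ge0 ?invr_ge0 ?(ltW c0)// fine_ge0.
exists (Num.truncn (c^-1 * fine (mu U))) => s sP ps.
have /overlap_sum_le : forall i, measurable (F i) by [].
move=> /(_ mu s \1_U 1 (measurable_indic mU)) h.
have : (\sum_(i <- s) \int[mu]_x (\1_(F i) x * \1_U x)%:E <= 1%:E * \int[mu]_x (\1_U x)%:E)%E.
  apply: h => // x _; apply: disjoint_indic_sum; apply: sub_pairwise ps => i j /asboolP ij.
  by apply/asboolP => -[Fi Fj]; have : (F i `&` F j) x by []; rewrite ij.
rewrite mul1e -measure_indicE// => h2.
have : (\sum_(i <- s) c%:E <= mu U)%E.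
  apply: le_trans h2; rewrite big_seq [leRHS]big_seq; apply: lee_sum => i si.
  have [FU cF] := sP i si; rewrite (le_trans cF)// measure_indicE//.
  rewrite (_ : (fun x => _) = (fun x => (\1_(F i) x)%:E))//; apply/funext => x; congr EFin.
  rewrite !indicE; have [Fx|Fx] := pselect (F i x); first by rewrite !mem_set ?mulr1//; exact: FU.
  by rewrite (memNset Fx) mul0r.
rewrite sumEFin big_const_seq count_predT iter_addr_0 -(@fineK _ (mu U)) ?ge0_fin_numE// lee_fin.
rewrite -mulr_natl -ler_pdivlMr// [X in _ <= X]mulrC => h3.
by rewrite truncn_ge_nat.
Qed.

Context {n : nat}.
Local Notation rV := 'rV[R]_n.
Local Notation L := (borel_lebesgue R n).

Lemma lebesgue_eballE (x : rV) r : 0 < r ->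
  L (eball x r) = ((r ^+ n)%:E * L (eball (0 : rV) 1))%E.
Proof.
by move=> r0; rewrite -(lebesgue_dilate x r0 (measurable_eball 0 1)) dilate_eball// mulr1.
Qed.

(** The balls of radius r/2 around the points are disjoint, of equal volume, and contained in one
    fixed ball. *)
Lemma packing (M r : R) : 0 < r -> exists N, forall s : seq rV,
  (forall x, x \in s -> enorm x <= M) ->
  pairwise (fun x y => r <= enorm (x - y)) s -> (size s <= N)%N.
Proof.
move=> r0; have r2 : 0 < r / 2 by rewrite divr_gt0.
pose c := (r / 2) ^+ n * fine (L (eball (0 : rV) 1)).
have Lf : L (eball (0 : rV) 1) \is a fin_num by rewrite ge0_fin_numE// lebesgue_eball_lty.
have c0 : 0 < c by rewrite mulr_gt0 ?exprn_gt0// fine_gt0// lebesgue_eball_lty lebesgue_eball_gt0.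
have [N NP] := @disjoint_mass_bound _ (borel_rV R n) L rV (fun x => eball x (r / 2))
  (eball 0 (M + r)) c (measurable_eball _ _) (lebesgue_eball_lty _ _) (fun x => measurable_eball _ _) c0.
exists N => s sM ps; apply: NP.
- move=> x xs; split.
  + move=> y; rewrite /eball /= subr0 => yx.
    by have := ler_enorm_dist y x 0; have := sM x xs; rewrite !subr0; lra.
  + apply: (@le_trans _ _ (((r / 2) ^+ n)%:E * L (eball (0 : rV) 1))%E); first by rewrite /c EFinM fineK.
    by have := lebesgue_eballE x r2 => /= ->.
- apply: sub_pairwise ps => x y xy; apply/asboolP; rewrite -subset0 => z [].
  rewrite /eball /= => zx zy; have := ler_enorm_dist x z y; rewrite (enormB x z); lra.
Qed.

(* Such a and b make an angle of at least 60 degrees. *)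
Lemma direction_separated (a b : rV) : enorm a < enorm (a - b) -> enorm b < enorm (a - b) ->
  1 <= enorm ((enorm a)^-1 *: a - (enorm b)^-1 *: b).
Proof.
move=> ha hb.
have a0 : 0 < enorm a.
  rewrite lt_neqAle enorm_ge0 andbT eq_sym enorm_eq0; apply/eqP => a0.
  by move: hb; rewrite a0 sub0r enormN ltxx.
have b0 : 0 < enorm b.
  rewrite lt_neqAle enorm_ge0 andbT eq_sym enorm_eq0; apply/eqP => b0.
  by move: ha; rewrite b0 subr0 ltxx.
have sq (x y : rV) : enorm (x - y) ^+ 2 = enorm x ^+ 2 - 2 * dot x y + enorm y ^+ 2.
  by rewrite !sqr_enorm dotBl !dotBr (dotC y x); ring.
have u1 (x : rV) : 0 < enorm x -> enorm ((enorm x)^-1 *: x) = 1.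
  by move=> x0; rewrite enormZ normfV ger0_norm ?ltW// mulVf ?gt_eqF.
have d1 : 2 * dot a b < enorm b ^+ 2.
  by move: ha; rewrite -(ltr_sqr0 (enorm_ge0 _) (enorm_ge0 _)) sq; lra.
have d2 : 2 * dot a b < enorm a ^+ 2.
  by move: hb; rewrite -(ltr_sqr0 (enorm_ge0 _) (enorm_ge0 _)) sq; lra.
have d3 : 2 * dot a b <= enorm a * enorm b by nra.
rewrite -(ler_sqr0 ler01 (enorm_ge0 _)) expr1n sq !u1// dotZl dotZr !expr1n.
have : (enorm a)^-1 * ((enorm b)^-1 * dot a b) * 2 <= 1; last by lra.
rewrite mulrA -invfM mulrC mulrCA -ler_pdivlMl ?invr_gt0 ?mulr_gt0// invrK mulr1.
by apply: le_trans d3 _; rewrite mulrC.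
Qed.

(** No centre lies in another ball of the family. By [direction_separated], the directions from y to
    the centres of the balls containing y are then at mutual distance at least 1, so [packing]
    bounds their number. *)
Lemma bounded_overlap : exists N : nat, forall (I : eqType) (c : I -> rV) (r : I -> R) (s : seq I),
  pairwise (fun i j => (r i <= enorm (c i - c j)) && (r j <= enorm (c i - c j))) s ->
  forall y, \sum_(i <- s) \1_(eball (c i) (r i)) y <= N%:R :> R.
Proof.
have [N NP] := @packing 1 1 ltr01; exists N => I c r s ps y.
pose t := [seq i <- s | `[< eball (c i) (r i) y >]].
pose u i : rV := (enorm (c i - y))^-1 *: (c i - y).
have -> : \sum_(i <- s) \1_(eball (c i) (r i)) y = (size t)%:R :> R.
  rewrite size_filter -sum1_count natr_sum [RHS]big_mkcond /=; apply: eq_bigr => i _.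
  rewrite indicE; case: asboolP => h; first by rewrite mem_set.
  by rewrite memNset.
rewrite ler_nat -(size_map u); apply: NP.
- move=> x /mapP[i _ ->]; rewrite /u enormZ normfV ger0_norm ?enorm_ge0//.
  by have [->|h] := eqVneq (enorm (c i - y)) 0; rewrite ?mulr0// mulVf.
rewrite pairwise_map.
have tP : all (fun i => `[< eball (c i) (r i) y >]) t by exact: filter_all.
have := pairwise_filter (fun i => `[< eball (c i) (r i) y >]) ps; rewrite -/t.
apply: sub_in_pairwise tP => i j /asboolP iy /asboolP jy /andP[h1 h2] /=.
move: iy jy; rewrite /eball /= !(enormB y) => iy jy.
have E : c i - c j = (c i - y) - (c j - y) by rewrite opprB addrA subrK.
by apply: direction_separated; rewrite -E; lra.
Qed.

End packing.

(* Level by level, a maximal set of points compatible with those already chosen. *)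
Lemma maximal_stages (X : eqType) (P : nat -> set X) (sep : rel (X * nat)) :
  (forall k, exists N, forall s : seq (X * nat), (forall p, p \in s -> P p.2 p.1 /\ (p.2 <= k)%N) ->
    pairwise sep s -> (size s <= N)%N) ->
  exists ext st : nat -> seq (X * nat), [/\ st 0%N = [::],
    forall k, st k.+1 = ext k ++ st k,
    forall k, pairwise sep (st k),
    forall k p, p \in ext k -> P k p.1 /\ p.2 = k &
    forall k x, P k x -> exists2 p, p \in st k.+1 & ~~ sep (x, k) p].
Proof.
move=> Pbound.
pose good k (l : seq (X * nat)) := pairwise sep l /\ forall p, p \in l -> P p.2 p.1 /\ (p.2 < k)%N.
pose okext k l e := [/\ pairwise sep (e ++ l) & forall p, p \in e -> P k p.1 /\ p.2 = k].
have step k l : exists e, good k l -> okext k l e /\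
    forall x, P k x -> exists2 p, p \in e ++ l & ~~ sep (x, k) p.
  have [gl|gl] := pselect (good k l); last by exists [::].
  have [N NP] := Pbound k.
  have szN e : okext k l e -> (size e <= N)%N.
    move=> [pe eP]; apply: (@leq_trans (size (e ++ l))); first by rewrite size_cat leq_addr.
    apply: NP => // p; rewrite mem_cat => /orP[/eP[Pp ->]//|pl].
    by have [_ /(_ p pl)[Pp pk]] := gl; split => //; exact: ltnW.
  pose Q j := `[< exists2 e, okext k l e & size e = j >].
  have Q0 : exists j, Q j by exists 0%N; apply/asboolP; exists [::] => //; split => //; case: gl.
  have QN j : Q j -> (j <= N)%N by move=> /asboolP[e eo <-]; exact: szN.
  case: (ex_maxnP Q0 QN) => j /asboolP[e eo ej] jmax; exists e => _; split => // x Px.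
  apply: contrapT => nex; have : (j.+1 <= j)%N; last by rewrite ltnn.
  apply: jmax; apply/asboolP; exists ((x, k) :: e); last by rewrite /= ej.
  have [pe eP] := eo; split; last by move=> p; rewrite inE => /orP[/eqP ->//|/eP].
  rewrite /= pe andbT; apply/allP => p pel; apply/negPn/negP => np.
  by apply: nex; exists p.
have /choice[F FP] : forall kl, exists e, good kl.1 kl.2 -> okext kl.1 kl.2 e /\
    forall x, P kl.1 x -> exists2 p, p \in e ++ kl.2 & ~~ sep (x, kl.1) p.
  by move=> [k l]; exact: step.
pose st := fix st k := if k is k'.+1 then F (k', st k') ++ st k' else [::].
have gst k : good k (st k).
  elim: k => [|k IH]; first by split.
  have [[p1 p2] _] := FP (k, st k) IH; split => //= p.
  rewrite mem_cat => /orP[/p2[Pp pk]|]; first by rewrite pk.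
  by move=> pl; have [_ /(_ p pl)[Pp pk]] := IH; split => //; exact: ltnW.
exists (fun k => F (k, st k)), st; split => //.
- by move=> k; case: (gst k).
- by move=> k p pk; have [[_ h] _] := FP (k, st k) (gst k); exact: h.
- by move=> k x Px; have [_ h] := FP (k, st k) (gst k); exact: h.
Qed.

(** * Weak type inequality and Lebesgue points *)

Section differentiation.
Context {R : realType} {n : nat}.
Local Notation rV := 'rV[R]_n.
Local Notation T := (borel_rV R n).
Variable mu : {finite_measure set T -> \bar R}.

Let mufin (A : set T) : measurable A -> (mu A < +oo)%E.
Proof. by move=> mA; rewrite -ge0_fin_numE//; exact: fin_num_measure. Qed.

Section maximal_function.
Variables (w : T -> R) (B : R).
Hypotheses (mw : measurable_fun setT w) (w0 : forall x, 0 <= w x) (wB : forall x, w x <= B).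

Definition ball_mass (rho : R) (x : T) : R := \int[mu]_y (\1_(eball (x : rV) rho) y * w y).

Let mball x rho : measurable (eball (x : rV) rho : set T).
Proof. exact: measurable_eball. Qed.

Let wn x : `|w x| <= B.
Proof. by rewrite ger0_norm. Qed.

Let iw : mu.-integrable setT (EFin \o w).
Proof. by apply: (bounded_integrable (C := B)) => //; exact: mufin. Qed.

Let ibw x rho : mu.-integrable setT (EFin \o (fun y => \1_(eball (x : rV) rho) y * w y)).
Proof.
apply: (bounded_integrable (C := B)) => //; first exact: mufin.
- by apply: measurable_funM => //; exact: measurable_indic.
- move=> y; rewrite indicE; case: (_ \in _); rewrite ?mul1r ?wn// mul0r normr0.
  exact: le_trans (w0 y) (wB y).
Qed.

Lemma measurable_ball_mass rho : measurable_fun setT (ball_mass rho).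
Proof.
have mf : measurable_fun setT
    ((fun p => (\1_(eball (0 : rV) rho) ((p.2 : rV) - (p.1 : rV)) * w p.2)%:E) : T * T -> \bar R).
  apply/measurable_EFinP; apply: measurable_funM; last exact: (measurableT_comp mw measurable_snd).
  apply: (@measurableT_comp _ _ _ _ _ _ (\1_(eball (0 : rV) rho) : T -> R) _
    (fun p : T * T => (p.2 : rV) - (p.1 : rV) : T)).
    exact: measurable_indic.
  by measurable_rV.
have f0 p : (0 <= (\1_(eball (0 : rV) rho) ((p.2 : rV) - (p.1 : rV)) * w p.2)%:E)%E.
  by rewrite lee_fin mulr_ge0 ?indicE.
have := @measurable_fun_fubini_tonelli_F _ _ T T R mu _ mf f0.
move=> mF; rewrite (_ : ball_mass rho = fine \o fubini_F mu
    (fun p : T * T => (\1_(eball (0 : rV) rho) ((p.2 : rV) - (p.1 : rV)) * w p.2)%:E)).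
  by apply: (@measurableT_comp _ _ _ _ _ _ (fine : \bar R -> R)) => //; exact: fine_measurable.
apply/funext => x; rewrite /ball_mass /Rintegral /fubini_F; congr fine.
apply: eq_integral => y _ /=; congr (_ * _)%:E.
by rewrite !indicE; congr (_%:R); congr nat_of_bool; apply/idP/idP => /set_mem h; apply/mem_set;
  move: h; rewrite /eball /= subr0.
Qed.

Lemma ball_massE rho x : (ball_mass rho x)%:E = (\int[mu]_y (\1_(eball (x : rV) rho) y * w y)%:E)%E.
Proof. exact: EFin_Rintegral. Qed.

Lemma ball_mass_homo r s x : r <= s -> ball_mass r x <= ball_mass s x.
Proof.
move=> rs; apply: le_Rintegral => // y _; rewrite ler_wpM2r// !indicE.
have [h|h] := pselect (eball x r y); last by rewrite memNset.
by rewrite !mem_set//; exact: lt_le_trans rs.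
Qed.

(** An open ball is the increasing union of smaller concentric ones, so the mass is left continuous
    in the radius. This allows the passage to dyadic radii. *)
Lemma ball_mass_left (rho t : R) x : 0 < rho -> t < ball_mass rho x ->
  exists2 s : R, 0 <= s < rho & t < ball_mass s x.
Proof.
move=> r0 tx; pose s (j : nat) : R := rho - rho * j.+1%:R^-1.
have cv : ball_mass (s j) x @[j --> \oo] --> ball_mass rho x.
  apply: (@Rbounded_cvg _ _ _ _ setT _ _ B) => //; first exact: mufin.
  - by move=> j; apply: measurable_funM => //; exact: measurable_indic.
  - by apply: measurable_funM => //; exact: measurable_indic.
  - move=> y _; apply: (@cvgMr_tmp _ _ _ _ (fun j => \1_(eball x (s j)) y)).
    have [yr|yr] := pselect (eball x rho y).
      rewrite [\1_(eball x rho) y]indicE mem_set//.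
      apply: cvg_near_cst; move: yr; rewrite /eball /= => yr.
      have d0 : 0 < (rho - enorm ((y : rV) - x)) / rho by rewrite divr_gt0// subr_gt0.
      near=> j; rewrite indicE mem_set// /eball /= /s.
      have : j.+1%:R^-1 < (rho - enorm ((y : rV) - x)) / rho.
        near: j; exact: (near_infty_natSinv_lt (PosNum d0)).
      set q := j.+1%:R^-1; rewrite ltr_pdivlMr// => h.
      by have := mulrC rho q; lra.
    rewrite [\1_(eball x rho) y]indicE memNset//; apply: cvg_near_cst; near=> j.
    rewrite indicE memNset// => h; apply: yr; apply: lt_le_trans h _.
    by rewrite /s gerBl mulr_ge0 ?ltW// invr_ge0.
  - move=> j y; rewrite indicE; case: (_ \in _); rewrite ?mul1r ?wn// mul0r normr0.
    exact: le_trans (w0 y) (wB y).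
have [N _ NP] : \forall j \near \oo, t < ball_mass (s j) x by exact: (cvgr_gt _ cv).
exists (s N); last exact: NP N (leqnn N).
rewrite /s; apply/andP; split; last by rewrite gtrBl mulr_gt0// invr_gt0.
by rewrite subr_ge0 ler_pdivrMr// ler_peMr ?ler1n// ltW.
Unshelve. all: by end_near. Qed.

End maximal_function.

(** The mean of w over the ball exceeds lam, written without division: the ball has small mu-mass
    compared with its mass for w mu. *)
Definition small_mass (w : T -> R) (lam : R) (x : T) (rho : R) :=
  lam * ball_mass (fun=> 1) rho x < ball_mass w rho x.

Definition maximal_set (w : T -> R) (lam : R) : set T :=
  [set x | exists2 rho : R, 0 < rho < 1 & small_mass w lam x rho].

(** Besicovitch's covering argument. Disks of bounded overlap cover the set, each with mu-mass less
    than its w mu-mass divided by lam. Dyadic radii and bounded centres make the selection finite,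
    and they show that the set is Borel. *)
Lemma weak_type : exists2 N : nat, (0 < N)%N & forall (w : T -> R) (B lam : R), measurable_fun setT w ->
  (forall x, 0 <= w x) -> (forall x, w x <= B) -> 0 < lam ->
  measurable (maximal_set w lam) /\
  (lam%:E * mu (maximal_set w lam) <= N%:R%:E * \int[mu]_x (w x)%:E)%E.
Proof.
have [N NP] := @bounded_overlap R n; exists N.+1 => // w B lam mw w0 wB lam0.
pose rad p j : R := j%:R / 2 ^+ p.
have p20 p : 0 < 2 ^+ p :> R by exact: exprn_gt0.
pose bad p j : set T := [set x : T | small_mass w lam x (rad p j)].
have mbad p j : measurable (bad p j).
  apply: (@measurable_lt_set _ T R (fun x => lam * ball_mass (fun=> 1) (rad p j) x) (ball_mass w (rad p j))).
    by apply: measurable_funM => //; exact: (measurable_ball_mass (measurable_cst _) (fun=> ler01)).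
  exact: (measurable_ball_mass mw w0).
(* Radii are multiples of 2^-p below 1, and centres lie in a bounded set; so there are finitely many
   levels and, at each of them, boundedly many separated centres. *)
pose A p : set T := eball (0 : rV) p%:R `&` \bigcup_(j in [set j | (0 < j < 2 ^ p)%N]) bad p j.
have mA p : measurable (A p).
  by apply: measurableI; [exact: measurable_eball|apply: bigcup_measurable => j _; exact: mbad].
have radS p j : rad p.+1 (2 * j) = rad p j.
  by rewrite /rad natrM exprS invfM mulrACA divff ?mul1r// gt_eqF.
have Ahomo p q : (p <= q)%N -> A p `<=` A q.
  move=> /subnKC <-; elim: (q - p)%N => [|d IH]; rewrite ?addn0// addnS.
  apply: subset_trans IH _ => x [xp [j /= /andP[j0 jp] xj]]; split.
    by apply: lt_le_trans xp _; rewrite ler_nat.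
  exists (2 * j)%N; last by rewrite /bad /= radS.
  by rewrite /= muln_gt0 j0/= expnS ltn_pmul2l.
have AE : maximal_set w lam = \bigcup_p A p.
  apply/seteqP; split=> x; last first.
    move=> [p _ [xp [j /= /andP[j0 jp] xj]]]; exists (rad p j) => //.
    by rewrite divr_gt0 ?ltr0n//= ltr_pdivrMr// mul1r -natrX ltr_nat.
  move=> [rho /andP[r0 r1] xr].
  (* Any radius between s and rho is still bad: its mu-mass is at most that of radius rho, and its w
     mu-mass at least that of radius s. A dyadic radius is placed between them. *)
  have [s /andP[s0 sr] xs] := ball_mass_left mw w0 wB r0 xr.
  have d0 : 0 < rho - s by rewrite subr_gt0.
  have [p1 p1P] : exists p : nat, (2 ^+ p)^-1 < rho - s.
    exists (Num.truncn (rho - s)^-1).+1; rewrite -[X in _ < X]invrK ltf_pV2 ?posrE ?invr_gt0//.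
    apply: lt_le_trans (truncnS_gt _) _; rewrite -natrX ler_nat; exact/ltnW/ltn_expl.
  pose p := maxn p1 (Num.truncn (enorm (x : rV))).+1.
  have pP : (2 ^+ p)^-1 < rho - s.
    apply: le_lt_trans p1P; rewrite lef_pV2 ?posrE// -!natrX ler_nat leq_exp2l//; exact: leq_maxl.
  exists p => //; split.
    rewrite /eball /= subr0; apply: lt_le_trans (truncnS_gt _) _; rewrite ler_nat; exact: leq_maxr.
  pose j := (Num.truncn (s * 2 ^+ p)).+1.
  have s2 : 0 <= s * 2 ^+ p by rewrite mulr_ge0// ltW.
  have js : s < rad p j by rewrite ltr_pdivlMr// truncnS_gt.
  have jr : rad p j < rho.
    rewrite ltr_pdivrMr// /j -natr1; have := truncn_le (s * 2 ^+ p); rewrite s2.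
    have : 1 < (rho - s) * 2 ^+ p by rewrite -ltr_pdivrMr// mul1r.
    rewrite mulrBl; move: (Num.truncn (s * 2 ^+ p))%:R => c.
    by move: (s * 2 ^+ p) (rho * 2 ^+ p) => a b; clear; lra.
  have jp : (j < 2 ^ p)%N.
    by rewrite -(ltr_nat R) natrX -[X in _ < X]mul1r -ltr_pdivrMr//; exact: lt_trans jr r1.
  exists j; first by rewrite /= jp.
  rewrite /bad /= /small_mass; apply: le_lt_trans (lt_le_trans xs _).
    rewrite ler_wpM2l ?(ltW lam0)//; apply: (ball_mass_homo (measurable_cst (1 : R)) (fun=> ler01) (fun=> lexx (1 : R))); exact: ltW.
  by apply: (ball_mass_homo mw w0 wB); exact: ltW.
have bound p : (lam%:E * mu (A p) <= N.+1%:R%:E * \int[mu]_x (w x)%:E)%E.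
  (* Radii decrease with the level, so larger balls are chosen first. A centre that is rejected is
     close to one chosen at the same or an earlier level, whose ball is at least as large and
     therefore contains it. *)
  pose rd k : R := rad p (2 ^ p - k)%N.
  pose P k : set rV := [set x | (0 < k < 2 ^ p)%N /\ A p x /\ bad p (2 ^ p - k)%N x].
  pose sep : rel (rV * nat) := fun a b =>
    (rd a.2 <= enorm (a.1 - b.1)) && (rd b.2 <= enorm (a.1 - b.1)).
  have rd_ge k : (0 < k < 2 ^ p)%N -> (2 ^+ p)^-1 <= rd k.
    move=> /andP[k0 kp]; rewrite /rd /rad -[X in X <= _]mul1r ler_pM2r ?invr_gt0//.
    by rewrite ler1n subn_gt0.
  have Pb k : exists N0, forall s : seq (rV * nat),
      (forall q, q \in s -> P q.2 q.1 /\ (q.2 <= k)%N) -> pairwise sep s -> (size s <= N0)%N.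
    have p2i : 0 < (2 ^+ p)^-1 :> R by rewrite invr_gt0.
    have [N0 N0P] := @packing R n p%:R _ p2i.
    exists N0 => s sP ps; rewrite -(size_map fst); apply: N0P.
      move=> x /mapP[q qs ->]; have [[_ [[h _] _]] _] := sP q qs.
      by move: h; rewrite /eball /= subr0 => /ltW.
    rewrite pairwise_map; have : all (fun q => (0 < q.2 < 2 ^ p)%N) s.
      by apply/allP => q qs; have [[]] := sP q qs.
    move=> /sub_in_pairwise; apply; last exact: ps.
    move=> a b a1 b1 /andP[h1 _] /=; apply: le_trans h1; exact: rd_ge.
  have [ext [st [st0 stS stsep extP stmax]]] := maximal_stages Pb.
  pose l := st (2 ^ p)%N.
  have stP k q : q \in st k -> P q.2 q.1 /\ (q.2 < k)%N.
    elim: k => [|k IH]; first by rewrite st0.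
    rewrite stS mem_cat => /orP[/extP[Pq ->]//|/IH[Pq qk]]; split => //; exact: ltnW.
  have stmono a b : (a <= b)%N -> {subset st a <= st b}.
    move=> /subnKC <-; elim: (b - a)%N => [|d IH] q; rewrite ?addn0// addnS stS mem_cat => /IH ->.
    by rewrite orbT.
  have cover : A p `<=` [set x | exists2 q, q \in l & eball q.1 (rd q.2) x].
    move=> x Ax; have [_ [j /= /andP[j0 jp] xj]] := Ax.
    pose k := (2 ^ p - j)%N.
    have kP : (0 < k < 2 ^ p)%N by rewrite subn_gt0 jp/= ltn_subrL j0 expn_gt0.
    have jk : (2 ^ p - k)%N = j by rewrite subKn// ltnW.
    have Pk : P k x by split => //; rewrite jk.
    have [q qs] := stmax k x Pk.
    have [_] := stP _ _ qs; rewrite ltnS => q2.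
    move=> nsep; exists q.
      apply: stmono qs; by case/andP: kP.
    rewrite /eball /=; move: nsep; rewrite /sep /= negb_and -!ltNge.
    have : rd k <= rd q.2 by rewrite /rd /rad ler_wpM2r ?invr_ge0 ?(ltW (p20 p))// ler_nat leq_sub2l.
    by move=> le /orP[]; lra.
  pose F (q : rV * nat) : set T := eball q.1 (rd q.2).
  have mF q : measurable (F q) by exact: measurable_eball.
  have NF x : \sum_(q <- l) \1_(F q) x <= N.+1%:R :> R.
    apply: (@le_trans _ _ N%:R); last by rewrite ler_nat.
    exact: (NP _ (fun q : rV * nat => q.1) (fun q => rd q.2) l (stsep _)).
  apply: le_trans (overlap_sum_le (s := l) mu mF mw w0 (ler0n R N.+1) (fun x _ => NF x)).
  have le1 : (mu (A p) <= \sum_(q <- l) mu (F q))%E.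
    rewrite measure_indicE//; under eq_bigr => q _ do rewrite measure_indicE//.
    have mi q : measurable_fun setT (fun x => (\1_(F q) x)%:E : \bar R).
      by apply/measurable_EFinP; exact: measurable_indic.
    have pi q x : (0 <= (\1_(F q) x)%:E :> \bar R)%E by rewrite lee_fin indicE.
    rewrite -ge0_integral_sum//; apply: ge0_le_integral => //.
    - by apply/measurable_EFinP; exact: measurable_indic.
    - exact: emeasurable_sum.
    - move=> x _; rewrite sumEFin lee_fin; have [Ax|Ax] := pselect (A p x); last first.
        by rewrite indicE memNset// sumr_ge0.
      have [q ql qx] := cover x Ax; rewrite indicE mem_set// (big_rem q)//= [X in X + _]indicE mem_set//.
      by rewrite lerDl sumr_ge0.
  apply: (@le_trans _ _ (lam%:E * \sum_(q <- l) mu (F q))%E); first by rewrite lee_pmul2l.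
  rewrite ge0_sume_distrr; last by move=> q _.
  rewrite big_seq [leRHS]big_seq; apply: lee_sum => q ql.
  have [[kP [_ bq]] _] := stP _ _ ql.
  rewrite -(ball_massE mw w0 wB) measure_indicE//.
  rewrite (_ : \int[mu]_x _ = (ball_mass (fun=> 1) (rd q.2) q.1)%:E)%E.
    by rewrite -EFinM lee_fin; exact: ltW.
  rewrite (@ball_massE (fun=> 1) 1)//; apply: eq_integral => x _; by rewrite mulr1.
rewrite AE; split; first exact: bigcupT_measurable.
rewrite -lee_pdivlMl//.
have cv := @nondecreasing_cvg_mu _ _ _ mu A mA (bigcupT_measurable A mA)
  (fun i j ij => introT (subsetPset _ _) (Ahomo i j ij)).
apply: (cvge_le _ cv).
by near=> p; rewrite /= lee_pdivlMl//; exact: bound.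
Unshelve. all: by end_near. Qed.
Definition lebesgue_point (h : T -> R) (x : T) := forall d : R, 0 < d -> exists2 r : R, 0 < r &
  forall rho, 0 < rho < r ->
    \int[mu]_(y in eball (x : rV) rho) `|h y - h x| <= d * fine (mu (eball (x : rV) rho)).

(** Let g_j be test functions with L^1 distance to h at most d/(j + 1). By continuity of g_j, a
    point can be bad for the tolerance 3 d only if |h - g_j| exceeds d there or in the mean over
    some ball of radius less than 1. Both events have measure O(1/(j + 1)), so their intersection
    over j is negligible. *)
Lemma lebesgue_points_ae (h : T -> R) (C : R) : measurable_fun setT h -> (forall x, `|h x| <= C) ->
  mu.-negligible [set x | ~ lebesgue_point h x].
Proof.
move=> mh hC; have [N N0 NP] := weak_type.
pose bad (k : nat) : set T := [set x : T | ~ exists2 r : R, 0 < r & forall rho, 0 < rho < r ->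
  \int[mu]_(y in eball (x : rV) rho) `|h y - h x| <= k.+1%:R^-1 * fine (mu (eball (x : rV) rho))].
apply: (@negligibleS _ _ _ mu (\bigcup_k bad k)).
  move=> x nx; apply: contrapT => nb; apply: nx => d d0.
  have [k _ kd] : \forall k \near \oo, k.+1%:R^-1 < d by exact: (near_infty_natSinv_lt (PosNum d0)).
  have : ~ bad k x by move=> bk; apply: nb; exists k.
  move=> /contrapT[r r0 rP]; exists r => // rho rr; apply: le_trans (rP rho rr) _.
  by rewrite ler_wpM2r ?fine_ge0// ltW// kd//=.
apply: negligible_bigcup => k; pose d : R := k.+1%:R^-1 / 3.
have d0 : 0 < d by rewrite divr_gt0// invr_gt0.
have muT : (mu setT < +oo)%E by exact: mufin.
have /choice[g gP] : forall j : nat, exists g, is_test g /\ \int[mu]_x `|h x - g x| <= j.+1%:R^-1 * d.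
  move=> j; have j0 : 0 < j.+1%:R^-1 * d by rewrite mulr_gt0// invr_gt0.
  by have [g g1 g2] := test_dense muT mh hC j0; exists g.
pose w j (x : T) : R := `|h x - g j x|.
have w0 j x : 0 <= w j x by exact: normr_ge0.
have mg j : measurable_fun setT (g j : T -> R) by have [/is_test_measurable] := gP j.
have mw j : measurable_fun setT (w j) by apply: measurableT_comp => //; exact: measurable_funB.
have /choice[B BP] : forall j, exists B, forall x, w j x <= B.
  move=> j; have [/is_test_bounded[D D0 gD] _] := gP j; exists (C + D) => x.
  by apply: le_trans (ler_normB _ _) _; exact: lerD.
have iw j : mu.-integrable setT (EFin \o w j).
  by apply: (bounded_integrable (C := (B j))) => // x; rewrite ger0_norm.
pose far j : set T := [set x | d < w j x].
have mfar j : measurable (far j) by exact: (measurable_lt_set (measurable_cst d) (mw j)).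
pose W j := maximal_set (w j) d `|` far j.
have mW j : measurable (W j).
  by apply: measurableU => //; have [] := NP (w j) (B j) d (mw j) (w0 j) (BP j) d0.
exists (\bigcap_j W j); split; first exact: bigcapT_measurable.
- have muW j : fine (mu (W j)) <= (N%:R + 1) * j.+1%:R^-1.
    have h1 : (d%:E * mu (maximal_set (w j) d) <= N%:R%:E * \int[mu]_x (w j x)%:E)%E.
      by have [] := NP (w j) (B j) d (mw j) (w0 j) (BP j) d0.
    have h2 : (d%:E * mu (far j) <= \int[mu]_x (w j x)%:E)%E.
      rewrite measure_indicE// -ge0_integralZl_EFin//; last 2 first.
      - by apply/measurable_EFinP; exact: measurable_indic.
      - exact: ltW.
      apply: ge0_le_integral => //.
      - by move=> x _; rewrite -EFinM lee_fin mulr_ge0 ?indicE// ltW.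
      - by apply: measurable_funeM; apply/measurable_EFinP; exact: measurable_indic.
      - exact/measurable_EFinP.
      - move=> x _; rewrite -EFinM lee_fin; have [fx|fx] := pselect (far j x).
          by rewrite indicE mem_set// mulr1 ltW.
        by rewrite indicE memNset// mulr0.
    have h3 : (mu (W j) <= mu (maximal_set (w j) d) + mu (far j))%E.
      by apply: measureU2 => //; have [] := NP (w j) (B j) d (mw j) (w0 j) (BP j) d0.
    have mm : measurable (maximal_set (w j) d) by have [] := NP (w j) (B j) d (mw j) (w0 j) (BP j) d0.
    have [_ h4] := gP j; have f1 := mufin mm; have f2 := mufin (mfar j); have f3 := mufin (mW j).
    move: h1 h2 h3; rewrite -(EFin_Rintegral measurableT (iw j)).
    rewrite -(@fineK _ (mu (maximal_set (w j) d))) ?ge0_fin_numE//.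
    rewrite -(@fineK _ (mu (far j))) ?ge0_fin_numE// -(@fineK _ (mu (W j))) ?ge0_fin_numE//.
    rewrite -!EFinM -EFinD !lee_fin /= => h1 h2 h3.
    rewrite -(ler_pM2l d0); apply: (@le_trans _ _ ((N%:R + 1) * \int[mu]_x w j x)).
      by rewrite mulrDl mul1r; apply: le_trans (lerD h1 h2); rewrite -mulrDr ler_wpM2l// ltW.
    rewrite mulrCA ler_wpM2l ?addr_ge0// mulrC; exact: h4.
  apply/eqP; rewrite eq_le measure_ge0 andbT.
  have mI : measurable (\bigcap_j W j) by exact: bigcapT_measurable.
  have Ifin := mufin mI.
  apply: (@le_trans _ _ (fine (mu (\bigcap_j W j)))%:E); first by rewrite fineK// ge0_fin_numE.
  rewrite lee_fin leNgt; apply/negP => m0.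
  have c0 : 0 < fine (mu (\bigcap_j W j)) / (N%:R + 1) by rewrite divr_gt0// ltr_wpDl.
  have [j _ jP] : \forall j \near \oo, j.+1%:R^-1 < fine (mu (\bigcap_j W j)) / (N%:R + 1).
    exact: (near_infty_natSinv_lt (PosNum c0)).
  have := jP j (leqnn j) => /=; rewrite ltr_pdivlMr ?ltr_wpDl// mulrC ltNge => /negP; apply.
  apply: le_trans (muW j); apply: fine_le; rewrite ?ge0_fin_numE ?mufin//.
  by apply: le_measureS => //; exact: bigcap_inf.
move=> x bx j _; apply: contrapT => /not_orP[nW nf]; apply: bx.
have gc : \forall y \near (x : rV), `|g j x - g j y| < d.
  have [/is_test_C1[G gG] _] := gP j.
  by have /cvgrPdist_lt := @has_gradient_continuous R n _ _ gG (x : rV); apply.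
have [r1 r10 r1P] := (open_eballP _).1 (@open_interior _ _) x gc.
exists (Num.min r1 1) => [|rho]; first by rewrite lt_min r10/=.
rewrite lt_min => /andP[p0 /andP[pr p1]].
have h1 : ball_mass (w j) rho x <= d * ball_mass (fun=> 1) rho x.
  by rewrite leNgt; apply/negP => sm; apply: nW; exists rho => //; rewrite p0.
have mb : measurable (eball (x : rV) rho : set T) by exact: measurable_eball.
have bI (f : T -> R) : mu.-integrable setT (EFin \o f) ->
    mu.-integrable setT (EFin \o (fun y => \1_(eball (x : rV) rho) y * f y)).
  move=> fi; apply: (integrable_indicM mb); exact: (integrableS measurableT mb (@subsetT _ _) fi).
have i1 := bI _ (iw j).
have ic c : mu.-integrable setT (EFin \o (cst c : T -> R)).
  by apply: (bounded_integrable (C := `|c|)).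
have i2 := bI _ (ic 1).
have mhx : measurable_fun setT ((fun y => `|h y - h x|) : T -> R).
  by apply: measurableT_comp => //; exact: measurable_funB.
have -> : fine (mu (eball (x : rV) rho)) = ball_mass (fun=> 1) rho x.
  rewrite measure_indicE; last exact: measurable_eball.
  by congr fine; apply: eq_integral => y _; rewrite mulr1.
rewrite Rintegral_indic.
apply: (@le_trans _ _ (\int[mu]_y (\1_(eball (x : rV) rho) y * w j y + 2 * d * (\1_(eball (x : rV) rho) y * 1)))).
  apply: le_Rintegral => //.
  - apply: bI.
    apply: (bounded_integrable (C := (C + C))) => // y.
    by rewrite normr_id (le_trans (ler_normB _ _))// lerD.
  - by apply: integrableDR => //; exact: integrableZR.
  - move=> y _; rewrite mulr1 indicE; case: (boolP (_ \in _)) => [/set_mem yx|_]; last by rewrite !mul0r mulr0 addr0.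
    rewrite !mul1r mulr1; have := r1P y (lt_trans yx pr) => /interior_subset /=.
    move/negP: nf; rewrite -leNgt; move: (ler_distD (g j y) (h y) (h x)) (ler_distD (g j x) (g j y) (h x)).
    by rewrite (distrC (g j y) (g j x)) (distrC (g j x) (h x)) /w; lra.
rewrite RintegralD//; last exact: integrableZR.
rewrite RintegralZl// -!/(ball_mass _ _ _).
have -> : k.+1%:R^-1 = 3 * d by rewrite /d mulrC divfK.
by move: h1; lra.
Qed.
End differentiation.

Lemma common_radius {R : realType} (I : finType) (Q : I -> R -> Prop) :
  (forall i, exists2 r : R, 0 < r & forall rho, 0 < rho < r -> Q i rho) ->
  exists2 r : R, 0 < r & forall i rho, 0 < rho < r -> Q i rho.
Proof.
move=> h; have [r r0 rP] : exists2 r : R, 0 < r & forall i, i \in enum I -> forall rho, 0 < rho < r -> Q i rho.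
  elim: (enum I) => [|i s [r r0 IH]]; first by exists 1.
  have [q q0 qP] := h i; exists (Num.min q r); first by rewrite lt_min q0.
  move=> j; rewrite inE => /orP[/eqP ->|js] rho; rewrite lt_min => /andP[p0 /andP[pq pr]].
    by apply: qP; rewrite p0.
  by apply: IH => //; rewrite p0.
by exists r => // i; apply: rP; rewrite mem_enum.
Qed.

(** * Comparison with Hausdorff measure *)

Section nets.
Context {R : realType} {n : nat}.
Local Notation rV := 'rV[R]_n.
Local Notation T := (borel_rV R n).

Lemma finite_net (M d : R) : 0 < d -> exists s : seq rV,
  forall x, enorm x <= M -> exists2 z, z \in s & enorm (x - z) < d.
Proof.
move=> d0; have [N NP] := @packing R n M d d0.
(* Only level 0 is populated, so a single stage of [maximal_stages] yields a maximal separated set,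
   which is a net. *)
pose P (k : nat) : set rV := [set x | k = 0%N /\ enorm x <= M].
pose sep : rel (rV * nat) := fun a b => d <= enorm (a.1 - b.1).
have Pb k : exists N0, forall s : seq (rV * nat),
    (forall q, q \in s -> P q.2 q.1 /\ (q.2 <= k)%N) -> pairwise sep s -> (size s <= N0)%N.
  exists N => s sP ps; rewrite -(size_map fst); apply: NP; last by rewrite pairwise_map.
  by move=> x /mapP[q qs ->]; have [[]] := sP q qs.
have [ext [st [_ _ _ _ stmax]]] := maximal_stages Pb.
exists (map fst (st 1%N)) => x xM; have [q qs] := stmax 0%N x (conj erefl xM).
by rewrite /sep /= -ltNge => h; exists q.1 => //; exact: map_f.
Qed.

Lemma ball_cutoff (z : rV) (d : R) : 0 < d -> exists2 g, is_test g &
  [/\ forall x, 0 <= g x <= 1, forall x, enorm (x - z) <= d -> g x = 1 &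
      forall x, 2 * d <= enorm (x - z) -> g x = 0].
Proof.
move=> d0; have d2 : d < 2 * d by lra.
exists (fun x => radial_cutoff d (2 * d) (x + - z)).
  by eexists; apply: test_fun_shift; exact: radial_test_fun d0 d2.
split=> [x|x h|x h].
- exact: radial_cutoff_itv.
- exact: radial_cutoff_in d0 d2 _ h.
- exact: radial_cutoff_out d0 d2 _ h.
Qed.

Lemma finite_cutoff (s : seq rV) (d : R) : 0 < d -> exists2 g, is_test g &
  [/\ forall x, 0 <= g x <= 1, forall x z, z \in s -> enorm (x - z) <= d -> g x = 1 &
      forall x, (forall z, z \in s -> 2 * d <= enorm (x - z)) -> g x = 0].
Proof.
move=> d0; have /choice[g gP] : forall z : rV, exists g, is_test g /\
    [/\ forall x, 0 <= g x <= 1, forall x, enorm (x - z) <= d -> g x = 1 &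
      forall x, 2 * d <= enorm (x - z) -> g x = 0].
  by move=> z; have [g g1 g2] := ball_cutoff z d0; exists g.
exists (fun x => smooth_step (\sum_(z <- s) g z x)).
  apply: (is_test_comp (@is_derive_smooth_step R) (@continuous_dsmooth_step R)).
    by rewrite smooth_step_le0.
  by apply: is_test_sum => z; have [] := gP z.
split=> [x|x z zs xz|x xs].
- exact: smooth_step_itv.
- apply: smooth_step_ge1; rewrite (big_rem z)//=; have [_ [_ h _]] := gP z.
  by rewrite h// lerDl sumr_ge0// => y _; have [_ [/(_ x)/andP[]]] := gP y.
- rewrite big1_seq ?smooth_step_le0// => z /andP[_ zs].
  by have [_ [_ _ h]] := gP z; apply/h/xs.
Qed.

End nets.

(** Each induction step costs at most the factor 2 + t <= 8; the range is that of t = 6 d with d <=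
    1. *)
Lemma pow_1D_le {R : realType} (m : nat) (t : R) : 0 <= t <= 6 -> (1 + t) ^+ m <= 1 + 8 ^+ m * t.
Proof.
move=> /andP[t0 t6]; elim: m => [|m IH]; first by rewrite !expr0; lra.
rewrite exprSr; apply: (@le_trans _ _ ((1 + 8 ^+ m * t) * (1 + t))).
  by rewrite ler_wpM2r// addr_ge0.
have m1 : 1 <= 8 ^+ m :> R by apply: exprn_ege1; lra.
rewrite exprS; move: (8 ^+ m) m1 => q q1.
have h1 : t <= q * t by rewrite ler_peMl.
have h2 : q * t * t <= q * t * 6 by rewrite ler_wpM2l// mulr_ge0//; lra.
by lra.
Qed.

(** * The perimeter measure is at most the Hausdorff measure *)

Section hausdorff_comparison.
Context {R : realType} {m : nat}.
Local Notation n := m.+1.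
Local Notation rV := 'rV[R]_n.
Local Notation L := (borel_lebesgue R).
Local Notation T := (borel_rV R n).
Local Notation H := (@hausdorff R n m).
Local Notation omega := (fine (L m (eball (0 : 'rV[R]_m) 1))).
Context (E : set T) (mu : {measure set T -> \bar R}) (nu : rV -> rV).
Hypotheses (mE : measurable E) (gg : scalar_gauss_green E mu nu).

Definition blowup_point (x v : rV) := [/\ enorm v = 1, excess_small mu nu x v &
  forall s, 0 < s -> (0 < mu (eball x s))%E].

Let muT : (mu setT < +oo)%E. Proof. by case: gg. Qed.

Lemma omega_gt0 : 0 < omega.
Proof. by rewrite fine_gt0// lebesgue_eball_gt0 lebesgue_eball_lty. Qed.

Let muf (A : set T) : measurable A -> mu A = (fine (mu A))%:E.
Proof. by move=> mA; rewrite fineK// ge0_fin_numE//; exact: (mu_fin gg). Qed.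

Let dilate_test x rho g : is_test g -> measurable_fun setT ((fun y => g (dilate x rho y)) : T -> R).
Proof. by move=> gt; exact: (measurableT_comp (is_test_measurable gt) (measurable_dilate x rho)). Qed.

Let dilate_integrable x rho g : is_test g -> mu.-integrable setT (EFin \o ((fun y => g (dilate x rho y)) : T -> R)).
Proof.
move=> gt; have [C C0 gC] := is_test_bounded gt.
by apply: (bounded_integrable (C := C)) => //; exact: dilate_test.
Qed.

Let slice_test v g : is_test g -> measurable_fun setT ((fun y => g (slice v y)) : borel_rV R m -> R).
Proof. by move=> gt; exact: (measurableT_comp (is_test_measurable gt) (measurable_slice v)). Qed.

(** The trace on the hyperplane of the 2d-neighbourhood of s is open, with distances below (1 + 2 d)
    + 2 (2 d) = 1 + 6 d; the isodiametric inequality bounds its volume. *)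
Lemma slice_cutoff_le (v : rV) (s : seq rV) d g : 0 < d -> is_test g -> (forall x, 0 <= g x <= 1) ->
  (forall x, (forall z, z \in s -> 2 * d <= enorm (x - z)) -> g x = 0) ->
  (forall z z', z \in s -> z' \in s -> enorm (z - z') < 1 + 2 * d) ->
  \int[L m]_y g (slice v y) <= (1 + 6 * d) ^+ m * (2 ^- m * omega).
Proof.
move=> d0 gt g01 g0 sd.
pose P : set 'rV[R]_m := [set y | exists2 z, z \in s & enorm (slice v y - z) < 2 * d].
have oP : open P.
  apply/open_eballP => y [z zs yz]; exists (2 * d - enorm (slice v y - z)); first by rewrite subr_gt0.
  move=> w; rewrite /eball /= => wy; exists z => //.
  have := ler_enorm_dist (slice v w) (slice v y) z; rewrite enorm_sliceB; lra.
have Pd x y : P x -> P y -> enorm (x - y) < 1 + 6 * d.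
  move=> [z zs xz] [z' zs' yz']; rewrite -(enorm_sliceB v).
  have h1 := ler_enorm_dist (slice v x) z (slice v y).
  have h2 := ler_enorm_dist z z' (slice v y).
  by have := sd z z' zs zs'; rewrite (enormB z') in h2; lra.
have mP : measurable (P : set (borel_rV R m)) by exact: open_measurable_rV.
have gP y : ~ P y -> g (slice v y) = 0.
  move=> nP; apply: g0 => z zs; rewrite leNgt; apply/negP => h; by apply: nP; exists z.
have rhs0 : 0 <= (1 + 6 * d) ^+ m * (2 ^- m * omega).
  by rewrite mulr_ge0 ?exprn_ge0 ?mulr_ge0 ?invr_ge0 ?exprn_ge0 ?(ltW omega_gt0)//; lra.
have [P0|/eqP/set0P P0] := pselect (P = set0).
  by rewrite Rintegral_eq0// => y _; apply: gP; rewrite P0.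
have [y0 Py0] := P0.
have Pb : P `<=` eball y0 (1 + 6 * d) by move=> y Py; rewrite /eball /=; exact: Pd.
have Lfin : (L m P < +oo)%E.
  by apply: le_lt_trans (lebesgue_eball_lty y0 (1 + 6 * d)); apply: le_measureS => //; exact: measurable_eball.
apply: (@le_trans _ _ (fine (L m P))).
  rewrite (measure_indicE _ mP) -/(Rintegral _ _ _); apply: le_Rintegral => //.
  - apply: (support_integrable mP Lfin (slice_test v gt) gP (C := 1)) => // y.
    by have /andP[h1 h2] := g01 (slice v y); rewrite ger0_norm.
  - apply: (support_integrable mP Lfin _ _ (C := 1)) => //.
    + exact: measurable_indic.
    + by move=> y nP; rewrite memNset.
    + by move=> y; case: (_ \in _); rewrite ?normr0 ?normr1.
  - move=> y _; have [Py|Py] := pselect (P y); last by rewrite gP.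
    by rewrite mem_set//; have /andP[] := g01 (slice v y).
have := isodiametric oP P0 Pd; rewrite -ler_pdivlMl ?exprn_gt0// => /le_trans; apply.
by rewrite mulrCA.
Qed.

(** The radius must not depend on S. Rescaled to diameter at most 1, S is dominated by the cutoff of
    a subset of a finite net of the unit ball; there are finitely many such cutoffs, hence a common
    radius for their blow-up limits. The isodiametric inequality bounds each limit. *)
Lemma diameter_density x v (e : R) : blowup_point x v -> 0 < e -> exists2 r : R, 0 < r &
  forall rho (S : set rV), 0 < rho < r -> open S -> S x ->
    (forall y z, S y -> S z -> enorm (y - z) <= rho) ->
    (mu S <= ((2 ^- m * omega + e) * rho ^+ m)%:E)%E.
Proof.
move=> [v1 exs pos] e0; set K := 2 ^- m * omega.
have K0 : 0 < K by rewrite mulr_gt0 ?omega_gt0// invr_gt0 exprn_gt0.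
have [d /andP[d0 d1] dK] : exists2 d : R, 0 < d <= 1 & (1 + 6 * d) ^+ m * K <= K + e / 2.
  have c0 : 0 < 12 * 8 ^+ m * K by have q0 : 0 < 8 ^+ m :> R by [exact: exprn_gt0]; rewrite mulr_gt0// mulr_gt0.
  exists (Num.min 1 (e / (12 * 8 ^+ m * K))).
    by rewrite lt_min ge_min lexx/= ltr01 divr_gt0.
  set d := Num.min _ _.
  have d1 : d <= 1 by rewrite ge_min lexx.
  have d2 : d <= e / (12 * 8 ^+ m * K) by rewrite ge_min lexx orbT.
  have d0 : 0 < d by rewrite lt_min ltr01 divr_gt0.
  have h : (1 + 6 * d) ^+ m <= 1 + 8 ^+ m * (6 * d) by apply: pow_1D_le; apply/andP; split; lra.
  apply: (@le_trans _ _ ((1 + 8 ^+ m * (6 * d)) * K)).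
    by rewrite ler_wpM2r ?(ltW K0).
  by move: d2; rewrite ler_pdivlMr//; lra.
have [s sP] := @finite_net R n 1 d d0.
pose N := size s; pose z (i : 'I_N) := nth 0 s i.
have zP i : z i \in s by rewrite mem_nth.
have /choice[g gP] : forall F : {set 'I_N}, exists g, is_test g /\
    [/\ forall x, 0 <= g x <= 1, forall x w, w \in map z (enum F) -> enorm (x - w) <= d -> g x = 1 &
      forall x, (forall w, w \in map z (enum F) -> 2 * d <= enorm (x - w)) -> g x = 0].
  by move=> F; have [g g1 g2] := finite_cutoff (map z (enum F)) d0; exists g.
have [r r0 rP] : exists2 r : R, 0 < r & forall (F : {set 'I_N}) rho, 0 < rho < r ->
    `|rho ^- m * \int[mu]_y g F (dilate x rho y) - \int[L m]_y g F (slice v y)| <= e / 2.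
  apply: common_radius => F; have [[G gG] _] := gP F.
  by apply: (blowup_limit mE gg v1 exs pos gG); rewrite divr_gt0.
exists r => // rho S /[dup] rr /andP[p0 _] oS Sx Sd.
(* The net points within d of the rescaled set: their balls of radius d cover it, and their mutual
   distances are below 1 + 2 d. *)
pose F := [set i : 'I_N | `[< exists2 y, S y & enorm (dilate x rho y - z i) < d >]]%SET.
have mS : measurable (S : set T) by exact: open_measurable_rV.
have [gt [g01 g1 g0]] := gP F.
have dS y w : S y -> S w -> enorm (dilate x rho y - dilate x rho w) <= 1.
  move=> Sy Sw; rewrite /dilate opprB addrA subrK -scalerBr enormZ ger0_norm ?invr_ge0 ?(ltW p0)//.
  by rewrite ler_pdivrMl// mulr1; exact: Sd.
have h1 : (mu S <= (\int[mu]_y g F (dilate x rho y))%:E)%E.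
  rewrite (EFin_Rintegral measurableT (dilate_integrable x rho gt)) measure_indicE//.
  apply: ge0_le_integral => //.
  - by apply/measurable_EFinP; exact: measurable_indic.
  - by apply/measurable_EFinP; exact: dilate_test.
  - move=> y _; rewrite lee_fin; have [Sy|Sy] := pselect (S y); last first.
      by rewrite indicE memNset//; have /andP[] := g01 (dilate x rho y).
    have [w ws yw] : exists2 w, w \in s & enorm (dilate x rho y - w) < d.
      apply: sP; have := dS y x Sy Sx; by rewrite {2}/dilate subrr subr0.
    have [i wi] : exists i : 'I_N, z i = w.
      have wsz : (index w s < N)%N by rewrite index_mem.
      by exists (Ordinal wsz); rewrite /z /= nth_index.
    have -> : g F (dilate x rho y) = 1.
      apply: (g1 _ w); last exact: ltW.
      by rewrite -wi map_f// mem_enum inE; apply/asboolP; exists y => //; rewrite wi.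
    by rewrite indicE; case: (_ \in _).
have h2 : \int[L m]_y g F (slice v y) <= K + e / 2.
  apply: le_trans dK; apply: (slice_cutoff_le v d0 gt g01 g0).
  move=> w w' /mapP[i iF ->] /mapP[j jF ->].
  have Fy k : k \in enum F -> exists2 y, S y & enorm (dilate x rho y - z k) < d.
    by rewrite mem_enum inE => /asboolP.
  have [y Sy yi] := Fy i iF; have [y' Sy' yj] := Fy j jF.
  have h3 := ler_enorm_dist (z i) (dilate x rho y) (z j).
  have h4 := ler_enorm_dist (dilate x rho y) (dilate x rho y') (z j).
  by have := dS y y' Sy Sy'; rewrite (enormB (z i) (dilate x rho y)) in h3; lra.
apply: (le_trans h1); rewrite lee_fin.
have := rP F rho rr; rewrite ler_distl => /andP[_ h3].
have : rho ^- m * \int[mu]_y g F (dilate x rho y) <= K + e by lra.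
by rewrite ler_pdivrMl ?exprn_gt0// mulrC.
Qed.

(** Sets of a Hausdorff covering are arbitrary; this allows their replacement by open neighbourhoods
    at a small cost, even when their diameter is 0. *)
Lemma exists_enlargement (K c d b : R) : 0 <= K -> 0 <= d < b -> 0 < c ->
  exists2 eta : R, 0 < eta & d + 2 * eta < b /\ K * (d + 2 * eta) ^+ m <= K * d ^+ m + c.
Proof.
move=> K0 /andP[d0 db] c0.
have cv : K * (d + 2 * t) ^+ m @[t --> (0 : R)] --> K * (d + 2 * 0) ^+ m.
  apply: (@cvgMl_tmp _ _ (nbhs (0 : R)) _ (fun t => (d + 2 * t) ^+ m)).
  have cl : (d + 2 * t) @[t --> (0 : R)] --> d + 2 * 0.
    by apply: cvgD; [exact: cvg_cst|apply: (@cvgMl_tmp _ _ (nbhs (0 : R)) _ id); exact: cvg_id].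
  exact: (continuous_cvg _ (@exprn_continuous _ m _) cl).
rewrite mulr0 addr0 in cv.
have : \forall t \near (0 : R)^'+, K * (d + 2 * t) ^+ m < K * d ^+ m + c.
  by apply: (@cvg_within R (nbhs (0 : R))); apply: (cvgr_lt _ cv); rewrite ltrDl.
have : \forall t \near (0 : R)^'+, 0 < t < (b - d) / 2.
  near=> t; apply/andP; split; near: t; [exact: nbhs_right_gt|apply: nbhs_right_lt].
  by rewrite divr_gt0// subr_gt0.
move=> A B; have [t [/andP[t0 tb] tc]] := filter_ex (filterI A B).
exists t => //; split; last exact: ltW.
by move: tb; rewrite ltr_pdivlMr//; lra.
Unshelve. all: by end_near. Qed.

(** The diameter density holds below a radius that depends on the point, so A is exhausted by the
    sets B k on which 1/(k + 1) will do. A fine covering of A, restricted to members that meet the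
    k-th part and enlarged to open sets, bounds the mass of that part. *)
Lemma measure_le_hausdorff (A : set T) : measurable A ->
  (forall x, A x -> exists v, blowup_point x v) -> (mu A <= H A)%E.
Proof.
move=> mA AD; have [HA|] := pselect (H A = +oo%E); first by rewrite HA leey.
move=> /eqP; rewrite -ltey => HA.
have H0 : (0 <= H A)%E by exact: outer_measure_ge0.
have HAE : H A = (fine (H A))%:E by rewrite fineK// ge0_fin_numE.
set K := 2 ^- m * omega.
have K0 : 0 < K by rewrite mulr_gt0 ?omega_gt0// invr_gt0 exprn_gt0.
have key (e : R) : 0 < e -> (mu A <= ((1 + e / K) * (fine (H A) + e) + e)%:E)%E.
  move=> e0.
  pose B k : set T := [set x | forall (S : set rV) rho, 0 < rho < k.+1%:R^-1 -> open S -> S x ->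
    (forall y z, S y -> S z -> enorm (y - z) <= rho) -> (mu S <= ((K + e) * rho ^+ m)%:E)%E].
  (* The set is closed: a counterexample S at x is open, hence a counterexample at every point of
     S. *)
  have mB k : measurable (B k).
    apply: closed_measurable_rV; rewrite -openC; apply/open_eballP => x nB.
    have [S [oS Sx Sbad]] : exists S : set rV, [/\ open S, S x & exists rho, [/\ 0 < rho < k.+1%:R^-1,
        (forall y z, S y -> S z -> enorm (y - z) <= rho) & ~ (mu S <= ((K + e) * rho ^+ m)%:E)%E]].
      apply: contrapT => h; apply: nB => S rho r1 oS Sx Sd; apply: contrapT => h2; apply: h.
      by exists S; split => //; exists rho.
    have [d d0 dS] := (open_eballP S).1 oS x Sx; exists d => // y /dS Sy By.
    by have [rho [r1 Sd]] := Sbad; apply; exact: By r1 oS Sy Sd.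
  have Bmono i j : (i <= j)%N -> B i `<=` B j.
    move=> ij x Bx S rho /andP[p0 pj]; apply: Bx; rewrite p0/=; apply: lt_le_trans pj _.
    by rewrite lef_pV2 ?posrE// ler_nat ltnS.
  have AB : A = \bigcup_k (A `&` B k).
    apply/seteqP; split => [x Ax|x [k _ []]//].
    have [v vP] := AD x Ax; have [r r0 rP] := diameter_density vP e0.
    have [k _ kr] : \forall k \near \oo, k.+1%:R^-1 < r by exact: (near_infty_natSinv_lt (PosNum r0)).
    exists k => //; split => // S rho /andP[p0 pk] oS Sx Sd; apply: rP => //.
    by rewrite p0/= (lt_trans pk)// kr//=.
  have bound k : (mu (A `&` B k) <= ((1 + e / K) * (fine (H A) + e) + e)%:E)%E.
    pose del : R := k.+1%:R^-1 / 2.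
    have del0 : 0 < del by rewrite divr_gt0// invr_gt0.
    have delk : del < k.+1%:R^-1 by have h : 0 < k.+1%:R^-1 :> R by [rewrite invr_gt0]; rewrite /del; move: (k.+1%:R^-1) h => q; lra.
    have : (hausdorff_delta m del A < (fine (H A) + e)%:E)%E.
      apply: le_lt_trans (hausdorff_delta_le_hausdorff A del0) _.
      by rewrite HAE lte_fin ltrDl.
    move=> /ereal_inf_lt[_ [C [Cd AC] <-] Csum].
    have /choice[S SP] : forall i, exists S : set T, [/\ measurable S, A `&` B k `&` C i `<=` S &
        (mu S <= (1 + e / K)%:E * hausdorff_gauge m (C i) + (e / (2 ^ i.+1)%:R)%:E)%E].
      move=> i; have c0 : 0 < e / (2 ^ i.+1)%:R :> R by rewrite divr_gt0// ltr0n expn_gt0.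
      have [nC|/contrapT[x [[Ax Bx] Cx]]] := pselect (~ exists x, (A `&` B k `&` C i) x).
        exists set0; split => //; first by move=> x h; apply: nC; exists x.
        rewrite measure0 adde_ge0 ?mule_ge0 ?hausdorff_gauge_ge0// lee_fin ?(ltW c0)//.
        by rewrite addr_ge0 ?divr_ge0 ?ltW.
      have ediam0 : (0 <= ediam (C i))%E by apply: ediam_ge0; exists x.
      have dE : ediam (C i) = (fine (ediam (C i)))%:E.
        by rewrite fineK// ge0_fin_numE//; apply: le_lt_trans (Cd i) (ltry _).
      set d := fine _ in dE.
      have d0 : 0 <= d by exact: fine_ge0.
      have ddel : d <= del by rewrite -lee_fin -dE.
      have Ke : 0 <= K + e by rewrite addr_ge0// ltW.
      have db : 0 <= d < k.+1%:R^-1 by rewrite d0 (le_lt_trans ddel).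
      have [eta eta0 [etab etac]] := exists_enlargement Ke db c0.
      exists (\bigcup_(a in C i) eball a eta); split.
      - by apply: open_measurable_rV; exact: open_nbhd_set.
      - by move=> y [_ Cy]; exists y => //; exact: eball_center.
      have Sd y w : (\bigcup_(a in C i) eball a eta) y -> (\bigcup_(a in C i) eball a eta) w ->
          enorm (y - w) <= d + 2 * eta.
        move=> [a Ca ya] [b Cb wb].
        have h1 := ler_enorm_dist y a w; have h2 := ler_enorm_dist a b w.
        have : enorm (a - b) <= d by rewrite -lee_fin -dE; exact: ediam_ubound.
        by move: ya wb; rewrite /eball /= (enormB w); lra.
      have Sx : (\bigcup_(a in C i) eball a eta) x by exists x => //; exact: eball_center.
      have rb : 0 < d + 2 * eta < k.+1%:R^-1 by rewrite etab andbT; lra.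
      have oC : open (\bigcup_(a in C i) eball a eta) by exact: open_nbhd_set.
      have h := Bx (\bigcup_(a in C i) eball a eta) _ rb oC Sx Sd.
      apply: (@le_trans _ _ (((K + e) * (d + 2 * eta) ^+ m)%:E)); first exact: h.
      rewrite /hausdorff_gauge; case: asboolP => [C0|_]; first by move: Cx; rewrite C0.
      have oE : L m (eball (0 : 'rV[R]_m) 1) = omega%:E.
        by rewrite fineK// ge0_fin_numE// lebesgue_eball_lty.
      rewrite oE dE -EFinM -EFin_expe -!EFinM -EFinD lee_fin; apply: le_trans etac _.
      have -> : omega * (2^-1 * d) ^+ m = K * d ^+ m by rewrite exprMn exprVn /K mulrA [omega * _]mulrC.
      have -> : (1 + e / K) * (K * d ^+ m) = (K + e) * d ^+ m by field; rewrite gt_eqF.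
      by rewrite lerD2r.
    have cover : A `&` B k `<=` \bigcup_i S i.
      move=> x ABx; have [i _ Cx] := AC x ABx.1; exists i => //.
      by have [_ h _] := SP i; apply: h.
    have mS i : measurable (S i) by have [] := SP i.
    have h : (mu (A `&` B k) <= \sum_(i <oo) mu (S i))%E.
      by apply: measure_sigma_subadditive => //; exact: measurableI.
    apply: (le_trans h).
    apply: (@le_trans _ _ (\sum_(i <oo) ((1 + e / K)%:E * hausdorff_gauge m (C i) + (e / (2 ^ i.+1)%:R)%:E))%E).
      by apply: lee_nneseries => // i _; have [] := SP i.
    have eK : 0 <= 1 + e / K by rewrite addr_ge0 ?divr_ge0 ?ltW.
    have g0 i : (0 <= (1 + e / K)%:E * hausdorff_gauge m (C i))%E by rewrite mule_ge0 ?hausdorff_gauge_ge0.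
    apply: (le_trans (epsilon_trick xpredT g0 (ltW e0))).
    rewrite nneseriesZl; last by move=> i _; exact: hausdorff_gauge_ge0.
    rewrite [leRHS]EFinD EFinM; apply: leeD2r; apply: lee_wpmul2l; [by rewrite lee_fin|exact: ltW].
  have mAB k : measurable (A `&` B k) by exact: measurableI.
  have cv := @nondecreasing_cvg_mu _ _ _ mu (fun k => A `&` B k) mAB (bigcupT_measurable _ mAB)
    (fun i j ij => introT (subsetPset _ _) (@setIS _ A _ _ (Bmono i j ij))).
  by rewrite [X in mu X]AB; apply: (cvge_le _ cv); near=> k; exact: bound.
rewrite muf// HAE lee_fin; apply/ler_addgt0Pr => e e0.
have h0 : 0 <= fine (H A) by exact: fine_ge0.
pose c := 3 + (fine (H A) + 1) / K.
have c0 : 0 < c by rewrite /c addr_gt0// divr_gt0//; exact: ltr_wpDl.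
pose t := Num.min 1 (e / c).
have t0 : 0 < t by rewrite lt_min ltr01 divr_gt0.
have t1 : t <= 1 by rewrite ge_min lexx.
have t2 : t * c <= e by rewrite -ler_pdivlMr// ge_min lexx orbT.
have := key t t0; rewrite muf// lee_fin => /le_trans; apply.
move: t2; rewrite /c; set q := K^-1; have q0 : 0 < q by rewrite invr_gt0.
have h3 : t * q * t <= t * q by rewrite ler_piMr// mulr_ge0// ltW.
by move: (fine (H A)) h0 => h h0 h2; lra.
Unshelve. all: by end_near. Qed.

End hausdorff_comparison.

Section hausdorff_delta_outer.
Context {R : realType} {n k : nat}.
Local Notation rV := 'rV[R]_n.
Variable d : R.
Local Notation Hd := (@hausdorff_delta R n k d).

(** Its outer extension is the Hausdorff content at the fixed scale d, which thereby inherits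
    countable subadditivity and monotonicity. *)
Definition bounded_gauge (A : set (g_sigma_algebraType [set: set rV])) : \bar R :=
  if (ediam (A : set rV) <= d%:E)%E then hausdorff_gauge k A else +oo%E.

Lemma bounded_gauge_ge0 A : (0 <= bounded_gauge A)%E.
Proof. by rewrite /bounded_gauge; case: ifP => // _; exact: hausdorff_gauge_ge0. Qed.

Lemma bounded_gauge0 : bounded_gauge set0 = 0%E.
Proof.
rewrite /bounded_gauge hausdorff_gauge0 ifT//; apply: ediam_le => x y; case.
Qed.

Lemma hausdorff_deltaE : Hd = mu_ext bounded_gauge.
Proof.
apply/funext => A; apply/eqP; rewrite eq_le; apply/andP; split.
- apply: le_ereal_inf_tmp => _ [C [_ AC] <-].
  have [dC|/existsNP[i /negP dC]] := pselect (forall i, (ediam (C i : set rV) <= d%:E)%E).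
    apply: (le_trans (hausdorff_delta_le dC AC)); apply: le_of_eq.
    by apply: eq_eseriesr => i _; rewrite /bounded_gauge dC.
  rewrite [leRHS](@eseries_pinfty _ _ _ i) ?leey//.
    by move=> j _; rewrite -ltNye (lt_le_trans _ (bounded_gauge_ge0 _)).
  by rewrite /bounded_gauge (negbTE dC).
- apply: le_ereal_inf_tmp => _ [C [dC AC] <-]; apply: ereal_inf_lbound; exists C.
    by split => // i; exact: sub_sigma_algebra.
  by apply: eq_eseriesr => i _; rewrite /bounded_gauge dC.
Qed.

Lemma hausdorff_delta_sigma_subadditive (F : (set rV)^nat) :
  (Hd (\bigcup_i F i) <= \sum_(i <oo) Hd (F i))%E.
Proof. by rewrite hausdorff_deltaE; exact: (mu_ext_sigma_subadditive bounded_gauge_ge0). Qed.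

Lemma le_hausdorff_delta (A B : set rV) : A `<=` B -> (Hd A <= Hd B)%E.
Proof. by move=> AB; rewrite hausdorff_deltaE; exact: (le_mu_ext bounded_gauge AB). Qed.

Lemma nneseries_prefix (f : nat -> \bar R) N : (forall i, (0 <= f i)%E) ->
  (forall i, (N <= i)%N -> f i = 0%E) -> (\sum_(i <oo) f i = \sum_(i < N) f i)%E.
Proof.
move=> f0 fN; rewrite (nneseries_split 0 N)// add0n eseries0 ?adde0 ?big_mkord// => i Ni _.
exact: fN.
Qed.

Lemma hausdorff_delta_set0 : Hd set0 = 0%E.
Proof. by rewrite hausdorff_deltaE; exact: (mu_ext0 bounded_gauge0 bounded_gauge_ge0). Qed.

Lemma hausdorff_delta_gauge (A : set rV) : (ediam A <= d%:E)%E -> (Hd A <= hausdorff_gauge k A)%E.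
Proof.
move=> dA; pose C i : set rV := if i is 0%N then A else set0.
have e0 : (ediam (set0 : set rV) <= d%:E)%E by apply: ediam_le => x y; case.
have : (Hd A <= \sum_(i <oo) hausdorff_gauge k (C i))%E.
  apply: hausdorff_delta_le => [[|i]//|x Ax]; by exists 0%N.
rewrite (@nneseries_prefix _ 1) ?big_ord1// => [i|[|i]//= _].
- exact: hausdorff_gauge_ge0.
- exact: hausdorff_gauge0.
Qed.

Lemma hausdorff_delta_setU (A B : set rV) : (Hd (A `|` B) <= Hd A + Hd B)%E.
Proof.
have := hausdorff_delta_sigma_subadditive (bigcup2 A B); rewrite bigcup2E (@nneseries_prefix _ 2).
- by rewrite big_ord_recl big_ord1.
- by move=> i; exact: hausdorff_delta_ge0.
- by move=> [|[|i]]// _; exact: hausdorff_delta_set0.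
Qed.

Lemma hausdorff_delta_seq (I : eqType) (s : seq I) (F : I -> set rV) :
  (Hd [set x | exists2 i, i \in s & F i x] <= \sum_(i <- s) Hd (F i))%E.
Proof.
elim: s => [|i s IH].
  by rewrite big_nil (_ : [set x | _] = set0) ?hausdorff_delta_set0// -subset0 => x [].
rewrite big_cons; apply: (@le_trans _ _ (Hd (F i `|` [set x | exists2 i, i \in s & F i x]))).
  apply: le_hausdorff_delta => x [j]; rewrite inE => /orP[/eqP ->|js Fx]; first by left.
  by right; exists j.
by apply: (le_trans (hausdorff_delta_setU _ _)); exact: leeD2l.
Qed.

End hausdorff_delta_outer.

Lemma gauge_ball_le {R : realType} {n k : nat} (z : 'rV[R]_n) (r : R) : 0 <= r ->
  (hausdorff_gauge k [set x : 'rV[R]_n | (enorm (x - z) <= r)%R] <=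
   (fine (borel_lebesgue R k (eball (0 : 'rV[R]_k) 1)) * r ^+ k)%:E)%E.
Proof.
move=> r0; set A := [set x | _]; rewrite /hausdorff_gauge.
have w0 : 0 <= fine (borel_lebesgue R k (eball (0 : 'rV[R]_k) 1)) by exact: fine_ge0.
case: asboolP => [_|_]; first by rewrite lee_fin mulr_ge0// exprn_ge0.
have Az : A z by rewrite /A /= subrr enorm0.
have d0 : (0 <= ediam A)%E by apply: ediam_ge0; exists z.
have d1 : (ediam A <= (2 * r)%:E)%E.
  apply: ediam_le => x y; rewrite /A /= => xz yz; rewrite lee_fin.
  by have := ler_enorm_dist x z y; rewrite (enormB z); lra.
have dE : ediam A = (fine (ediam A))%:E by rewrite fineK// ge0_fin_numE// (le_lt_trans d1 (ltry _)).
have oE : borel_lebesgue R k (eball (0 : 'rV[R]_k) 1) =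
    (fine (borel_lebesgue R k (eball (0 : 'rV[R]_k) 1)))%:E.
  by rewrite fineK// ge0_fin_numE// lebesgue_eball_lty.
rewrite oE dE -EFinM -EFin_expe -EFinM lee_fin ler_wpM2l// lerXn2r ?nnegrE//.
  by rewrite mulr_ge0// fine_ge0.
by rewrite mulrC ler_pdivrMr// mulrC -lee_fin -dE.
Qed.

Lemma bernoulli {R : realType} (m : nat) (t : R) : 0 <= t <= 1 -> 1 - m%:R * t <= (1 - t) ^+ m.
Proof.
move=> /andP[t0 t1]; elim: m => [|m IH]; first by rewrite expr0; lra.
rewrite exprSr; apply: (@le_trans _ _ ((1 - m%:R * t) * (1 - t))); last by rewrite ler_wpM2r// subr_ge0.
rewrite -natr1; have : 0 <= m%:R * t * t by rewrite !mulr_ge0.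
by move: (m%:R : R) => q; lra.
Qed.

(** * The Hausdorff measure is at most the perimeter measure *)

Section hausdorff_upper.
Context {R : realType} {m : nat}.
Local Notation n := m.+1.
Local Notation rV := 'rV[R]_n.
Local Notation L := (borel_lebesgue R).
Local Notation T := (borel_rV R n).
Local Notation H := (@hausdorff R n m).
Local Notation omega := (fine (L m (eball (0 : 'rV[R]_m) 1))).
Context (E : set T) (mu : {measure set T -> \bar R}) (nu : rV -> rV).
Hypotheses (mE : measurable E) (gg : scalar_gauss_green E mu nu).

Let muT : (mu setT < +oo)%E. Proof. by case: gg. Qed.

(** The blow-up limit for a cutoff that is 1 up to radius 1 - t and supported in the unit ball is at
    least (1 - t)^m omega, hence at least (1 - e/2) omega by Bernoulli's inequality. *)
Lemma lower_density x v (e : R) : blowup_point mu nu x v -> 0 < e < 1 -> exists2 r : R, 0 < r &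
  forall rho, 0 < rho < r -> (((1 - e) * omega * rho ^+ m)%:E <= mu (eball x rho))%E.
Proof.
move=> [v1 exs pos] /andP[e0 e1].
have w0 := @omega_gt0 R m.
(* Chosen for m t <= e/2; the denominator with m + 1 is nonzero in the case m = 0 too. *)
pose t : R := e / (2 * m.+1%:R).
have m0 : 0 < 2 * m.+1%:R :> R by rewrite mulr_gt0.
have t0 : 0 < t by rewrite divr_gt0.
have tm : m%:R * t <= e / 2.
  rewrite /t mulrCA ler_pM2l// invfM mulrCA -[X in _ <= X]mulr1 ler_pM2l ?invr_gt0//.
  by rewrite ler_pdivrMr// mul1r ler_nat.
have t1 : t < 1.
  rewrite ltr_pdivrMr// mul1r; apply: (lt_le_trans e1); have : 1 <= m.+1%:R :> R by rewrite ler1n.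
  by move: (m.+1%:R : R) => q; lra.
have a0 : 0 < 1 - t by rewrite subr_gt0.
have a1 : 1 - t < 1 by rewrite ltrBlDr ltrDl.
have gT := @radial_test_fun R n _ _ a0 a1.
have gt : is_test (@radial_cutoff R n (1 - t) 1) by eexists; exact: gT.
have c0 : 0 < e / 2 * omega by rewrite mulr_gt0// divr_gt0.
have [r r0 rP] := blowup_limit mE gg v1 exs pos gT c0; exists r => // rho rr.
have /andP[p0 _] := rr.
have mb : measurable (eball x rho : set T) by exact: measurable_eball.
have mball : measurable (eball (0 : 'rV[R]_m) (1 - t) : set (borel_rV R m)) by exact: measurable_eball.
have g1 : \int[mu]_y radial_cutoff (1 - t) 1 (dilate x rho y) <= fine (mu (eball x rho)).
  rewrite (measure_indicE _ mb) -/(Rintegral _ _ _); apply: le_Rintegral => //.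
  - apply: (bounded_integrable (C := 1)) => //.
      exact: (measurableT_comp (is_test_measurable gt) (measurable_dilate x rho)).
    by move=> y; have /andP[h0 h1] := radial_cutoff_itv (1 - t) 1 (dilate x rho y); rewrite ger0_norm.
  - apply: (bounded_integrable (C := 1)) => //; first exact: measurable_indic.
    by move=> y; case: (_ \in _); rewrite ?normr0 ?normr1.
  - move=> y _; have [yb|yb] := pselect (eball x rho y).
      by rewrite mem_set//; have /andP[] := radial_cutoff_itv (1 - t) 1 (dilate x rho y).
    rewrite memNset// (radial_cutoff_out a0 a1)// (enorm_dilate _ p0).
    by rewrite ler_pdivlMl// mulr1 leNgt; apply/negP.
have g2 : (1 - t) ^+ m * omega <= \int[L m]_y radial_cutoff (1 - t) 1 (slice v y).
  have -> : (1 - t) ^+ m * omega = fine (L m (eball (0 : 'rV[R]_m) (1 - t))).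
    by have := @lebesgue_eballE R m 0 _ a0 => /= ->; rewrite fineM// ge0_fin_numE// lebesgue_eball_lty.
  rewrite (measure_indicE _ mball) -/(Rintegral _ _ _); apply: le_Rintegral => //.
  - apply: (support_integrable mball (lebesgue_eball_lty _ _) _ _ (C := 1)) => //.
    + exact: measurable_indic.
    + by move=> y ny; rewrite memNset.
    + by move=> y; case: (_ \in _); rewrite ?normr0 ?normr1.
  - apply: (support_integrable (measurable_eball (0 : 'rV[R]_m) 1) (lebesgue_eball_lty _ _) _ _ (C := 1)) => //.
    + exact: (measurableT_comp (is_test_measurable gt) (measurable_slice v)).
    + move=> y ny; rewrite (radial_cutoff_out a0 a1)// enorm_slice leNgt; apply/negP => h; apply: ny.
      by rewrite /eball /= subr0.
    + by move=> y; have /andP[h0 h1] := radial_cutoff_itv (1 - t) 1 (slice v y); rewrite ger0_norm.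
  - move=> y _; have [yb|yb] := pselect (eball (0 : 'rV[R]_m) (1 - t) y).
      rewrite mem_set// (radial_cutoff_in a0 a1)// enorm_slice; move: yb; rewrite /eball /= subr0; exact: ltW.
    by rewrite memNset//; have /andP[] := radial_cutoff_itv (1 - t) 1 (slice v y).
have g3 := bernoulli m (introT andP (conj (ltW t0) (ltW t1))).
have g4 : (1 - e / 2) * omega <= (1 - t) ^+ m * omega by rewrite ler_wpM2r ?(ltW w0)//; lra.
have := rP rho rr; rewrite ler_distl => /andP[g5 _].
have mf : mu (eball x rho) = (fine (mu (eball x rho)))%:E.
  by rewrite fineK// ge0_fin_numE//; exact: (mu_fin gg).
rewrite mf lee_fin mulrC -ler_pdivlMl ?exprn_gt0//.
apply: (@le_trans _ _ (rho ^- m * \int[mu]_y radial_cutoff (1 - t) 1 (dilate x rho y))); first by lra.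
by rewrite ler_wpM2l// invr_ge0 exprn_ge0// ltW.
Qed.

(** Vitali's covering argument with radii 2^-k, larger balls first. The chosen balls are disjoint
    and have mass at least (1 - e) omega rad^m, so the sum of omega rad^m is at most mu(R^n) / (1 -
    e). A point missed by the closed balls of the first N stages lies in a doubled ball of a later
    stage, and these contribute the tail of a convergent series. D need not be measurable. *)
Lemma hausdorff_le_measure (D : set rV) :
  (forall x, D x -> exists v, blowup_point mu nu x v) -> (H D <= mu setT)%E.
Proof.
move=> DP; set M := fine (mu setT).
have muE : mu setT = M%:E by rewrite fineK// ge0_fin_numE.
have M0 : 0 <= M by exact: fine_ge0.
have W0 := @omega_gt0 R m; set W := omega in W0.
have key (e d : R) : 0 < e < 1 -> 0 < d -> (hausdorff_delta m d D <= (M / (1 - e))%:E)%E.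
  move=> /andP[e0 e1] d0; have e2 : 0 < 1 - e by rewrite subr_gt0.
  pose c := (1 - e) * W; have c0 : 0 < c by rewrite mulr_gt0.
  pose rad k : R := 2 ^- k.
  have rad0 k : 0 < rad k by rewrite invr_gt0 exprn_gt0.
  have radm j k : (j <= k)%N -> rad k <= rad j.
    by move=> jk; rewrite lef_pV2 ?posrE ?exprn_gt0// ler_weXn2l// ler1n.
  have radlim (b : R) : 0 < b -> \forall k \near \oo, rad k < b.
    move=> b0; have [k _ kb] : \forall k \near \oo, k.+1%:R^-1 < b by exact: (near_infty_natSinv_lt (PosNum b0)).
    exists k => // j /= kj; apply: le_lt_trans (kb k (leqnn k)); apply: le_trans (radm _ _ kj) _.
    by rewrite lef_pV2 ?posrE ?exprn_gt0// -natrX ler_nat ltn_expl.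
  (* Doubled balls have diameter at most 4 rad, which must not exceed the scale d. *)
  have [K0 _ K0P] : \forall k \near \oo, rad k < d / 4 by apply: radlim; rewrite divr_gt0.
  (* Requiring the bound at all smaller dyadic radii makes a point available at every later
     level. *)
  pose P k : set rV := [set x | (K0 <= k)%N /\
    forall j, (k <= j)%N -> ((c * rad j ^+ m)%:E <= mu (eball x (rad j)))%E].
  pose sep : rel (rV * nat) := fun a b => rad a.2 + rad b.2 < enorm (a.1 - b.1).
  pose F (q : rV * nat) : set T := eball q.1 (rad q.2).
  have mF q : measurable (F q) by exact: measurable_eball.
  have disj a b : sep a b -> F a `&` F b = set0.
    rewrite /sep => ab; rewrite -subset0 => y []; rewrite /F /eball /= => ya yb.
    by have := ler_enorm_dist a.1 y b.1; rewrite (enormB a.1 y); lra.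
  have Pb k : exists N0, forall s : seq (rV * nat),
      (forall q, q \in s -> P q.2 q.1 /\ (q.2 <= k)%N) -> pairwise sep s -> (size s <= N0)%N.
    have ck : 0 < c * rad k ^+ m by rewrite mulr_gt0// exprn_gt0.
    have [N0 N0P] := disjoint_mass_bound measurableT muT mF ck.
    exists N0 => s sP ps; apply: N0P; last by apply: sub_pairwise ps => a b /disj h; apply/asboolP.
    move=> q qs; split => //; have [[_ h] qk] := sP q qs; apply: le_trans (h _ (leqnn _)).
    by rewrite lee_fin ler_pM2l// lerXn2r ?nnegrE ?(ltW (rad0 _))// radm.
  have [ext [st [st0 stS stsep extP stmax]]] := maximal_stages Pb.
  have stP k q : q \in st k -> exists2 j, (j < k)%N & q \in ext j.
    elim: k => [|k IH]; first by rewrite st0.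
    rewrite stS mem_cat => /orP[qk|/IH[j jk qj]]; first by exists k.
    by exists j => //; exact: ltnW.
  have stmono a b : (a <= b)%N -> {subset st a <= st b}.
    move=> /subnKC <-; elim: (b - a)%N => [|i IH] q; rewrite ?addn0// addnS stS mem_cat => /IH ->.
    by rewrite orbT.
  have stsum N : \sum_(q <- st N) W * rad q.2 ^+ m <= M / (1 - e).
    have FC x : \sum_(q <- st N) \1_(F q) x <= 1 :> R.
      apply: disjoint_indic_sum; apply: sub_pairwise (stsep N) => a b /disj h; apply/asboolP => -[Fa Fb].
      by have : (F a `&` F b) x by []; rewrite h.
    have := overlap_sum_le (s := st N) mu mF (measurable_cst (1 : R)) (fun=> ler01) ler01 (fun x _ => FC x).
    rewrite mul1e (_ : (\int[mu]_x (cst 1 x)%:E)%E = M%:E) => [h|]; last by rewrite -muE -[RHS]mul1e -integral_cst.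
    have : (\sum_(q <- st N) (c * rad q.2 ^+ m)%:E <= M%:E)%E.
      apply: le_trans h; rewrite big_seq [leRHS]big_seq; apply: lee_sum => q qN.
      have [j _ qj] := stP N q qN; have [[_ hq] q2] := extP j q qj; rewrite q2.
      apply: (le_trans (hq _ (leqnn j))); rewrite (measure_indicE _ (measurable_eball _ _)) le_eqVlt.
      by apply/orP; left; apply/eqP; apply: eq_integral => x _; rewrite mulr1 /F q2.
    rewrite sumEFin lee_fin -!mulr_sumr /c -mulrA => h2.
    by rewrite ler_pdivlMr// mulrC.
  pose a k : R := \sum_(q <- ext k) W * rad q.2 ^+ m.
  have a0 k : 0 <= a k by apply: sumr_ge0 => q _; rewrite mulr_ge0 ?exprn_ge0 ?(ltW W0)// ltW.
  have asum N : \sum_(0 <= k < N) a k = \sum_(q <- st N) W * rad q.2 ^+ m.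
    elim: N => [|N IH]; first by rewrite big_geq// st0 big_nil.
    by rewrite big_nat_recr//= IH stS big_cat/= addrC.
  have afin : (\sum_(0 <= k <oo) (a k)%:E < +oo)%E.
    apply: le_lt_trans (ltry (M / (1 - e))); apply: lime_le.
      by apply: is_cvg_nneseries => k _ _; rewrite lee_fin.
    by apply: nearW => N; rewrite sumEFin lee_fin asum stsum.
  have tail := nneseries_tail_cvg afin (fun k _ => a0 k : (0 <= (a k)%:E)%E).
  have bound N : (hausdorff_delta m d D <= (M / (1 - e))%:E + (2 ^+ m)%:E * \sum_(N <= k <oo) (a k)%:E)%E.
    pose U1 := [set x | exists2 q, q \in st N & enorm (x - q.1) <= rad q.2].
    pose U2 i := [set x | exists2 q, q \in ext (i + N)%N & enorm (x - q.1) <= 2 * rad q.2].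
    have cover : D `<=` U1 `|` \bigcup_i U2 i.
      move=> x Dx; have [xU|xU] := pselect (U1 x); [by left|right].
      have [v vP] := DP x Dx; have [r0 r00 r0P] := lower_density vP (introT andP (conj e0 e1)).
      (* The finitely many closed balls of the first N stages are at positive distance from x, so at
         a late level x can only conflict with a ball chosen after stage N. That ball is at least as
         large as the one around x, hence the factor 2. *)
      have far : \forall k \near \oo, forall q, q \in st N -> rad k + rad q.2 < enorm (x - q.1).
        have : forall q, q \in st N -> rad q.2 < enorm (x - q.1).
          by move=> q qN; rewrite ltNge; apply/negP => h; apply: xU; exists q.
        elim: (st N) => [|q s IH] h; first by near=> k.
        have h1 : 0 < enorm (x - q.1) - rad q.2 by rewrite subr_gt0 h// mem_head.
        have h2 := IH (fun p ps => h p (mem_behead (ps : p \in behead (q :: s)))).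
        move: (radlim _ h1) h2; apply: filterS2 => k k1 k2 p.
        by rewrite inE => /orP[/eqP ->|/k2//]; lra.
      have [k1 _ k1P] := filterI far (radlim _ r00).
      pose k := maxn (maxn k1 K0) N.
      have kk1 : (k1 <= k)%N by rewrite /k !leq_max leqnn.
      have kK0 : (K0 <= k)%N by rewrite /k !leq_max leqnn orbT.
      have kN : (N <= k)%N by rewrite /k !leq_max leqnn !orbT.
      have Px : P k x.
        split => // j kj; apply: r0P; rewrite rad0/=.
        by have [_] := k1P j (leq_trans kk1 kj).
      have [q qk nsep] := stmax k x Px.
      have [j jk qj] := stP _ _ qk.
      have Nj : (N <= j)%N.
        rewrite leqNgt; apply/negP => jN; move/negP: nsep; apply.
        have [h _] := k1P k kk1; apply: h; apply: (stmono j.+1 N jN).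
        by rewrite stS mem_cat qj.
      exists (j - N)%N => //; exists q; first by rewrite subnK.
      have [_ q2] := extP j q qj; rewrite ltnS in jk.
      by have := radm _ _ jk; move: nsep; rewrite /sep /= -leNgt q2; lra.
    have g1 q (t : R) : (K0 <= q.2)%N -> 0 <= t <= 2 ->
        (hausdorff_delta m d [set x : rV | (enorm (x - q.1) <= t * rad q.2)%R] <= (W * (t * rad q.2) ^+ m)%:E)%E.
      move=> qK /andP[t0 t2]; have hr := rad0 q.2; have t3 : 0 <= t * rad q.2 by rewrite mulr_ge0// ltW.
      apply: le_trans (gauge_ball_le q.1 t3); apply: hausdorff_delta_gauge.
      apply: ediam_le => x y /= xq yq; rewrite lee_fin.
      have := ler_enorm_dist x q.1 y; rewrite (enormB q.1).
      have := K0P q.2 qK => /=; have : t * rad q.2 <= 2 * rad q.2 by rewrite ler_wpM2r// ltW.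
      by rewrite ltr_pdivlMr//; lra.
    have extK k q : q \in ext k -> (K0 <= q.2)%N by move=> /extP[[h _] ->].
    apply: (le_trans (le_hausdorff_delta d cover)); apply: (le_trans (hausdorff_delta_setU _ _ _)); apply: leeD.
      rewrite (_ : U1 = [set x | exists2 q, q \in st N & [set x : rV | enorm (x - q.1) <= 1 * rad q.2] x]); last first.
        by apply/seteqP; split => x [q qN h]; exists q => //; move: h; rewrite /= mul1r.
      apply: (le_trans (hausdorff_delta_seq _ _ _)); apply: (@le_trans _ _ (\sum_(q <- st N) (W * rad q.2 ^+ m)%:E)%E).
        rewrite big_seq [leRHS]big_seq; apply: lee_sum => q qN; have [j _ qj] := stP N q qN.
        by apply: (le_trans (g1 q 1 (extK _ _ qj) _)); rewrite ?mul1r// ler01 ler1n.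
      by rewrite sumEFin lee_fin stsum.
    apply: (le_trans (hausdorff_delta_sigma_subadditive _ _)).
    rewrite -(nneseries_addn (f := fun k => (a k)%:E) N); last by move=> k; rewrite lee_fin.
    rewrite -nneseriesZl; last by move=> k _; rewrite lee_fin.
    apply: lee_nneseries => [i _ _|i _]; first exact: hausdorff_delta_ge0.
    apply: (le_trans (hausdorff_delta_seq _ _ _)); rewrite -EFinM /a mulr_sumr -sumEFin.
    rewrite big_seq [leRHS]big_seq; apply: lee_sum => q qN.
    apply: (le_trans (g1 q 2 (extK _ _ qN) _)); first by rewrite ler0n lexx.
    by rewrite lee_fin exprMn mulrCA.
  apply/lee_addgt0Pr => t t0.
  have t1 : (0%E < (t / 2 ^+ m)%:E)%E by rewrite lte_fin divr_gt0// exprn_gt0.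
  have [N _ NP] := tail _ (open_nbhs_nbhs (conj (@open_ereal_lt_ereal _ (t / 2 ^+ m)%:E) t1)).
  apply: (le_trans (bound N)); apply: leeD2l.
  have := ltW (NP N (leqnn N)) => /= /(lee_wpmul2l (_ : (0 <= (2 ^+ m)%:E)%E)) h.
  apply: (le_trans (h _)); first by rewrite lee_fin exprn_ge0.
  by rewrite -EFinM lee_fin mulrCA divff ?mulr1// gt_eqF// exprn_gt0.
have HM : (H D <= mu setT)%E.
  apply: ge_ereal_sup => _ [d d0 <-]; rewrite muE; apply/lee_addgt0Pr => t t0; rewrite -EFinD.
  pose e := t / (2 * (M + t)).
  have Mt : 0 < M + t by rewrite ltr_wpDl.
  have e0 : 0 < e by rewrite divr_gt0// mulr_gt0.
  have e1 : e * (M + t) = t / 2 by rewrite /e; field; rewrite gt_eqF.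
  have e2 : e < 1 by rewrite /e ltr_pdivrMr ?mulr_gt0//; lra.
  apply: (le_trans (key e d (introT andP (conj e0 e2)) d0)); rewrite lee_fin ler_pdivrMr ?subr_gt0//.
  by rewrite mulrBr mulr1 mulrC e1; lra.
exact: HM.
Unshelve. all: by end_near. Qed.

End hausdorff_upper.

(** * The energy limit *)

Section fubini_real.
Context {d1 d2} {T1 : measurableType d1} {T2 : measurableType d2} {R : realType}.
Variables (m1 : {sigma_finite_measure set T1 -> \bar R}) (m2 : {sigma_finite_measure set T2 -> \bar R}).

Lemma product_sigma_finite : sigma_finite setT (m1 \x m2)%E.
Proof.
have /sigma_finiteP[F [FT ndF Foo]] := sigma_finiteT m1.
have /sigma_finiteP[G [GT ndG Goo]] := sigma_finiteT m2.
exists (fun k => F k `*` G k).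
  rewrite -setXTT FT GT predeqE => -[x y]; split.
    move=> [/= [i _ Fix] [j _ Gjy]]; exists (maxn i j) => //; split.
    - by move: x Fix; exact/subsetPset/ndF/leq_maxl.
    - by move: y Gjy; exact/subsetPset/ndG/leq_maxr.
  by move=> [i _ []/= ? ?]; split; exists i.
move=> k; have [mFk Fk] := Foo k; have [mGk Gk] := Goo k; split; first exact: measurableX.
by rewrite product_measure1E// lte_mul_pinfty// ge0_fin_numE.
Qed.

(** Packaged as a sigma-finite measure so that the product can itself be a factor in the integrals
    over triples. *)
Definition sigma_finite_product : {sigma_finite_measure set (T1 * T2)%type -> \bar R} :=
  sigma_finite_alias product_sigma_finite.

Lemma Rfubini1 (f : T1 * T2 -> R) : (m1 \x m2)%E.-integrable setT (EFin \o f) ->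
  (forall x, m2.-integrable setT (EFin \o (fun y => f (x, y)))) ->
  \int[m1]_x \int[m2]_y f (x, y) = \int[(m1 \x m2)%E]_p f p.
Proof.
move=> fi fx; rewrite /Rintegral -(integral12_prod_meas1 fi); congr fine.
by apply: eq_integral => x _; exact: (EFin_Rintegral measurableT (fx x)).
Qed.

Lemma Rfubini2 (f : T1 * T2 -> R) : (m1 \x m2)%E.-integrable setT (EFin \o f) ->
  (forall y, m1.-integrable setT (EFin \o (fun x => f (x, y)))) ->
  \int[m2]_y \int[m1]_x f (x, y) = \int[(m1 \x m2)%E]_p f p.
Proof.
move=> fi fx; rewrite /Rintegral -(integral21_prod_meas1 fi); congr fine.
by apply: eq_integral => x _; exact: (EFin_Rintegral measurableT (fx x)).
Qed.

Lemma integrable_prod (g : T1 -> R) (h : T2 -> R) : m1.-integrable setT (EFin \o g) ->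
  m2.-integrable setT (EFin \o h) ->
  (m1 \x m2)%E.-integrable setT (EFin \o (fun p => g p.1 * h p.2)).
Proof.
move=> ig ih; have mg := measurable_int _ ig; have mh := measurable_int _ ih.
have mf : measurable_fun setT (EFin \o (fun p : T1 * T2 => g p.1 * h p.2)).
  apply/measurable_EFinP; apply: measurable_funM.
    by apply: measurableT_comp; [exact/measurable_EFinP|exact: measurable_fst].
  by apply: measurableT_comp; [exact/measurable_EFinP|exact: measurable_snd].
apply: ((@integrable12ltyP _ _ _ _ _ m1 m2 _ mf).2).
have /integrableP[_ gfin] := ig; have /integrableP[_ hfin] := ih.
have h0 : (0 <= \int[m2]_y `|(h y)%:E|)%E by exact: integral_ge0.
have hE : (\int[m2]_y `|(h y)%:E| = (fine (\int[m2]_y `|(h y)%:E|))%:E)%E by rewrite fineK// ge0_fin_numE.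
rewrite (eq_integral (fun x => ((fine (\int[m2]_y `|(h y)%:E|)%E)%:E * `|(g x)%:E|)%E)).
  rewrite ge0_integralZl_EFin ?fine_ge0//; last exact: measurableT_comp.
  by rewrite lte_mul_pinfty ?lee_fin ?fine_ge0.
move=> x _; rewrite -hE muleC -ge0_integralZl//; last exact: measurableT_comp.
by apply: eq_integral => y _; rewrite /= normrM EFinM.
Qed.

Lemma Rintegral_prod (g : T1 -> R) (h : T2 -> R) : m1.-integrable setT (EFin \o g) ->
  m2.-integrable setT (EFin \o h) ->
  \int[(m1 \x m2)%E]_p (g p.1 * h p.2) = \int[m1]_x g x * \int[m2]_y h y.
Proof.
move=> ig ih; have ix x : m2.-integrable setT (EFin \o (fun y => g (x, y).1 * h (x, y).2)).
  exact: (integrableZR (g x) measurableT ih).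
rewrite -(Rfubini1 (integrable_prod ig ih) ix).
transitivity (\int[m1]_x (\int[m2]_y h y * g x)); last by rewrite RintegralZl// mulrC.
by apply: eq_Rintegral => x _ /=; rewrite RintegralZl// mulrC.
Qed.

End fubini_real.

Lemma le_integrableR {d} {T : measurableType d} {R : realType} (mu : {measure set T -> \bar R})
    (f g : T -> R) : measurable_fun setT f -> (forall x, `|f x| <= g x) ->
  mu.-integrable setT (EFin \o g) -> mu.-integrable setT (EFin \o f).
Proof.
move=> mf fg ig; apply: (le_integrable measurableT _ _ ig); first exact/measurable_EFinP.
by move=> x _; rewrite /= lee_fin; apply: le_trans (fg x) (ler_norm _).
Qed.

Section energy.
Context {R : realType} {n : nat}.
Local Notation rV := 'rV[R]_n.
Local Notation L := (borel_lebesgue R n).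
Local Notation T := (borel_rV R n).
Local Notation LL := (sigma_finite_product L L).
Variable f : T -> R.
Hypotheses (mf : measurable_fun setT f) (fi : L.-integrable setT (EFin \o f))
  (fi1 : L.-integrable setT (EFin \o (fun x => enorm (x : rV) * f x)))
  (f0 : \int[L]_x f x = 0).

(** The dominating function throughout, integrable by the first moment. Up to constants it bounds
    both the integrand of the tension and, by [jump_le], the rescaled translation energy. *)
Definition pair_weight (p : T * T) : R := `|f p.1| * `|f p.2| * (enorm (p.1 : rV) + enorm (p.2 : rV)).

Let nfi : L.-integrable setT (EFin \o (fun x => `|f x|)).
Proof. exact: integrable_norm. Qed.

Let nfi1 : L.-integrable setT (EFin \o (fun x => enorm (x : rV) * `|f x|)).
Proof.
apply: le_integrableR (integrable_norm fi1).
  by apply: measurable_funM; [exact: measurable_enorm|exact: measurableT_comp].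
by move=> x /=; rewrite normrM normr_id normrM.
Qed.

Lemma pair_weight_integrable : LL.-integrable setT (EFin \o pair_weight).
Proof.
have i1 := integrable_prod nfi1 nfi; have i2 := integrable_prod nfi nfi1.
rewrite (_ : pair_weight = fun p => enorm (p.1 : rV) * `|f p.1| * `|f p.2| +
    `|f p.1| * (enorm (p.2 : rV) * `|f p.2|)); first exact: integrableDR.
by apply/funext => p; rewrite /pair_weight; ring.
Qed.

Lemma measurable_pair : measurable_fun setT ((fun p => f p.1 * f p.2) : T * T -> R).
Proof.
by apply: measurable_funM; [exact: (measurableT_comp mf measurable_fst)|exact: (measurableT_comp mf measurable_snd)].
Qed.

Lemma measurable_pair_sub : measurable_fun setT ((fun p => (p.1 : rV) - (p.2 : rV)) : T * T -> T).
Proof. by measurable_rV. Qed.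

Lemma pair_integrable (g : T * T -> R) (C : R) : measurable_fun setT g ->
  (forall p, `|g p| <= C * (enorm (p.1 : rV) + enorm (p.2 : rV))) ->
  LL.-integrable setT (EFin \o (fun p => f p.1 * f p.2 * g p)).
Proof.
move=> mg gC; apply: (le_integrableR _ _ (integrableZR C measurableT pair_weight_integrable)).
  by apply: measurable_funM => //; exact: measurable_pair.
move=> p; rewrite !normrM /pair_weight mulrCA ler_wpM2l// mulr_ge0//.
Qed.

Definition tension (v : rV) : R :=
  - 2^-1 * \int[LL]_p (f p.1 * f p.2 * `|dot ((p.1 : rV) - (p.2 : rV)) v|).

Let mdot v : measurable_fun setT ((fun p => `|dot ((p.1 : rV) - (p.2 : rV)) v|) : T * T -> R).
Proof.
apply: measurableT_comp => //; apply: measurable_dot; [exact: measurable_pair_sub|exact: measurable_cst].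
Qed.

Let dot_le (p : T * T) v : `|dot ((p.1 : rV) - (p.2 : rV)) v| <=
  enorm v * (enorm (p.1 : rV) + enorm (p.2 : rV)).
Proof.
apply: le_trans (normr_dot _ _) _; rewrite mulrC ler_wpM2l ?enorm_ge0//.
by rewrite -(enormN (p.2 : rV)); exact: ler_enormD.
Qed.

Let tension_integrable v : LL.-integrable setT (EFin \o (fun p : T * T =>
  f p.1 * f p.2 * `|dot ((p.1 : rV) - (p.2 : rV)) v|)).
Proof. by apply: (pair_integrable (C := enorm v)) => // p; rewrite normr_id. Qed.

Lemma tension_lipschitz : exists C : R, forall u v, `|tension u - tension v| <= C * enorm (u - v).
Proof.
pose C := 2^-1 * \int[LL]_p pair_weight p; exists C => u v.
rewrite /tension -mulrBr normrM normrN [X in X * _]ger0_norm ?invr_ge0//.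
apply: (@le_trans _ _ (2^-1 * (\int[LL]_p pair_weight p * enorm (u - v)))); last by rewrite /C mulrA.
rewrite ler_wpM2l ?invr_ge0//.
rewrite -RintegralB//; have iB := integrableBR measurableT (tension_integrable u) (tension_integrable v).
apply: (le_trans (le_normr_Rintegral measurableT iB)).
rewrite mulrC -RintegralZl//; last exact: pair_weight_integrable.
apply: le_Rintegral => //.
- exact: integrable_norm.
- by apply: integrableZR => //; exact: pair_weight_integrable.
- move=> p _; rewrite -mulrBr !normrM /pair_weight mulrCA ler_wpM2l ?mulr_ge0//.
  apply: le_trans (ler_dist_dist _ _) _; rewrite -dotBr; exact: dot_le.
Qed.

Section set.
Variables (E : set T) (mu : {finite_measure set T -> \bar R}) (nu : rV -> rV).
Hypotheses (mE : measurable E) (gg : scalar_gauss_green E mu nu).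

Let del (h : rV) (x : T) : R := \1_E ((x : rV) - h) - \1_E x.
Let M : R := fine (mu setT).

Definition jump (h : T) : R := fine (shift_var E h).

Let mdel2 : measurable_fun setT ((fun p => del p.2 p.1) : T * T -> R).
Proof.
apply: measurable_funB.
  apply: (@measurableT_comp _ _ _ _ _ _ (\1_E : T -> R) _ (fun p : T * T => (p.1 : rV) - (p.2 : rV) : T)).
    exact: measurable_indic.
  exact: measurable_pair_sub.
by apply: (@measurableT_comp _ _ _ _ _ _ (\1_E : T -> R) _ fst) => //; exact: measurable_indic.
Qed.

Let del1 h x : `|del h x| <= 1. Proof. exact: shift_indicB_le1. Qed.

Let mdel h : measurable_fun setT (del h). Proof. exact: measurable_shift_indicB. Qed.

Lemma del_integrable h : L.-integrable setT (EFin \o del h).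
Proof.
apply/integrableP; split; first exact/measurable_EFinP.
rewrite (_ : (\int[L]_x `|(EFin \o del h) x|)%E = shift_var E h)//.
by have := shift_var_fin mE gg h; rewrite ge0_fin_numE//; exact: integral_ge0.
Qed.

Lemma jumpE h : jump h = \int[L]_x `|del h x|. Proof. by []. Qed.

Lemma measurable_jump : measurable_fun setT jump.
Proof.
have mg : measurable_fun setT ((fun p => `|del p.2 p.1|%:E) : T * T -> \bar R).
  by apply/measurable_EFinP; apply: measurableT_comp => //; exact: mdel2.
have := @measurable_fun_fubini_tonelli_G _ _ T T R L _ mg (fun p => normr_ge0 _ : (0 <= `|del p.2 p.1|%:E)%E).
by move=> mG; apply: (@measurableT_comp _ _ _ _ _ _ (fine : \bar R -> R)) => //; exact: fine_measurable.
Qed.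

Lemma jump_ge0 h : 0 <= jump h. Proof. by apply: fine_ge0; exact: integral_ge0. Qed.

Lemma jump_le h : jump h <= M * enorm (h : rV).
Proof.
have [_ nu1 mufin _] := gg.
rewrite -lee_fin /jump fineK ?(shift_var_fin mE gg)//; apply: le_trans (shift_var_le mE gg h) _.
rewrite lee_fin; apply: (@le_trans _ _ (\int[mu]_x (enorm (h : rV) * \1_setT x))).
  apply: le_Rintegral => //.
  - exact: (normr_dot_integrable gg h).
  - apply: (@bounded_integrable _ _ _ _ _ _ (enorm (h : rV))) => //.
      by apply: measurable_funM => //; exact: measurable_indic.
    by move=> x; rewrite indicT mulr1 ger0_norm ?enorm_ge0.
  - by move=> x _; rewrite indicT mulr1; exact: (nu_dot_le gg).
rewrite RintegralZl//; last first.
  by apply: (bounded_integrable (C := 1)) => // x; rewrite indicT normr1.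
by rewrite mulrC /M /Rintegral -measure_indicE.
Qed.

Lemma jump_shift a b : \int[L]_x `|\1_E ((x : rV) - a) - \1_E ((x : rV) - b)| =
  jump ((a : rV) - (b : rV)).
Proof.
rewrite -(preserves_Rintegral (borel_lebesgue_shift b)).
  apply: eq_Rintegral => x _; rewrite addrK /del; congr (`|\1_E _ - _|).
  by rewrite opprB addrA.
by apply: measurableT_comp => //; apply: measurable_funB; exact: measurable_shift_indic.
Qed.

(** Polarisation of a product: all three differences of indicators take values in {-1, 0, 1}, where
    the square equals the absolute value. *)
Lemma del_mul (a b : rV) (x : T) : del a x * del b x =
  2^-1 * (`|del a x| + `|del b x| - `|\1_E ((x : rV) - a) - \1_E ((x : rV) - b)|).
Proof.
rewrite /del !indicE; case: (_ \in E); case: (_ \in E); case: (_ \in E);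
  rewrite /= ?mulr1n ?mulr0n ?subrr ?subr0 ?sub0r ?normrN ?normr1 ?normr0; lra.
Qed.

Lemma del_mul_integral a b : \int[L]_x (del a x * del b x) =
  2^-1 * (jump a + jump b - jump ((a : rV) - (b : rV))).
Proof.
have iab : L.-integrable setT (EFin \o (fun x : T => `|\1_E ((x : rV) - a) - \1_E ((x : rV) - b)|)).
  have i2 := integrableDR measurableT (integrable_norm (del_integrable a)) (integrable_norm (del_integrable b)).
  apply: le_integrableR i2.
    by apply: measurableT_comp => //; apply: measurable_funB; exact: measurable_shift_indic.
  move=> x /=; rewrite normr_id; apply: le_trans (ler_normB _ _).
  by rewrite /del opprB addrA subrK.
under eq_Rintegral => x _ do rewrite del_mul.
have ia := integrable_norm (del_integrable a); have ib := integrable_norm (del_integrable b).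
rewrite RintegralZl//; last by apply: integrableBR => //; exact: integrableDR.
rewrite RintegralB//; last exact: integrableDR.
by rewrite RintegralD// jump_shift.
Qed.

(** The convolution after the substitution y = x - r z. Subtracting 1_E(x), which the mean zero
    condition allows, makes the integrand integrable in x as well. *)
Definition smoothing (r : R) (x : T) : R := \int[L]_z (f z * del (r *: (z : rV)) x).

Let mscale2 (r : R) : measurable_fun setT ((fun q => r *: (q : rV)) : T -> T).
Proof. by measurable_rV. Qed.

Let mker r : measurable_fun setT ((fun p => f p.2 * del (r *: (p.2 : rV)) p.1) : T * T -> R).
Proof.
apply: measurable_funM; first exact: (measurableT_comp mf measurable_snd).
apply: (@measurableT_comp _ _ _ _ _ _ (fun p : T * T => del p.2 p.1) _
  (fun p : T * T => (p.1, r *: (p.2 : rV) : T))); first exact: mdel2.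
apply/measurable_fun_pair; first exact: measurable_fst.
by apply: (measurableT_comp (mscale2 r)); exact: measurable_snd.
Qed.

Let ker_integrable r x : L.-integrable setT (EFin \o (fun z : T => f z * del (r *: (z : rV)) x)).
Proof.
apply: le_integrableR nfi.
  have mp : measurable_fun setT ((fun z => (x, z)) : T -> T * T).
    by apply/measurable_fun_pair; [exact: measurable_cst|exact: measurable_id].
  exact: (measurableT_comp (mker r) mp).
by move=> z; rewrite normrM ler_piMr.
Qed.

Definition triple (r : R) (p : T * (T * T)) : R :=
  f p.2.1 * del (r *: (p.2.1 : rV)) p.1 * (f p.2.2 * del (r *: (p.2.2 : rV)) p.1).

Let mtriple r : measurable_fun setT (triple r).
Proof.
apply: measurable_funM.
  apply: (measurableT_comp (mker r) (_ : measurable_fun setT (fun p : T * (T * T) => (p.1, p.2.1)))).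
  by apply/measurable_fun_pair => //; exact: (measurableT_comp measurable_fst measurable_snd).
apply: (measurableT_comp (mker r) (_ : measurable_fun setT (fun p : T * (T * T) => (p.1, p.2.2)))).
by apply/measurable_fun_pair => //; exact: (measurableT_comp measurable_snd measurable_snd).
Qed.

Let triple_x_integrable r (q : T * T) : L.-integrable setT (EFin \o (fun x => triple r (x, q))).
Proof.
have i1 := integrableZR (`|f q.1| * `|f q.2|) measurableT (integrable_norm (del_integrable (r *: (q.1 : rV)))).
apply: le_integrableR i1; first by apply: (measurableT_comp (mtriple r)); apply/measurable_fun_pair.
move=> x; rewrite /triple /= !normrM mulrACA -[X in _ <= X]mulr1 -!mulrA ler_wpM2l// ler_wpM2l// ler_wpM2l//.
Qed.

(** Bound one of the two differences by 1; the integral in x of the other is at most mu(R^n) |r|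
    |z|, and the first moment of f takes over. *)
Let triple_integrable r : (L \x LL)%E.-integrable setT (EFin \o triple r).
Proof.
have mt : measurable_fun setT (EFin \o triple r) by exact/measurable_EFinP.
apply: ((@integrable21ltyP _ _ _ _ _ L LL _ mt).2).
have iw := integrableZR (M * `|r|) measurableT pair_weight_integrable.
have /integrableP[_ wfin] := iw; apply: le_lt_trans wfin.
apply: ge0_le_integral => //.
- by move=> q _; exact: integral_ge0.
- have mt2 : measurable_fun setT ((fun p => `|(triple r p)%:E|%E) : T * (T * T) -> \bar R) by exact: measurableT_comp.
  exact: (@measurable_fun_fubini_tonelli_G _ _ T (T * T)%type R L _ mt2 (fun p => abse_ge0 _)).
- by apply: measurableT_comp => //; exact: (measurable_int _ iw).
move=> q _; rewrite gee0_abs; last first.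
  by rewrite lee_fin /pair_weight !mulr_ge0 ?addr_ge0 ?enorm_ge0 ?fine_ge0.
have i1 := integrable_norm (triple_x_integrable r q).
rewrite -(EFin_Rintegral measurableT i1) lee_fin.
apply: (@le_trans _ _ (`|f q.1| * `|f q.2| * jump (r *: (q.1 : rV)))).
  rewrite jumpE -RintegralZl//; last exact: integrable_norm (del_integrable _).
  apply: le_Rintegral => //.
    by apply: integrableZR => //; exact: integrable_norm (del_integrable _).
  move=> x _; rewrite /triple /= !normrM mulrACA -[X in _ <= X]mulr1 -!mulrA ler_wpM2l// ler_wpM2l// ler_wpM2l//.
have j := jump_le (r *: (q.1 : rV)); rewrite enormZ mulrA in j.
rewrite /pair_weight mulrCA ler_wpM2l ?mulr_ge0//; apply: (le_trans j).
by rewrite ler_wpM2l ?mulr_ge0 ?fine_ge0// lerDl enorm_ge0.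
Qed.

Lemma smoothing_sqr_integrable r : L.-integrable setT (EFin \o (fun x => smoothing r x ^+ 2)).
Proof.
have ik x : LL.-integrable setT (EFin \o (fun q => triple r (x, q))).
  exact: (integrable_prod (ker_integrable r x) (ker_integrable r x)).
have h := integrable_fubini_F (triple_integrable r).
rewrite (_ : EFin \o (fun x => smoothing r x ^+ 2) = fubini_F LL (EFin \o triple r)); first exact: h.
apply/funext => x; rewrite /= expr2 /smoothing -(Rintegral_prod (ker_integrable r x) (ker_integrable r x)).
exact: (EFin_Rintegral measurableT (ik x)).
Qed.

(** Expand the square and integrate in x first. The terms of [del_mul_integral] that depend on one
    of the two variables only vanish because f has mean zero. *)
Lemma smoothing_energy r : \int[L]_x smoothing r x ^+ 2 =
  - 2^-1 * \int[LL]_p (f p.1 * f p.2 * jump (r *: ((p.1 : rV) - (p.2 : rV)))).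
Proof.
have ik x : LL.-integrable setT (EFin \o (fun q => triple r (x, q))).
  exact: (integrable_prod (ker_integrable r x) (ker_integrable r x)).
transitivity (\int[L]_x \int[LL]_q triple r (x, q)).
  by apply: eq_Rintegral => x _; rewrite expr2 /smoothing -Rintegral_prod.
rewrite (Rfubini1 (triple_integrable r) ik) -(Rfubini2 (triple_integrable r) (triple_x_integrable r)).
pose J (z : T) := jump (r *: (z : rV)).
have mJ : measurable_fun setT J by exact: (measurableT_comp measurable_jump (mscale2 r)).
have iJ : L.-integrable setT (EFin \o (fun z => f z * J z)).
  apply: (le_integrableR _ _ (integrableZR (M * `|r|) measurableT nfi1)); first exact: measurable_funM.
  move=> z; rewrite normrM (ger0_norm (jump_ge0 _)) mulrC mulrA ler_wpM2r//.
  by have := jump_le (r *: (z : rV)); rewrite enormZ mulrA.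
have iP : LL.-integrable setT (EFin \o (fun p : T * T => f p.1 * f p.2 * jump (r *: ((p.1 : rV) - (p.2 : rV))))).
  apply: (pair_integrable (C := M * `|r|)).
    by apply: (measurableT_comp measurable_jump); apply: (measurableT_comp (mscale2 r)); exact: measurable_pair_sub.
  move=> p; rewrite ger0_norm ?jump_ge0//; apply: le_trans (jump_le _) _.
  rewrite enormZ mulrA ler_wpM2l ?mulr_ge0 ?fine_ge0//.
  by rewrite -(enormN (p.2 : rV)); exact: ler_enormD.
have i1 := integrable_prod iJ fi; have i2 := integrable_prod fi iJ.
transitivity (\int[LL]_p (2^-1 * (f p.1 * J p.1 * f p.2 + f p.1 * (f p.2 * J p.2)
    - f p.1 * f p.2 * jump (r *: ((p.1 : rV) - (p.2 : rV)))))).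
  apply: eq_Rintegral => p _.
  transitivity (\int[L]_x (f p.1 * f p.2 * (del (r *: (p.1 : rV)) x * del (r *: (p.2 : rV)) x))).
    by apply: eq_Rintegral => x _; rewrite /triple /=; ring.
  rewrite RintegralZl//; last first.
    apply: (le_integrableR _ _ (integrable_norm (del_integrable (r *: (p.1 : rV))))); first exact: measurable_funM.
    by move=> x; rewrite normrM ler_piMr.
  rewrite del_mul_integral -scalerBr -/(J p.1) -/(J p.2).
  by move: (J p.1) (J p.2) (jump _) (f p.1) (f p.2) => a b c k l; ring.
rewrite RintegralZl//; last by apply: integrableBR => //; exact: integrableDR.
rewrite RintegralB//; last exact: integrableDR.
rewrite RintegralD// (Rintegral_prod iJ fi) (Rintegral_prod fi iJ) f0 mulr0 mul0r.
by rewrite addr0 sub0r mulrN mulNr.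
Qed.

(** For each pair (z, w) the quotient jump(r (z - w)) / r converges by [shift_var_cvg], and it is
    dominated by mu(R^n) (|z| + |w|). Fubini's theorem moves the integral against mu outside. *)
Lemma smoothing_energy_cvg :
  r^-1 * \int[L]_x smoothing r x ^+ 2 @[r --> 0^'+] --> \int[mu]_x tension (nu x).
Proof.
have [mnu nu1 mufin _] := gg.
pose A (h : rV) := \int[mu]_x `|dot h (nu x)|.
have -> : \int[mu]_x tension (nu x) =
    - 2^-1 * \int[LL]_p (f p.1 * f p.2 * A ((p.1 : rV) - (p.2 : rV))).
  pose g (q : T * (T * T)) := f q.2.1 * f q.2.2 * `|dot ((q.2.1 : rV) - (q.2.2 : rV)) (nu q.1)|.
  have mg : measurable_fun setT g.
    apply: measurable_funM; first exact: (measurableT_comp measurable_pair measurable_snd).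
    apply: measurableT_comp => //; apply: measurable_dot.
      exact: (measurableT_comp measurable_pair_sub measurable_snd).
    exact: (measurableT_comp mnu measurable_fst).
  have ix (x : T) : LL.-integrable setT (EFin \o (fun p => g (x, p))) by exact: (tension_integrable (nu x)).
  have ip (p : T * T) : mu.-integrable setT (EFin \o (fun x => g (x, p))).
    exact: (integrableZR (f p.1 * f p.2) measurableT (normr_dot_integrable gg ((p.1 : rV) - (p.2 : rV)))).
  have ig : (mu \x LL)%E.-integrable setT (EFin \o g).
    have i1 : mu.-integrable setT (EFin \o (cst 1 : T -> R)).
      by apply: (bounded_integrable (C := 1)) => // x; rewrite normr1.
    apply: le_integrableR (integrable_prod i1 pair_weight_integrable) => // q.
    rewrite mul1r /g !normrM normr_id /pair_weight ler_wpM2l ?mulr_ge0//.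
    by have := dot_le q.2 (nu q.1); rewrite nu1 mul1r.
  transitivity (- 2^-1 * \int[mu]_x \int[LL]_p g (x, p)).
    rewrite -RintegralZl//.
    have h := integrable_fubini_F ig.
    rewrite (_ : EFin \o (fun x => _) = fubini_F LL (EFin \o g)); first exact: h.
    by apply/funext => x; exact: (EFin_Rintegral measurableT (ix x)).
  rewrite (Rfubini1 ig ix) -(Rfubini2 ig ip); congr (_ * _); apply: eq_Rintegral => p _.
  by rewrite /g /= RintegralZl//; exact: (normr_dot_integrable gg).
(* The one-sided limit is tested along positive sequences u tending to 0, to which dominated
   convergence applies. *)
apply/cvg_at_rightP => u [u0 ul].
rewrite (_ : (fun k => _) = fun k => - 2^-1 * \int[LL]_p (f p.1 * f p.2 *
    ((u k)^-1 * jump (u k *: ((p.1 : rV) - (p.2 : rV)))))); last first.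
  apply/funext => k; rewrite smoothing_energy mulrCA; congr (_ * _).
  rewrite -RintegralZl//; first by apply: eq_Rintegral => p _; ring.
  apply: (pair_integrable (C := M * `|u k|)).
    by apply: (measurableT_comp measurable_jump); apply: (measurableT_comp (mscale2 _)); exact: measurable_pair_sub.
  move=> p; rewrite ger0_norm ?jump_ge0//; apply: le_trans (jump_le _) _.
  rewrite enormZ mulrA ler_wpM2l ?mulr_ge0 ?fine_ge0//.
  by rewrite -(enormN (p.2 : rV)); exact: ler_enormD.
apply: (@cvgMl_tmp _ _ \oo _ (fun k => \int[LL]_p (f p.1 * f p.2 *
    ((u k)^-1 * jump (u k *: ((p.1 : rV) - (p.2 : rV))))))).
have mA : measurable_fun setT ((fun p => A ((p.1 : rV) - (p.2 : rV))) : T * T -> R).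
  have mG : measurable_fun setT ((fun q => `|dot ((q.2.1 : rV) - (q.2.2 : rV)) (nu q.1)|%:E) : T * (T * T) -> \bar R).
    apply/measurable_EFinP; apply: measurableT_comp => //; apply: measurable_dot.
      exact: (measurableT_comp measurable_pair_sub measurable_snd).
    exact: (measurableT_comp mnu measurable_fst).
  have mF := @measurable_fun_fubini_tonelli_G _ _ T (T * T)%type R mu _ mG (fun p => normr_ge0 _).
  by apply: (@measurableT_comp _ _ _ _ _ _ (fine : \bar R -> R)) => //; exact: fine_measurable.
apply: (@Rdominated_cvg _ _ _ _ setT _ _ (fun p => M * pair_weight p)) => //.
- move=> k; apply: measurable_funM; first exact: measurable_pair.
  apply: measurable_funM; first exact: measurable_cst.
  by apply: (measurableT_comp measurable_jump); apply: (measurableT_comp (mscale2 _)); exact: measurable_pair_sub.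
- by apply: measurable_funM => //; exact: measurable_pair.
- move=> p _; apply: (@cvgMl_tmp _ _ \oo _ (fun k => (u k)^-1 * jump (u k *: ((p.1 : rV) - (p.2 : rV))))).
  set h := (p.1 : rV) - (p.2 : rV).
  exact: (((cvg_at_rightP (fun r : R => r^-1 * fine (shift_var E (r *: h))) 0 _).1 (@shift_var_cvg _ _ _ _ _ mE gg h)) u (conj u0 ul)).
- by apply: integrableZR => //; exact: pair_weight_integrable.
- move=> k p _; rewrite !normrM /pair_weight [X in _ <= X]mulrCA ler_wpM2l ?mulr_ge0//.
  rewrite (ger0_norm (jump_ge0 _)) normfV (gtr0_norm (u0 k)) ler_pdivrMl//.
  apply: le_trans (jump_le _) _; rewrite enormZ (gtr0_norm (u0 k)) mulrCA ler_wpM2l ?(ltW (u0 k))//.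
  rewrite ler_wpM2l ?fine_ge0//.
  by rewrite -(enormN (p.2 : rV)); exact: ler_enormD.
Qed.

End set.
End energy.

(** * Lebesgue measurable sets and the reduced boundary *)

Section completion.
Context {R : realType} {n : nat}.
Local Notation rV := 'rV[R]_n.
Local Notation L := (borel_lebesgue R n).
Local Notation T := (borel_rV R n).
Local Notation CT := (lebesgue_type R n).
Local Notation CL := (lebesgue_rV R n).

Lemma lebesgue_rV_borel (A : set T) : measurable A -> measurable (A : set CT).
Proof. by move=> mA; apply: sub_caratheodory; exact: sub_sigma_algebra. Qed.

Lemma lebesgue_rVE (A : set T) : measurable A -> CL A = L A.
Proof. by move=> mA; exact: measurable_mu_extE. Qed.

Lemma measurable_to_borel : measurable_fun setT (id : CT -> T).
Proof. by move=> _ A mA; rewrite setTI; exact: lebesgue_rV_borel. Qed.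

Lemma lebesgue_measurable_fun {d} {T' : measurableType d} (f : T -> T') : measurable_fun setT f ->
  measurable_fun setT (f : CT -> T').
Proof. by move=> mf; exact: (measurableT_comp mf measurable_to_borel). Qed.

Lemma integral_lebesgue_rV (f : T -> \bar R) : measurable_fun setT f ->
  (\int[CL]_x f x = \int[L]_x f x)%E.
Proof.
move=> mf; rewrite -(integral_image_measure CL measurable_to_borel mf).
by apply: eq_measure_integral => A mA _; exact: lebesgue_rVE.
Qed.

Lemma Rintegral_lebesgue_rV (f : T -> R) : measurable_fun setT f ->
  \int[CL]_x f x = \int[L]_x f x.
Proof. by move=> mf; rewrite /Rintegral (integral_lebesgue_rV (f := EFin \o f))//; exact/measurable_EFinP. Qed.

Definition borel_hull (E E' : set 'rV[R]_n) :=
  [/\ measurable (E' : set T), E `<=` E' & CL.-negligible (E' `\` E)].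

(** On each ball the part of E has finite measure and is approximated from outside by countable
    unions of Borel sets. Intersect these over the errors 1/(j + 1) and take the union over the
    balls. *)
Lemma borel_hull_exists (E : set CT) : measurable E -> exists E', borel_hull E E'.
Proof.
move=> mE; pose Ek k : set CT := E `&` eball (0 : 'rV[R]_n) k%:R.
have mb k : measurable (eball (0 : 'rV[R]_n) k%:R : set T) by exact: measurable_eball.
have mEk k : measurable (Ek k) by apply: measurableI => //; exact: lebesgue_rV_borel.
have Ekfin k : (CL (Ek k) < +oo)%E.
  apply: (@le_lt_trans _ _ (CL (eball (0 : 'rV[R]_n) k%:R))).
    have mbC : measurable (eball (0 : 'rV[R]_n) k%:R : set CT) by exact: lebesgue_rV_borel (mb k).
    by apply: (@le_measureS _ CT R CL _ _ (mEk k) mbC) => x [].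
  by rewrite lebesgue_rVE// lebesgue_eball_lty.
have EkE k : CL (Ek k) = (fine (CL (Ek k)))%:E by rewrite fineK// ge0_fin_numE.
have /choice[B BP] : forall kj : nat * nat, exists B : set T, [/\ measurable B, Ek kj.1 `<=` B &
    (CL (B `\` Ek kj.1) <= (kj.2.+1%:R^-1)%:E)%E].
  move=> [k j]; have j0 : 0 < j.+1%:R^-1 :> R by rewrite invr_gt0.
  have : (CL (Ek k) < (fine (CL (Ek k)) + j.+1%:R^-1)%:E)%E by rewrite [ltLHS]EkE lte_fin ltrDl.
  (* The completed measure is by construction an infimum over countable Borel coverings. *)
  move=> /ereal_inf_lt[_ [F [mF EF] <-] Fs].
  have mFU : measurable (\bigcup_i F i) by exact: bigcupT_measurable.
  have mFC : measurable (\bigcup_i F i : set CT) by exact: lebesgue_rV_borel.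
  exists (\bigcup_i F i); split => //=.
  have h : (CL (\bigcup_i F i) < (fine (CL (Ek k)) + j.+1%:R^-1)%:E)%E.
    rewrite lebesgue_rVE//; apply: le_lt_trans Fs.
    by apply: measure_sigma_subadditive.
  have := measureDI CL mFC (mEk k).
  rewrite (_ : _ `&` Ek k = Ek k); last by rewrite setIC; exact/setIidPl.
  have Efin : CL (Ek k) \is a fin_num by rewrite ge0_fin_numE.
  move=> E1; apply: ltW; rewrite -(lteD2rE _ _ Efin) -E1; apply: (lt_le_trans h).
  by rewrite EFinD fineK// addeC.
pose C k := \bigcap_j B (k, j).
have mC k : measurable (C k) by apply: bigcapT_measurable => j; have [] := BP (k, j).
exists (\bigcup_k C k); split; first exact: bigcupT_measurable.
- move=> x Ex; exists (Num.truncn (enorm x)).+1 => // j _.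
  have [_ h _] := BP ((Num.truncn (enorm x)).+1, j); apply: h; split => //=.
  by rewrite /eball /= subr0 truncnS_gt.
apply: (@negligibleS _ _ _ CL (\bigcup_k ((C k : set CT) `\` Ek k))).
  by move=> x [[k _ Ckx] nEx]; exists k => //; split => // -[].
apply: negligible_bigcup => k.
have mCk : measurable ((C k : set CT) `\` Ek k) by apply: measurableD => //; exact: lebesgue_rV_borel.
exists ((C k : set CT) `\` Ek k); split => //.
apply/eqP; rewrite eq_le measure_ge0 andbT; apply/lee_addgt0Pr => e e0; rewrite add0e.
have [j _ je] : \forall j \near \oo, j.+1%:R^-1 < e by exact: (near_infty_natSinv_lt (PosNum e0)).
have [mB _ h] := BP (k, j).
have mBE : measurable ((B (k, j) : set CT) `\` Ek k) by apply: measurableD => //; exact: lebesgue_rV_borel.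
apply: (@le_trans _ _ (CL (B (k, j) `\` Ek k))).
  by apply: (@le_measureS _ CT R CL _ _ mCk mBE); apply: setSD; exact: bigcap_inf.
by apply: (le_trans h); rewrite lee_fin ltW// je//=.
Qed.

Context {E E' : set rV}.
Hypotheses (mE : measurable (E : set CT)) (EE' : borel_hull E E').

Lemma integral_hull (f : T -> \bar R) : measurable_fun setT f ->
  (\int[CL]_(x in E) f x = \int[L]_(x in (E' : set T)) f x)%E.
Proof.
have [mE' sub [N [mN N0 Nsub]]] := EE' => mf.
have mf' := lebesgue_measurable_fun mf.
have mr : measurable_fun setT (f \_ E' : T -> \bar R).
  by apply/(measurable_restrictT _ mE'); exact: measurable_funTS.
rewrite integral_mkcond [RHS]integral_mkcond -(integral_lebesgue_rV mr).
apply: (@ae_eq_integral _ _ _ CL setT _ _ measurableT).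
- by apply/(measurable_restrictT _ mE); exact: measurable_funTS.
- exact: (lebesgue_measurable_fun mr).
exists N; split => // x /= h; apply: Nsub; apply: contrapT => nE; apply: h => _.
rewrite /patch; have [Ex|Ex] := pselect (E x); first by rewrite !mem_set//; exact: sub.
by rewrite (memNset Ex) memNset// => E'x; apply: nE.
Qed.

Lemma divergence_integrable (phi : rV -> rV) : is_C1c phi ->
  (\int[CL]_(x in E) (divergence phi x)%:E =
   (\sum_i \int[L]_(x in (E' : set T)) dot (\row_j partial (fun y => phi y 0 i) j x) (delta_mx 0 i))%:E)%E.
Proof.
move=> pC; have [mE' _ _] := EE'.
have gi i := C1c_test_fun i pC.
have md i : measurable_fun setT ((fun x => dot (\row_j partial (fun y => phi y 0 i) j x) (delta_mx 0 i)) : T -> R).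
  by have [g _] := gi i; exact: (has_gradient_measurable_dot _ g).
have ig i : L.-integrable (E' : set T) (EFin \o ((fun x => dot (\row_j partial (fun y => phi y 0 i) j x) (delta_mx 0 i)) : T -> R)).
  by apply: test_grad_integrable; [exact: gi|].
rewrite -(Rintegral_sum _ mE' ig) EFin_Rintegral//; last exact: integrable_sumR.
rewrite -integral_hull; last first.
  by apply/measurable_EFinP; apply: measurable_sum.
by apply: eq_integral => x _; rewrite divergence_sum.
Qed.

Lemma gauss_green_of_scalar (mu : {finite_measure set T -> \bar R}) nu :
  scalar_gauss_green E' mu nu -> gauss_green E mu nu.
Proof.
move=> gg; have [mnu nu1 mufin gE] := gg; split => //; first by apply: aeW => x; rewrite nu1.
move=> phi pC; rewrite (divergence_integrable pC).
have gi i := C1c_test_fun i pC.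
have ii i : mu.-integrable setT (EFin \o ((fun x => phi x 0 i * dot (delta_mx 0 i) (nu x)) : T -> R)).
  have ti : is_test (fun x => phi x 0 i) by eexists; exact: gi.
  have [C _ pC'] := is_test_bounded ti.
  exact: (@nu_dot_integrable _ _ E' mu nu gg _ (fun x => phi x 0 i) C _ measurableT (is_test_measurable ti) pC').
under eq_bigr => i _ do rewrite (gE _ _ _ (gi i)).
rewrite -(Rintegral_sum _ measurableT ii) EFin_Rintegral//; last exact: integrable_sumR.
apply: eq_integral => x _; congr EFin; rewrite /dot; apply: eq_bigr => i _; congr (_ * _).
by rewrite (bigD1 i)//= big1 ?addr0 ?mxE ?eqxx ?mul1r// => j ji; rewrite mxE (negbTE ji) andbF mul0r.
Qed.

(** [gauss_green] gives |nu| = 1 only almost everywhere; the modification on a null set makes it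
    hold everywhere, as [scalar_gauss_green] asks. *)
Definition renormalise (e : rV) (nu : rV -> rV) (x : rV) : rV :=
  if enorm (nu x) == 1 then nu x else e.

Lemma scalar_of_gauss_green (mu : {finite_measure set T -> \bar R}) nu (e : rV) : enorm e = 1 ->
  gauss_green E mu nu ->
  [/\ scalar_gauss_green E' mu (renormalise e nu) &
      forall D i, measurable (D : set T) ->
        \int[mu]_(x in D) nu x 0 i = \int[mu]_(x in D) renormalise e nu x 0 i].
Proof.
move=> e1 [mnu ae1 gE].
have mr : measurable_fun setT (renormalise e nu : T -> T).
  apply: measurable_fun_ifT => //.
  by apply: measurable_fun_eqr; [exact: (measurableT_comp measurable_enorm mnu)|exact: measurable_cst].
have aer : {ae mu, forall x, nu x = renormalise e nu x}.
  have [N [mN N0 sub]] := ae1; exists N; split => // x h; apply: sub => /= q; apply: h.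
  by rewrite /= /renormalise q eqxx.
have mc i (w : T -> T) : measurable_fun setT w -> measurable_fun setT (fun x => ((w x : rV) 0 i)%:E : \bar R).
  by move=> mw; apply/measurable_EFinP; exact: (measurableT_comp (measurable_rV_coord i) mw).
split; last first.
  move=> D i mD; rewrite /Rintegral; congr fine; apply: ae_eq_integral => //.
  - by apply: measurable_funTS; exact: mc.
  - by apply: measurable_funTS; exact: mc.
  - by have [N [mN N0 sub]] := aer; exists N; split => // x h; apply: sub => /= q; apply: h => _; rewrite -q.
split => //.
- by move=> x; rewrite /renormalise; case: eqP.
- by rewrite -ge0_fin_numE//; exact: fin_num_measure.
move=> g G h gG; have [mE' _ _] := EE'.
have := gE _ (test_fun_C1c h gG).
under eq_integral => x _ do rewrite (divergence_scale h x gG.1).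
rewrite integral_hull; last by apply/measurable_EFinP; exact: (has_gradient_measurable_dot _ gG.1).
move=> E1; rewrite /Rintegral E1; congr fine.
have mg := has_gradient_measurable gG.1.
have md (w : T -> T) : measurable_fun setT w -> measurable_fun setT ((fun x => (g x * dot h (w x : rV))%:E) : T -> \bar R).
  move=> mw; apply/measurable_EFinP; apply: measurable_funM => //.
  by apply: measurable_dot => //; exact: measurable_cst.
transitivity (\int[mu]_x (g x * dot h (nu x))%:E)%E; first by apply: eq_integral => x _; rewrite dotZl.
apply: ae_eq_integral => //; [exact: md|exact: md|].
by have [N [mN N0 sub]] := aer; exists N; split => // x h1; apply: sub => /= q; apply: h1 => _; rewrite -q.
Qed.

Lemma perimeter_bound i g G : (perimeter E < +oo)%E -> test_fun g G -> (forall x, `|g x| <= 1) ->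
  \int[L]_(x in (E' : set T)) dot (G x) (delta_mx 0 i) <= fine (perimeter E).
Proof.
move=> Pfin gG g1; have [mE' _ _] := EE'.
have e1 : enorm (delta_mx 0 i : rV) = 1.
  rewrite /enorm /dot (bigD1 i)//= big1 ?addr0 ?mxE ?eqxx ?mulr1 ?sqrtr1// => j ji.
  by rewrite !mxE (negbTE ji) andbF mulr0.
have h : ((\int[L]_(x in (E' : set T)) dot (G x) (delta_mx 0 i))%:E <= perimeter E)%E.
  apply: ereal_sup_ubound; exists (fun x => g x *: delta_mx 0 i).
    by split; [exact: test_fun_C1c gG|move=> x; rewrite enormZ e1 mulr1].
  under eq_integral => x _ do rewrite (divergence_scale (delta_mx 0 i) x gG.1).
  rewrite integral_hull; last by apply/measurable_EFinP; exact: (has_gradient_measurable_dot _ gG.1).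
  by rewrite EFin_Rintegral//; exact: (test_grad_integrable (delta_mx 0 i) gG mE').
have Pf : perimeter E \is a fin_num.
  by rewrite fin_numElt Pfin andbT (lt_le_trans _ h)// ltNyr.
by have q := h; rewrite -(fineK Pf) lee_fin in q; apply: le_trans q; apply: le_refl.
Qed.

End completion.

Section reduced_boundary_structure.
Context {R : realType} {m : nat}.
Local Notation n := m.+1.
Local Notation rV := 'rV[R]_n.
Local Notation T := (borel_rV R n).
Local Notation H := (@hausdorff R n m).
Context {E E' : set rV} {mu : {finite_measure set T -> \bar R}} {nu : rV -> rV}.
Hypotheses (mE : measurable (E : set (lebesgue_type R n))) (EE' : borel_hull E E')
  (gg : scalar_gauss_green E' mu nu).

Let mE' : measurable (E' : set T). Proof. by case: EE'. Qed.

Definition average (x : rV) (rho : R) : rV :=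
  \row_i ((fine (mu (eball x rho)))^-1 * \int[mu]_(y in eball x rho) nu y 0 i).

Let dot_delta (i : 'I_n) (w : rV) : dot (delta_mx 0 i) w = w 0 i.
Proof.
rewrite /dot (bigD1 i)//= big1 ?addr0 ?mxE ?eqxx ?mul1r// => j ji.
by rewrite mxE (negbTE ji) andbF mul0r.
Qed.

Let mball x rho : measurable (eball (x : rV) rho : set T).
Proof. exact: measurable_eball. Qed.

Let mufin (A : set T) : measurable A -> (mu A < +oo)%E. Proof. exact: (mu_fin gg). Qed.

Let mnu i : measurable_fun setT ((fun y => nu y 0 i) : T -> R).
Proof. by have [mn _ _ _] := gg; exact: (measurableT_comp (measurable_rV_coord i) mn). Qed.

Let nu_le i y : `|nu y 0 i| <= 1.
Proof. by have [_ nu1 _ _] := gg; rewrite -(nu1 y) ler_coord_enorm. Qed.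

Let inu i (A : set T) : measurable A -> mu.-integrable A (EFin \o ((fun y => nu y 0 i) : T -> R)).
Proof. by move=> mA; apply: (bounded_integrable (C := 1)) => //; exact: mufin. Qed.

Lemma right_nbhd (P : R -> Prop) : (\forall rho \near (0 : R)^'+, P rho) <->
  exists2 r : R, 0 < r & forall rho, 0 < rho < r -> P rho.
Proof.
split=> [[r /= r0 rP]|[r r0 rP]].
  exists r => // rho /andP[p0 pr]; apply: rP => //=.
  by rewrite /ball_ /= sub0r normrN gtr0_norm.
near=> rho; apply: rP; apply/andP; split; near: rho; [exact: nbhs_right_gt|exact: nbhs_right_lt].
Unshelve. all: by end_near. Qed.

(** The mean excess over a ball is 1 - v . average, which tends to 1 - v . v = 0. *)
Lemma blowup_point_average x v : enorm v = 1 -> (forall s, 0 < s -> (0 < mu (eball x s))%E) ->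
  average x rho @[rho --> 0^'+] --> v -> blowup_point mu nu x v.
Proof.
move=> v1 pos cv; split => // d d0.
have cd : dot (average x rho) v @[rho --> 0^'+] --> dot v v.
  exact: (continuous_cvg _ (@dotl_continuous R n v v) cv).
have : \forall rho \near (0 : R)^'+, dot v v - d < dot (average x rho) v.
  by apply: (cvgr_gt _ cd); rewrite ltrBlDr ltrDl.
rewrite -sqr_enorm v1 expr1n => /right_nbhd[r r0 rP]; exists r => // rho rr.
have /andP[p0 _] := rr; have mb := mball x rho.
have m0 : 0 < fine (mu (eball x rho)) by rewrite fine_gt0// pos//= mufin.
have i1 : mu.-integrable (eball x rho : set T) (EFin \o (cst 1 : T -> R)).
  by apply: (bounded_integrable (C := 1)) => //; [exact: mufin|move=> y; rewrite normr1].
have ii i : mu.-integrable (eball x rho : set T) (EFin \o ((fun y => v 0 i * nu y 0 i) : T -> R)).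
  by apply: integrableZR => //; exact: inu.
have is1 := integrable_sumR (index_enum _) mb ii.
rewrite RintegralB//.
have -> : \int[mu]_(y in eball x rho) 1 = fine (mu (eball x rho)).
  by rewrite Rintegral_indic (measure_indicE mu mb); congr fine; apply: eq_integral => y _; rewrite mulr1.
have -> : \int[mu]_(y in eball x rho) dot v (nu y) = fine (mu (eball x rho)) * dot (average x rho) v.
  rewrite (Rintegral_sum _ mb ii) /dot mulr_sumr; apply: eq_bigr => i _.
  rewrite RintegralZl//; last exact: inu.
  by rewrite mxE -mulrA mulVKf ?gt_eqF// mulrC.
have h : 0 <= fine (mu (eball x rho)) * (dot (average x rho) v - (1 - d)).
  by rewrite mulr_ge0 ?(ltW m0)// subr_ge0 ltW// rP.
by lra.
Qed.

Lemma average_lebesgue_points x : (forall i, lebesgue_point mu (fun y => nu y 0 i) x) ->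
  (forall s, 0 < s -> (0 < mu (eball x s))%E) -> average x rho @[rho --> 0^'+] --> nu x.
Proof.
move=> lp pos; apply: enorm_cvg => e e0; apply/right_nbhd.
have d0 : 0 < e / (2 * n%:R) by rewrite divr_gt0// mulr_gt0.
have [r r0 rP] := common_radius (fun i => lp i _ d0).
exists r => // rho rr; have /andP[p0 _] := rr; have mb := mball x rho.
have m0 : 0 < fine (mu (eball x rho)) by rewrite fine_gt0// pos//= mufin.
have ci i : `|(nu x - average x rho) 0 i| <= e / (2 * n%:R).
  rewrite !mxE.
  have i1 : mu.-integrable (eball x rho : set T) (EFin \o (cst (nu x 0 i) : T -> R)).
    by apply: (@bounded_integrable _ _ _ mu _ _ 1 mb (mufin mb) (measurable_cst _)) => y; exact: nu_le.
  have i2 := integrableBR mb (inu i mb) i1.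
  have c1 : \int[mu]_(y in eball x rho) (nu x 0 i) = fine (mu (eball x rho)) * nu x 0 i.
    rewrite Rintegral_indic; under eq_Rintegral => y _ do rewrite mulrC.
    rewrite RintegralZl//; last first.
      by apply: (bounded_integrable (C := 1)) => //; [exact: mufin|move=> y; exact: normr_indic_le1].
    by rewrite mulrC; congr (_ * _); rewrite (measure_indicE mu mb).
  have -> : nu x 0 i - (fine (mu (eball x rho)))^-1 * \int[mu]_(y in eball x rho) nu y 0 i =
      - ((fine (mu (eball x rho)))^-1 * \int[mu]_(y in eball x rho) (nu y 0 i - nu x 0 i)).
    by rewrite RintegralB//; [rewrite c1 mulrBr mulKf ?gt_eqF// opprB|exact: inu].
  rewrite normrN normrM normfV (gtr0_norm m0) ler_pdivrMl// mulrC.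
  apply: le_trans (le_normr_Rintegral mb i2) _; exact: rP.
suff : enorm (nu x - average x rho) <= e / 2 by rewrite /=; lra.
rewrite -(ler_sqr0 (enorm_ge0 _) (ltW (divr_gt0 e0 _)))// sqr_enorm /dot.
apply: (@le_trans _ _ (\sum_(i < n) (e / (2 * n%:R)) ^+ 2)).
  apply: ler_sum => i _; rewrite -expr2 -real_normK ?num_real//.
  by rewrite ler_sqr0 ?ci// ltW.
have E2 : e / 2 = n%:R * (e / (2 * n%:R)).
  by have : (n%:R : R) != 0 by []; move: (n%:R : R) => N N0; field.
apply: (@le_trans _ _ ((n%:R * (e / (2 * n%:R))) ^+ 2)); last by rewrite -E2.
move: (e / (2 * n%:R)) => q; rewrite sumr_const card_ord -[leLHS]mulr_natl exprMn ler_wpM2r ?sqr_ge0//.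
by rewrite expr2 ler_peMr ?ler0n// ler1n.
Qed.

(** Uniqueness of the Gauss-Green pair replaces whichever pair witnesses [is_normal] by the fixed
    one, so that averages no longer depend on the witness. *)
Lemma is_normalE x v : is_normal E x v <-> [/\ forall s, 0 < s -> (0 < mu (eball x s))%E,
  average x rho @[rho --> 0^'+] --> v & enorm v = 1].
Proof.
split=> [[mu1 [nu1 [g1 pos cv v1]]]|[pos cv v1]]; last first.
  by exists mu, nu; split => //; exact: gauss_green_of_scalar gg.
pose e : rV := delta_mx 0 0.
have e1 : enorm e = 1 by exact: enorm_delta0.
have [gg1 gi] := scalar_of_gauss_green mE EE' e1 g1.
have muE A : measurable (A : set T) -> mu1 A = mu A.
  by move=> mA; apply/eqP; rewrite eq_le (gauss_green_unique_le gg1 gg mA) (gauss_green_unique_le gg gg1 mA).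
split => //; first by move=> s s0; rewrite -muE//; exact: pos.
rewrite (_ : average x = fun rho => \row_i ((fine (mu1 (eball x rho)))^-1 * \int[mu1]_(y in eball x rho) nu1 y 0 i))//.
apply/funext => rho; apply/rowP => i; rewrite !mxE muE//; congr (_ * _).
transitivity (\int[mu1]_(y in eball x rho) renormalise e nu1 y 0 i); last by rewrite -(gi _ i (mball x rho)).
rewrite [LHS]Rintegral_indic [RHS]Rintegral_indic.
have m1 : measurable_fun setT (\1_(eball x rho) : T -> R) by exact: measurable_indic.
have b1 (y : T) : `|\1_(eball x rho) y : R| <= 1 := normr_indic_le1 _ y.
have q := gauss_green_unique_integral (delta_mx 0 i) gg gg1 m1 b1.
transitivity (\int[mu]_y (\1_(eball x rho) y * dot (delta_mx 0 i) (nu y))).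
  by apply: eq_Rintegral => y _; rewrite dot_delta.
by rewrite q; apply: eq_Rintegral => y _; rewrite dot_delta.
Qed.

(** A point with a null ball around it lies in a null ball of rational centre and radius 1/(j + 1),
    and there are countably many of these. *)
Lemma support_ae : mu.-negligible [set x | ~ forall s, 0 < s -> (0 < mu (eball (x : rV) s))%E].
Proof.
pose Z (k : nat) : set T := if unpickle k is Some (q, j) then
    if mu (eball (map_mx ratr (q : 'rV[rat]_n)) (j : nat).+1%:R^-1) == 0%E
    then eball (map_mx ratr q) j.+1%:R^-1 else set0 else set0.
apply: (@negligibleS _ _ _ mu (\bigcup_k Z k)).
  move=> x /existsNP[s /not_implyP[s0 /negP]]; rewrite -leNgt => h.
  have s2 : 0 < s / 2 by rewrite divr_gt0.
  have [j _ js] : \forall j \near \oo, j.+1%:R^-1 < s / 2 by exact: (near_infty_natSinv_lt (PosNum s2)).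
  have j0 : 0 < j.+1%:R^-1 :> R by rewrite invr_gt0.
  have [q xq] := rat_dense_enorm (x : rV) j0.
  exists (pickle (q, j)) => //; rewrite /Z pickleK.
  rewrite ifT; first by rewrite /eball /=.
  rewrite -measure_le0; apply: le_trans h; apply: le_measureS => // y; rewrite /eball /= => yq.
  have := ler_enorm_dist y (map_mx ratr q) x; rewrite (enormB (map_mx ratr q) x).
  have js' : j.+1%:R^-1 < s / 2 by exact: js j (leqnn j).
  move=> h; apply: (le_lt_trans h); rewrite [ltRHS]splitr.
  by apply: ltrD; [exact: lt_trans yq js'|exact: lt_trans xq js'].
apply: negligible_bigcup => k; rewrite /Z; case: unpickle => [[q j]|]; last exact: negligible_set0.
case: eqP => h; last exact: negligible_set0.
by exists (eball (map_mx ratr q) j.+1%:R^-1); split; [exact: mball|exact: h|].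
Qed.

(** B is Borel of full mu-measure and consists of points of the support that are Lebesgue points of
    nu. Since H of the whole reduced boundary is at most mu(R^n) = mu(B) < +oo and mu <= H on Borel
    subsets of B, no inequality can be strict: H = mu on these subsets, and nothing remains for the
    reduced boundary outside B. *)
Lemma reduced_boundary_structure : exists B : set T, [/\ measurable B, B `<=` reduced_boundary E,
    mu (~` B) = 0%E, H (reduced_boundary E `\` B) = 0%E &
    (forall x, B x -> normal E x = nu x) /\
    forall A, measurable A -> A `<=` B -> H A = mu A].
Proof.
have bad : mu.-negligible ([set x | ~ forall s, 0 < s -> (0 < mu (eball (x : rV) s))%E] `|`
    \bigcup_k (if insub k is Some i then [set x | ~ lebesgue_point mu (fun y => nu y 0 (i : 'I_n)) x] else set0)).
  apply: negligibleU; first exact: support_ae.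
  apply: negligible_bigcup => k; case: insubP => [i _ _|_]; last exact: negligible_set0.
  exact: (lebesgue_points_ae mu (mnu i) (nu_le i)).
have [N [mN N0 Nbad]] := bad.
pose B : set T := ~` N; have mB : measurable B by exact: measurableC.
have [_ nu1 muT _] := gg.
have BP x : B x -> (forall s, 0 < s -> (0 < mu (eball (x : rV) s))%E) /\ average x rho @[rho --> 0^'+] --> nu x.
  move=> Bx; have pos : forall s, 0 < s -> (0 < mu (eball (x : rV) s))%E.
    by apply: contrapT => h; apply: Bx; apply: Nbad; left.
  split => //; apply: average_lebesgue_points => // i; apply: contrapT => h; apply: Bx; apply: Nbad; right.
  by exists (val i) => //; rewrite valK.
have Bn x : B x -> is_normal E x (nu x).
  by move=> /BP[pos av]; apply/is_normalE; split.
have BD : B `<=` reduced_boundary E by move=> x /Bn h; exists (nu x).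
have DP x : reduced_boundary E x -> exists v, blowup_point mu nu x v.
  by move=> [v /is_normalE[pos cv v1]]; exists v; exact: blowup_point_average.
have muB : mu B = mu setT.
  apply/eqP; rewrite eq_le le_measureS//= -(setUv N) -[leRHS]add0e -[X in (_ <= X + _)%E]N0.
  by apply: measureU2.
have HD := hausdorff_le_measure mE' gg DP.
have low A : measurable (A : set T) -> A `<=` B -> (mu A <= H A)%E.
  by move=> mA AB; apply: (measure_le_hausdorff mE' gg mA) => x /AB/BD/DP.
have cara (A : set T) (X : set rV) : measurable A -> H X = (H (X `&` A) + H (X `&` ~` A))%E.
  by move=> mA; exact: (hausdorff_borel mA).
have Heq A : measurable (A : set T) -> A `<=` B -> H A = mu A.
  move=> mA AB; apply/eqP; rewrite eq_le low// andbT.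
  have mBA : measurable (B `\` A) by exact: measurableD.
  have BAB : B `\` A `<=` B by move=> x [].
  (* The upper bound is known for the total mass only; additivity over A and its complement in B
     localises it. *)
  have h1 : (H A + H (B `\` A) <= mu A + mu (B `\` A))%E.
    have := cara A B mA; rewrite (_ : B `&` A = A) => [<-|]; last by rewrite setIC; exact/setIidPl.
    apply: (@le_trans _ _ (mu B)).
      by rewrite muB; apply: le_trans HD; exact: (le_outer_measure (@hausdorff R n m) _ _ BD).
    have := measureDI mu mB mA; rewrite (_ : B `&` A = A) => [->|]; last by rewrite setIC; exact/setIidPl.
    by rewrite addeC.
  have h2 := low _ mBA BAB.
  have f1 : mu (B `\` A) \is a fin_num by rewrite ge0_fin_numE// mufin.
  rewrite -(leeD2rE _ _ f1); apply: le_trans h1; exact: leeD2l.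
exists B; split => //.
- by rewrite /B setCK.
- have := cara B (reduced_boundary E) mB; rewrite (_ : _ `&` B = B); last by rewrite setIC; exact/setIidPl.
  rewrite (Heq B mB)// muB => h3.
  have h4 : (mu setT + H (reduced_boundary E `&` ~` B) <= mu setT)%E by rewrite -h3.
  have f1 : mu setT \is a fin_num by rewrite ge0_fin_numE.
  apply/eqP; rewrite eq_le outer_measure_ge0 andbT -(leeD2lE _ _ f1) adde0.
  exact: h4.
split => // x Bx; rewrite /normal; case: xgetP => [v _ /is_normalE[_ cv _]|h]; last by have := h _ (Bn x Bx).
have [_ av] := BP x Bx.
by apply: (cvg_unique _ cv av).
Qed.

Lemma reduced_boundary_integral (h : T -> R) (g : rV -> rV -> R) :
  measurable_fun setT h -> (forall x, h x = g x (nu x)) ->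
  (\int[hausdorff_measure R n m]_(x in reduced_boundary E) (g x (normal E x))%:E =
   \int[mu]_x (h x)%:E)%E.
Proof.
move=> mh hg; have [B [mB BD B0 HN [nB HB]]] := reduced_boundary_structure.
pose CH := caratheodory_type H; pose hm := hausdorff_measure R n m.
have mid : measurable_fun setT (id : CH -> T).
  by move=> _ A mA; rewrite setTI; exact: hausdorff_borel.
have complete : measure_is_complete hm by exact: measure_is_complete_caratheodory.
(* A set of outer measure 0 is Caratheodory measurable. By completeness the integrand, known only on
   B, is then measurable as extended by 0 off the reduced boundary. *)
have mN : measurable (reduced_boundary E `\` B : set CH).
  apply: le_caratheodory_measurable => X.
  rewrite -[leRHS]add0e; apply: leeD; last exact: (le_outer_measure (@hausdorff R n m) _ _ (@subIsetl _ X _)).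
  apply: (@le_trans _ _ (H (reduced_boundary E `\` B))); last by rewrite HN.
  exact: (le_outer_measure (@hausdorff R n m) _ _ (@subIsetr _ X _)).
have mhE : measurable_fun setT ((EFin \o h) \_ B : T -> \bar R).
  by apply/(measurable_restrictT _ mB); apply: measurable_funTS; exact/measurable_EFinP.
have mhC : measurable_fun setT ((EFin \o h) \_ B : CH -> \bar R) by exact: (measurableT_comp mhE mid).
have ae : ae_eq hm setT ((EFin \o h) \_ B : CH -> \bar R)
    ((fun x => (g x (normal E x))%:E) \_ (reduced_boundary E) : CH -> \bar R).
  exists (reduced_boundary E `\` B); split => // x /= nx; apply: contrapT => nN; apply: nx => _.
  rewrite /patch; have [Bx|Bx] := pselect (B x).
    by rewrite !mem_set//; [rewrite /= hg nB|exact: BD].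
  by rewrite (memNset Bx) memNset// => Dx; apply: nN.
have mg := ae_measurable_fun complete ae mhC.
rewrite integral_mkcond -(@ae_eq_integral _ _ _ hm setT _ _ measurableT mhC mg ae).
rewrite -(integral_image_measure hm mid mhE) -[LHS]integral_mkcond.
rewrite (_ : (\int[image_measure hm mid]_(x in B) (EFin \o h) x = \int[mu]_(x in B) (EFin \o h) x)%E); last first.
  by apply: eq_measure_integral => A mA AB; exact: HB.
rewrite integral_mkcond; apply: (@ae_eq_integral _ _ _ mu setT _ _ measurableT) => //.
- exact/measurable_EFinP.
- exists (~` B); split => //; first exact: measurableC.
  by move=> x /= nx Bx; apply: nx => _; rewrite /patch mem_set.
Qed.

End reduced_boundary_structure.

Section smoothing_identification.
Context {R : realType} {n : nat}.
Local Notation rV := 'rV[R]_n.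
Local Notation L := (borel_lebesgue R n).
Local Notation T := (borel_rV R n).
Local Notation CT := (lebesgue_type R n).
Local Notation CL := (lebesgue_rV R n).
Variable f : rV -> R.
Hypotheses (mf : measurable_fun setT (f : T -> R)) (fi : L.-integrable setT (EFin \o (f : T -> R)))
  (fi1 : L.-integrable setT (EFin \o ((fun x => enorm x * f x) : T -> R)))
  (f0 : \int[L]_x f x = 0).

Lemma surface_tensionE v : surface_tension f v = tension f v.
Proof.
pose k (p : T * T) : R := f p.1 * f p.2 * `|dot ((p.1 : rV) - (p.2 : rV)) v|.
have md : measurable_fun setT ((fun p => `|dot ((p.1 : rV) - (p.2 : rV)) v|) : T * T -> R).
  by apply: measurableT_comp => //; apply: measurable_dot; [exact: measurable_pair_sub|exact: measurable_cst].
have dle (p : T * T) : `|dot ((p.1 : rV) - (p.2 : rV)) v| <=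
    enorm v * (enorm (p.1 : rV) + enorm (p.2 : rV)).
  apply: le_trans (normr_dot _ _) _; rewrite mulrC ler_wpM2l ?enorm_ge0//.
  by rewrite -(enormN (p.2 : rV)); exact: ler_enormD.
have ik : (sigma_finite_product L L).-integrable setT (EFin \o k).
  by apply: (pair_integrable mf fi fi1 (C := enorm v)) => // p; rewrite normr_id.
have mk : measurable_fun setT k by apply/measurable_EFinP; exact: (measurable_int _ ik).
have mpair (y : T) : measurable_fun setT ((fun x => (x, y)) : T -> T * T).
  by apply/measurable_fun_pair; [exact: measurable_id|exact: measurable_cst].
have iky y : L.-integrable setT (EFin \o (fun x => k (x, y))).
  have i1 := integrableZR (`|f y| * enorm v) measurableT (integrable_norm fi1).
  have i2 := integrableZR (`|f y| * enorm v * enorm (y : rV)) measurableT (integrable_norm fi).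
  apply: le_integrableR (integrableDR measurableT i1 i2); first exact: (measurableT_comp mk (mpair y)).
  move=> x; rewrite /k /= !normrM normr_id (ger0_norm (enorm_ge0 _)).
  apply: (@le_trans _ _ (`|f x| * `|f y| * (enorm v * (enorm (x : rV) + enorm (y : rV))))).
    by rewrite ler_wpM2l ?mulr_ge0//; exact: (dle (x, y)).
  apply: le_of_eq; ring.
rewrite /surface_tension /tension; congr (_ * _).
have mF : measurable_fun setT ((fun y => \int[L]_x k (x, y)) : T -> R).
  rewrite (_ : (fun y => _) = fine \o fubini_G L (EFin \o k))//.
  apply: (@measurableT_comp _ _ _ _ _ _ (fine : \bar R -> R)) => //.
  exact: measurable_fubini_G ik.
transitivity (\int[CL]_y \int[L]_x k (x, y)).
  by apply: eq_Rintegral => y _; rewrite -(Rintegral_lebesgue_rV (measurableT_comp mk (mpair y))).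
by rewrite (Rintegral_lebesgue_rV mF) (Rfubini2 ik iky).
Qed.

Context {E E' : set rV}.
Hypotheses (mE : measurable (E : set CT)) (EE' : borel_hull E E').

Let mE' : measurable (E' : set T). Proof. by case: EE'. Qed.

Lemma convolution_smoothing (r : R) (x : rV) : 0 < r ->
  convolution (rescale r f) \1_E x = smoothing f E' r x.
Proof.
move=> r0; have [_ sub [N [mN N0 Nsub]]] := EE'.
(* The integrand after the substitution y = x + r w; the reflection w -> - w then leads to the form
   of [smoothing]. *)
pose g (w : T) : R := f (- (w : rV)) * \1_E' (x + r *: (w : rV)).
have mneg : measurable_fun setT ((fun w => - (w : rV)) : T -> T).
  by measurable_rV.
have mzoom (s : R) : measurable_fun setT ((fun w => x + s *: (w : rV)) : T -> T).
  apply: measurable_rVD; first exact: measurable_cst.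
  by measurable_rV.
have mind (s : R) : measurable_fun setT ((fun w => \1_E' (x + s *: (w : rV))) : T -> R).
  by apply: (@measurableT_comp _ _ _ _ _ _ (\1_E' : T -> R) _ _ _ (mzoom s)); exact: measurable_indic.
have mg : measurable_fun setT g by apply: measurable_funM; [exact: (measurableT_comp mf mneg)|exact: mind].
have ind1 (A : set T) y : `|\1_A y : R| <= 1 := normr_indic_le1 _ y.
have [_ po] := @borel_lebesgue_opp R n.
have ig : L.-integrable setT (EFin \o g).
  have in_ := preserves_integrable (@borel_lebesgue_opp R n) (measurable_int _ (integrable_norm fi)) (integrable_norm fi).
  by apply: le_integrableR in_ => // w; rewrite /g normrM ler_piMr.
have mres : measurable_fun setT ((fun y => rescale r f (x - (y : rV))) : T -> R).
  rewrite /rescale; apply: measurable_funM; first exact: measurable_cst.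
  have mz : measurable_fun setT ((fun y => r^-1 *: (x - (y : rV))) : T -> T).
    apply: measurable_rVZ; first exact: measurable_cst.
    by measurable_rV.
  exact: (measurableT_comp mf mz).
have mr : measurable_fun setT ((fun y => rescale r f (x - (y : rV)) * \1_E' y) : T -> R).
  by apply: measurable_funM => //; exact: measurable_indic.
transitivity (\int[CL]_y (rescale r f (x - y) * \1_E' y)).
  rewrite /convolution /Rintegral; congr fine.
  apply: (@ae_eq_integral _ _ _ CL setT _ _ measurableT).
  - apply/measurable_EFinP; apply: measurable_funM; last exact: measurable_indic.
    exact: (lebesgue_measurable_fun mres).
  - by apply/measurable_EFinP; exact: (lebesgue_measurable_fun mr).
  exists N; split => // y /= h; apply: Nsub; apply: contrapT => nE; apply: h => _.
  congr (_ * _)%:E; rewrite !indicE; have [Ey|Ey] := pselect (E y); first by rewrite !mem_set//; exact: sub.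
  by rewrite (memNset Ey) memNset// => E'y; apply: nE.
rewrite (Rintegral_lebesgue_rV mr).
have igr : L.-integrable setT (EFin \o (fun w => r ^- n * g w)) by exact: integrableZR.
transitivity (\int[L]_y (r ^- n * g (dilate x r y))).
  apply: eq_Rintegral => y _; rewrite /g /rescale (dilateK x r0) mulrA; congr (_ * f _ * _).
  by rewrite /dilate opprB -scalerBr.
rewrite (Rintegral_dilate x r0 igr) RintegralZl// mulrA mulfV ?mul1r ?expf_neq0 ?gt_eqF//.
have mo : measurable_fun setT ((fun w => f w * \1_E' (x - r *: (w : rV))) : T -> R).
  by apply: measurable_funM => //; under eq_fun do rewrite -scaleNr; exact: mind.
transitivity (\int[L]_w (f w * \1_E' (x - r *: (w : rV)))).
  rewrite -(preserves_Rintegral (@borel_lebesgue_opp R n) mo).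
  by apply: eq_Rintegral => w _; rewrite /g scalerN opprK.
have io : L.-integrable setT (EFin \o (fun w : T => f w * \1_E' (x - r *: (w : rV)))).
  by apply: le_integrableR (integrable_norm fi) => // w; rewrite normrM ler_piMr.
have ic := integrableZR (\1_E' x) measurableT fi.
rewrite /smoothing; transitivity (\int[L]_w (f w * \1_E' (x - r *: (w : rV)) - \1_E' x * f w)).
  by rewrite RintegralB// RintegralZl// f0 mulr0 subr0.
by apply: eq_Rintegral => w _; rewrite mulrBr [\1_E' x * _]mulrC.
Qed.

Lemma energy_LnormE (mu : {finite_measure set T -> \bar R}) nu (r : R) :
  scalar_gauss_green E' mu nu -> 0 < r ->
  (('N[CL]_2%:E [EFin \o convolution (rescale r f) \1_E]) ^+ 2 = (\int[L]_x smoothing f E' r x ^+ 2)%:E)%E.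
Proof.
move=> gg r0; have si := smoothing_sqr_integrable mf fi fi1 mE' gg r.
have -> : convolution (rescale r f) \1_E = smoothing f E' r by apply/funext => x; exact: convolution_smoothing.
rewrite unlock /Lnorm.
have -> : (\int[CL]_x (`|(EFin \o smoothing f E' r) x| `^ 2) = (\int[L]_x smoothing f E' r x ^+ 2)%:E)%E.
  rewrite (EFin_Rintegral measurableT si) -(integral_lebesgue_rV (measurable_int _ si)).
  apply: eq_integral => x _; rewrite /=; congr EFin.
  by rewrite powR_mulrn// real_normK ?num_real.
rewrite poweR_EFin -EFin_expe; congr EFin; rewrite -powR_mulrn ?powR_ge0// -powRrM mulVf// powRr1//.
by apply: Rintegral_ge0 => x _; exact: sqr_ge0.
Qed.

End smoothing_identification.

Theorem theorem4p1 (R : realType) (n : nat) (n_gt0 : (0 < n)%N)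
    (f : 'rV[R]_n -> R) (f_smooth : is_smooth f)
    (f_mean0 : (\int[lebesgue_rV R n]_x (f x)%:E = 0)%E)
    (f_moment1 : (\int[lebesgue_rV R n]_x (enorm x * `|f x|)%:E < +oo)%E) :
  (exists L : R, forall u v : 'rV[R]_n, usphere u -> usphere v ->
    `|surface_tension f u - surface_tension f v| <= L * enorm (u - v)) /\
  (forall E : set 'rV[R]_n, finite_perimeter E ->
    ((r^-1)%:E * 'N[lebesgue_rV R n]_2%:E
        [EFin \o convolution (rescale r f) \1_E] ^+ 2)%E @[r --> 0^'+] -->
    (\int[hausdorff_measure R n n.-1]_(x in reduced_boundary E)
        (surface_tension f (normal E x))%:E)%E).
Proof.
have cf : continuous f := f_smooth 0%N.
have mf : measurable_fun setT (f : borel_rV R n -> R) by exact: continuous_measurable_rV.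
have mef : measurable_fun setT ((fun x => enorm x * f x) : borel_rV R n -> R).
  by apply: measurable_funM => //; exact: measurable_enorm.
have manf : measurable_fun setT ((fun x => (enorm x * `|f x|)%:E) : borel_rV R n -> \bar R).
  by apply/measurable_EFinP; apply: measurable_funM; [exact: measurable_enorm|exact: measurableT_comp].
have fi1 : (borel_lebesgue R n).-integrable setT (EFin \o ((fun x => enorm x * f x) : borel_rV R n -> R)).
  apply/integrableP; split; first exact/measurable_EFinP.
  rewrite (integral_lebesgue_rV manf) in f_moment1; apply: le_lt_trans f_moment1.
  apply: le_of_eq; apply: eq_integral => x _ /=.
  by rewrite normrM ger0_norm ?enorm_ge0.
(* Integrability of f: it is bounded on the unit ball by continuity, and |f| <= |x| |f| outside. *)
have fi : (borel_lebesgue R n).-integrable setT (EFin \o (f : borel_rV R n -> R)).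
  have gT := @radial_test_fun R n _ _ (ltr01 : 0 < 1) (ltr1n R 2 : 1 < 2).
  have [C C0 CP] : exists2 C : R, 0 <= C & forall x, `|radial_cutoff 1 2 x * f x| <= C.
    apply: (@continuous_support_bounded R n _ 2).
      by move=> x; apply: (@cvgM _ _ (nbhs x)); [exact: (has_gradient_continuous gT.1)|exact: cf].
    by move=> x x2; rewrite (@radial_cutoff_out R n _ _ (ltr01 : 0 < 1) (ltr1n R 2 : 1 < 2) _ x2) mul0r.
  have mb1 := @measurable_eball R n 0 1.
  have ib : (borel_lebesgue R n).-integrable setT (EFin \o ((fun x => C * \1_(eball (0 : 'rV[R]_n) 1) x) : borel_rV R n -> R)).
    apply: integrableZR => //; apply: (support_integrable mb1 (lebesgue_eball_lty 0 1) _ _ (C := 1)) => //.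
    - by move=> y ny; rewrite indicE memNset.
    - exact: normr_indic_le1.
  apply: le_integrableR (integrableDR measurableT ib (integrable_norm fi1)) => // x /=.
  rewrite normrM (ger0_norm (enorm_ge0 _)); have [x1|x1] := ltP (enorm x) 1.
    rewrite indicE mem_set ?mulr1; last by rewrite /eball /= subr0.
    have := CP x; rewrite (radial_cutoff_in ltr01 (ltr1n R 2) (ltW x1)) mul1r => h.
    by apply: (le_trans h); rewrite lerDl mulr_ge0 ?enorm_ge0.
  by rewrite -[leLHS]add0r lerD ?mulr_ge0 ?indicE// ler_peMl.
have f0 : \int[borel_lebesgue R n]_x f x = 0.
  by rewrite /Rintegral -(integral_lebesgue_rV (f := EFin \o f)) ?f_mean0//; exact/measurable_EFinP.
have [C CP] := tension_lipschitz mf fi fi1.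
split; first by exists C => u v _ _; rewrite !(surface_tensionE mf fi fi1).
move=> E [mE Pfin]; have [E' EE'] := borel_hull_exists mE; have [mE' _ _] := EE'.
have [mu [nu gg]] := gauss_green_exists n_gt0 mE' (fun i g G => perimeter_bound mE EE' i Pfin).
(* The dimension is written as m + 1, so that the dimension n - 1 of the Hausdorff measure becomes
   the m of the blow-up results. *)
case: n n_gt0 f f_smooth f_mean0 f_moment1 cf mf mef manf fi1 fi f0 C CP E mE Pfin E' EE' mE' mu nu gg
  => // m _ f _ _ _ _ mf _ _ fi1 fi f0 C CP E mE Pfin E' EE' mE' mu nu gg.
have [mnu nu1 mufin _] := gg.
have ct : continuous (tension f).
  move=> x; apply/(@cvgrPdist_lt _ _ _ (nbhs x)) => e e0.
  have c0 : 0 < `|C| + 1 by rewrite ltr_wpDl.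
  apply: filterS (near_enorm x (divr_gt0 e0 c0)) => y; rewrite ltr_pdivlMr// => h.
  apply: le_lt_trans (CP x y) _; apply: le_lt_trans h; rewrite mulrC ler_wpM2l ?enorm_ge0//.
  by apply: (le_trans (ler_norm C)); rewrite lerDl.
have mt : measurable_fun setT ((fun x => tension f (nu x)) : borel_rV R m.+1 -> R).
  exact: (measurableT_comp (continuous_measurable_rV ct) mnu).
have it : mu.-integrable setT (EFin \o ((fun x => tension f (nu x)) : borel_rV R m.+1 -> R)).
  apply: (bounded_integrable (C := (`|tension f 0| + C))) => // x.
  rewrite -[X in `|X|](subrK (tension f 0)); apply: le_trans (ler_normD _ _) _.
  rewrite addrC lerD2l; apply: le_trans (CP _ _) _; by rewrite subr0 nu1 mulr1.
rewrite (reduced_boundary_integral mE EE' gg (h := fun x => tension f (nu x))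
  (g := fun _ v => surface_tension f v) mt (fun x => esym (surface_tensionE mf fi fi1 _))).
rewrite -(EFin_Rintegral measurableT it).
have cv : (r^-1 * \int[borel_lebesgue R m.+1]_x smoothing f E' r x ^+ 2)%:E @[r --> 0^'+] -->
    (\int[mu]_x tension f (nu x))%:E.
  by apply: cvg_EFin; [exact: nearW|exact: (smoothing_energy_cvg mf fi fi1 f0 mE' gg)].
apply: cvg_trans cv; apply: near_eq_cvg; near=> r.
by rewrite (energy_LnormE mf fi fi1 f0 mE EE' gg).
Unshelve. all: by end_near. Qed.
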